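(* Let $G$ be a Lie group with a left-invariant Riemannian metric, let $(\pi,E)$ be a Banach representation of $G$, and let $R>R_E$. Let $m$ be the smallest even integer greater than or equal to $1+\dim G$. Then for all $k\in\mathbb N_0$ there exist $c_k,C_k>0$ such that for all $v\in E^\infty$ $$c_k\cdot{}^\Delta p_{2k}(v)\le p_{2k}(v)\le C_k\cdot{}^\Delta p_{2k+m}(v).$$
   Context: $G$ is a Lie group with identity $\mathbf 1$, dimension $n$ and Lie algebra $\mathfrak g$; a left-invariant Riemannian metric $\mathbf g$ is fixed, whose Riemannian measure $dg$ is a left Haar measure, and $d(g)$ is the Riemannian distance from $g$ to $\mathbf 1$. Fix $c_G>0$ such that $\int_G e^{-Cd(g)}\,dg<\infty$ for all $C>c_G$ (such a constant exists). A Banach representation $(\pi,E)$ is a Banach space $E$ with a group homomorphism $\pi:G\to GL(E)$ (topological linear isomorphisms) such that $G\times E\to E$, $(g,v)\mapsto\pi(g)v$, is continuous. For $v\in E$ put $\gamma_v(g)=\pi(g)v$; $E^k=\{v\in E:\gamma_v\in C^k(G,E)\}$ and $E^\infty=\bigcap_{k\ge0}E^k$. Set $$c_\pi:=\inf\{c>0:\exists C>0\ \forall g\in G:\ \|\pi(g)\|\le Ce^{cd(g)}\},\qquad R_E:=c_\pi+c_G.$$ Let $X_1,\dots,X_n$ be a basis of $\mathfrak g$ orthonormal with respect to $\mathbf g$, and $\Delta=\sum_{j=1}^n(-X_j-\operatorname{tr}(\operatorname{ad}X_j))X_j\in\mathcal U(\mathfrak g)$, where $\mathcal U(\mathfrak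 g)$ is the universal enveloping algebra; $d\pi:\mathcal U(\mathfrak g)\to\operatorname{End}(E^\infty)$ is the derived representation. Let $p$ be the norm of $E$. Standard $k$-th Sobolev norm ($k\in\mathbb N_0$): $p_k(v)=\Big[\sum_{m_1+\dots+m_n\le k}p\big(d\pi(X_1^{m_1}\cdots X_n^{m_n})v\big)^2\Big]^{1/2}$ for $v\in E^\infty$ (sum over $m_i\in\mathbb N_0$). Laplace Sobolev norm of even order $k\in2\mathbb N_0$ (depending on the fixed $R>R_E$): ${}^\Delta p_k(v)=p\big(d\pi((R^2+\Delta)^{k/2})v\big)$ for $v\in E^\infty$. *)

(* Defs.v *)
From HB Require Import structures.
From mathcomp Require Import all_boot all_order all_algebra.
From mathcomp Require Import all_classical all_reals all_analysis.
Set Implicit Arguments.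
Unset Strict Implicit.
Unset Printing Implicit Defensive.
Import Order.TTheory GRing.Theory Num.Theory.
Import numFieldNormedType.Exports.
Local Open Scope classical_set_scope.
Local Open Scope ring_scope.

(* [f] is C^k on the open set [U].  This is the usual notion for a finite
   dimensional domain [V]; [f] may take arbitrary values outside [U]. *)
Fixpoint Ck_on (R : realType) (V W : normedModType R) (k : nat) (U : set V)
    (f : V -> W) : Prop :=
  (forall x, U x -> {for x, continuous f}) /\
  (if k is k'.+1 then
     forall v : V, (forall x, U x -> derivable f x v) /\
                   Ck_on k' U (fun x => 'D_v f x)
   else True).

Definition smooth_on (R : realType) (V W : normedModType R) (U : set V)
    (f : V -> W) : Prop := forall k, Ck_on k U f.

(* A Lie group of dimension [n].  The smooth structure is given by the atlas
   [chart a : chart_dom a -> 'rV_n], [a : G], with inverse charts [chart_inv a]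
   (total functions, whose values are irrelevant outside the chart domain,
   resp. outside its image), the chart of index [a] being centred around [a].
   The tangent space at [a] is ['rV[R]_n], through the preferred chart at [a].
   Pointedness plays no role beyond the requirements of the measure library. *)
HB.mixin Record isLieGroup (R : realType) (n : nat) G
    of PointedTopological G & Group G := {
  chart_dom : G -> set G ;
  chart : G -> G -> 'rV[R]_n ;
  chart_inv : G -> 'rV[R]_n -> G ;
  lie_hausdorff : hausdorff_space G ;
  lie_second_countable : @second_countable G ;
  chart_dom_open : forall a, open (chart_dom a) ;
  chart_dom_self : forall a, chart_dom a a ;
  chart_img_open : forall a, open (chart a @` chart_dom a) ;
  chartK : forall a x, chart_dom a x -> chart_inv a (chart a x) = x ;
  chart_continuous : forall a x, chart_dom a x -> {for x, continuous (chart a)} ;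
  chart_inv_continuous : forall a y, (chart a @` chart_dom a) y ->
    {for y, continuous (chart_inv a)} ;
  chart_compatible : forall a b,
    smooth_on (chart a @` (chart_dom a `&` chart_dom b))
              (fun y => chart b (chart_inv a y)) ;
  lie_mul_continuous : continuous (fun z : G * G => (z.1 * z.2)%g) ;
  lie_inv_continuous : continuous (fun x : G => (x^-1)%g) ;
  lie_mul_smooth : forall a b c,
    smooth_on [set z : 'rV[R]_n * 'rV[R]_n |
                [/\ (chart a @` chart_dom a) z.1, (chart b @` chart_dom b) z.2
                  & chart_dom c (chart_inv a z.1 * chart_inv b z.2)%g]]
              (fun z => chart c (chart_inv a z.1 * chart_inv b z.2)%g) ;
  lie_inv_smooth : forall a b,
    smooth_on [set y | (chart a @` chart_dom a) y /\
                       chart_dom b (chart_inv a y)^-1%g]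
              (fun y => chart b (chart_inv a y)^-1%g)
}.

#[short(type="lieGroupType")]
HB.structure Definition LieGroup (R : realType) (n : nat) :=
  {G of PointedTopological G & Group G & isLieGroup R n G}.

Section Manifold.
Context (R : realType) (n : nat) (G : lieGroupType R n).

Definition chart_img (a : G) : set 'rV[R]_n := chart a @` chart_dom a.

Definition Ck_lie (W : normedModType R) (k : nat) (f : G -> W) : Prop :=
  forall a, Ck_on k (chart_img a) (fun y => f (chart_inv a y)).

Definition C1_curve (c : R -> G) : Prop :=
  continuous c /\
  forall a, Ck_on 1 [set t | chart_dom a (c t)] (fun t => chart a (c t)).

(* tangent vector c'(t), in the preferred chart at c(t) *)
Definition velocity (c : R -> G) (t : R) : 'rV[R]_n :=
  'D_1 (fun s => chart (c t) (c s)) t.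

(* Bilinear forms on the tangent spaces are given by Gram matrices; jacobians
   act on row vectors from the right. *)

(* the form [gm], expressed in the coordinates of the chart [a] *)
Definition gram_in_chart (gm : G -> 'M[R]_n) (a : G) (y : 'rV[R]_n) : 'M[R]_n :=
  let x := chart_inv a y in
  let J := 'J (fun z => chart x (chart_inv a z)) y in
  J *m gm x *m J^T.

Record is_riemannian_metric (gm : G -> 'M[R]_n) : Prop := {
  metric_sym : forall x, (gm x)^T = gm x ;
  metric_pos : forall x (u : 'rV[R]_n), u != 0 -> 0 < (u *m gm x *m u^T) 0 0 ;
  metric_smooth : forall a i j,
    smooth_on (chart_img a) (fun y => gram_in_chart gm a y i j) }.

Definition left_invariant_metric (gm : G -> 'M[R]_n) : Prop :=
  forall a x : G,
    let J := 'J (fun y => chart (a * x)%g (a * chart_inv x y)%g) (chart x x) in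
    J *m gm (a * x)%g *m J^T = gm x.

Definition curve_length (gm : G -> 'M[R]_n) (c : R -> G) : \bar R :=
  (\int[lebesgue_measure]_(t in `[0%R, 1%R])
     (Num.sqrt ((velocity c t *m gm (c t) *m (velocity c t)^T) 0 0))%:E)%E.

(* [piecewise_length gm x y L]: some piecewise C^1 curve (a concatenation of
   C^1 curves parametrised by [0,1]) from [x] to [y] has length [L] *)
Inductive piecewise_length (gm : G -> 'M[R]_n) : G -> G -> \bar R -> Prop :=
| PLnil x : piecewise_length gm x x 0%E
| PLcons c y L : C1_curve c -> piecewise_length gm (c 1) y L ->
    piecewise_length gm (c 0) y (curve_length gm c + L)%E.

(* Riemannian distance to the identity; it is [+oo] outside of the identity
   component *)
Definition dist1 (gm : G -> 'M[R]_n) (g : G) : \bar R :=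
  ereal_inf [set L | piecewise_length gm g 1%g L].

End Manifold.

Definition borel (T : ptopologicalType) := g_sigma_algebraType (@open T).

Definition is_lebesgue (R : realType) (n : nat)
    (lam : {measure set (borel 'rV[R]_n) -> \bar R}) : Prop :=
  forall a b : 'rV[R]_n, (forall i, a 0 i <= b 0 i) ->
    lam [set x : 'rV[R]_n | forall i, a 0 i <= x 0 i <= b 0 i] =
    (\prod_(i < n) (b 0 i - a 0 i))%:E.

Definition is_riemannian_measure (R : realType) (n : nat)
    (G : lieGroupType R n) (gm : G -> 'M[R]_n)
    (mu : {measure set (borel G) -> \bar R}) : Prop :=
  exists2 lam : {measure set (borel 'rV[R]_n) -> \bar R}, is_lebesgue lam &
    forall (a : G) (A : set (borel G)), measurable A -> A `<=` chart_dom a ->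
      mu A = (\int[lam]_(y in chart a @` A)
                (Num.sqrt (\det (gram_in_chart gm a y)))%:E)%E.

Section LieAlgebra.
Context (R : realType) (n : nat) (G : lieGroupType R n).

(* The Lie algebra is the tangent space ['rV[R]_n] at the identity. *)

(* the left-invariant vector field of value [X] at the identity, in the
   coordinates of the chart at the identity *)
Definition left_field (X y : 'rV[R]_n) : 'rV[R]_n :=
  'D_X (fun z => chart (1%g : G) (chart_inv (1%g : G) y *
                                  chart_inv (1%g : G) z)%g)
       (chart (1%g : G) 1%g).

(* value at the identity of the commutator of the left-invariant fields, by the
   coordinate formula [X,Y]^i = X(Y^i) - Y(X^i) *)
Definition lie_bracket (X Y : 'rV[R]_n) : 'rV[R]_n :=
  'D_X (left_field Y) (chart (1%g : G) 1%g)
  - 'D_Y (left_field X) (chart (1%g : G) 1%g).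

Definition tr_ad (X : 'rV[R]_n) : R := \tr (lin1_mx (lie_bracket X)).

Definition lie_hom (A : algType R) (f : 'rV[R]_n -> A) : Prop :=
  linear f /\ forall X Y, f (lie_bracket X Y) = f X * f Y - f Y * f X.

(* [(U, iota)] is the universal enveloping algebra *)
Definition is_enveloping_algebra (U : algType R) (iota : 'rV[R]_n -> U) : Prop :=
  lie_hom iota /\
  forall (A : algType R) (f : 'rV[R]_n -> A), lie_hom f ->
    exists F : {lrmorphism U -> A}, (forall X, F (iota X) = f X) /\
      forall F' : {lrmorphism U -> A}, (forall X, F' (iota X) = f X) ->
        forall u, F' u = F u.

Definition is_orthonormal_basis (gm : G -> 'M[R]_n)
    (X : 'I_n -> 'rV[R]_n) : Prop :=
  row_free (\matrix_i X i) /\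
  forall i j, (X i *m gm 1%g *m (X j)^T) 0 0 = (i == j)%:R.

Definition laplace (U : algType R) (iota : 'rV[R]_n -> U)
    (X : 'I_n -> 'rV[R]_n) : U :=
  \sum_(j < n) (- iota (X j) - (tr_ad (X j))%:A) * iota (X j).

End LieAlgebra.

Arguments is_enveloping_algebra {R n} G {U} iota.
Arguments laplace {R n} G {U} iota X.

Section Representation.
Context (R : realType) (n : nat) (G : lieGroupType R n).
Context (E : completeNormedModType R).

(* invertibility of [pi g] in GL(E) follows, with inverse [pi g^-1] *)
Record is_banach_rep (pi : G -> E -> E) : Prop := {
  rep_linear : forall g, linear (pi g) ;
  rep_one : forall v, pi 1%g v = v ;
  rep_mul : forall g h v, pi (g * h)%g v = pi g (pi h v) ;
  rep_continuous : continuous (fun z : G * E => pi z.1 z.2) }.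

Definition opnorm (T : E -> E) : \bar R :=
  ereal_sup [set (`|T v|)%:E | v in [set v : E | `|v| <= 1]].

Definition growth_rate (gm : G -> 'M[R]_n) (pi : G -> E -> E) : R :=
  inf [set c : R | 0 < c /\ exists2 C : R, 0 < C &
        forall g, (opnorm (pi g) <= C%:E * expeR (c%:E * dist1 gm g))%E].

Definition smooth_vector (pi : G -> E -> E) (v : E) : Prop :=
  forall k, Ck_lie k (fun g => pi g v).

(* [dpi] restricts to an algebra morphism from the enveloping algebra to
   End(E^oo) that sends [X] in the Lie algebra to the operator mapping [v] to
   the differential at the identity, in direction [X], of g |-> pi(g) v *)
Record is_derived_rep (pi : G -> E -> E) (U : algType R)
    (iota : 'rV[R]_n -> U) (dpi : U -> E -> E) : Prop := {
  dpi_smooth : forall u v, smooth_vector pi v -> smooth_vector pi (dpi u v) ;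
  dpi_linear : forall u a v w, smooth_vector pi v -> smooth_vector pi w ->
    dpi u (a *: v + w) = a *: dpi u v + dpi u w ;
  dpi_linearl : forall a u u' v, smooth_vector pi v ->
    dpi (a *: u + u') v = a *: dpi u v + dpi u' v ;
  dpi_one : forall v, smooth_vector pi v -> dpi 1 v = v ;
  dpi_mul : forall u u' v, smooth_vector pi v ->
    dpi (u * u') v = dpi u (dpi u' v) ;
  dpi_lie : forall X v, smooth_vector pi v ->
    dpi (iota X) v =
    'D_X (fun y => pi (chart_inv (1%g : G) y) v) (chart (1%g : G) 1%g) }.

Definition sobolev_norm (U : algType R) (iota : 'rV[R]_n -> U)
    (dpi : U -> E -> E) (X : 'I_n -> 'rV[R]_n) (k : nat) (v : E) : R :=
  Num.sqrt (\sum_(m : {ffun 'I_n -> 'I_k.+1} | (\sum_(i < n) m i <= k)%N)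
              `|dpi (\prod_(i < n) iota (X i) ^+ m i) v| ^+ 2).

(* meant for even [k] *)
Definition laplace_norm (U : algType R) (iota : 'rV[R]_n -> U)
    (dpi : U -> E -> E) (X : 'I_n -> 'rV[R]_n) (r : R) (k : nat) (v : E) : R :=
  `|dpi (((r ^+ 2)%:A + laplace G iota X) ^+ k./2) v|.

End Representation.

Arguments laplace_norm {R n} G {E U} iota dpi X r k v.

(* Main.v *)
(* Fix a linear functional l with |l v| <= |v| and attach to v its matrix
   coefficient f_v(g) = l(pi(g^-1) v).  Let Q(u,v) be the integral of
   f_u f_v Psi, where Psi mollifies exp(-2 s d(g)) and s slightly exceeds the
   growth rate plus cG/2, so that Q is bounded on E.  Left invariance of the
   measure and |grad Psi| <= 2 s' Psi make the operators dpi(X_j) skew for Q up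
   to an error s', and the sum of the (tr ad X_j)^2 is at most cG^2 because the
   modular function is dominated by exp(cG d).  Hence r^2 + Delta is coercive
   for Q as soon as s'^2 + s' cG < r^2, which r > R_E permits; commuting with
   the X_j turns this into elliptic regularity for the norms of Q, with
   constants independent of l.  A local Sobolev inequality recovers |l v| from
   dim G + 1 derivatives in these norms, and Hahn-Banach chooses l.  The first
   inequality is the reordering of words in the X_j into ordered monomials. *)

Require Import Defs.
From HB Require Import structures.
From mathcomp Require Import all_boot all_order all_algebra.
From mathcomp Require Import all_classical all_reals all_analysis.
Set Implicit Arguments.
Unset Strict Implicit.
Unset Printing Implicit Defensive.
Import Order.TTheory GRing.Theory Num.Theory.
Import numFieldNormedType.Exports.
Local Open Scope classical_set_scope.
Local Open Scope ring_scope.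
From mathcomp Require Import ring lra.
From mathcomp Require Import measurable_realfun.
(** * Strict differentiability *)

(** Why [r] above growth rate plus [cG] is enough: coercivity asks for s^2 + s T < r^2, where s is
    the skewness error and T bounds the length of the vector (tr ad X_j). This reads (s + T/2)^2 -
    (T/2)^2 < r^2. With s close to c + cG/2, c a growth exponent, and T close to cG, the first
    square is close to (c + cG)^2. The form Q may be degenerate and depends on the functional, hence
    on the vector to be estimated. Every constant is therefore fixed before Q, and the elliptic part
    is algebra with a seminorm on smooth vectors: nothing is completed and no weak derivative
    occurs. The distance is not differentiable and group elements have no difference, so curves,
    weights and coefficients are all handled by first-order estimates on increments x^-1 y. Strict
    differentiability, which controls the increment between two moving points, is the notion of
    derivative that suits this. *)

Lemma near_distP (R : realType) (V : normedModType R) (x : V) (P : V -> Prop) :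
  (\forall y \near x, P y) <->
  exists2 d : R, 0 < d & forall y, `|y - x| < d -> P y.
Proof.
rewrite nbhs_normP; split=> -[d d0 h]; exists d => // y /= hy; apply: h => //=.
  by rewrite distrC.
by rewrite distrC.
Qed.

Lemma continuous_distP (R : realType) (V W : normedModType R) (f : V -> W) (x : V) :
  {for x, continuous f} <-> forall e : R, 0 < e ->
  exists2 d : R, 0 < d & forall y, `|y - x| < d -> `|f y - f x| < e.
Proof.
split.
  by move=> /cvgrPdistC_lt h e e0; apply/near_distP; exact: h.
by move=> h; apply/cvgrPdistC_lt => e e0; apply/near_distP; exact: h.
Qed.

Lemma le_addgt0P (R : realType) (x y : R) :
  (forall e, 0 < e -> x <= y + e) -> x <= y.
Proof.
move=> h; rewrite leNgt; apply/negP => yx.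
by have := h ((x - y) / 2); rewrite divr_gt0 ?subr_gt0// => /(_ isT); lra.
Qed.

(** Real induction: the supremum of the points t with f a <= f t is such a point and cannot lie
    below b. The hypothesis only compares points on the two sides of t, which is what a derivative
    at t controls. *)
Lemma local_ndecr (R : realType) (f : R -> R) (a b : R) : a <= b ->
  (forall t, a <= t <= b -> exists2 d : R, 0 < d & forall s s',
     a <= s -> s <= t -> t <= s' -> s' <= b -> s' - s < d -> f s <= f s') ->
  f a <= f b.
Proof.
move=> ab h; pose S := [set t | a <= t <= b /\ f a <= f t].
have Sa : S a by split; rewrite ?lexx.
have hS : has_sup S by split; [exists a | exists b => t [/andP[]]].
pose c := sup S.
have ac : a <= c by apply: ub_le_sup Sa; case: hS.
have cb : c <= b by apply: ge_sup; [exists a | move=> t [/andP[]]].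
have [d d0 hd] := h c (introT andP (conj ac cb)).
have Sc : f a <= f c.
  have [t [/andP[at_ tb] ft]] := sup_adherent d0 hS; rewrite -/c => ct.
  have tc : t <= c by apply: ub_le_sup; [case: hS | split=> //; apply/andP].
  by rewrite (le_trans ft)// hd//; lra.
have [<-//|cb'] := eqVneq c b.
have {}cb' : c < b by rewrite lt_neqAle cb'.
pose s' := Num.min b (c + d / 2).
have cs' : c < s' by rewrite /s' lt_min cb'/= ltrDl divr_gt0.
have s'b : s' <= b by rewrite /s' ge_min lexx.
have s'd : s' <= c + d / 2 by rewrite /s' ge_min lexx orbT.
have Ss' : S s'.
  split; first by rewrite s'b andbT (le_trans ac)// ltW.
  by rewrite (le_trans Sc)// hd//; [exact: ltW | lra].
have : s' <= c by apply: ub_le_sup Ss'; case: hS.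
by rewrite leNgt cs'.
Qed.

(** A vector-valued map has no mean value point. Instead, for each eps > 0, the real function (e +
    eps) t - |g t - g a| is nondecreasing around every t. *)
Lemma le_norm_derive (R : realType) (W : normedModType R) (g : R -> W) (a b e : R) :
  a <= b -> (forall t, a <= t <= b -> derivable g t 1 /\ `|'D_1 g t| <= e) ->
  `|g b - g a| <= e * (b - a).
Proof.
move=> ab hg; apply: le_addgt0P => eta eta0.
have ba : 0 < b - a + 1 by lra.
pose eps := eta / (b - a + 1).
have eps0 : 0 < eps by rewrite divr_gt0.
have epsE : eps * (b - a) <= eta.
  rewrite /eps mulrAC ler_pdivrMr// ler_pM2l//; lra.
have := @local_ndecr R (fun t => (e + eps) * t - `|g t - g a|) a b ab.
rewrite subrr normr0 subr0 => H.
suff : (e + eps) * a <= (e + eps) * b - `|g b - g a|.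
  by rewrite mulrBr; move: epsE; rewrite mulrBr; lra.
apply: H => t atb; have [dg De] := hg t atb.
have /cvgrPdistC_lt/(_ eps eps0) : h^-1 *: (g (h *: (1:R) + t) - g t)
   @[h --> 0^'] --> 'D_1 g t by exact: dg.
rewrite near_withinE => /near_distP[d d0 hd].
exists d => // s s' as_ st ts' s'b s'sd.
have key u : `|u - t| < d -> `|g u - g t| <= (e + eps) * `|u - t|.
  move=> ud; have [->|ut] := eqVneq u t; first by rewrite !subrr !normr0 mulr0.
  have ut0 : u - t != 0 by rewrite subr_eq0.
  have := hd (u - t); rewrite subr0 => /(_ ud ut0) /=.
  have -> : (u - t) *: (1 : R) + t = u by rewrite [_ *: _]mulr1 subrK.
  move=> h1; have : `|(u - t)^-1 *: (g u - g t)| <= e + eps.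
    rewrite -[_ *: _](subrK ('D_1 g t)) (le_trans (ler_normD _ _))// addrC lerD//.
    exact: ltW.
  rewrite normrZ normfV mulrC ler_pdivrMr ?normr_gt0//.
have h1 := key s; have h2 := key s'.
have e1 : `|s - t| = t - s by rewrite distrC ger0_norm ?subr_ge0.
have e2 : `|s' - t| = s' - t by rewrite ger0_norm ?subr_ge0.
rewrite e1 in h1; rewrite e2 in h2.
have ts : t - s < d by apply: le_lt_trans s'sd; rewrite lerD2r.
have s't : s' - t < d by apply: le_lt_trans s'sd; rewrite lerD2l lerN2.
have {}h1 := h1 ts; have {}h2 := h2 s't.
have key2 : `|g s' - g a| <= `|g s - g a| + (e + eps) * (s' - s).
  have -> : g s' - g a = (g s - g a) + ((g s' - g t) - (g s - g t)).
    have -> : g s' - g t - (g s - g t) = g s' - g s by rewrite opprB addrA subrK.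
    by rewrite [RHS]addrC addrA subrK.
  rewrite (le_trans (ler_normD _ _))// lerD2l (le_trans (ler_normB _ _))//.
  have -> : (e + eps) * (s' - s) = (e + eps) * (s' - t) + (e + eps) * (t - s) by ring.
  exact: lerD.
rewrite lerBrDr addrAC lerBlDr -lerBrDl (le_trans key2)//.
by rewrite mulrBr addrCA addrA.
Qed.

Section StrictDifferentiability.
Context (R : realType).
Implicit Types U V W : normedModType R.

Definition bounded_linear V W (L : V -> W) :=
  (forall a u v, L (a *: u + v) = a *: L u + L v) /\
  exists2 K : R, 0 < K & forall v, `|L v| <= K * `|v|.

(** Strict differentiability: both points of the increment move. It is a condition at one point that
    contains a local Lipschitz bound, composes, and follows from C^1; two-variable maps such as x^-1
    y can thus be expanded along the diagonal. *)
Definition sdiff V W (f : V -> W) (x : V) (L : V -> W) :=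
  bounded_linear L /\
  forall e : R, 0 < e -> exists2 d : R, 0 < d & forall y z,
    `|y - x| < d -> `|z - x| < d -> `|f y - f z - L (y - z)| <= e * `|y - z|.

Lemma bl0 V W (L : V -> W) : bounded_linear L -> L 0 = 0.
Proof.
case=> h _; have := h 1 0 0; rewrite !scale1r addr0 => e.
by apply: (@addrI _ (L 0)); rewrite addr0 -e.
Qed.

Lemma blD V W (L : V -> W) u v : bounded_linear L -> L (u + v) = L u + L v.
Proof. by case=> h _; rewrite -[u in LHS]scale1r h scale1r. Qed.

Lemma blZ V W (L : V -> W) a u : bounded_linear L -> L (a *: u) = a *: L u.
Proof. by move=> hL; rewrite -[_ *: _ in LHS]addr0 hL.1 bl0// addr0. Qed.

Lemma blN V W (L : V -> W) u : bounded_linear L -> L (- u) = - L u.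
Proof. by move=> hL; rewrite -scaleN1r blZ// scaleN1r. Qed.

Lemma blB V W (L : V -> W) u v : bounded_linear L -> L (u - v) = L u - L v.
Proof. by move=> hL; rewrite blD// blN. Qed.

Lemma bl_comp U V W (L : U -> V) (M : V -> W) :
  bounded_linear L -> bounded_linear M -> bounded_linear (M \o L).
Proof.
move=> [hL [K K0 hK]] [hM [K' K'0 hK']]; split.
  by move=> a u v /=; rewrite hL hM.
exists (K' * K); first exact: mulr_gt0.
by move=> v /=; rewrite (le_trans (hK' _))// -mulrA ler_pM2l.
Qed.

Lemma bl_pair U V W (L : U -> V) (M : U -> W) : bounded_linear L ->
  bounded_linear M -> bounded_linear (fun u => (L u, M u)).
Proof.
move=> [hL [K K0 hK]] [hM [K' K'0 hK']]; split.
  by move=> a u v /=; rewrite hL hM.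
exists (K + K'); first exact: addr_gt0.
move=> v /=; rewrite prod_normE/= ge_max mulrDl.
by rewrite ler_wpDr ?mulr_ge0 ?(ltW K'0)//= ler_wpDl// mulr_ge0// ltW.
Qed.

Lemma sdiff_bl V W (f : V -> W) x L : sdiff f x L -> bounded_linear L.
Proof. by case. Qed.

Lemma sdiff_lip V W (f : V -> W) x L : sdiff f x L ->
  exists2 K : R, 0 < K & exists2 d : R, 0 < d & forall y z,
    `|y - x| < d -> `|z - x| < d -> `|f y - f z| <= K * `|y - z|.
Proof.
move=> [[_ [K K0 hK]] h]; have [d d0 hd] := h 1 ltr01.
exists (K + 1); first lra.
exists d => // y z hy hz; rewrite -[f y - f z](subrK (L (y - z))).
rewrite (le_trans (ler_normD _ _))// mulrDl mul1r addrC lerD//.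
by rewrite (le_trans (hd _ _ hy hz))// mul1r.
Qed.

Lemma sdiff_continuous V W (f : V -> W) x L : sdiff f x L -> {for x, continuous f}.
Proof.
move=> /sdiff_lip[K K0 [d d0 hd]]; apply/continuous_distP => e e0.
exists (Num.min d (e / K)); first by rewrite lt_min d0 divr_gt0.
move=> y; rewrite lt_min => /andP[yd ye].
rewrite (le_lt_trans (hd _ _ yd _)) ?subrr ?normr0//.
by rewrite mulrC -ltr_pdivlMr.
Qed.

Lemma sdiff_comp U V W (f : U -> V) (g : V -> W) x L M :
  sdiff f x L -> sdiff g (f x) M -> sdiff (g \o f) x (M \o L).
Proof.
move=> hf hg; have [bL hL] := hf; have [bM hM] := hg.
split; first exact: bl_comp.
move=> e e0.
have [K K0 [d1 d10 hd1]] := sdiff_lip hf.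
have [_ [K' K'0 hK']] := bM.
have [|d2 d20 hd2] := hM (e / 2 / K); first by rewrite !divr_gt0.
have [|d3 d30 hd3] := hL (e / 2 / K'); first by rewrite !divr_gt0.
have [d4 d40 hd4] : exists2 d, 0 < d & forall y, `|y - x| < d -> `|f y - f x| < d2.
  by have /continuous_distP := sdiff_continuous hf; apply.
exists (Num.min d1 (Num.min d3 d4)); first by rewrite !lt_min d10 d30.
move=> y z; rewrite !lt_min => /andP[y1 /andP[y3 y4]] /andP[z1 /andP[z3 z4]] /=.
have -> : g (f y) - g (f z) - M (L (y - z)) =
    (g (f y) - g (f z) - M (f y - f z)) + M (f y - f z - L (y - z)).
  by rewrite [M (_ - L _)]blB// addrA subrK.
rewrite (le_trans (ler_normD _ _))//.
have h1 := hd2 _ _ (hd4 _ y4) (hd4 _ z4).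
have h2 : e / 2 / K * `|f y - f z| <= e / 2 * `|y - z|.
  by rewrite mulrAC ler_pdivrMr// -[leRHS]mulrA ler_pM2l ?divr_gt0// mulrC hd1.
have h3 : `|M (f y - f z - L (y - z))| <= e / 2 * `|y - z|.
  rewrite (le_trans (hK' _))// mulrC -ler_pdivlMr// mulrAC.
  exact: hd3.
have -> : e * `|y - z| = e / 2 * `|y - z| + e / 2 * `|y - z| by field.
by apply: lerD => //; exact: le_trans h2.
Qed.

Lemma sdiff_pair U V W (f : U -> V) (g : U -> W) x L M : sdiff f x L ->
  sdiff g x M -> sdiff (fun u => (f u, g u)) x (fun u => (L u, M u)).
Proof.
move=> [bL hL] [bM hM]; split; first exact: bl_pair.
move=> e e0; have [d d0 hd] := hL e e0; have [d' d'0 hd'] := hM e e0.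
exists (Num.min d d'); first by rewrite lt_min d0.
move=> y z; rewrite !lt_min => /andP[y1 y2] /andP[z1 z2].
by rewrite prod_normE/= ge_max hd// hd'.
Qed.

Lemma sdiff_linear V W (L : V -> W) x : bounded_linear L -> sdiff L x L.
Proof.
move=> bL; split=> // e e0; exists 1 => // y z _ _.
by rewrite -blB// subrr normr0 mulr_ge0// ltW.
Qed.

Lemma bl_id V : bounded_linear (@id V).
Proof. by split=> //; exists 1 => // v; rewrite mul1r. Qed.

Lemma bl_zero V W : bounded_linear (fun _ : V => 0 : W).
Proof.
split; first by move=> a u v; rewrite scaler0 addr0.
by exists 1 => // v; rewrite normr0 mulr_ge0.
Qed.

Lemma bl_fst V W : bounded_linear (@fst V W).
Proof.
split=> //; exists 1 => // v; rewrite mul1r prod_normE/=.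
by rewrite le_max lexx.
Qed.

Lemma bl_snd V W : bounded_linear (@snd V W).
Proof.
split=> //; exists 1 => // v; rewrite mul1r prod_normE/=.
by rewrite le_max lexx orbT.
Qed.

Lemma sdiff_id V (x : V) : sdiff id x id.
Proof. exact/sdiff_linear/bl_id. Qed.

Lemma sdiff_cst V W (x : V) (w : W) : sdiff (fun _ => w) x (fun _ => 0).
Proof.
split; first exact: bl_zero.
by move=> e e0; exists 1 => // y z _ _; rewrite !subrr normr0 mulr_ge0// ltW.
Qed.

Lemma sdiff_translate V W (f : V -> W) x L w : sdiff f x L ->
  sdiff (fun y => f y + w) x L.
Proof.
move=> [bL hL]; split=> // e e0; have [d d0 hd] := hL e e0.
by exists d => // y z hy hz; rewrite opprD addrACA subrr addr0; exact: hd.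
Qed.

Lemma sdiff_near V W (f g : V -> W) x L : (\forall y \near x, f y = g y) ->
  sdiff f x L -> sdiff g x L.
Proof.
move=> /near_distP[d' d'0 hd'] [bL hL]; split=> // e e0.
have [d d0 hd] := hL e e0; exists (Num.min d d'); first by rewrite lt_min d0.
move=> y z; rewrite !lt_min => /andP[y1 y2] /andP[z1 z2].
by rewrite -!hd'//; exact: hd.
Qed.

Lemma sdiff_derive V W (f : V -> W) x L v : sdiff f x L -> is_derive x v f (L v).
Proof.
move=> [bL hL].
suff H : h^-1 *: (f (h *: v + x) - f x) @[h --> 0^'] --> L v.
  split; last exact: cvg_lim H.
  by apply/cvg_ex; exists (L v).
apply/cvgrPdistC_le => e e0; rewrite near_withinE; apply/(@near_distP R R^o).
have v1 : 0 < `|v| + 1 by rewrite ltr_wpDl.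
have [d d0 hd] := hL (e / (`|v| + 1)) (divr_gt0 e0 v1).
exists (d / (`|v| + 1)); first by rewrite divr_gt0.
move=> h; rewrite subr0 => hh h0.
have hv : `|h *: v + x - x| < d.
  rewrite addrK normrZ (le_lt_trans (_ : _ <= `|h| * (`|v| + 1)))//.
    by rewrite ler_wpM2l// lerDl.
  by rewrite -ltr_pdivlMr.
have := hd _ x hv; rewrite subrr normr0 => /(_ d0).
rewrite addrK blZ// normrZ => h1.
have -> : h^-1 *: (f (h *: v + x) - f x) - L v =
   h^-1 *: (f (h *: v + x) - f x - h *: L v).
  by rewrite [RHS]scalerBr scalerA mulVf// scale1r.
rewrite normrZ normfV ler_pdivrMl ?normr_gt0// (le_trans h1)//.
rewrite mulrCA ler_wpM2l// mulrAC ler_pdivrMr// ler_wpM2l ?(ltW e0)//.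
by rewrite lerDl.
Qed.

Lemma sdiff_uniq V W (f : V -> W) x L M : sdiff f x L -> sdiff f x M -> L =1 M.
Proof.
move=> hL hM v; have [_ <-] := sdiff_derive v hL.
by have [_ ->] := sdiff_derive v hM.
Qed.

Lemma sdiff_jacobian m k (f : 'rV[R]_m -> 'rV[R]_k) x L v : sdiff f x L ->
  v *m 'J f x = L v.
Proof.
move=> hf; have [bL hL] := hf.
pose LL : {linear 'rV[R]_m -> 'rV[R]_k} :=
  HB.pack L (GRing.isLinear.Build R _ _ _ L bL.1).
have cL : continuous LL.
  by move=> y; apply: sdiff_continuous; exact: (@sdiff_linear _ _ L y bL).
have e : 'd f x = LL :> (_ -> _).
  apply: diff_unique => //; apply/eqaddoP => e e0.
  suff H : \forall y \near (0 : 'rV[R]_m),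
      `|(f \o shift x - (cst (f x) + LL)) y| <= e * `|y| by exact: H.
  apply/near_distP; have [d d0 hd] := hL e e0; exists d => // y; rewrite subr0 => hy.
  rewrite !fctE/= /shift/=.
  have := hd (y + x) x; rewrite subrr normr0 addrK => /(_ hy d0).
  by rewrite opprD addrA.
by rewrite /jacobian mul_rV_lin1/= e.
Qed.

End StrictDifferentiability.

Section ContinuouslyDifferentiable.
Context (R : realType).
Implicit Types U V W : normedModType R.

(** A finite basis whose coordinate functionals have norm at most 1. It lets the passage from
    partial derivatives to strict derivatives be proved once for the line, for row vectors and for
    products. *)
Definition coordinates V (I : finType) (e : I -> V) (c : I -> V -> R) :=
  [/\ forall v, v = \sum_i c i v *: e i,
      forall i a u v, c i (a *: u + v) = a * c i u + c i v &
      forall i v, `|c i v| <= `|v|].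

Lemma coordinates_real : @coordinates R^o unit (fun=> 1) (fun=> id).
Proof.
split=> // v; rewrite (bigD1 tt)//= big1 ?addr0; last by case.
by rewrite [_ *: _]mulr1.
Qed.

Lemma norm_coord m (v : 'rV[R]_m) i : `|v 0 i| <= `|v|.
Proof.
have -> : `|v| = mx_norm v by []; rewrite mx_normrE.
exact: (le_bigmax _ (fun ij : 'I_1 * 'I_m => `|v ij.1 ij.2|) (0, i)).
Qed.

Lemma norm_rV_le m (v : 'rV[R]_m) (K : R) : 0 <= K ->
  (forall i, `|v 0 i| <= K) -> `|v| <= K.
Proof.
move=> K0 h; have -> : `|v| = mx_norm v by []; rewrite mx_normrE; apply/bigmax_leP; split=> //.
by move=> [i j] _ /=; rewrite ord1.
Qed.

Lemma coordinates_rV m : @coordinates 'rV[R]_m 'I_m (fun i => delta_mx 0 i)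
  (fun i v => v 0 i).
Proof.
split; first by move=> v; exact: row_sum_delta.
  by move=> i a u v; rewrite !mxE.
by move=> i v; exact: norm_coord.
Qed.

Lemma coordinates_prod U V (I J : finType) e c e' c' :
  @coordinates U I e c -> @coordinates V J e' c' ->
  @coordinates (U * V)%type (I + J)%type
    (fun k => match k with inl i => (e i, 0) | inr j => (0, e' j) end)
    (fun k v => match k with inl i => c i v.1 | inr j => c' j v.2 end).
Proof.
move=> [h1 h2 h3] [k1 k2 k3]; split.
- move=> [u v]; rewrite big_sumType/=.
  have e1 : \sum_i c i u *: (e i, 0 : V) = (u, 0).
    rewrite [in RHS](h1 u); apply: (big_ind2 (fun x y => x = (y, 0))) => //.
      by move=> _ x2 _ y2 -> ->; congr pair; rewrite /= addr0.
    by move=> i _; congr pair; rewrite /= scaler0.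
  have e2 : \sum_j c' j v *: (0 : U, e' j) = (0, v).
    rewrite [in RHS](k1 v); apply: (big_ind2 (fun x y => x = (0, y))) => //.
      by move=> _ x2 _ y2 -> ->; congr pair; rewrite /= addr0.
    by move=> i _; congr pair; rewrite /= scaler0.
  by rewrite e1 e2; congr pair; rewrite /= ?addr0 ?add0r.
- by move=> [i|j] a [u u'] [v v'] /=; rewrite ?h2 ?k2.
- move=> [i|j] [u v] /=; rewrite prod_normE/= le_max.
    by rewrite h3.
  by rewrite k3 orbT.
Qed.

Lemma derive_line V W (f : V -> W) p v (t : R) : derivable f (p + t *: v) v ->
  is_derive t (1 : R) (fun s : R => f (p + s *: v)) ('D_v f (p + t *: v)).
Proof.
move=> df.
have e : (fun h : R => h^-1 *: (f (p + (h *: (1 : R) + t) *: v) - f (p + t *: v))) =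
         (fun h => h^-1 *: (f (h *: v + (p + t *: v)) - f (p + t *: v))).
  apply/funext => h; congr (_ *: (f _ - _)).
  by rewrite [h *: (1 : R)]mulr1 scalerDl addrCA.
by split; rewrite /derivable /derive e.
Qed.

(** Going from z to y one coordinate at a time, each move is estimated by the mean value inequality
    for f minus its linear part at x; the partial derivatives vary little near x. *)
Lemma sdiff_C1 V W (I : finType) (e : I -> V) c (f : V -> W) (U : set V) x :
  coordinates e c -> open U -> U x -> Ck_on 1 U f ->
  sdiff f x (fun v => \sum_i c i v *: 'D_(e i) f x).
Proof.
move=> [ce clin cb] oU Ux [fcont fD]; split.
  split.
    move=> a u v; rewrite scaler_sumr -big_split/=; apply: eq_bigr => i _.
    by rewrite clin scalerDl scalerA.
  exists (1 + \sum_i `|'D_(e i) f x|); first by rewrite ltr_pwDl// sumr_ge0.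
  move=> v; rewrite (le_trans (ler_norm_sum _ _ _))// mulrDl mul1r.
  rewrite ler_wpDl// mulr_suml; apply: ler_sum => i _.
  by rewrite normrZ mulrC ler_wpM2l.
move=> e0 e00.
pose N : R := #|I|%:R + 1.
have N0 : 0 < N by rewrite ltr_wpDl.
pose e1 := e0 / N; have e10 : 0 < e1 by rewrite divr_gt0.
have [d d0 hd] : exists2 d : R, 0 < d & forall y, `|y - x| < d ->
    U y /\ forall i, `|'D_(e i) f y - 'D_(e i) f x| < e1.
  apply/near_distP.
  have h1 : \forall y \near x, U y by exact: open_nbhs_nbhs.
  have h2 : \forall y \near x, forall i, `|'D_(e i) f y - 'D_(e i) f x| < e1.
    apply: filter_forall => i; have [_ [Dc _]] := fD (e i).
    by have /cvgrPdistC_lt/(_ _ e10) := Dc x Ux.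
  by apply: filterS2 h1 h2.
(* [|v| * k] bounds every partial sum of coordinates of v, so with d' = d / (1 + 2 k) all
   intermediate points stay within d of x. *)
pose k : R := \sum_i `|e i| + 1.
have k0 : 0 < k by rewrite ltr_wpDl// sumr_ge0.
pose d' := d / (1 + 2 * k).
have k2 : 0 < 1 + 2 * k by lra.
have d'0 : 0 < d' by rewrite divr_gt0.
exists d' => // y z hy hz.
set v := y - z.
have hv : `|v| <= 2 * d'.
  have -> : v = (y - x) - (z - x) by rewrite opprB addrA subrK.
  by rewrite (le_trans (ler_normB _ _))//; lra.
have small w : `|w| <= `|v| * k -> `|z + w - x| < d.
  move=> hw; rewrite addrAC (le_lt_trans (ler_normD _ _))//.
  have : `|v| * k <= 2 * d' * k by rewrite ler_wpM2r// ltW.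
  have : d' * (1 + 2 * k) = d by rewrite /d' divfK// gt_eqF.
  by rewrite mulrDr mulr1 mulrA [d' * 2]mulrC; lra.
pose S (s : seq I) := \sum_(i <- s) c i v *: e i.
have hS s (t : R) i : uniq (i :: s) -> `|t| <= `|c i v| -> `|S s + t *: e i| <= `|v| * k.
  move=> us ht.
  have h1 : \sum_(j <- i :: s) `|e j| <= k.
    rewrite /k (le_trans (_ : _ <= \sum_j `|e j|)) ?lerDl//.
    by rewrite big_uniq//= [leRHS](bigID (mem (i :: s)))/= lerDl sumr_ge0.
  rewrite (le_trans (ler_normD _ _))// (le_trans _ (ler_wpM2l (normr_ge0 v) h1))//.
  rewrite big_cons mulrDr addrC lerD//.
    by rewrite normrZ ler_wpM2r// (le_trans ht).
  rewrite (le_trans (ler_norm_sum _ _ _))// mulr_sumr ler_sum// => j _.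
  by rewrite normrZ ler_wpM2r.
(* Induction on the list of coordinates already changed; [g] below is the next move with its linear
   part removed. *)
have main s : uniq s -> `|f (z + S s) - f z - \sum_(i <- s) c i v *: 'D_(e i) f x|
     <= (size s)%:R * e1 * `|v|.
  elim: s => [|i s ih] us.
    by rewrite /S !big_nil addr0 subrr subr0 normr0 mulr_ge0// mulr_ge0// ltW.
  have {}ih := ih (andP us).2.
  pose g (t : R) : W := f (z + S s + t *: e i) - t *: 'D_(e i) f x.
  have gd t : `|t| <= `|c i v| -> derivable g t 1 /\ `|'D_1 g t| <= e1.
    move=> ht.
    have [Ut Dt] := hd (z + S s + t *: e i)
      ltac:(by rewrite -[z + S s + _]addrA; apply: small; exact: hS).
    have [df _] := fD (e i).
    have D1 := derive_line (df _ Ut).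
    have D2 : is_derive t (1 : R) (fun s : R => s *: 'D_(e i) f x) ('D_(e i) f x).
      have hs : @sdiff R R^o W (fun s => s *: 'D_(e i) f x) t (fun s => s *: 'D_(e i) f x).
        apply: sdiff_linear; split.
          by move=> a u w; rewrite scalerDl scalerA.
        exists (`|'D_(e i) f x| + 1); first by rewrite ltr_wpDl.
        by move=> w; rewrite normrZ mulrC ler_wpM2r// lerDl.
      by have := sdiff_derive (1 : R^o) hs; rewrite scale1r.
    have D3 : is_derive t (1 : R) g ('D_(e i) f (z + S s + t *: e i) - 'D_(e i) f x).
      exact: is_deriveB.
    by split; [case: D3 | rewrite (@derive_val _ _ _ _ _ _ _ D3) ltW].
  have step : `|g (c i v) - g 0| <= e1 * `|c i v|.
    have [c0|c0] := leP 0 (c i v).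
      have := @le_norm_derive R W g 0 (c i v) e1 c0.
      rewrite subr0 ger0_norm//; apply => t /andP[t0 tc].
      by apply: gd; rewrite !ger0_norm.
    have := @le_norm_derive R W g (c i v) 0 e1 (ltW c0).
    rewrite sub0r distrC ltr0_norm//; apply => t /andP[tc t0].
    by apply: gd; rewrite ler0_norm// ltr0_norm// lerN2.
  have -> : f (z + S (i :: s)) - f z - \sum_(j <- i :: s) c j v *: 'D_(e j) f x =
    (f (z + S s) - f z - \sum_(j <- s) c j v *: 'D_(e j) f x) + (g (c i v) - g 0).
    rewrite /S !big_cons /g !scale0r addr0 subr0.
    have -> : z + (c i v *: e i + \sum_(j <- s) c j v *: e j) =
              z + \sum_(j <- s) c j v *: e j + c i v *: e i by rewrite -addrA [_ *: _ + _]addrC.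
    set a := f _; set b := f z; set p := _ *: _; set q := \sum_(j <- s) _.
    set o := f _.
    by rewrite [RHS]addrC !addrA subrK opprD addrA [a - b - p]addrAC.
  have -> : (size (i :: s))%:R * e1 * `|v| = (size s)%:R * e1 * `|v| + e1 * `|v|.
    by rewrite /= -natr1 !mulrDl mul1r.
  rewrite (le_trans (ler_normD _ _))// lerD//.
  by rewrite (le_trans step)// ler_pM2l.
have := main (enum I) (enum_uniq _).
have -> : S (enum I) = y - z by rewrite /S big_enum/= -ce.
have -> : z + (y - z) = y by rewrite addrC subrK.
rewrite big_enum/= => /le_trans; apply.
rewrite -cardE ler_wpM2r// /e1 mulrCA ger_pMr// ler_pdivrMr// mul1r /N.
by rewrite lerDl.
Qed.

Lemma fin_uniform (I : finType) (P : I -> R -> Prop) :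
  (forall i d d', P i d -> 0 < d' -> d' <= d -> P i d') ->
  (forall i, exists2 d : R, 0 < d & P i d) ->
  exists2 d : R, 0 < d & forall i, P i d.
Proof.
move=> mono h.
have /choice[d hd] : forall i, exists d : R, 0 < d /\ P i d.
  by move=> i; have [d d0 Pd] := h i; exists d.
pose m := \big[Num.min/1]_i d i.
have m0 : 0 < m by apply/bigmin_gtP; split=> // i _; exact: (hd i).1.
exists m => // i; apply: (mono _ (d i)) => //; first exact: (hd i).2.
exact: bigmin_le_cond.
Qed.

Lemma sdiff_C1_row m V (I : finType) (e : I -> V) c (f : V -> 'rV[R]_m)
    (U : set V) x : coordinates e c -> open U -> U x -> Ck_on 1 U f ->
  exists L, sdiff f x L.
Proof. by move=> hc oU Ux hf; eexists; exact: (sdiff_C1 hc oU Ux hf). Qed.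

End ContinuouslyDifferentiable.

(** * Differentiable maps into the group and increments near the identity *)

Section GroupValuedMaps.
Context (R : realType) (n : nat) (G : lieGroupType R n).
Implicit Types (U V W : normedModType R) (a b c : G).

Lemma chart_img_self a b : chart_dom a b -> chart_img a (chart a b).
Proof. by move=> h; exists b. Qed.

Lemma chart_imgP a (y : 'rV[R]_n) : chart_img a y ->
  chart_dom a (chart_inv a y) /\ chart a (chart_inv a y) = y.
Proof. by move=> [x hx <-]; rewrite chartK. Qed.

Lemma chart_open_preimage a (O : set G) : open O ->
  open (chart_img a `&` chart_inv a @^-1` O).
Proof.
move=> oO; rewrite openE => y [ay Oy]; apply: filterI.
  by apply: open_nbhs_nbhs; split=> //; exact: chart_img_open.
have c : {for y, continuous (chart_inv a)} by exact: chart_inv_continuous.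
by apply: (c O); exact: open_nbhs_nbhs.
Qed.

Lemma chart_image_setI a (O : set G) :
  chart a @` (chart_dom a `&` O) = chart_img a `&` chart_inv a @^-1` O.
Proof.
apply/seteqP; split=> [_ [x [ax Ox] <-]|y [/chart_imgP[h1 h2] Oy]].
  by split; [exact: chart_img_self | rewrite /= chartK].
by exists (chart_inv a y).
Qed.

Lemma chart_dom_near V (Phi : V -> G) x0 a : {for x0, continuous Phi} ->
  chart_dom a (Phi x0) -> \forall x \near x0, chart_dom a (Phi x).
Proof.
move=> cP ha; apply: (cP (chart_dom a)).
by apply: open_nbhs_nbhs; split=> //; exact: chart_dom_open.
Qed.

Lemma sdiff_transition a b (y : 'rV[R]_n) : chart_img a y ->
  chart_dom b (chart_inv a y) ->
  exists L, sdiff (fun z => chart b (chart_inv a z)) y L.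
Proof.
move=> ay hb; apply: (sdiff_C1_row (coordinates_rV R n) (U := chart a @` (chart_dom a `&` chart_dom b))).
- by rewrite chart_image_setI; apply: chart_open_preimage; exact: chart_dom_open.
- by rewrite chart_image_setI.
- exact: (chart_compatible a b 1%N).
Qed.

(** The chart at the value is only a normal form: [gdiff_chart] and [gdiff_of_chart] show that any
    chart around the value serves. *)
Definition gdiff V (Phi : V -> G) x0 := {for x0, continuous Phi} /\
  exists L, sdiff (fun x => chart (Phi x0) (Phi x)) x0 L.

Lemma gdiff_chart V (Phi : V -> G) x0 a : gdiff Phi x0 ->
  chart_dom a (Phi x0) -> exists L, sdiff (fun x => chart a (Phi x)) x0 L.
Proof.
move=> [cP [L hL]] ha; set b := Phi x0 in hL ha.
have hb : chart_dom b b by exact: chart_dom_self.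
have [M hM] : exists M, sdiff (fun z => chart a (chart_inv b z)) (chart b b) M.
  by apply: sdiff_transition; [exact: chart_img_self | rewrite chartK].
exists (M \o L); apply: (sdiff_near _ (sdiff_comp hL hM)).
have := chart_dom_near cP hb; apply: filterS => x hx /=.
by rewrite chartK.
Qed.

Lemma gdiff_of_chart V (Phi : V -> G) x0 a L : {for x0, continuous Phi} ->
  chart_dom a (Phi x0) -> sdiff (fun x => chart a (Phi x)) x0 L -> gdiff Phi x0.
Proof.
move=> cP ha hL; split=> //.
have [M hM] : exists M, sdiff (fun z => chart (Phi x0) (chart_inv a z)) (chart a (Phi x0)) M.
  apply: sdiff_transition; first exact: chart_img_self.
  by rewrite chartK//; exact: chart_dom_self.
exists (M \o L); apply: (sdiff_near _ (sdiff_comp hL hM)).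
have := chart_dom_near cP ha; apply: filterS => x hx /=.
by rewrite chartK.
Qed.

Lemma gdiff_cst V (x0 : V) (g : G) : gdiff (fun _ => g) x0.
Proof. by split; [exact: cst_continuous | exists (fun=> 0); exact: sdiff_cst]. Qed.

Lemma gdiff_chart_inv V (f : V -> 'rV[R]_n) x0 a L : sdiff f x0 L ->
  chart_img a (f x0) -> gdiff (fun x => chart_inv a (f x)) x0.
Proof.
move=> hf ha; have [h1 h2] := chart_imgP ha.
apply: (@gdiff_of_chart _ _ _ a L); [|exact: h1|].
  by apply: continuous_comp; [exact: sdiff_continuous hf | exact: chart_inv_continuous].
apply: (sdiff_near _ hf).
have : \forall x \near x0, chart_img a (f x).
  apply: (sdiff_continuous hf).
  by apply: open_nbhs_nbhs; split=> //; exact: chart_img_open.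
by apply: filterS => x /chart_imgP[_ ->].
Qed.

Lemma gdiff_comp U V (f : U -> V) (Phi : V -> G) x0 L : sdiff f x0 L ->
  gdiff Phi (f x0) -> gdiff (fun x => Phi (f x)) x0.
Proof.
move=> hf [cP [M hM]]; split.
  by apply: continuous_comp; [exact: sdiff_continuous hf | exact: cP].
by exists (M \o L); exact: (sdiff_comp hf hM).
Qed.

Definition mul_dom a b c : set ('rV[R]_n * 'rV[R]_n) :=
  [set z | [/\ chart_img a z.1, chart_img b z.2
  & chart_dom c (chart_inv a z.1 * chart_inv b z.2)%g]].

Lemma mul_dom_open a b c : open (mul_dom a b c).
Proof.
rewrite openE => -[u v] [/= hu hv huv].
have h1 : \forall z \near (u, v), chart_img a z.1.
  apply: (@cvg_fst _ _ (nbhs u) (nbhs v)).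
  by apply: open_nbhs_nbhs; split=> //; exact: chart_img_open.
have h2 : \forall z \near (u, v), chart_img b z.2.
  apply: (@cvg_snd _ _ (nbhs u) (nbhs v)).
  by apply: open_nbhs_nbhs; split=> //; exact: chart_img_open.
have h3 : \forall z \near (u, v), chart_dom c (chart_inv a z.1 * chart_inv b z.2)%g.
  have cc : {for (u, v), continuous (fun z : 'rV[R]_n * 'rV[R]_n =>
      (chart_inv a z.1 * chart_inv b z.2)%g)}.
    apply: (@continuous_comp _ _ _ (fun z : 'rV[R]_n * 'rV[R]_n =>
       (chart_inv a z.1, chart_inv b z.2)) (fun z : G * G => (z.1 * z.2)%g)).
      apply: cvg_pair.
        apply: (@continuous_comp _ _ _ fst (chart_inv a)); first exact: cvg_fst.
        exact: chart_inv_continuous.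
      apply: (@continuous_comp _ _ _ snd (chart_inv b)); first exact: cvg_snd.
      exact: chart_inv_continuous.
    exact: lie_mul_continuous.
  by apply: cc; apply: open_nbhs_nbhs; split=> //; exact: chart_dom_open.
by apply: filterS3 h1 h2 h3.
Qed.

Lemma gdiffM V (Phi Psi : V -> G) x0 : gdiff Phi x0 -> gdiff Psi x0 ->
  gdiff (fun x => (Phi x * Psi x)%g) x0.
Proof.
move=> hP hQ; have [cP [L hL]] := hP; have [cQ [M hM]] := hQ.
set a := Phi x0 in hL; set b := Psi x0 in hM; pose c := (a * b)%g.
have ha : chart_dom a a by exact: chart_dom_self.
have hb : chart_dom b b by exact: chart_dom_self.
have hc : chart_dom c c by exact: chart_dom_self.
have cm : {for x0, continuous (fun x => (Phi x * Psi x)%g)}.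
  apply: (@continuous_comp _ _ _ (fun x => (Phi x, Psi x)) (fun z : G * G => (z.1 * z.2)%g)).
    by apply: cvg_pair; [exact: cP | exact: cQ].
  exact: lie_mul_continuous.
have oS := @mul_dom_open a b c.
have [K hK] : exists K, sdiff (fun z : 'rV[R]_n * 'rV[R]_n =>
    chart c (chart_inv a z.1 * chart_inv b z.2)%g) (chart a a, chart b b) K.
  apply: (sdiff_C1_row (coordinates_prod (coordinates_rV R n) (coordinates_rV R n)) oS).
    by split=> /=; [exact: chart_img_self|exact: chart_img_self|rewrite !chartK].
  exact: (lie_mul_smooth a b c 1%N).
apply: (@gdiff_of_chart _ _ _ c (K \o (fun u => (L u, M u)))) => //.
apply: (sdiff_near _ (sdiff_comp (sdiff_pair hL hM) hK)).
have := chart_dom_near cP ha; have := chart_dom_near cQ hb.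
by apply: filterS2 => x hx hy /=; rewrite !chartK.
Qed.

Lemma gdiffV V (Phi : V -> G) x0 : gdiff Phi x0 -> gdiff (fun x => (Phi x)^-1%g) x0.
Proof.
move=> [cP [L hL]].
set a := Phi x0 in hL; pose b := (a^-1)%g.
have ha : chart_dom a a by exact: chart_dom_self.
have hb : chart_dom b b by exact: chart_dom_self.
have ci : {for x0, continuous (fun x => (Phi x)^-1%g)}.
  by apply: (continuous_comp cP); exact: lie_inv_continuous.
have [M hM] : exists M, sdiff (fun y => chart b (chart_inv a y)^-1%g) (chart a a) M.
  apply: (sdiff_C1_row (coordinates_rV R n) (U := [set y | chart_img a y /\
     chart_dom b (chart_inv a y)^-1%g])).
  - have := @chart_open_preimage a ((fun g : G => g^-1%g) @^-1` chart_dom b).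
    apply; apply: open_comp; last exact: chart_dom_open.
    by move=> x _; exact: lie_inv_continuous.
  - by split; [exact: chart_img_self | rewrite chartK].
  - exact: (lie_inv_smooth a b 1%N).
apply: (@gdiff_of_chart _ _ _ b (M \o L)) => //.
apply: (sdiff_near _ (sdiff_comp hL hM)).
by have := chart_dom_near cP ha; apply: filterS => x hx /=; rewrite chartK.
Qed.

Let z0 : 'rV[R]_n := chart (1%g : G) 1%g.

(* [gexp] is the inverse chart at the identity recentred at 0, not the
   exponential map; it agrees with it to first order, which is all we use. *)
Definition glog (g : G) : 'rV[R]_n := chart (1%g : G) g - z0.
Definition gexp (z : 'rV[R]_n) : G := chart_inv (1%g : G) (z0 + z).
Definition gdom : set 'rV[R]_n := [set z | chart_img (1%g : G) (z0 + z)].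

Lemma dom1 : chart_dom (1%g : G) 1%g.
Proof. exact: chart_dom_self. Qed.

Lemma gdom0 : gdom 0.
Proof. by rewrite /gdom/= addr0; exact/chart_img_self/dom1. Qed.

Lemma gdom_open : open gdom.
Proof.
rewrite openE => z hz.
have : \forall y \near z0 + z, chart_img (1%g : G) y.
  by apply: open_nbhs_nbhs; split=> //; exact: chart_img_open.
move=> /near_distP[d d0 hd].
suff : \forall y \near z, gdom y by [].
apply/near_distP; exists d => // y hy.
by apply: hd; rewrite opprD addrACA subrr add0r.
Qed.

Lemma gexp_dom z : gdom z -> chart_dom (1%g : G) (gexp z).
Proof. by move=> /chart_imgP[]. Qed.

Lemma gexpK z : gdom z -> glog (gexp z) = z.
Proof. by move=> /chart_imgP[_ h]; rewrite /glog h addrC addKr. Qed.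

Lemma glogK g : chart_dom (1%g : G) g -> gexp (glog g) = g.
Proof. by move=> hg; rewrite /gexp /glog addrC subrK chartK. Qed.

Lemma glog1 : glog 1%g = 0.
Proof. exact: subrr. Qed.

Lemma gexp0 : gexp 0 = 1%g.
Proof. by rewrite -glog1 glogK//; exact: dom1. Qed.

Lemma glog_continuous g : chart_dom (1%g : G) g -> {for g, continuous glog}.
Proof.
move=> hg; apply: cvgB; last exact: cvg_cst.
exact: chart_continuous.
Qed.

Lemma gdiff_gexp V (f : V -> 'rV[R]_n) x0 L : sdiff f x0 L -> gdom (f x0) ->
  gdiff (fun x => gexp (f x)) x0.
Proof.
move=> hf hd; have := sdiff_translate z0 hf => hf'.
apply: (@gdiff_chart_inv _ (fun x => z0 + f x) _ _ L); last exact: hd.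
by apply: sdiff_near hf'; apply: nearW => x; rewrite addrC.
Qed.

Lemma gexp_continuous z : gdom z -> {for z, continuous gexp}.
Proof. by move=> hz; have [] := gdiff_gexp (sdiff_id z) hz. Qed.

Lemma sdiff_glog V (Phi : V -> G) x0 : gdiff Phi x0 ->
  chart_dom (1%g : G) (Phi x0) -> exists L, sdiff (fun x => glog (Phi x)) x0 L.
Proof.
move=> hP hd; have [L hL] := gdiff_chart hP hd.
by exists L; exact: sdiff_translate.
Qed.

(** Makes the derivative of (x, y) |-> Phi(x)^-1 Phi(y) at a diagonal point a function of y - x
    alone. *)
Lemma sdiff_diagonal V (F : V * V -> 'rV[R]_n) x0 L : sdiff F (x0, x0) L ->
  (forall x, F (x, x) = 0) -> forall v, L (v, v) = 0.
Proof.
move=> hF hd v.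
have h1 : sdiff (fun x : V => (x, x)) x0 (fun v => (v, v)).
  exact: sdiff_pair (sdiff_id x0) (sdiff_id x0).
have h2 := sdiff_comp h1 hF.
have h3 : sdiff (F \o (fun x : V => (x, x))) x0 (fun _ => 0).
  by apply: (sdiff_near _ (sdiff_cst x0 0)); apply: nearW => x /=; rewrite hd.
exact: (sdiff_uniq h2 h3 v).
Qed.

(** Strict differentiability of (x, y) |-> glog (Phi(x)^-1 Phi(y)) at (x0, x0), applied to the
    points (x, y) and (x, x); the map vanishes at the second. The error is thus relative to |y - x|,
    uniformly in x. *)
Lemma gdiff_lincr V (Phi : V -> G) x0 : gdiff Phi x0 ->
  exists2 M : V -> 'rV[R]_n, bounded_linear M & forall e, 0 < e ->
  exists2 d, 0 < d & forall x y, `|x - x0| < d -> `|y - x0| < d ->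
    `|glog ((Phi x)^-1 * Phi y)%g - M (y - x)| <= e * `|y - x|.
Proof.
move=> hP.
have h1 : gdiff (fun p : V * V => Phi p.1) (x0, x0).
  by apply: (gdiff_comp (sdiff_linear (x0, x0) (bl_fst V V))).
have h2 : gdiff (fun p : V * V => Phi p.2) (x0, x0).
  by apply: (gdiff_comp (sdiff_linear (x0, x0) (bl_snd V V))).
have h3 := gdiffM (gdiffV h1) h2.
have [|L hL] := sdiff_glog h3; first by rewrite /= mulVg; exact: dom1.
have LD : forall v, L (v, v) = 0.
  by apply: (sdiff_diagonal hL) => x /=; rewrite mulVg glog1.
have bL := sdiff_bl hL.
exists (fun v => L (0, v)).
  have b0 : bounded_linear (fun v : V => (0 : V, v)).
    exact: bl_pair (bl_zero V V) (bl_id V).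
  exact: (bl_comp b0 bL).
move=> e e0; have [d d0 hd] := hL.2 e e0; exists d => // x y hx hy.
have := hd (x, y) (x, x).
have -> : (x, y) - (x, x) = (0, y - x) by congr pair; rewrite /= subrr.
rewrite /= mulVg glog1 subr0.
have -> : `|(0 : V, y - x)| = `|y - x|.
  by rewrite prod_normE/= normr0 max_r.
by apply; rewrite prod_normE/= gt_max ?hx ?hy.
Qed.

Lemma gdiff_rincr V (Phi : V -> G) x0 : gdiff Phi x0 ->
  exists2 M : V -> 'rV[R]_n, bounded_linear M & forall e, 0 < e ->
  exists2 d, 0 < d & forall x y, `|x - x0| < d -> `|y - x0| < d ->
    `|glog (Phi y * (Phi x)^-1)%g - M (y - x)| <= e * `|y - x|.
Proof.
move=> hP.
have h1 : gdiff (fun p : V * V => Phi p.1) (x0, x0).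
  by apply: (gdiff_comp (sdiff_linear (x0, x0) (bl_fst V V))).
have h2 : gdiff (fun p : V * V => Phi p.2) (x0, x0).
  by apply: (gdiff_comp (sdiff_linear (x0, x0) (bl_snd V V))).
have h3 := gdiffM h2 (gdiffV h1).
have [|L hL] := sdiff_glog h3; first by rewrite /= mulgV; exact: dom1.
have LD : forall v, L (v, v) = 0.
  by apply: (sdiff_diagonal hL) => x /=; rewrite mulgV glog1.
have bL := sdiff_bl hL.
exists (fun v => L (0, v)).
  have b0 : bounded_linear (fun v : V => (0 : V, v)).
    exact: bl_pair (bl_zero V V) (bl_id V).
  exact: (bl_comp b0 bL).
move=> e e0; have [d d0 hd] := hL.2 e e0; exists d => // x y hx hy.
have := hd (x, y) (x, x).
have -> : (x, y) - (x, x) = (0, y - x) by congr pair; rewrite /= subrr.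
rewrite /= mulgV glog1 subr0.
have -> : `|(0 : V, y - x)| = `|y - x|.
  by rewrite prod_normE/= normr0 max_r.
by apply; rewrite prod_normE/= gt_max ?hx ?hy.
Qed.

(** Comparing (u, z) with (u, 0), where the conjugate is 1, gives an error proportional to |z|
    uniformly in u; at u = 0 the map is the identity in z, which determines its derivative. *)
Lemma gexp_conj e : 0 < e -> exists2 d, 0 < d & forall u z : 'rV[R]_n,
  `|u| < d -> `|z| < d ->
  `|glog ((gexp u)^-1 * gexp z * gexp u)%g - z| <= e * `|z|.
Proof.
pose V := 'rV[R]_n.
have h1 : gdiff (fun p : V * V => gexp p.1) (0, 0).
  by apply: (gdiff_gexp (sdiff_linear (0, 0) (bl_fst V V))); exact: gdom0.
have h2 : gdiff (fun p : V * V => gexp p.2) (0, 0).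
  by apply: (gdiff_gexp (sdiff_linear (0, 0) (bl_snd V V))); exact: gdom0.
have h3 := gdiffM (gdiffM (gdiffV h1) h2) h1.
have [|L hL] := sdiff_glog h3.
  by rewrite /= gexp0 invg1 !mul1g; exact: dom1.
have bL := sdiff_bl hL.
have L2 v : L (0, v) = v.
  have k1 : sdiff (fun z : V => (0 : V, z)) 0 (fun v => (0, v)).
    exact: sdiff_pair (sdiff_cst 0 0) (sdiff_id 0).
  have k2 := sdiff_comp k1 hL.
  apply: (sdiff_uniq k2 (M := id)).
  apply: (sdiff_near _ (sdiff_id 0)).
  have : \forall z \near (0 : V), gdom z.
    by apply: open_nbhs_nbhs; split; [exact: gdom_open | exact: gdom0].
  by apply: filterS => z hz /=; rewrite gexp0 invg1 mul1g mulg1 gexpK.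
move=> e0; have [d d0 hd] := hL.2 e e0; exists d => // u z hu hz.
have h4 : `|(u, z) - (0 : V, 0 : V)| < d by rewrite prod_normE/= !subr0 gt_max hu hz.
have h5 : `|(u, 0 : V) - (0 : V, 0 : V)| < d.
  by rewrite prod_normE/= !subr0 normr0 gt_max hu d0.
have := hd _ _ h4 h5.
have -> : (u, z) - (u, 0) = (0, z) by congr pair; rewrite /= ?subrr ?subr0.
have -> : `|(0 : V, z)| = `|z| by rewrite prod_normE/= normr0 max_r.
by rewrite /= gexp0 mulg1 mulVg glog1 subr0 L2.
Qed.

End GroupValuedMaps.

(** * Borel sets, boxes and the uniqueness of measures on them *)

Section BorelSets.
Context (R : realType).

Lemma borel_open (T : ptopologicalType) (A : set T) :
  open A -> @measurable _ (borel T) A.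
Proof. exact: sub_sigma_algebra. Qed.

Lemma borel_closed (T : ptopologicalType) (A : set T) :
  closed A -> @measurable _ (borel T) A.
Proof.
by move=> cA; rewrite -[A]setCK; apply: measurableC; apply: borel_open; rewrite openC.
Qed.

(** Charts and their inverses are total functions that are continuous on an open set only, hence the
    intersection with [O]. *)
Lemma borel_preimage (T T' : ptopologicalType) (f : T -> T') (O : set T) :
  open O -> (forall x, O x -> {for x, continuous f}) ->
  forall A, @measurable _ (borel T') A -> @measurable _ (borel T) (O `&` f @^-1` A).
Proof.
move=> oO cf.
have mO : @measurable _ (borel T) O by exact: borel_open.
suff : @measurable _ (borel T') `<=`
    [set A | @measurable _ (borel T) (O `&` f @^-1` A)] by [].
apply: smallest_sub; last first.
  move=> A oA; apply: borel_open; rewrite openE => x [Ox Ax].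
  apply: filterI; first exact: open_nbhs_nbhs.
  by apply: (cf x Ox); exact: open_nbhs_nbhs.
split.
- by rewrite /= preimage_set0 setI0.
- move=> A mA; rewrite setTD /=.
  have -> : O `&` f @^-1` (~` A) = O `\` (O `&` f @^-1` A).
    by rewrite setDIr setDv set0U setDE preimage_setC.
  exact: measurableD.
- move=> F mF; rewrite /= preimage_bigcup setI_bigcupr.
  exact: bigcupT_measurable.
Qed.

Lemma borel_continuous (T T' : ptopologicalType) (f : T -> T') :
  continuous f -> measurable_fun [set: borel T] (f : borel T -> borel T').
Proof.
move=> cf _ A mA.
by apply: borel_preimage mA; [exact: openT | move=> x _; exact: cf].
Qed.

Lemma borel_continuous_real (T : ptopologicalType) (f : T -> R) :
  continuous f -> measurable_fun [set: borel T] (f : borel T -> R).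
Proof.
move=> cf; apply: (measurability _ (measurable_realfun.RGenOInfty.measurableE R)) => _ [_ [a ->] <-].
by rewrite setTI; apply: borel_open; apply: open_comp.
Qed.

Lemma borel_continuous_on_real (T : ptopologicalType) (f : T -> R) (O : set T) :
  open O -> (forall x, O x -> {for x, continuous f}) ->
  measurable_fun (O : set (borel T)) (f : borel T -> R).
Proof.
move=> oO cf; apply: (measurability _ (measurable_realfun.RGenOInfty.measurableE R)) => _ [_ [a ->] <-].
apply: borel_open; rewrite openE => x [Ox fx].
apply: filterI; first exact: open_nbhs_nbhs.
by apply: (cf x Ox); apply: open_nbhs_nbhs; split=> //; exact: interval_open.
Qed.

End BorelSets.

Section Boxes.
Context (R : realType) (n : nat).
Local Notation V := 'rV[R]_n.
Implicit Types a b x y : V.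

(** Half-open, unlike the closed boxes of [is_lebesgue]: such boxes split into disjoint boxes and
    are stable under intersection. *)
Definition box a b : set V := [set x | forall i, a 0 i <= x 0 i < b 0 i].

Lemma boxI a b a' b' : box a b `&` box a' b' =
  box (\row_i Num.max (a 0 i) (a' 0 i)) (\row_i Num.min (b 0 i) (b' 0 i)).
Proof.
apply/seteqP; split=> [x [h h'] i|x h].
  by rewrite !mxE ge_max lt_min; have /andP[-> ->] := h i; have /andP[-> ->] := h' i.
split=> i; have := h i; rewrite !mxE ge_max lt_min.
  by move=> /andP[/andP[-> _] /andP[-> _]].
by move=> /andP[/andP[_ ->] /andP[_ ->]].
Qed.

Lemma coord_cont i : continuous (fun x : V => x 0 i).
Proof. exact: coord_continuous. Qed.

Lemma box_measurable a b : @measurable _ (borel V) (box a b).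
Proof.
have -> : box a b = \bigcap_(i in [set: 'I_n]) [set x : V | a 0 i <= x 0 i < b 0 i].
  by apply/seteqP; split=> [x h i _|x h i]; [exact: h | exact: (h i I)].
apply: fin_bigcap_measurable => // i _.
have -> : [set x : V | a 0 i <= x 0 i < b 0 i] =
  (fun x : V => x 0 i) @^-1` [set t | a 0 i <= t] `\`
  (fun x : V => x 0 i) @^-1` [set t | b 0 i <= t].
  apply/seteqP; split=> x /=.
    by move=> /andP[-> h]; split=> //; apply/negP; rewrite -ltNge.
  by move=> [-> /negP]; rewrite -ltNge => ->.
apply: measurableD; apply: borel_closed; apply: preimage_closed; try exact: closed_ge.
  by move=> x _; exact: coord_cont.
by move=> x _; exact: coord_cont.
Qed.

(** For n = 0 every box is the whole space, so the empty set is adjoined. *)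
Definition boxes : set (set V) := [set A | A = set0 \/ exists a b, A = box a b].

Lemma boxes_setI : setI_closed boxes.
Proof.
move=> A B [->|[a [b ->]]]; first by rewrite set0I; left.
move=> [->|[a' [b' ->]]]; first by rewrite setI0; left.
by right; rewrite boxI; eexists; eexists.
Qed.

Lemma open_boxes (O : set V) : open O ->
  exists2 F : nat -> set V, (forall k, boxes (F k)) & O = \bigcup_k F k.
Proof.
move=> oO.
pose Q (p : 'rV[rat]_n * 'rV[rat]_n) := box (map_mx ratr p.1) (map_mx ratr p.2).
pose F k := if unpickle k is Some p then (if `[< Q p `<=` O >] then Q p else set0)
            else set0.
exists F.
  move=> k; rewrite /F; case: (unpickle k) => [p|]; last by left.
  by case: ifP => _; [right; eexists; eexists | left].
apply/seteqP; split=> x; last first.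
  move=> [k _]; rewrite /F; case: (unpickle k) => [p|//].
  by case: ifP => // /asboolP; apply.
move=> Ox.
have /near_distP[d d0 hd] : \forall y \near x, O y by exact: open_nbhs_nbhs.
have d2 : 0 < d / 2 by rewrite divr_gt0.
have /choice[a ha] : forall i, exists q : rat, x 0 i - d / 2 < ratr q < x 0 i.
  move=> i; have [q] := @rat_in_itvoo R (x 0 i - d / 2) (x 0 i) ltac:(by rewrite ltrBlDr ltrDl).
  by rewrite in_itv/= => h; exists q.
have /choice[b hb] : forall i, exists q : rat, x 0 i < ratr q < x 0 i + d / 2.
  move=> i; have [q] := @rat_in_itvoo R (x 0 i) (x 0 i + d / 2) ltac:(by rewrite ltrDl).
  by rewrite in_itv/= => h; exists q.
pose p : 'rV[rat]_n * 'rV[rat]_n := (\row_i a i, \row_i b i).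
have QO : Q p `<=` O.
  move=> y hy; apply: hd; apply: (@le_lt_trans _ _ (d / 2)); last first.
    by rewrite ltr_pdivrMr// ltr_pMr// ltr1n.
  apply: norm_rV_le; first exact: ltW.
  move=> i; rewrite !mxE ler_norml.
  have := hy i; rewrite /p !mxE => /andP[h1 h2].
  have /andP[a1 a2] := ha i; have /andP[b1 b2] := hb i.
  apply/andP; split.
    by rewrite lerBrDl (le_trans (ltW a1))// -?addrA.
  by rewrite lerBlDl (le_trans (ltW h2))// ltW.
exists (pickle p) => //; rewrite /F pickleK; case: asboolP => // _ i.
rewrite !mxE; have /andP[_ a2] := ha i; have /andP[b1 _] := hb i.
by rewrite b1 andbT ltW.
Qed.

End Boxes.

Section LebesgueOnRow.
Context (R : realType) (n : nat).
Local Notation V := 'rV[R]_n.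
Implicit Types (a b x y : V) (m : {measure set (borel V) -> \bar R}).

Lemma borel_boxes (A : set V) : @measurable _ (borel V) A -> <<s @boxes R n >> A.
Proof.
move: A; apply: smallest_sub; first exact: smallest_sigma_algebra.
move=> O /open_boxes[F Fb ->].
by apply: sigma_algebra_bigcup => k; exact: sub_sigma_algebra.
Qed.

Lemma boxes_measurable (A : set V) : boxes A -> @measurable _ (borel V) A.
Proof. by move=> [->|[a [b ->]]]; [exact: measurable0 | exact: box_measurable]. Qed.

Lemma box_cover (x : V) : exists k : nat, box (const_mx (- k%:R)) (const_mx k%:R) x.
Proof.
have [k hk] : exists k : nat, `|x| < k%:R.
  by exists (Num.bound `|x|); exact: archi_boundP.
exists k => i; rewrite !mxE.
have := le_lt_trans (norm_coord x i) hk.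
by rewrite ltr_norml => /andP[/ltW -> ->].
Qed.

Lemma box_measure_unique m1 m2 : (forall a b, m1 (box a b) = m2 (box a b)) ->
  (forall a b, (m1 (box a b) < +oo)%E) ->
  forall A, @measurable _ (borel V) A -> m1 A = m2 A.
Proof.
move=> m12 fin A mA.
apply: (@g_sigma_algebra_measure_unique _ R (borel V) (@boxes R n)
  (fun A hA => boxes_measurable hA)
  (fun k => box (const_mx (- k%:R)) (const_mx k%:R))) => //.
- by move=> k; right; eexists; eexists.
- apply/seteqP; split=> // x _; have [k hk] := box_cover x.
  by exists k.
- exact: boxes_setI.
- by move=> B [->|[a [b ->]]]; rewrite ?measure0.
- exact: borel_boxes.
Qed.

Lemma bernoulli_ineq (e : R) k : 0 <= e <= 1 -> 1 - k%:R * e <= (1 - e) ^+ k.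
Proof.
move=> /andP[e0 e1]; elim: k => [|k ih]; first by rewrite mul0r subr0 expr0.
rewrite exprS; apply: le_trans (ler_wpM2l _ ih); last by rewrite subr_ge0.
have -> : (1 - e) * (1 - k%:R * e) = 1 - k.+1%:R * e + k%:R * e ^+ 2.
  by rewrite -natr1; ring.
by rewrite lerDl mulr_ge0// sqr_ge0.
Qed.

Definition rect a b : set V := [set x | forall i, a 0 i <= x 0 i <= b 0 i].

Lemma rect_measurable a b : @measurable _ (borel V) (rect a b).
Proof.
have -> : rect a b = \bigcap_(i in [set: 'I_n])
    (fun x : V => x 0 i) @^-1` [set t | a 0 i <= t <= b 0 i].
  by apply/seteqP; split=> [x h i _|x h i]; [exact: h | exact: (h i I)].
apply: borel_closed; apply: closed_bigI => i _; apply: preimage_closed.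
  by move=> x _; exact: coord_cont.
have -> : [set t | a 0 i <= t <= b 0 i] =
    [set t | a 0 i <= t] `&` [set t | t <= b 0 i].
  by apply/seteqP; split=> t /=; [move=> /andP[-> ->] | move=> [-> ->]].
by apply: closedI; [exact: closed_ge | exact: closed_le].
Qed.

Section Lebesgue.
Variable lam : {measure set (borel V) -> \bar R}.
Hypothesis hlam : is_lebesgue lam.

(** The half-open box lies in the closed one and contains the closed boxes whose sides are shrunk by
    1 - t; by Bernoulli's inequality the latter lose at most n t times the volume. *)
Lemma leb_box a b : (forall i, a 0 i <= b 0 i) ->
  lam (box a b) = (\prod_(i < n) (b 0 i - a 0 i))%:E.
Proof.
move=> ab; set P := \prod_(i < n) _.
have P0 : 0 <= P by apply: prodr_ge0 => i _; rewrite subr_ge0.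
have up : (lam (box a b) <= P%:E)%E.
  rewrite /P -(hlam ab); apply: le_measure; rewrite ?inE.
  - exact: box_measurable.
  - exact: (rect_measurable a b).
  - by move=> x h i; have /andP[-> /ltW ->] := h i.
apply/eqP; rewrite eq_le up /=.
have [|/existsNP[i /negP]] := pselect (forall i, a 0 i < b 0 i); last first.
  rewrite -leNgt => bai; rewrite [P](_ : _ = 0) ?measure_ge0//.
  by rewrite /P (bigD1 i)//= (le_anti (introT andP (conj (ab i) bai))) subrr mul0r.
move=> ab'.
have fn : lam (box a b) \is a fin_num.
  by rewrite ge0_fin_numE ?measure_ge0// (le_lt_trans up)// ltry.
rewrite -(fineK fn) lee_fin; apply: le_addgt0P => e e0.
have nP : 0 < n%:R * P + 1 by rewrite ltr_wpDl// mulr_ge0.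
pose t := Num.min 1 (e / (n%:R * P + 1)).
have t0 : 0 < t by rewrite lt_min ltr01 divr_gt0.
have t1 : t <= 1 by rewrite ge_min lexx.
have te : n%:R * t * P <= e.
  have : t <= e / (n%:R * P + 1) by rewrite ge_min lexx orbT.
  rewrite ler_pdivlMr// => h; apply: le_trans h.
  by rewrite mulrDr mulr1 mulrCA mulrA lerDl ltW.
pose b' : V := \row_i (a 0 i + (1 - t) * (b 0 i - a 0 i)).
have ab'' i : a 0 i <= b' 0 i.
  by rewrite mxE lerDl mulr_ge0// subr_ge0.
have : (lam (rect a b') <= lam (box a b))%E.
  apply: le_measure; rewrite ?inE.
  - exact: rect_measurable.
  - exact: box_measurable.
  - move=> x h i; have /andP[-> h2] := h i; rewrite /= (le_lt_trans h2)// mxE.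
    by rewrite -ltrBrDl gtr_pMl ?subr_gt0// ltrBlDr ltrDl.
rewrite (hlam ab'') -(fineK fn) lee_fin.
have -> : \prod_(i < n) (b' 0 i - a 0 i) = (1 - t) ^+ n * P.
  rewrite -[n in _ ^+ n]card_ord -prodr_const -big_split/=.
  by apply: eq_bigr => i _; rewrite mxE addrC addKr.
move=> h; apply: (@le_trans _ _ ((1 - t) ^+ n * P + e)); last by rewrite lerD2r.
have := ler_wpM2r P0 (@bernoulli_ineq t n (introT andP (conj (ltW t0) t1))).
by rewrite mulrBl mul1r lerBlDr => /le_trans; apply; rewrite lerD2l.
Qed.

Lemma box_empty a b i : b 0 i <= a 0 i -> box a b = set0.
Proof.
move=> ba; apply/seteqP; split=> // x /(_ i) /andP[h1 h2].
by have := lt_le_trans h2 (le_trans ba h1); rewrite ltxx.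
Qed.

Lemma leb_box_fin a b : (lam (box a b) < +oo)%E.
Proof.
have [ab|/existsNP[i /negP]] := pselect (forall i, a 0 i <= b 0 i).
  by rewrite leb_box// ltry.
by rewrite -ltNge => /ltW h; rewrite (box_empty h) measure0.
Qed.

End Lebesgue.

Lemma translate_box w a b : [set x | box a b (x + w)] = box (a - w) (b - w).
Proof.
apply/seteqP; split=> x h i; have := h i; rewrite !mxE.
  by rewrite lerBlDr ltrBrDr.
by rewrite lerBlDr ltrBrDr.
Qed.

Lemma translate_continuous w : continuous (fun x : V => x + w).
Proof.
move=> x; apply/continuous_distP => e e0; exists e => // y.
by rewrite opprD addrACA subrr addr0.
Qed.

Lemma translate_measurable w (A : set V) : @measurable _ (borel V) A ->
  @measurable _ (borel V) [set x | A (x + w)].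
Proof.
move=> mA; rewrite -[X in measurable X]setTI.
exact: (borel_continuous (@translate_continuous w)).
Qed.

End LebesgueOnRow.

(** * Operators almost skew for a positive form *)

Section PreHilbertForm.
Context (R : realType) (E : lmodType R) (Q : E -> E -> R).

(** Semidefinite only: a form built from one functional may vanish on nonzero vectors, so
    [form_norm] is a seminorm. *)
Definition psd_form := [/\ forall a u v w, Q (a *: u + v) w = a * Q u w + Q v w,
  forall u v, Q u v = Q v u & forall v, 0 <= Q v v].

Definition form_norm (v : E) : R := Num.sqrt (Q v v).

Hypothesis hQ : psd_form.

Lemma form_linl a u v w : Q (a *: u + v) w = a * Q u w + Q v w.
Proof. by case: hQ => h _ _; exact: h. Qed.

Lemma form_sym u v : Q u v = Q v u.
Proof. by case: hQ => _ h _; exact: h. Qed.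

Lemma form_ge0 v : 0 <= Q v v.
Proof. by case: hQ => _ _ h; exact: h. Qed.

Lemma form0l v : Q 0 v = 0.
Proof.
have := form_linl 1 0 0 v; rewrite scale1r addr0 mul1r => h.
by apply: (@addrI _ (Q 0 v)); rewrite addr0 -h.
Qed.

Lemma formDl u v w : Q (u + v) w = Q u w + Q v w.
Proof. by rewrite -[u in LHS]scale1r form_linl mul1r. Qed.

Lemma formZl a u w : Q (a *: u) w = a * Q u w.
Proof. by rewrite -[_ *: _]addr0 form_linl form0l addr0. Qed.

Lemma formNl u w : Q (- u) w = - Q u w.
Proof. by rewrite -scaleN1r formZl mulN1r. Qed.

Lemma form_suml (I : Type) (s : seq I) (F : I -> E) w :
  Q (\sum_(i <- s) F i) w = \sum_(i <- s) Q (F i) w.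
Proof.
elim: s => [|i s ih]; first by rewrite !big_nil form0l.
by rewrite !big_cons formDl ih.
Qed.

Lemma form_expand u v (t : R) :
  Q (t *: v + u) (t *: v + u) = t ^+ 2 * Q v v + 2 * t * Q u v + Q u u.
Proof.
rewrite form_linl [Q v _]form_sym [Q u (_ + _)]form_sym !form_linl.
by rewrite [Q v u]form_sym; ring.
Qed.

Lemma form_cauchy_sq u v : Q u v ^+ 2 <= Q u u * Q v v.
Proof.
have h t := form_ge0 (t *: v + u).
have {}h t : 0 <= t ^+ 2 * Q v v + 2 * t * Q u v + Q u u.
  by rewrite -form_expand.
have [v0|v0] := eqVneq (Q v v) 0.
  rewrite v0 mulr0; have [->|uv] := eqVneq (Q u v) 0; first by rewrite expr0n.
  have := h (- (Q u u + 1) / (2 * Q u v)).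
  rewrite v0 mulr0 add0r.
  have -> : 2 * (- (Q u u + 1) / (2 * Q u v)) * Q u v = - (Q u u + 1).
    by field; rewrite uv.
  by move=> h1; exfalso; lra.
have vp : 0 < Q v v by rewrite lt_neqAle eq_sym v0 form_ge0.
have := h (- Q u v / Q v v).
have -> : (- Q u v / Q v v) ^+ 2 * Q v v + 2 * (- Q u v / Q v v) * Q u v + Q u u
   = (Q u u * Q v v - Q u v ^+ 2) / Q v v by field.
by rewrite pmulr_lge0 ?invr_gt0// subr_ge0.
Qed.

Lemma form_norm_ge0 v : 0 <= form_norm v.
Proof. exact: sqrtr_ge0. Qed.

Lemma form_norm_sq v : form_norm v ^+ 2 = Q v v.
Proof. by rewrite sqr_sqrtr// form_ge0. Qed.

Lemma form_cauchy u v : `|Q u v| <= form_norm u * form_norm v.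
Proof.
rewrite -(@ler_pXn2r _ 2)// ?nnegrE ?mulr_ge0 ?form_norm_ge0//.
by rewrite real_normK ?num_real// exprMn !form_norm_sq form_cauchy_sq.
Qed.

Lemma form_normD u v : form_norm (u + v) <= form_norm u + form_norm v.
Proof.
rewrite -(@ler_pXn2r _ 2)// ?nnegrE ?addr_ge0 ?form_norm_ge0//.
rewrite form_norm_sq -[v]scale1r addrC form_expand scale1r.
have := form_cauchy u v; rewrite ler_norml => /andP[_ h].
by rewrite sqrrD !form_norm_sq; lra.
Qed.

Lemma form_normZ a u : form_norm (a *: u) = `|a| * form_norm u.
Proof.
by rewrite /form_norm formZl form_sym formZl mulrA -expr2 sqrtrM ?sqr_ge0// sqrtr_sqr.
Qed.

Lemma form_normN u : form_norm (- u) = form_norm u.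
Proof. by rewrite -scaleN1r form_normZ normrN1 mul1r. Qed.

Lemma form_norm0 : form_norm 0 = 0.
Proof. by rewrite /form_norm form0l sqrtr0. Qed.

Lemma form_norm_sum (I : Type) (s : seq I) (F : I -> E) :
  form_norm (\sum_(i <- s) F i) <= \sum_(i <- s) form_norm (F i).
Proof.
elim: s => [|i s ih]; first by rewrite !big_nil form_norm0.
by rewrite !big_cons (le_trans (form_normD _ _))// lerD2l.
Qed.

End PreHilbertForm.

Section Elliptic.
Context (R : realType) (E : lmodType R) (n : nat) (P : E -> Prop).
Context (D : 'I_n -> E -> E) (c : 'I_n -> 'I_n -> 'I_n -> R) (t : 'I_n -> R).
Context (s r T : R).
Hypothesis P0 : P 0.
Hypothesis Plin : forall a u v, P u -> P v -> P (a *: u + v).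
Hypothesis PD : forall i v, P v -> P (D i v).
Hypothesis Dlin : forall i a u v, P u -> P v ->
  D i (a *: u + v) = a *: D i u + D i v.
Hypothesis Dcomm : forall i j v, P v ->
  D i (D j v) - D j (D i v) = \sum_k c i j k *: D k v.
Hypothesis s0 : 0 <= s.
Hypothesis T0 : 0 < T.
Hypothesis tT : \sum_j t j ^+ 2 <= T ^+ 2.
Hypothesis rsT : s ^+ 2 + s * T < r ^+ 2.

(** The action of r^2 + Delta on smooth vectors, with D_j for dpi(X_j) and t_j for tr ad X_j. *)
Definition elliptic_op v :=
  r ^+ 2 *: v - \sum_j D j (D j v) - \sum_j t j *: D j v.
Local Notation A := elliptic_op.

Definition word_act (w : seq 'I_n) v := foldr D v w.

(* Exact skewness is the case s = 0; coercivity optimises over [th]. *)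
Definition almost_skew (Q : E -> E -> R) :=
  forall (w : 'I_n -> E) v th, (forall j, P (w j)) -> P v -> 0 < th ->
  `|\sum_j (Q (D j (w j)) v + Q (w j) (D j v))|
    <= s * (th * Q v v + th^-1 * \sum_j Q (w j) (w j)).

Lemma dom_add u v : P u -> P v -> P (u + v).
Proof. by move=> hu hv; rewrite -[u]scale1r; exact: Plin. Qed.

Lemma dom_scale a u : P u -> P (a *: u).
Proof. by move=> hu; rewrite -[_ *: _]addr0; exact: Plin. Qed.

Lemma dom_opp u : P u -> P (- u).
Proof. by move=> hu; rewrite -scaleN1r; exact: dom_scale. Qed.

Lemma dom_sum (I : Type) (l : seq I) (F : I -> E) :
  (forall i, P (F i)) -> P (\sum_(i <- l) F i).
Proof.
move=> h; elim: l => [|i l ih]; first by rewrite big_nil.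
by rewrite big_cons; exact: dom_add.
Qed.

Lemma dom_word w v : P v -> P (word_act w v).
Proof. by move=> hv; elim: w => //= i w ih; exact: PD. Qed.

Lemma dom_op v : P v -> P (A v).
Proof.
move=> hv; apply: dom_add; last first.
  by apply/dom_opp/dom_sum => j; exact/dom_scale/PD.
apply: dom_add; first exact: dom_scale.
by apply/dom_opp/dom_sum => j; exact/PD/PD.
Qed.

Lemma D0 i : D i 0 = 0.
Proof.
have := Dlin i 1 P0 P0; rewrite !scale1r addr0 => h.
by apply: (@addrI _ (D i 0)); rewrite addr0 -h.
Qed.

Lemma DD i u v : P u -> P v -> D i (u + v) = D i u + D i v.
Proof. by move=> hu hv; rewrite -[u in LHS]scale1r Dlin// scale1r. Qed.

Lemma DZ i a u : P u -> D i (a *: u) = a *: D i u.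
Proof. by move=> hu; rewrite -[_ *: u]addr0 Dlin// D0 addr0. Qed.

Lemma DN i u : P u -> D i (- u) = - D i u.
Proof. by move=> hu; rewrite -scaleN1r DZ// scaleN1r. Qed.

Lemma D_sum (I : Type) i (l : seq I) (F : I -> E) :
  (forall i, P (F i)) -> D i (\sum_(k <- l) F k) = \sum_(k <- l) D i (F k).
Proof.
move=> h; elim: l => [|k l ih]; first by rewrite !big_nil D0.
by rewrite !big_cons DD// ?ih//; exact: dom_sum.
Qed.

Lemma word_actB w u v : P u -> P v ->
  word_act w (u - v) = word_act w u - word_act w v.
Proof.
move=> hu hv; elim: w => //= i w ->.
by rewrite DD ?DN//; do ?[exact: dom_word | apply: dom_opp].
Qed.

Lemma word_actZ w a u : P u -> word_act w (a *: u) = a *: word_act w u.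
Proof. by move=> hu; elim: w => //= i w ->; rewrite DZ//; exact: dom_word. Qed.

Lemma word_act_sum (I : Type) w (l : seq I) (F : I -> E) :
  (forall i, P (F i)) ->
  word_act w (\sum_(k <- l) F k) = \sum_(k <- l) word_act w (F k).
Proof.
move=> h; elim: w => //= i w ->; rewrite D_sum// => k; exact: dom_word.
Qed.

Lemma word_act_cat w1 w2 v : word_act (w1 ++ w2) v = word_act w1 (word_act w2 v).
Proof. by rewrite /word_act foldr_cat. Qed.

(** Almost skewness is used twice. With w_j = D_j v it turns - sum Q(D_j D_j v, v) into sum Q(D_j v,
    D_j v) up to an error. With w_j = t_j v the two terms of each summand coincide, so sum t_j Q(D_j
    v, v) is at most s T Q(v, v). *)
Lemma coercivity : exists2 kap : R, 0 < kap & forall Q, psd_form Q ->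
  almost_skew Q -> forall v, P v ->
  kap * (Q v v + \sum_j Q (D j v) (D j v)) <= Q (A v) v.
Proof.
move: (s0) (T0) (rsT) => hs0 hT0 hrsT; pose rho := r ^+ 2 - s * T.
have rhos : 0 < rho - s ^+ 2 by rewrite subr_gt0 ltrBrDr.
(* [th] is taken slightly above s: a positive share de / th of the gradient term survives, while s
   th exceeds s^2 by at most half of the gap rho - s^2. *)
pose de := (rho - s ^+ 2) / (2 * (s + 1)).
have de0 : 0 < de by rewrite divr_gt0// mulr_gt0//; lra.
have sde : s * de <= (rho - s ^+ 2) / 2.
  have e : de * (s + 1) = (rho - s ^+ 2) / 2.
    by rewrite /de; field; rewrite gt_eqF//; lra.
  by rewrite -e mulrDr mulr1 mulrC; lra.
pose th := s + de; have th0 : 0 < th by rewrite /th; lra.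
exists (Num.min (de / th) ((rho - s ^+ 2) / 2)).
  by rewrite lt_min divr_gt0//= divr_gt0.
move=> Q hQ hsk v hv.
have := hsk (fun j => D j v) v th (fun j => PD j hv) hv th0.
have := hsk (fun j => t j *: v) v T (fun j => dom_scale (t j) hv) hv T0.
rewrite !big_split/=.
under eq_bigr => j _ do rewrite DZ// (formZl hQ).
under [X in _ + X]eq_bigr => j _ do rewrite (formZl hQ) (form_sym hQ).
under [X in T^-1 * X]eq_bigr => j _ do
  rewrite (formZl hQ) (form_sym hQ) (formZl hQ) mulrA -expr2.
rewrite -mulr_suml.
have -> : Q (A v) v = r ^+ 2 * Q v v - \sum_j Q (D j (D j v)) v
    - \sum_j t j * Q (D j v) v.
  rewrite /elliptic_op !(formDl hQ) !(formNl hQ) !(form_suml hQ) (formZl hQ).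
  by congr (_ - _); apply: eq_bigr => j _; rewrite (formZl hQ).
set a := Q v v; set S := \sum_j Q (D j v) (D j v).
set x := \sum_j Q (D j (D j v)) v; set y := \sum_j t j * Q (D j v) v.
have a0 : 0 <= a by exact: form_ge0.
have S0 : 0 <= S by apply: sumr_ge0 => j _; exact: form_ge0.
rewrite ler_norml => /andP[_ h1]; rewrite ler_norml => /andP[_ h2].
have h3 : T^-1 * ((\sum_j t j ^+ 2) * a) <= T * a.
  rewrite mulrA ler_wpM2r// mulrC ler_pdivrMr// -expr2//.
have h4 : s * (T^-1 * ((\sum_j t j ^+ 2) * a)) <= s * (T * a) by rewrite ler_wpM2l.
have h5 : Num.min (de / th) ((rho - s ^+ 2) / 2) * S <= (de / th) * S.
  by rewrite ler_wpM2r// ge_min lexx.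
have h6 : Num.min (de / th) ((rho - s ^+ 2) / 2) * a <= (rho - s ^+ 2) / 2 * a.
  by rewrite ler_wpM2r// ge_min lexx orbT.
have h7 : s * (th^-1 * S) = S - de / th * S.
  rewrite /th; field; rewrite gt_eqF//.
have h8 : (s * de) * a <= (rho - s ^+ 2) / 2 * a by rewrite ler_wpM2r.
have h9 : s * (th * a) = s ^+ 2 * a + (s * de) * a by rewrite /th; ring.
rewrite mulrDr in h1; rewrite mulrDr in h2.
rewrite mulrDr; move: h6 h8; rewrite h7 h9 in h2; rewrite /rho.
move: h1 h2 h4 h5; rewrite !mulrBl => *; lra.
Qed.

(** The third-order terms cancel: commuting A with D_i costs words of length at most two. This is
    what makes an induction on the order possible. *)
Lemma commutator_op i v : P v -> A (D i v) - D i (A v) =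
  - \sum_j \sum_k c j i k *: (D j (D k v) + D k (D j v))
  - \sum_j \sum_k (t j * c j i k) *: D k v.
Proof.
move=> hv.
have hDj j : P (D j v) by exact: PD.
have hDDj j k : P (D j (D k v)) by exact/PD/PD.
have PS1 : P (\sum_j D j (D j v)) by exact: dom_sum.
have PS2 : P (\sum_j t j *: D j v) by apply: dom_sum => j; exact: dom_scale.
rewrite /elliptic_op DD; last 2 first.
  - by apply: dom_add; [exact: dom_scale | exact: dom_opp].
  - exact: dom_opp.
rewrite DD; last 2 first. exact: dom_scale. exact: dom_opp.
rewrite DZ// !DN// !D_sum//; last by move=> j; exact: dom_scale.
have e1 j : D j (D j (D i v)) = D i (D j (D j v))
   + \sum_k c j i k *: (D j (D k v) + D k (D j v)).
  have h1 : D j (D i v) = D i (D j v) + \sum_k c j i k *: D k v.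
    by rewrite -Dcomm// addrC subrK.
  rewrite {1}h1 DD//; last by apply: dom_sum => k; exact: dom_scale.
  have -> : D j (D i (D j v)) = D i (D j (D j v)) + \sum_k c j i k *: D k (D j v).
    by rewrite -Dcomm// addrC subrK.
  rewrite -addrA; congr (_ + _).
  rewrite D_sum; last by move=> k; exact: dom_scale.
  rewrite addrC -big_split/=; apply: eq_bigr => k _.
  by rewrite DZ// scalerDr.
have e2 j : t j *: D j (D i v) = D i (t j *: D j v)
    + \sum_k (t j * c j i k) *: D k v.
  rewrite DZ//.
  have -> : D j (D i v) = D i (D j v) + \sum_k c j i k *: D k v.
    by rewrite -Dcomm// addrC subrK.
  rewrite scalerDr scaler_sumr; congr (_ + _); apply: eq_bigr => k _.
  by rewrite scalerA.
under eq_bigr => j _ do rewrite e1.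
under [X in _ - X - _]eq_bigr => j _ do rewrite e2.
rewrite !big_split/=.
set a := r ^+ 2 *: _; set b := \sum_i0 D i _; set d := \sum_i0 D i _.
set e := \sum_j \sum_k _; set f := \sum_j \sum_k _.
have -> : a - (b + e) - (d + f) = (- e - f) + (a - b - d).
  by rewrite [RHS]addrC !opprD !addrA [a - b - e - d]addrAC.
by rewrite addrK.
Qed.


Lemma word_actN w u : P u -> word_act w (- u) = - word_act w u.
Proof. by move=> hu; rewrite -[- u]scaleN1r word_actZ// scaleN1r. Qed.

Lemma energy_bound : exists2 C : R, 0 < C & forall Q, psd_form Q ->
  almost_skew Q -> forall v, P v ->
  form_norm Q v <= C * form_norm Q (A v) /\
  forall i, form_norm Q (D i v) <= C * form_norm Q (A v).
Proof.
have [kap kap0 H] := coercivity.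
exists kap^-1; first by rewrite invr_gt0.
move=> Q hQ hsk v hv.
have S0 : 0 <= \sum_j Q (D j v) (D j v) by apply: sumr_ge0 => j _; exact: form_ge0.
have h1 : kap * (Q v v + \sum_j Q (D j v) (D j v)) <=
    form_norm Q (A v) * form_norm Q v.
  rewrite (le_trans (H _ hQ hsk _ hv))// (le_trans (ler_norm _))//.
  exact: form_cauchy.
set N := form_norm Q (A v) in h1 *.
have N0 : 0 <= N by exact: form_norm_ge0.
have hv1 : form_norm Q v <= kap^-1 * N.
  have [->|v0] := eqVneq (form_norm Q v) 0.
    by rewrite mulr_ge0// invr_ge0 ltW.
  have vp : 0 < form_norm Q v by rewrite lt_neqAle eq_sym v0 form_norm_ge0.
  rewrite -(ler_pM2r vp) -(ler_pM2l kap0) -[kap^-1 * N * _]mulrA mulVKf ?gt_eqF//.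
  rewrite -expr2 form_norm_sq//; apply: le_trans h1.
  by rewrite ler_pM2l// lerDl.
split=> // i.
have h2 : Q (D i v) (D i v) <= \sum_j Q (D j v) (D j v).
  rewrite (bigD1 i)//= lerDl; apply: sumr_ge0 => j _; exact: form_ge0.
rewrite -(@ler_pXn2r _ 2)// ?nnegrE ?form_norm_ge0//; last first.
  by rewrite mulr_ge0// invr_ge0 ltW.
rewrite form_norm_sq// (le_trans h2)//.
have h3 : kap * \sum_j Q (D j v) (D j v) <= N * (kap^-1 * N).
  apply: (@le_trans _ _ (N * form_norm Q v)); last by rewrite ler_wpM2l.
  apply: le_trans h1.
  by rewrite ler_pM2l// lerDr form_ge0.
by rewrite -(ler_pM2l kap0) (le_trans h3)// expr2 [leRHS]mulrA mulVKf ?gt_eqF.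
Qed.

(** Absorbs an unknown y that also occurs linearly on the right-hand side. *)
Lemma quadratic_bound (a b K y : R) : 0 <= a -> 0 <= b -> 0 <= K -> 0 <= y ->
  y ^+ 2 <= a * K * y + b * K ^+ 2 -> y <= (a + b + 1) * K.
Proof.
move=> a0 b0 K0 y0 h; rewrite leNgt; apply/negP => hy.
have yK : K < y.
  apply: le_lt_trans hy; rewrite !mulrDl mul1r.
  by rewrite lerDr addr_ge0// mulr_ge0.
have h1 : b * K ^+ 2 <= b * K * y.
  by rewrite expr2 mulrA ler_wpM2l ?mulr_ge0// ltW.
have h2 : (a + b + 1) * K * y < y ^+ 2.
  by rewrite expr2 ltr_pM2r// (le_lt_trans _ yK).
have h3 : 0 <= K * y by rewrite mulr_ge0.
by nra.
Qed.

(** Each structure constant multiplies two words of length two, and one word of length one with the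
    factor t_j. *)
Let cbound := \sum_j \sum_i \sum_k (`|c j i k| * (2 + `|t j|)).

Let cbound_ge0 : 0 <= cbound.
Proof.
by do 3 (apply: sumr_ge0 => ? _); rewrite mulr_ge0// addr_ge0.
Qed.

Let csum_le i : \sum_j \sum_k (`|c j i k| * (2 + `|t j|)) <= cbound.
Proof.
apply: ler_sum => j _; rewrite [leRHS](bigD1 i)//= lerDl.
by do 2 (apply: sumr_ge0 => ? _); rewrite mulr_ge0// addr_ge0.
Qed.

Lemma commutator_bound Q (w w' : seq 'I_n) i v K : psd_form Q -> P v -> 0 <= K ->
  (forall u, (size u <= size w + size w' + 2)%N ->
     form_norm Q (word_act u v) <= K) ->
  form_norm Q (word_act w (A (D i (word_act w' v)) - D i (A (word_act w' v))))
    <= cbound * K.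
Proof.
move=> hQ hv K0 hK.
set u := word_act w' v; have hu : P u by exact: dom_word.
have hK2 j k : form_norm Q (word_act w (D j (D k u))) <= K.
  have -> : word_act w (D j (D k u)) = word_act (w ++ [:: j, k & w']) v.
    by rewrite word_act_cat.
  by apply: hK; rewrite size_cat/= !addnS addn0.
have hK1 k : form_norm Q (word_act w (D k u)) <= K.
  have -> : word_act w (D k u) = word_act (w ++ k :: w') v by rewrite word_act_cat.
  by apply: hK; rewrite size_cat/= !addnS addn0.
have hP1 j k : P (D j (D k u)) by do 2 apply: PD.
have hP2 j k : P (c j i k *: (D j (D k u) + D k (D j u))).
  by apply: dom_scale; exact: dom_add.
have hP3 j k : P ((t j * c j i k) *: D k u) by apply: dom_scale; exact: PD.
have hS1 j : P (\sum_k c j i k *: (D j (D k u) + D k (D j u))) by exact: dom_sum.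
have hS2 j : P (\sum_k (t j * c j i k) *: D k u) by exact: dom_sum.
rewrite commutator_op// word_actB; last 2 first.
  - by apply/dom_opp/dom_sum.
  - exact: dom_sum.
rewrite -sub0r word_actB//; last exact: dom_sum.
rewrite (_ : word_act w 0 = 0); last first.
  by have := word_actZ w 0 hu; rewrite !scale0r.
rewrite sub0r -opprD form_normN// !word_act_sum//.
rewrite (le_trans (form_normD hQ _ _))//.
apply: (@le_trans _ _ (\sum_j \sum_k `|c j i k| * (2 * K)
    + \sum_j \sum_k `|c j i k| * (`|t j| * K))).
  apply: lerD.
    rewrite (le_trans (form_norm_sum hQ _ _))//; apply: ler_sum => j _.
    rewrite word_act_sum// (le_trans (form_norm_sum hQ _ _))//.
    apply: ler_sum => k _; rewrite word_actZ ?form_normZ ?ler_wpM2l//; last first.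
      exact: dom_add.
    have -> : D j (D k u) + D k (D j u) = D j (D k u) - - D k (D j u).
      by rewrite opprK.
    rewrite word_actB//; last exact: dom_opp.
    rewrite word_actN// opprK.
    by rewrite (le_trans (form_normD hQ _ _))// mulrDl !mul1r lerD.
  rewrite (le_trans (form_norm_sum hQ _ _))//; apply: ler_sum => j _.
  rewrite word_act_sum// (le_trans (form_norm_sum hQ _ _))//.
  apply: ler_sum => k _; rewrite word_actZ; last exact: PD.
  rewrite (form_normZ hQ) normrM.
  by rewrite [`|t j| * `|c j i k|]mulrC -mulrA ler_wpM2l// ler_wpM2l.
rewrite -big_split/=; under eq_bigr => j _ do rewrite -big_split/=.
apply: le_trans (ler_wpM2r K0 (csum_le i)).
rewrite mulr_suml; apply: ler_sum => j _; rewrite mulr_suml.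
by apply: ler_sum => k _; rewrite -mulrDr -mulrDl mulrA.
Qed.

(** Coercivity is applied to D_i v, and A D_i v is split as [A, D_i] v + D_i A v. The commutator has
    order two and almost skewness moves D_i off A v, so the square of the second-order norm [Y] is
    bounded by a multiple of K Y plus a multiple of K^2. *)
Lemma second_order_bound : exists2 C : R, 0 < C & forall Q, psd_form Q ->
  almost_skew Q -> forall v, P v -> forall u : seq 'I_n, (size u <= 2)%N ->
  form_norm Q (word_act u v) <= C * form_norm Q (A v).
Proof.
have [C C0 H] := energy_bound.
have [kap kap0 Hk] := coercivity.
pose G := n%:R * (1 + cbound * C) / kap.
pose B := n%:R * (s * (C ^+ 2 + 1) + cbound * (1 + C) * C) / kap.
have G0 : 0 <= G.
  by rewrite /G mulr_ge0 ?invr_ge0 ?(ltW kap0)// mulr_ge0// addr_ge0// mulr_ge0// ltW.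
have B0 : 0 <= B.
  rewrite /B mulr_ge0 ?invr_ge0 ?(ltW kap0)// mulr_ge0// addr_ge0//.
    by rewrite mulr_ge0// addr_ge0// sqr_ge0.
  by rewrite !mulr_ge0// ?addr_ge0// ltW.
exists (C + (G + B + 1)); first by lra.
move=> Q hQ hsk v hv.
set K := form_norm Q (A v); have K0 : 0 <= K by exact: form_norm_ge0.
have [hv0 hv1] := H _ hQ hsk _ hv.
pose Y := Num.sqrt (\sum_i \sum_j Q (D j (D i v)) (D j (D i v))).
have Yp : 0 <= \sum_i \sum_j Q (D j (D i v)) (D j (D i v)).
  by do 2 (apply: sumr_ge0 => ? _); exact: form_ge0.
have Y0 : 0 <= Y by exact: sqrtr_ge0.
have YY : Y ^+ 2 = \sum_i \sum_j Q (D j (D i v)) (D j (D i v)) by rewrite sqr_sqrtr.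
have hY i j : form_norm Q (D j (D i v)) <= Y.
  rewrite /Y /form_norm ler_wsqrtr// (bigD1 i)//= (bigD1 j)//= -addrA lerDl.
  rewrite addr_ge0//; first by apply: sumr_ge0 => ? _; exact: form_ge0.
  by do 2 (apply: sumr_ge0 => ? _); exact: form_ge0.
have hi i : kap * \sum_j Q (D j (D i v)) (D j (D i v)) <=
    (s * (C ^+ 2 + 1) + cbound * (1 + C) * C) * K ^+ 2 + (1 + cbound * C) * K * Y.
  have hDi : P (D i v) by exact: PD.
  have h1 := Hk _ hQ hsk _ hDi.
  have h2 : kap * \sum_j Q (D j (D i v)) (D j (D i v)) <= Q (A (D i v)) (D i v).
    by apply: le_trans h1; rewrite ler_pM2l// lerDr form_ge0.
  apply: (le_trans h2).
  rewrite -[A (D i v)](subrK (D i (A v))) formDl//.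
  pose L := Num.max (C * K) Y.
  have hcomm : form_norm Q (A (D i v) - D i (A v)) <= cbound * (Y + (1 + C) * K).
    have := @commutator_bound Q [::] [::] i v (Y + (1 + C) * K) hQ hv.
    apply; first by rewrite addr_ge0// mulr_ge0// addr_ge0// ltW.
    have CK : 0 <= C * K by rewrite mulr_ge0// ltW.
    move=> [|a [|b [|? ?]]]//= _.
    - by rewrite (le_trans hv0)// mulrDl mul1r addrA lerDr addr_ge0.
    - by rewrite (le_trans (hv1 a))// mulrDl mul1r addrA lerDr addr_ge0.
    - by rewrite (le_trans (hY b a))// lerDl mulr_ge0// addr_ge0// ltW.
  have h3 : Q (A (D i v) - D i (A v)) (D i v) <=
     (cbound * (Y + (1 + C) * K)) * (C * K).
    rewrite (le_trans (ler_norm _))// (le_trans (form_cauchy hQ _ _))//.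
    by rewrite ler_pM ?form_norm_ge0.
  have h4 : Q (D i (A v)) (D i v) <= s * (C ^+ 2 + 1) * K ^+ 2 + K * Y.
    (* The family is concentrated at i, so that almost skewness speaks of the single derivative D_i
       of A v; th = 1. *)
    pose w j := if j == i then A v else 0.
    have hw j : P (w j) by rewrite /w; case: ifP => // _; exact: dom_op.
    have eS : \sum_j Q (w j) (w j) = Q (A v) (A v).
      rewrite (bigD1 i)//= big1 ?addr0 ?/w ?eqxx//.
      by move=> j ji; rewrite (negbTE ji) (form0l hQ).
    have := hsk w (D i v) 1 hw hDi ltr01.
    rewrite eS.
    rewrite (bigD1 i)//= big1 ?addr0; last first.
      by move=> j ji; rewrite /w (negbTE ji) D0 (form0l hQ) (form0l hQ) addr0.
    rewrite /w eqxx invr1 !mul1r ler_norml => /andP[_].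
    have h5 : - Q (A v) (D i (D i v)) <= K * Y.
      rewrite (le_trans (ler_norm _))// normrN (le_trans (form_cauchy hQ _ _))//.
      by rewrite ler_wpM2l.
    have h6 : Q (D i v) (D i v) <= C ^+ 2 * K ^+ 2.
      rewrite -form_norm_sq// -exprMn ler_pXn2r// ?nnegrE ?form_norm_ge0//.
      by rewrite mulr_ge0// ltW.
    have h7 : Q (A v) (A v) = K ^+ 2 by rewrite -form_norm_sq.
    rewrite h7 => h8.
    have h9 : s * (Q (D i v) (D i v) + K ^+ 2) <= s * (C ^+ 2 + 1) * K ^+ 2.
      by rewrite -mulrA ler_wpM2l// mulrDl mul1r lerD2r.
    rewrite -[Q (D i (A v)) _](addrK (Q (A v) (D i (D i v)))) lerD//.
    exact: le_trans h8 h9.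
  have -> : (s * (C ^+ 2 + 1) + cbound * (1 + C) * C) * K ^+ 2 + (1 + cbound * C) * K * Y
    = cbound * (Y + (1 + C) * K) * (C * K) + (s * (C ^+ 2 + 1) * K ^+ 2 + K * Y) by ring.
  exact: lerD.
have hYb : Y <= (G + B + 1) * K.
  apply: quadratic_bound => //.
  have : kap * Y ^+ 2 <= n%:R * ((s * (C ^+ 2 + 1) + cbound * (1 + C) * C) * K ^+ 2
      + (1 + cbound * C) * K * Y).
    rewrite YY mulr_sumr (le_trans (ler_sum _ (fun i _ => hi i)))//.
    by rewrite [leRHS]mulr_natl sumr_const card_ord.
  rewrite -ler_pdivlMl// => h; apply: (le_trans h).
  by rewrite le_eqVlt; apply/orP; left; apply/eqP; rewrite /G /B; ring.
have CK : 0 <= C * K by rewrite mulr_ge0// ltW.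
have GK : 0 <= (G + B + 1) * K by rewrite mulr_ge0// !addr_ge0.
move=> [|a [|b [|? ?]]]//= _; rewrite mulrDl.
- by rewrite (le_trans hv0)// lerDl.
- by rewrite (le_trans (hv1 a))// lerDl.
- by rewrite (le_trans (hY b a))// (le_trans hYb)// lerDr.
Qed.

(** A is moved through w' one letter at a time; each exchange is a commutator [A, D_i] framed by
    words, hence the letter is appended to the outer word w in the induction. *)
Lemma word_commutator_bound Q w w' v K : psd_form Q -> P v -> 0 <= K ->
  (forall u, (size u <= size w + size w' + 1)%N ->
     form_norm Q (word_act u v) <= K) ->
  form_norm Q (word_act w (A (word_act w' v) - word_act w' (A v)))
    <= (size w')%:R * cbound * K.
Proof.
move=> hQ hv K0; elim: w' w => [|i w' ih] w hK /=.
  rewrite subrr (_ : word_act w 0 = 0) ?form_norm0 ?mul0r//.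
  by have := word_actZ w 0 hv; rewrite !scale0r.
have hu : P (word_act w' v) by exact: dom_word.
have hAv : P (word_act w' (A v)) by apply/dom_word/dom_op.
have hAu : P (A (word_act w' v)) by exact: dom_op.
have -> : A (D i (word_act w' v)) - D i (word_act w' (A v)) =
   (A (D i (word_act w' v)) - D i (A (word_act w' v)))
   - D i (word_act w' (A v) - A (word_act w' v)).
  rewrite DD//; last exact: dom_opp.
  by rewrite DN// opprB addrA subrK.
rewrite word_actB; last 2 first.
  - by apply: dom_add; [exact/dom_op/PD | exact/dom_opp/PD].
  - by apply: PD; apply: dom_add => //; exact: dom_opp.
rewrite (le_trans (form_normD hQ _ _))// form_normN//.
rewrite -natr1 2!mulrDl mul1r addrC lerD//.
  have -> : word_act w (D i (word_act w' (A v) - A (word_act w' v)))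
      = - word_act (rcons w i) (A (word_act w' v) - word_act w' (A v)).
    rewrite -cats1 word_act_cat/= -opprB DN; last first.
      by apply: dom_add => //; exact: dom_opp.
    rewrite -scaleN1r word_actZ ?scaleN1r//.
    by apply: PD; apply: dom_add => //; exact: dom_opp.
  rewrite form_normN//; apply: ih => u hsz; apply: hK.
  by move: hsz; rewrite size_rcons/= addSnnS.
apply: commutator_bound => // u hsz; apply: hK.
by move: hsz; rewrite /= addn2 addn1 addnS.
Qed.

(** A longest word is i :: j :: w. The second-order bound applied to the vector D_w v reduces it to
    A D_w v, and moving A through w costs words of length at most size w + 1, already bounded by
    induction. *)
Lemma higher_order_bound k : exists2 C : R, 0 < C & forall Q, psd_form Q ->
  almost_skew Q -> forall v K, P v -> 0 <= K ->
  (forall u, (size u <= k)%N -> form_norm Q (word_act u (A v)) <= K) ->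
  forall u, (size u <= k + 2)%N -> form_norm Q (word_act u v) <= C * K.
Proof.
elim: k => [|k [C C0 ih]].
  have [C C0 H] := second_order_bound; exists C => // Q hQ hsk v K hv K0 hK u hu.
  rewrite (le_trans (H _ hQ hsk _ hv _ hu))// ler_pM2l//.
  exact: (hK [::]).
have [C2 C20 H] := second_order_bound.
exists (C + C2 * (1 + k.+1%:R * cbound * C)).
  by rewrite ltr_pwDl// mulr_ge0 ?(ltW C20)// addr_ge0// !mulr_ge0// ltW.
move=> Q hQ hsk v K hv K0 hK.
have ihv u : (size u <= k + 2)%N -> form_norm Q (word_act u v) <= C * K.
  by apply: ih => // u' hu'; apply: hK; exact: leqW.
have hpos : 0 <= C2 * (1 + k.+1%:R * cbound * C) * K.
  by rewrite !mulr_ge0 ?(ltW C20)// addr_ge0// !mulr_ge0// ltW.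
move=> u hu; have [hu'|hu'] := leqP (size u) (k + 2).
  by rewrite (le_trans (ihv _ hu'))// mulrDl lerDl.
have {}hu : size u = k.+3.
  by move: hu hu'; rewrite !addn2 => hu hu'; apply/eqP; rewrite eqn_leq hu hu'.
case: u hu {hu'} => [|i [|j w]]//= [hw].
have hPw : P (word_act w v) by exact: dom_word.
apply: (@le_trans _ _ (C2 * form_norm Q (A (word_act w v)))).
  exact: (H _ hQ hsk _ hPw [:: i; j]).
rewrite mulrDl; apply: ler_wpDl; first by rewrite mulr_ge0// ltW.
rewrite -mulrA ler_pM2l// mulrDl mul1r.
rewrite -[A (word_act w v)](subrK (word_act w (A v))) addrC.
rewrite (le_trans (form_normD hQ _ _))// lerD//.
  by apply: hK; rewrite hw.
have -> : k.+1%:R * cbound * C * K = (size w)%:R * cbound * (C * K).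
  by rewrite hw !mulrA.
apply: (@word_commutator_bound Q [::] w v (C * K) hQ hv).
  by rewrite mulr_ge0// ltW.
by move=> u hu; apply: ihv; move: hu; rewrite /= hw add0n addn1 addn2.
Qed.

(** The constant comes before Q because the form will be chosen after the vector, through a
    functional that norms it. *)
Lemma elliptic_regularity k : exists2 C : R, 0 < C & forall Q, psd_form Q ->
  almost_skew Q -> forall v, P v -> forall u, (size u <= 2 * k)%N ->
  form_norm Q (word_act u v) <= C * form_norm Q (iter k A v).
Proof.
elim: k => [|k [C C0 ih]].
  exists 1 => // Q hQ _ v hv [|? ?]//= _; by rewrite mul1r.
have [C2 C20 H] := higher_order_bound (2 * k).
exists (C2 * C); first by rewrite mulr_gt0.
move=> Q hQ hsk v hv u hu; rewrite iterSr -mulrA.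
apply: (H Q hQ hsk v) => //.
- by rewrite mulr_ge0 ?form_norm_ge0// ltW.
- by move=> u' hu'; apply: ih => //; exact: dom_op.
- by rewrite (leq_trans hu)// mulnS addnC.
Qed.

End Elliptic.

(* Hahn-Banach through graphs of partial functionals dominated by the norm: the
   bound [p.2 <= `|p.1|] on a linear graph already makes it single-valued. *)
Lemma norming_functional (R : realType) (E : normedModType R) (x0 : E) :
  exists l : E -> R, [/\ forall a u v, l (a *: u + v) = a * l u + l v,
    forall v, `|l v| <= `|v| & l x0 = `|x0|].
Proof.
pose lin (A : set (E * R)) := forall a p q, A p -> A q ->
  A (a *: p.1 + q.1, a * p.2 + q.2).
pose bnd (A : set (E * R)) := forall p, A p -> p.2 <= `|p.1|.
pose L0 : set (E * R) := [set p | exists a, p = (a *: x0, a * `|x0|)].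
pose good A := A = set0 \/ [/\ lin A, bnd A & L0 `<=` A].
have L0good : good L0.
  right; split=> //.
    move=> a _ _ [b ->] [d ->] /=; exists (a * b + d).
    by rewrite scalerDl mulrDl scalerA mulrA.
  move=> _ [a ->] /=; rewrite normrZ ler_wpM2r//; exact: ler_norm.
have [A [gA maxA]] : exists A, good A /\ forall B, A `<` B -> ~ good B.
  apply: Zorn_bigcup => F Fg totF.
  have [[X [FX X0]]|noX] := pselect (exists X, F X /\ X !=set0); last first.
    left; apply/seteqP; split=> // p [X FX Xp].
    by exfalso; apply: noX; exists X; split=> //; exists p.
  right; split.
  - move=> a p q [Y FY Yp] [Z FZ Zq].
    have [YZ|ZY] := totF _ _ FY FZ.
      exists Z => //; have [Z0|[lZ _ _]] := Fg _ FZ; last by apply: lZ => //; exact: YZ.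
      by move: Zq; rewrite Z0.
    exists Y => //; have [Y0|[lY _ _]] := Fg _ FY; last by apply: lY => //; exact: ZY.
    by move: Yp; rewrite Y0.
  - move=> p [Y FY Yp]; have [Y0|[_ bY _]] := Fg _ FY; last exact: bY.
    by move: Yp; rewrite Y0.
  - have [XE|[_ _ L0X]] := Fg _ FX; first by move: X0; rewrite XE => -[].
    by move=> p /L0X Xp; exists X.
have [A0|[lA bA L0A]] := gA.
  exfalso; apply: (maxA L0) L0good; rewrite A0; split=> // h.
  by have := h (0, 0); apply; exists 0; rewrite scale0r mul0r.
have A00 : A (0, 0) by apply: L0A; exists 0; rewrite scale0r mul0r.
have dom v : exists s, A (v, s).
  apply: contrapT => nv.
  pose S := [set p.2 - `|p.1 - v| | p in A].
  have SA p q : A p -> A q -> p.2 - `|p.1 - v| <= `|q.1 + v| - q.2.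
    move=> Ap Aq.
    have h1 : p.2 + q.2 <= `|p.1 + q.1|.
      by have := bA _ (lA 1 _ _ Ap Aq); rewrite /= scale1r mul1r.
    have h2 : `|p.1 + q.1| <= `|p.1 - v| + `|q.1 + v|.
      by apply: le_trans (ler_normD _ _); rewrite addrACA addNr addr0.
    lra.
  have S0 : S !=set0 by exists (0 - `|0 - v|), (0, 0).
  have Sub q : A q -> ubound S (`|q.1 + v| - q.2).
    by move=> Aq _ [p Ap <-]; exact: SA.
  have hS : has_ubound S by exists (`|0 + v| - 0); exact: Sub (_, _) A00.
  (* By [SA] every lower constraint on the value at v lies below every upper constraint; any value
     in between extends the graph. *)
  pose a := sup S.
  have a1 p : A p -> p.2 - `|p.1 - v| <= a.
    by move=> Ap; apply: ub_le_sup => //; exists p.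
  have a2 q : A q -> a <= `|q.1 + v| - q.2.
    by move=> Aq; apply: ge_sup => //; exact: Sub.
  have As b p : A p -> A (b *: p.1, b * p.2).
    by move=> Ap; have := lA b _ _ Ap A00; rewrite /= !addr0.
  pose B := [set (p.1 + x *: v, p.2 + x * a) | p in A & x in [set: R]].
  apply: (maxA [set q | exists p x, A p /\ q = (p.1 + x *: v, p.2 + x * a)]).
    split.
      move=> p Ap; exists p, 0; split=> //.
      by rewrite scale0r mul0r !addr0 -surjective_pairing.
    move=> h; apply: nv; exists a; apply: h; exists (0, 0), 1; split=> //.
    by rewrite scale1r mul1r !add0r.
  right; split.
  - move=> b _ _ [p [x [Ap ->]]] [q [y [Aq ->]]] /=.
    exists (b *: p.1 + q.1, b * p.2 + q.2), (b * x + y); split; first exact: lA.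
    rewrite /= scalerDr scalerA mulrDr scalerDl mulrDl mulrA.
    by rewrite addrACA [X in (_, X)]addrACA.
  - move=> _ [p [x [Ap ->]]] /=.
    have [x0'|x0'|->] := ltgtP x 0; last first.
    + by rewrite scale0r mul0r !addr0; exact: bA.
    + have := a2 _ (As x^-1 _ Ap); rewrite /= => h.
      have e : `|p.1 + x *: v| = x * `|x^-1 *: p.1 + v|.
        have -> : p.1 + x *: v = x *: (x^-1 *: p.1 + v).
          by rewrite scalerDr scalerA divff ?gt_eqF// scale1r.
        by rewrite normrZ gtr0_norm.
      rewrite e; have := ler_wpM2l (ltW x0') h.
      by rewrite mulrBr mulrA divff ?gt_eqF// mul1r; lra.
    + have y0 : 0 < - x by rewrite oppr_gt0.
      have := a1 _ (As (- x)^-1 _ Ap); rewrite /= => h.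
      have e : `|p.1 + x *: v| = (- x) * `|(- x)^-1 *: p.1 - v|.
        have -> : p.1 + x *: v = (- x) *: ((- x)^-1 *: p.1 - v).
          by rewrite scalerBr scalerA divff ?gt_eqF// scale1r scaleNr opprK.
        by rewrite normrZ gtr0_norm.
      rewrite e; have := ler_wpM2l (ltW y0) h.
      by rewrite mulrBr mulrA divff ?gt_eqF// mul1r; lra.
  - move=> p /L0A Ap; exists p, 0; split=> //.
    by rewrite scale0r mul0r !addr0 -surjective_pairing.
have [l lP] := choice dom.
have uniq u s1 s2 : A (u, s1) -> A (u, s2) -> s1 = s2.
  move=> h1 h2; apply/eqP; rewrite eq_le.
  have := bA _ (lA (-1) _ _ h1 h2); have := bA _ (lA (-1) _ _ h2 h1).
  rewrite /= scaleN1r addNr normr0 !mulN1r => h3 h4.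
  by apply/andP; split; lra.
have llin a u v : l (a *: u + v) = a * l u + l v.
  by apply: (uniq (a *: u + v)) => //; exact: lA a _ _ (lP u) (lP v).
exists l; split=> //.
- move=> v; rewrite ler_norml; apply/andP; split; last exact: bA (_, _) (lP v).
  have := bA _ (lA (-1) _ _ (lP v) A00); rewrite /= !addr0 scaleN1r normrN mulN1r.
  lra.
- apply: (uniq x0) => //; apply: L0A; exists 1; by rewrite scale1r mul1r.
Qed.

(** * Reordering words into ordered monomials *)

Section OrderedMonomials.
Context (R : realType) (U : algType R) (n : nat) (x : 'I_n -> U).
Context (c : 'I_n -> 'I_n -> 'I_n -> R) (B : U -> Prop).
Hypothesis xcomm : forall i j, x i * x j - x j * x i = \sum_k c i j k *: x k.
Hypothesis Blin : forall a u v, B u -> B v -> B (a *: u + v).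
Hypothesis B0 : B 0.

Definition word_prod (w : seq 'I_n) : U := \prod_(i <- w) x i.

Definition monomial_word (m : 'I_n -> nat) : seq 'I_n :=
  flatten [seq nseq (m i) i | i <- enum 'I_n].

Definition sorted_word (w : seq 'I_n) : seq 'I_n := monomial_word (fun i => count_mem i w).

Lemma word_prod_cat w1 w2 : word_prod (w1 ++ w2) = word_prod w1 * word_prod w2.
Proof. by rewrite /word_prod big_cat. Qed.

Lemma word_prod_cons i w : word_prod (i :: w) = x i * word_prod w.
Proof. by rewrite /word_prod big_cons. Qed.

Lemma B_add u v : B u -> B v -> B (u + v).
Proof. by move=> hu hv; rewrite -[u]scale1r; exact: Blin. Qed.

Lemma B_scale a u : B u -> B (a *: u).
Proof. by move=> hu; rewrite -[_ *: _]addr0; exact: Blin. Qed.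

Lemma B_sum (I : Type) (l : seq I) (F : I -> U) :
  (forall i, B (F i)) -> B (\sum_(i <- l) F i).
Proof.
move=> h; elim: l => [|i l ih]; first by rewrite big_nil.
by rewrite big_cons; exact: B_add.
Qed.

Lemma perm_sorted_word w : perm_eq w (sorted_word w).
Proof.
apply/permP => p; rewrite /sorted_word /monomial_word count_flatten -map_comp.
have -> : map (count p \o (fun i => nseq (count_mem i w) i)) (enum 'I_n) =
  [seq (p i * count_mem i w)%N | i <- enum 'I_n].
  by apply: eq_map => i /=; rewrite count_nseq.
rewrite sumnE big_map enumT -/(index_enum _).
elim: w => [|j w ih] /=; first by rewrite big1// => i _; rewrite muln0.
rewrite ih; under [RHS]eq_bigr => i _ do rewrite mulnDr.
rewrite big_split/=; congr (_ + _)%N.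
rewrite (bigD1 j)//= eqxx muln1 big1 ?addn0// => i ij.
by rewrite eq_sym (negbTE ij) muln0.
Qed.

Lemma word_prod_monomial m : word_prod (monomial_word m) = \prod_(i < n) x i ^+ m i.
Proof.
rewrite /word_prod /monomial_word big_flatten big_map enumT -/(index_enum _)/=.
apply: eq_bigr => i _; elim: (m i) => [|k ih] /=; first by rewrite big_nil.
by rewrite big_cons ih exprS.
Qed.

Lemma size_monomial_word m : size (monomial_word m) = (\sum_(i < n) m i)%N.
Proof.
rewrite /monomial_word size_flatten /shape -map_comp sumnE big_map enumT -/(index_enum _)/=.
by apply: eq_bigr => i _; rewrite size_nseq.
Qed.

Lemma count_word w : (\sum_(i < n) count_mem i w)%N = size w.
Proof. by rewrite -size_monomial_word (perm_size (perm_sorted_word w)). Qed.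

Section Step.
Variable d : nat.
Hypothesis Bd : forall w, (size w < d)%N -> B (word_prod w).

Lemma word_prod_swap a b i j : (size a + size b + 2 = d)%N ->
  B (word_prod (a ++ i :: j :: b) - word_prod (a ++ j :: i :: b)).
Proof.
move=> hd.
have -> : word_prod (a ++ i :: j :: b) - word_prod (a ++ j :: i :: b) =
  \sum_k c i j k *: word_prod (a ++ k :: b).
  rewrite !word_prod_cat -mulrBr !word_prod_cons !mulrA -mulrBl.
  rewrite xcomm mulr_suml mulr_sumr; apply: eq_bigr => k _.
  by rewrite word_prod_cat word_prod_cons -scalerAl -scalerAr.
apply: B_sum => k; apply/B_scale/Bd.
by rewrite -hd size_cat/= !(addn2, addnS).
Qed.

Lemma word_prod_move p a b i : (size p + size a + size b + 1 = d)%N ->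
  B (word_prod (p ++ i :: a ++ b) - word_prod (p ++ a ++ i :: b)).
Proof.
elim: a p => [|j a ih] p hd; first by rewrite subrr.
rewrite -[_ - _](subrKA (word_prod (p ++ j :: i :: a ++ b))).
apply: B_add.
  apply: word_prod_swap.
  by rewrite -hd size_cat/= !(addn1, addn2, addSn, addnS) addnA.
have := ih (rcons p j); rewrite -cats1 -!catA; apply.
by rewrite -hd size_cat/= !(addn1, addSn, addnS).
Qed.

Lemma word_prod_perm p w w' : (size p + size w = d)%N -> perm_eq w w' ->
  B (word_prod (p ++ w) - word_prod (p ++ w')).
Proof.
elim: w p w' => [|i w ih] p w' hd hp.
  by move: hp; rewrite perm_sym => /perm_nilP ->; rewrite subrr.
have : i \in w' by rewrite -(perm_mem hp) mem_head.
move=> iw'; case/splitPr: iw' hp => a b hp.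
have {}hp : perm_eq w (a ++ b).
  by rewrite -(perm_cons i) (perm_trans hp)// perm_catC/= perm_cons perm_catC.
rewrite -[_ - _](subrKA (word_prod (p ++ i :: a ++ b))).
apply: B_add.
  have := ih (rcons p i) (a ++ b); rewrite -cats1 -!catA; apply => //.
  by rewrite -hd size_cat/= !(addn1, addSn, addnS).
apply: word_prod_move.
by rewrite -hd/= (perm_size hp) size_cat !(addn1, addnS) addnA.
Qed.

End Step.

Variable N : nat.
Hypothesis Bmono : forall w, (size w <= N)%N ->
  B (\prod_(i < n) x i ^+ count_mem i w).

(** The spanning half of the Poincare-Birkhoff-Witt theorem, stated for an arbitrary linear
    predicate B instead of a span. Exchanging two neighbours changes a word by shorter words, so the
    induction is on the length. *)
Lemma word_prod_span w : (size w <= N)%N -> B (word_prod w).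
Proof.
have [d] := ubnP (size w); elim: d w => // d ih w hw hN.
rewrite -[word_prod w](subrK (word_prod (sorted_word w))).
apply: B_add; last by rewrite word_prod_monomial; exact: Bmono.
apply: (@word_prod_perm (size w) _ [::]) => //; last exact: perm_sorted_word.
move=> w' hw'; apply: ih; first exact: leq_trans hw' _.
by rewrite (leq_trans (ltnW hw')).
Qed.

End OrderedMonomials.

(** * Curves and the distance to the identity *)

Section StrictlyDifferentiableC1.
Context (R : realType) (V W : normedModType R).

(** Continuity of the derivative: the strict estimate at x also governs small increments based at y,
    and these determine the derivative at y. *)
Lemma sdiff_near_bound (f : V -> W) x L e : sdiff f x L -> 0 < e ->
  exists2 d : R, 0 < d & forall y L', `|y - x| < d -> sdiff f y L' ->
    forall v, `|L' v - L v| <= e * `|v|.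
Proof.
move=> [bL hL] e0; have [d d0 hd] := hL e e0; exists d => // y L' hy hL' v.
apply: le_addgt0P => eta eta0.
have [v0|v0] := eqVneq v 0.
  by rewrite v0 (bl0 (sdiff_bl hL')) (bl0 bL) subr0 !normr0 mulr0 add0r ltW.
have vp : 0 < `|v| by rewrite normr_gt0.
have [d' d'0 hd'] := hL'.2 (eta / `|v|) (divr_gt0 eta0 vp).
pose rho := Num.min d' (d - `|y - x|).
have rho0 : 0 < rho by rewrite lt_min d'0 subr_gt0.
pose h := rho / 2 / `|v|.
have h0 : 0 < h by rewrite !divr_gt0.
have hv : `|h *: v| = rho / 2.
  by rewrite normrZ gtr0_norm// /h divfK// gt_eqF.
have r2 : rho / 2 < rho by rewrite ltr_pdivrMr// ltr_pMr// ltr1n.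
have k1 : `|h *: v + y - y| < d'.
  by rewrite addrK hv (lt_le_trans r2)// ge_min lexx.
have k2 : `|h *: v + y - x| < d.
  rewrite -addrA (le_lt_trans (ler_normD _ _))// hv -ltrBrDr (lt_le_trans r2)//.
  by rewrite ge_min lexx orbT.
have := hd' _ y k1; rewrite subrr normr0 => /(_ d'0) h1.
have h2 := hd _ y k2 hy.
rewrite addrK in h1 h2; rewrite (blZ _ _ (sdiff_bl hL')) in h1; rewrite (blZ _ _ bL) in h2.
have h3 : `|h *: (L' v - L v)| <= eta / `|v| * `|h *: v| + e * `|h *: v|.
  have -> : h *: (L' v - L v) = - (f (h *: v + y) - f y - h *: L' v) +
     (f (h *: v + y) - f y - h *: L v).
    by rewrite opprB addrA subrK scalerBr.
  by rewrite (le_trans (ler_normD _ _))// normrN lerD.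
move: h3; rewrite (normrZ h (L' v - L v)) (normrZ h v) (gtr0_norm h0) !(mulrCA _ h) -mulrDr ler_pM2l//.
by rewrite -mulrA mulVf ?normr_eq0// mulr1 [eta + _]addrC.
Qed.

Lemma sdiff_Ck_on (U : set V) (f : V -> W) : open U ->
  (forall x, U x -> exists L, sdiff f x L) -> Ck_on 1 U f.
Proof.
move=> oU h; split=> [x Ux|v]; first by have [L hL] := h x Ux; exact: sdiff_continuous hL.
split=> [x Ux|]; first by have [L hL] := h x Ux; have [] := sdiff_derive v hL.
split=> // x Ux; have [L hL] := h x Ux; apply/continuous_distP => e e0.
have v1 : 0 < `|v| + 1 by rewrite ltr_wpDl.
have [d d0 hd] := sdiff_near_bound hL (divr_gt0 e0 v1).
have /near_distP[d' d'0 hd'] : \forall y \near x, U y by exact: open_nbhs_nbhs.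
exists (Num.min d d'); first by rewrite lt_min d0.
move=> y; rewrite lt_min => /andP[y1 y2].
have [L' hL'] := h y (hd' _ y2).
have [_ ->] := sdiff_derive v hL'; have [_ ->] := sdiff_derive v hL.
rewrite (le_lt_trans (hd _ _ y1 hL' v))// mulrAC ltr_pdivrMr// ltr_pM2l//.
by rewrite ltrDl.
Qed.

End StrictlyDifferentiableC1.

Section Curves.
Context (R : realType) (n : nat) (G : lieGroupType R n).
Implicit Types c : R -> G.

Lemma C1_curveP c : C1_curve c <-> forall t, @gdiff R n G R^o c t.
Proof.
have oU a : continuous c -> open [set t | chart_dom a (c t)].
  by move=> cc; apply: open_comp => [t _|]; [exact: cc | exact: chart_dom_open].
split=> [[cc hc] t|hc].
  split; first exact: cc.
  apply: (sdiff_C1_row (coordinates_real R) (oU (c t) cc) _ (hc (c t))).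
  exact: chart_dom_self.
have cc : continuous c by move=> t; have [] := hc t.
split; first exact: cc.
move=> a; apply: (@sdiff_Ck_on R R^o _ _ _ (oU a cc)).
by move=> t ht; apply: (gdiff_chart (hc t)).
Qed.

End Curves.

Section Metric.
Context (R : realType) (n : nat) (G : lieGroupType R n) (gm : G -> 'M[R]_n).
Hypothesis hgm : is_riemannian_metric gm.
Local Notation V := 'rV[R]_n.

Definition metric_form (u v : V) : R := (u *m gm 1%g *m v^T) 0 0.
Local Notation qn := (form_norm metric_form).

Lemma metric_psd : psd_form metric_form.
Proof.
split.
- by move=> a u v w; rewrite /metric_form !mulmxDl -!scalemxAl !mxE.
- move=> u v; rewrite /metric_form.
  have -> : u *m gm 1%g *m v^T = (v *m gm 1%g *m u^T)^T.
    by rewrite !trmx_mul trmxK (Defs.metric_sym hgm) mulmxA.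
  by rewrite mxE.
- move=> v; have [->|v0] := eqVneq v 0; first by rewrite /metric_form !mul0mx mxE.
  exact/ltW/(Defs.metric_pos hgm).
Qed.

Lemma qn_le : exists2 K : R, 0 < K & forall v, qn v <= K * `|v|.
Proof.
pose S := \sum_i qn (delta_mx 0 i : V).
exists (S + 1); first by rewrite ltr_wpDl// sumr_ge0// => i _; exact: sqrtr_ge0.
move=> v; rewrite {1}[v]row_sum_delta.
rewrite (le_trans (form_norm_sum metric_psd _ _))// mulrDl mul1r ler_wpDr//.
rewrite mulr_suml ler_sum// => i _; rewrite (form_normZ metric_psd) mulrC.
by rewrite ler_wpM2l ?sqrtr_ge0// norm_coord.
Qed.

Hypothesis hinv : left_invariant_metric gm.

Definition left_jacobian (x : G) : 'M[R]_n :=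
  'J (fun y => chart x (x * chart_inv (1%g : G) y)%g) (chart (1%g : G) 1%g).

Lemma left_jacobian_metric x :
  left_jacobian x *m gm x *m (left_jacobian x)^T = gm 1%g.
Proof. by have := hinv x 1%g; rewrite /= mulg1. Qed.

(** Chain rule for Phi(y) = x (x^-1 Phi(y)): a velocity at x is the translate of the derivative of
    the left increment at 1. *)
Lemma left_chart x (W : normedModType R) (Phi : W -> G) p L M : Phi p = x ->
  gdiff Phi p -> sdiff (fun y => chart x (Phi y)) p L ->
  sdiff (fun y => glog (x^-1 * Phi y)%g) p M ->
  forall v, L v = M v *m left_jacobian x.
Proof.
move=> px hP hL hM v.
have z0x : chart_inv (1%g : G) (chart (1%g : G) 1%g) = 1%g by rewrite chartK//; exact: dom1.
have h1 : gdiff (fun y : V => (x * chart_inv (1%g : G) y)%g) (chart (1%g : G) 1%g).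
  apply: gdiffM; first exact: gdiff_cst.
  by apply: (gdiff_chart_inv (sdiff_id _)); apply: chart_img_self; exact: dom1.
have [|J hJ] := gdiff_chart (a := x) h1.
  by rewrite z0x mulg1; exact: chart_dom_self.
have JE w : J w = w *m left_jacobian x by rewrite (sdiff_jacobian w hJ).
have hM' : sdiff (fun y => chart (1%g : G) (x^-1 * Phi y)%g) p M.
  have := sdiff_translate (chart (1%g : G) 1%g) hM; apply: sdiff_near.
  by apply: nearW => y; rewrite /glog subrK.
have hC := sdiff_comp hM' (g := fun y => chart x (x * chart_inv (1%g : G) y)%g) (M := J).
suff hh : sdiff (fun y => chart x (Phi y)) p (J \o M).
  by rewrite -JE; exact: (sdiff_uniq hL hh v).
apply: (sdiff_near _ (hC _)); last by rewrite px mulVg.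
have hq : gdiff (fun y => x^-1 * Phi y)%g p by exact: (gdiffM (gdiff_cst _ _) hP).
have hq1 : chart_dom (1%g : G) (x^-1 * Phi p)%g by rewrite px mulVg; exact: dom1.
have := chart_dom_near hq.1 hq1; apply: filterS => y hy /=.
by rewrite chartK// mulVKg.
Qed.

Definition speed (c : R -> G) (t : R) : R :=
  Num.sqrt ((velocity c t *m gm (c t) *m (velocity c t)^T) 0 0).

(** w is the left logarithmic derivative of the curve at t0. Left invariance of the metric makes its
    length the speed, and the expansion holds with both times moving. Lengths are later compared
    through this statement alone. *)
Lemma curve_increment (c : R -> G) t0 : C1_curve c ->
  exists2 w, speed c t0 = qn w & forall e, 0 < e -> exists2 d : R, 0 < d &
    forall s t, `|s - t0| < d -> `|t - t0| < d ->
    `|glog ((c t)^-1 * c s)%g - (s - t) *: w| <= e * `|s - t|.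
Proof.
move=> /C1_curveP hc; have hct := hc t0.
have [M bM hM] := gdiff_lincr hct.
have ME (h : R^o) : M h = h *: M 1.
  by rewrite -(blZ _ _ bM) [_ *: _]mulr1.
exists (M 1); last first.
  move=> e e0; have [d d0 hd] := hM e e0; exists d => // s t hs ht.
  by rewrite -ME; exact: hd.
have [L hL] := gdiff_chart hct (chart_dom_self (c t0)).
have hM' : @sdiff R R^o V (fun s => glog ((c t0)^-1 * c s)%g) t0 M.
  split=> // e e0.
  have hq : @gdiff R n G R^o (fun y => (c t0)^-1 * c y)%g t0.
    exact: (gdiffM (gdiff_cst _ _) hct).
  have [|L' hL'] := sdiff_glog hq; first by rewrite mulVg; exact: dom1.
  (* The uniform expansion with derivative M has to be identified with the chart derivative L': both
     approximate the increment from t0 along one small multiple of v. *)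
  suff LM : L' =1 M by have [d d0 hd] := hL'.2 e e0; exists d => // y z; rewrite -LM; exact: hd.
  move=> v; apply/eqP; rewrite -subr_eq0 -normr_le0; apply: le_addgt0P => eta eta0.
  have v1 : 0 < `|v| + 1 by rewrite ltr_wpDl.
  have [d1 d10 hd1] := hL'.2 _ (divr_gt0 (divr_gt0 eta0 v1) (ltr0n _ 2)).
  have [d2 d20 hd2] := hM _ (divr_gt0 (divr_gt0 eta0 v1) (ltr0n _ 2)).
  pose h := Num.min d1 d2 / 2 / (`|v| + 1).
  have m0 : 0 < Num.min d1 d2 by rewrite lt_min d10.
  have h0 : 0 < h by rewrite !divr_gt0.
  have hv : `|(h * v + t0 : R) - t0| < Num.min d1 d2.
    rewrite addrK normrM gtr0_norm// /h mulrAC ltr_pdivrMr//.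
    apply: (@le_lt_trans _ _ (Num.min d1 d2 / 2 * (`|v| + 1))).
      by rewrite ler_wpM2l ?divr_ge0 ?(ltW m0)// lerDl.
    by rewrite ltr_pM2r// ltr_pdivrMr// ltr_pMr// ltr1n.
  move: hv; rewrite lt_min => /andP[hv1 hv2].
  have := hd1 _ t0 hv1; rewrite subrr normr0 => /(_ d10) k1.
  have := hd2 t0 _ _ hv2; rewrite subrr normr0 => /(_ d20) k2.
  rewrite mulVg glog1 subr0 addrK in k1; rewrite addrK in k2.
  rewrite add0r.
  have k3 : h * `|L' v - M v| <= eta * h.
    have -> : h * `|L' v - M v| = `|L' (h * v) - M (h * v)|.
      by rewrite -[h * v]/(h *: (v : R^o)) (blZ _ _ (sdiff_bl hL')) (blZ _ _ bM)
        -scalerBr normrZ gtr0_norm.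
    have -> : L' (h * v) - M (h * v) =
       (glog ((c t0)^-1 * c (h * v + t0)%R)%g - M (h * v)) -
       (glog ((c t0)^-1 * c (h * v + t0)%R)%g - L' (h * v)).
      by rewrite opprB [RHS]addrC addrA subrK.
    rewrite (le_trans (ler_normB _ _))// (le_trans (lerD k2 k1))//.
    rewrite -mulrDl -splitr normrM gtr0_norm// mulrAC ler_pdivrMr//.
    rewrite mulrA; apply: ler_wpM2l; last by rewrite lerDl.
    by rewrite mulr_ge0 ?ltW.
  by move: k3; rewrite mulrC ler_pM2r.
have hv := left_chart erefl hct hL hM'.
have vE : velocity c t0 = M 1 *m left_jacobian (c t0).
  by rewrite -hv /velocity; have [_ ->] := sdiff_derive (1 : R^o) hL.
rewrite /speed vE /form_norm /metric_form; congr (Num.sqrt (_ 0 0)).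
by rewrite trmx_mul -(left_jacobian_metric (c t0)) !mulmxA.
Qed.

(** The vector w at t is known only through its expansion. The expansion at t0 also covers
    increments based at nearby t, so it almost determines w there. *)
Lemma speed_continuous (c : R -> G) : C1_curve c -> continuous (speed c).
Proof.
move=> hc t0; have [K K0 hK] := qn_le.
have [w0 e0 hw0] := curve_increment t0 hc.
apply/(@continuous_distP R R^o R^o) => e egt0.
have eK : 0 < e / (2 * K) by rewrite divr_gt0// mulr_gt0.
have eK2 : 0 < e / (2 * K) / 2 by rewrite divr_gt0.
have [d d0 hd] := hw0 _ eK2; exists d => // t ht.
have [w e1 hw] := curve_increment t hc.
rewrite e0 e1.
have ww : `|w - w0| <= e / (2 * K).
  have [d1 d10 hd1] := hw _ eK2.
  pose s := t + Num.min d1 (d - `|t - t0|) / 2.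
  have m0 : 0 < Num.min d1 (d - `|t - t0|) by rewrite lt_min d10 subr_gt0.
  have st : s - t = Num.min d1 (d - `|t - t0|) / 2 by rewrite /s addrC addKr.
  have st0 : 0 < s - t by rewrite st divr_gt0.
  have st1 : `|s - t| < Num.min d1 (d - `|t - t0|).
    by rewrite gtr0_norm// st ltr_pdivrMr// ltr_pMr// ltr1n.
  move: st1; rewrite lt_min => /andP[s1 s2].
  have s3 : `|s - t0| < d.
    by rewrite -(subrK t s) -addrA (le_lt_trans (ler_normD _ _))// -ltrBrDr.
  have := hd s t s3 ht => k1.
  have := hd1 s t s1; rewrite subrr normr0 => /(_ d10) k2.
  have : `|(s - t) *: (w - w0)| <= e / (2 * K) * `|s - t|.
    have -> : (s - t) *: (w - w0) = (glog ((c t)^-1 * c s)%g - (s - t) *: w0) -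
       (glog ((c t)^-1 * c s)%g - (s - t) *: w).
      by rewrite opprB [RHS]addrC addrA subrK scalerBr.
    rewrite (le_trans (ler_normB _ _))// (le_trans (lerD k1 k2))//.
    by rewrite -mulrDl -splitr.
  by rewrite normrZ mulrC ler_pM2r// gtr0_norm.
have key u v : qn u <= qn v + K * `|u - v|.
  rewrite -[u in leLHS](subrK v) addrC (le_trans (form_normD metric_psd _ _))// lerD2l.
  exact: hK.
have hKe : K * `|w - w0| < e.
  have : K * `|w - w0| <= e / 2.
    rewrite (le_trans (ler_wpM2l (ltW K0) ww))//.
    by rewrite le_eqVlt; apply/orP; left; apply/eqP; field; rewrite gt_eqF.
  by move=> /le_lt_trans; apply; rewrite ltr_pdivrMr// ltr_pMr// ltr1n.
have := key w w0; have := key w0 w; rewrite [`|w0 - w|]distrC => k1 k2.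
by rewrite ltr_distl ltrBlDr (le_lt_trans k1) ?ltrD2l//= (le_lt_trans k2) ?ltrD2l.
Qed.

End Metric.

Section RealDerivatives.
Context (R : realType).

Lemma is_derive_near (F : R -> R) (t f e : R) : is_derive t 1 F f -> 0 < e ->
  exists2 d : R, 0 < d & forall s, `|s - t| < d ->
    `|F s - F t - (s - t) * f| <= e * `|s - t|.
Proof.
move=> [dF DF] e0.
have /cvgrPdistC_lt/(_ e e0) : h^-1 *: (F (h *: (1:R) + t) - F t)
   @[h --> 0^'] --> 'D_1 F t by exact: dF.
rewrite DF near_withinE => /(@near_distP R R^o)[d d0 hd].
exists d => // s sd; have [->|st] := eqVneq s t; first by rewrite !subrr mul0r !subrr normr0 mulr0.
have st0 : s - t != 0 by rewrite subr_eq0.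
have := hd (s - t); rewrite subr0 => /(_ sd st0) /=.
have -> : (s - t) *: (1 : R) + t = s by rewrite [_ *: _]mulr1 subrK.
move=> /ltW h1.
have -> : `|F s - F t - (s - t) * f| = `|s - t| * `|(s - t)^-1 * (F s - F t) - f|.
  by rewrite -normrM mulrBr mulrA divff// mul1r.
by rewrite mulrC; apply: ler_wpM2r.
Qed.

Lemma le_is_derive (F P f p : R -> R) (a b : R) : a <= b ->
  (forall t : R, a <= t <= b ->
     [/\ is_derive t (1 : R) F (f t), is_derive t (1 : R) P (p t) & f t <= p t]) ->
  F b - F a <= P b - P a.
Proof.
move=> ab h.
have [||c + e] := @MVT_segment R (P - F) (p - f) a b ab.
- move=> x; rewrite in_itv/= => /andP[/ltW ax /ltW xb].
  have [h1 h2 _] := h x (introT andP (conj ax xb)).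
  exact: is_deriveB.
- apply: derivable_within_continuous => x; rewrite in_itv/= => hx.
  have [[d1 _] [d2 _] _] := h x hx; exact: (derivableB d2 d1).
rewrite in_itv/= => /h[_ _ fp].
have : 0 <= (p - f) c * (b - a) by rewrite mulr_ge0// subr_ge0.
by rewrite -e !fctE; lra.
Qed.

Lemma sdiff_real (f f' : R -> R) (x : R) : (forall t : R, is_derive t (1 : R) f (f' t)) ->
  {for x, continuous f'} -> @sdiff R R^o R^o f x (fun h => h * f' x).
Proof.
move=> df cf; split.
  split; first by move=> a u v; rewrite mulrDl -mulrA.
  by exists (`|f' x| + 1) => [|v]; rewrite ?ltr_wpDl// normrM mulrC ler_wpM2r// lerDl.
move=> e e0; have /(@continuous_distP R R^o R^o)/(_ e e0)[d d0 hd] := cf.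
exists d => // y z hy hz.
wlog zy : y z hy hz / z <= y.
  move=> H; have [|/ltW yz] := leP z y; first exact: H.
  rewrite -normrN [`|y - z|]distrC.
  have -> : - (f y - f z - (y - z) * f' x) = f z - f y - (z - y) * f' x by ring.
  exact: H.
pose g (t : R) : R^o := f t - t * f' x.
have -> : f y - f z - (y - z) * f' x = g y - g z by rewrite /g; ring.
rewrite [`|y - z|]ger0_norm ?subr_ge0//.
apply: (le_norm_derive zy) => t /andP[zt ty].
have dg : is_derive t (1 : R) g (f' t - f' x).
  have h1 : is_derive t (1 : R) (fun t : R => t * f' x) (f' x).
    have := @is_deriveM R R^o id (cst (f' x)) t 1 1 0 (is_derive_id _ _) (is_derive_cst _ _ _).
    by rewrite scaler0 add0r [_ *: _]mulr1.
  exact: is_deriveB.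
have [k1 k2] := dg; split=> //; rewrite k2; apply/ltW/hd.
move: hy hz; rewrite !ltr_distl => /andP[_ h2] /andP[h3 _].
by rewrite (lt_le_trans h3)//= (le_lt_trans ty).
Qed.

End RealDerivatives.

Section Distance.
Context (R : realType) (n : nat) (G : lieGroupType R n) (gm : G -> 'M[R]_n).
Hypothesis hgm : is_riemannian_metric gm.
Hypothesis hinv : left_invariant_metric gm.
Local Notation V := 'rV[R]_n.
Local Notation qn := (form_norm (metric_form gm)).
Local Notation speed := (speed gm).
Implicit Types c : R -> G.

Let curve_lengthE c : curve_length gm c =
  (\int[lebesgue_measure]_(t in `[0%R, 1%R]) (speed c t)%:E)%E.
Proof. by []. Qed.

Lemma length_primitive c : C1_curve c -> exists F : R -> R,
  (forall t : R, 0 <= t <= 1 -> is_derive t (1 : R) F (speed c t)) /\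
  curve_length gm c = (F 1 - F 0)%:E.
Proof.
move=> hc; have cs := speed_continuous hgm hinv hc.
(* The primitive starts at -1 and is studied on ]-1, 2[, so that it is differentiable at the end
   points 0 and 1 as well. *)
have [F dF] : exists F : R -> R, forall t : R, -1 < t < 2 ->
    derivable F t 1 /\ derive1 F t = speed c t.
  exists (fun x => \int[lebesgue_measure]_(t in `[(-1 : R), x]) speed c t) => t.
  move=> /andP[t1 t2]; apply: (@continuous_FTC1_closed R (speed c) (-1) t 2) => //.
    apply: continuous_compact_integrable; first exact: segment_compact.
    by apply: continuous_subspaceT.
  exact: cs.
have dF' t : 0 <= t <= 1 -> derivable F t 1 /\ derive1 F t = speed c t.
  by move=> /andP[t0 t1]; apply: dF; apply/andP; split; lra.
exists F; split.
  by move=> t /dF'[h1 h2]; split=> //; rewrite -derive1E.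
have wF : {within `[0%R, 1%R], continuous F}.
  by apply: derivable_within_continuous => x; rewrite in_itv/= => /dF'[].
rewrite curve_lengthE EFinB -(@continuous_FTC2 R (speed c) F 0 1 ltr01)//.
- exact: continuous_subspaceT.
- have [w1 w2 w3] := (continuous_within_itvP F (@ltr01 R)).1 wF.
  split=> // x; rewrite in_itv/= => /andP[/ltW x0 /ltW x1].
  by have [] := dF' x (introT andP (conj x0 x1)).
- move=> x; rewrite in_itv/= => /andP[/ltW x0 /ltW x1].
  by have [] := dF' x (introT andP (conj x0 x1)).
Qed.

(** Serves both left translates (u = id, k = 1) and reversed curves (u t = 1 - t, k = -1): equal
    left increments up to the parameter u give equal speeds. *)
Lemma speed_eq c1 c2 t0 (k : R) (u : R -> R) : C1_curve c1 -> C1_curve c2 ->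
  `|k| = 1 -> (forall t s, u t - u s = k * (t - s)) ->
  (forall s, ((c1 t0)^-1 * c1 s = (c2 (u t0))^-1 * c2 (u s))%g) ->
  speed c1 t0 = speed c2 (u t0).
Proof.
move=> h1 h2 k1 hu e12.
have [w1 -> H1] := curve_increment hinv t0 h1.
have [w2 -> H2] := curve_increment hinv (u t0) h2.
suff -> : w1 = k *: w2 by rewrite (form_normZ (metric_psd hgm)) k1 mul1r.
apply/eqP; rewrite -subr_eq0 -normr_le0; apply: le_addgt0P => e e0; rewrite add0r.
have [d1 d10 hd1] := H1 _ (divr_gt0 e0 (ltr0n _ 2)).
have [d2 d20 hd2] := H2 _ (divr_gt0 e0 (ltr0n _ 2)).
pose h := Num.min d1 d2 / 2.
have m0 : 0 < Num.min d1 d2 by rewrite lt_min d10.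
have h0 : 0 < h by rewrite divr_gt0.
have hm : h < Num.min d1 d2 by rewrite /h ltr_pdivrMr// ltr_pMr// ltr1n.
move: hm; rewrite lt_min => /andP[hm1 hm2].
have s1 : t0 + h - t0 = h by rewrite addrC addKr.
have s2 : u (t0 + h) - u t0 = k * h by rewrite hu s1.
have := hd1 (t0 + h) t0; rewrite s1 subrr normr0 gtr0_norm// => /(_ hm1 d10).
have := hd2 (u (t0 + h)) (u t0); rewrite s2 subrr normr0 normrM k1 mul1r gtr0_norm//.
move=> /(_ hm2 d20); rewrite e12 => k2 k3.
have : `|h *: (w1 - k *: w2)| <= e * h.
  set x := glog _ in k2 k3.
  have -> : h *: (w1 - k *: w2) = (x - (k * h) *: w2) - (x - h *: w1).
    by rewrite opprB [RHS]addrC addrA subrK scalerBr scalerA mulrC.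
  rewrite (le_trans (ler_normB _ _))// (le_trans (lerD k2 k3))//.
  by rewrite -mulrDl -splitr.
by rewrite normrZ gtr0_norm// mulrC ler_pM2r.
Qed.

Lemma translate_curve g c : C1_curve c -> C1_curve (fun t => g * c t)%g.
Proof.
by move=> /C1_curveP hc; apply/C1_curveP => t; apply: gdiffM => //; exact: gdiff_cst.
Qed.

Lemma reverse_curve c : C1_curve c -> C1_curve (fun t => c (1 - t)).
Proof.
move=> /C1_curveP hc; apply/C1_curveP => t.
have h : @sdiff R R^o R^o (fun t => 1 - t) t (fun h => - h).
  have bl : @bounded_linear R R^o R^o (fun h => - h).
    split; first by move=> a u v; rewrite opprD -scalerN.
    by exists 1 => // v; rewrite normrN mul1r.
  have := sdiff_translate (1 : R^o) (sdiff_linear (t : R^o) bl).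
  suff -> : (fun y : R^o => - y + 1) = (fun t => 1 - t) by [].
  by apply/funext => x; rewrite addrC.
exact: (gdiff_comp h (hc _)).
Qed.

Lemma translate_length g c : C1_curve c ->
  curve_length gm (fun t => g * c t)%g = curve_length gm c.
Proof.
move=> hc; rewrite !curve_lengthE.
suff -> : speed (fun t => g * c t)%g = speed c by [].
apply/funext => t.
apply: (@speed_eq _ _ t 1 id); [exact: translate_curve | exact: hc | exact: normr1 | |].
- by move=> s s'; rewrite mul1r.
- by move=> s; rewrite invgM -mulgA mulKg.
Qed.

Lemma reverse_length c : C1_curve c ->
  curve_length gm (fun t => c (1 - t)) = curve_length gm c.
Proof.
move=> hc; rewrite !curve_lengthE.
suff -> : speed (fun t => c (1 - t)) = (fun t => speed c (unstable.onem t)).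
  have := @integration_by_substitution_onem R (speed c) 1.
  rewrite unstable.onem1 lexx ler01 => /(_ isT) h.
  by apply: esym; apply: h; apply: continuous_subspaceT; exact: speed_continuous.
apply/funext => t.
apply: (@speed_eq _ _ t (-1) (fun t => 1 - t)); [exact: reverse_curve | exact: hc | | |].
- by rewrite normrN1.
- by move=> s s'; rewrite mulN1r; ring.
- by move=> s.
Qed.

Lemma piecewise_real x y L : piecewise_length gm x y L ->
  exists2 l : R, 0 <= l & L = l%:E.
Proof.
elim=> [z|c z M hc _ [l l0 ->]]; first by exists 0.
have [F [hF lF]] := length_primitive hc.
exists (F 1 - F 0 + l); last by rewrite lF EFinD.
rewrite addr_ge0//.
have := @le_is_derive R (fun=> 0) F (fun=> 0) (speed c) 0 1 ler01.
rewrite subrr; apply=> t ht; split; [exact: is_derive_cst|exact: hF|exact: sqrtr_ge0].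
Qed.

Lemma piecewise_translate g x y L : piecewise_length gm x y L ->
  piecewise_length gm (g * x)%g (g * y)%g L.
Proof.
elim=> [z|c z M hc _ ih]; first exact: PLnil.
rewrite -(translate_length g hc).
exact: (PLcons (c := fun t => (g * c t)%g) (translate_curve g hc) ih).
Qed.

Lemma piecewise_cat x y z L M : piecewise_length gm x y L ->
  piecewise_length gm y z M -> piecewise_length gm x z (L + M)%E.
Proof.
move=> h; elim: h => [w|c w K hc _ ih] hM; first by rewrite add0e.
by rewrite -addeA; apply: PLcons => //; exact: ih.
Qed.

Lemma piecewise_reverse x y L : piecewise_length gm x y L ->
  piecewise_length gm y x L.
Proof.
elim=> [z|c z M hc _ ih]; first exact: PLnil.
rewrite addeC; apply: (piecewise_cat ih).
have := PLcons (c := fun t => c (1 - t)) (reverse_curve hc) (PLnil gm _).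
by rewrite subr0 subrr adde0 reverse_length.
Qed.

Local Notation d := (dist1 gm).

Lemma dist1_ge0 g : (0 <= d g)%E.
Proof. by apply: le_ereal_inf_tmp => L /piecewise_real[l l0 ->]. Qed.

Lemma dist1_one : d 1%g = 0%E.
Proof.
by apply/eqP; rewrite eq_le dist1_ge0 andbT; apply: ereal_inf_lbound; exact: PLnil.
Qed.

Lemma dist1_lt g a : (d g < a%:E)%E ->
  exists2 l : R, l < a & piecewise_length gm g 1%g l%:E.
Proof.
move=> /ereal_inf_lt[L hL La]; have [l l0 e] := piecewise_real hL.
by move: hL La; rewrite e lte_fin => hL la; exists l.
Qed.

Lemma dist1_le g l : piecewise_length gm g 1%g l%:E -> (d g <= l%:E)%E.
Proof. exact: ereal_inf_lbound. Qed.

Lemma dist1M x y : (d (x * y)%g <= d x + d y)%E.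
Proof.
have [fx|] := boolP (d x \is a fin_num); last first.
  rewrite ge0_fin_numE ?dist1_ge0// -leNgt leye_eq => /eqP ->.
  by rewrite addye ?leey// gt_eqF// (lt_le_trans _ (dist1_ge0 y))// ltNy0.
have [fy|] := boolP (d y \is a fin_num); last first.
  rewrite ge0_fin_numE ?dist1_ge0// -leNgt leye_eq => /eqP ->.
  by rewrite addey ?leey// gt_eqF// (lt_le_trans _ (dist1_ge0 x))// ltNy0.
apply/lee_addgt0Pr => e e0.
have e2 : 0 < e / 2 by rewrite divr_gt0.
have [|a ha1 ha2] := @dist1_lt x (fine (d x) + e / 2).
  by rewrite EFinD fineK// lteDl// lte_fin.
have [|b hb1 hb2] := @dist1_lt y (fine (d y) + e / 2).
  by rewrite EFinD fineK// lteDl// lte_fin.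
have hp : piecewise_length gm (x * y)%g 1%g (b + a)%:E.
  rewrite EFinD; apply: piecewise_cat ha2.
  by have := piecewise_translate x hb2; rewrite mulg1.
rewrite (le_trans (dist1_le hp))// -(fineK fx) -(fineK fy) -!EFinD lee_fin.
by rewrite [e in leRHS]splitr addrACA addrC lerD// ltW.
Qed.

Lemma dist1V_le x : (d x^-1%g <= d x)%E.
Proof.
have [fx|] := boolP (d x \is a fin_num); last first.
  by rewrite ge0_fin_numE ?dist1_ge0// -leNgt leye_eq => /eqP ->; rewrite leey.
apply/lee_addgt0Pr => e e0.
have [|a ha1 ha2] := @dist1_lt x (fine (d x) + e).
  by rewrite EFinD fineK// lteDl// lte_fin.
have hp : piecewise_length gm (x^-1)%g 1%g a%:E.
  have := piecewise_reverse (piecewise_translate x^-1%g ha2).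
  by rewrite mulg1 mulVg.
by rewrite (le_trans (dist1_le hp))// -(fineK fx) -EFinD lee_fin ltW.
Qed.

Lemma dist1V x : d x^-1%g = d x.
Proof.
by apply/eqP; rewrite eq_le dist1V_le -{1}[x]invgK dist1V_le.
Qed.



Lemma speed_le c t B : C1_curve c ->
  (forall e : R, 0 < e -> exists2 d : R, 0 < d & forall s, `|s - t| < d ->
     qn (glog ((c t)^-1 * c s)%g) <= (B + e) * `|s - t|) ->
  speed c t <= B.
Proof.
move=> hc h; have [w -> hw] := curve_increment hinv t hc.
have [K K0 hK] := qn_le hgm.
apply: le_addgt0P => e e0.
have e2 : 0 < e / 2 by rewrite divr_gt0.
have [d1 d10 hd1] := hw _ (divr_gt0 e2 K0).
have [d2 d20 hd2] := h _ e2.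
pose x := Num.min d1 d2 / 2.
have m0 : 0 < Num.min d1 d2 by rewrite lt_min d10.
have x0 : 0 < x by rewrite divr_gt0.
have : x < Num.min d1 d2 by rewrite /x ltr_pdivrMr// ltr_pMr// ltr1n.
rewrite lt_min => /andP[x1 x2].
have s1 : t + x - t = x by rewrite addrC addKr.
have := hd1 (t + x) t; rewrite s1 subrr normr0 gtr0_norm// => /(_ x1 d10) k1.
have := hd2 (t + x); rewrite s1 gtr0_norm// => /(_ x2).
set y := glog _ in k1 *; move=> k2.
have : qn (x *: w) <= (B + e) * x.
  have -> : x *: w = y + - (y - x *: w) by rewrite opprB addrC subrK.
  rewrite (le_trans (form_normD (metric_psd hgm) _ _))// (form_normN (metric_psd hgm)).
  rewrite [e]splitr addrA [leRHS]mulrDl lerD// (le_trans (hK _))//.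
  by rewrite mulrC -ler_pdivlMr// mulrAC.
by rewrite (form_normZ (metric_psd hgm)) gtr0_norm// mulrC ler_pM2r.
Qed.

Context (X : 'I_n -> V) (hX : is_orthonormal_basis gm X).

Lemma basis_expand v : v = \sum_j metric_form gm v (X j) *: X j.
Proof.
have [fX oX] := hX.
have uX : (\matrix_i X i) \in unitmx by rewrite -row_free_unit.
have e : v = \sum_i (v *m invmx (\matrix_i X i)) 0 i *: X i.
  rewrite -{1}[v](mulmxKV uX) mulmx_sum_row; apply: eq_bigr => i _.
  by rewrite rowK.
rewrite {1}e; apply: eq_bigr => j _; congr (_ *: _).
rewrite {2}e (form_suml (metric_psd hgm)) (bigD1 j)//=.
rewrite (formZl (metric_psd hgm)) /metric_form oX eqxx mulr1 big1 ?addr0// => i ij.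
by rewrite -/(metric_form gm _ _) (formZl (metric_psd hgm)) /metric_form oX (negbTE ij) mulr0.
Qed.

Lemma qn_basis j : qn (X j) = 1.
Proof. by rewrite /form_norm /metric_form (hX.2) eqxx sqrtr1. Qed.

Lemma norm_le_qn : exists2 K : R, 0 < K & forall v : V, `|v| <= K * qn v.
Proof.
exists (\sum_j `|X j| + 1); first by rewrite ltr_wpDl// sumr_ge0.
move=> v; rewrite {1}[v]basis_expand (le_trans (ler_norm_sum _ _ _))//.
rewrite mulrDl mul1r ler_wpDr ?sqrtr_ge0// mulr_suml ler_sum// => j _.
rewrite normrZ mulrC ler_wpM2l// (le_trans (form_cauchy (metric_psd hgm) _ _))//.
by rewrite qn_basis mulr1.
Qed.

Lemma gdiff_quotient_dom (W : normedModType R) (Phi : W -> G) x0 : gdiff Phi x0 ->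
  exists2 d : R, 0 < d & forall x y, `|x - x0| < d -> `|y - x0| < d ->
    chart_dom (1%g : G) ((Phi x)^-1 * Phi y)%g.
Proof.
move=> hP.
have h1 : gdiff (fun p : W * W => Phi p.1) (x0, x0).
  by apply: (gdiff_comp (sdiff_linear (x0, x0) (bl_fst W W))).
have h2 : gdiff (fun p : W * W => Phi p.2) (x0, x0).
  by apply: (gdiff_comp (sdiff_linear (x0, x0) (bl_snd W W))).
have [h3 _] := gdiffM (gdiffV h1) h2.
have [|d d0 hd] := (near_distP _ _).1 (chart_dom_near (a := 1%g) h3 _).
  by rewrite /= mulVg; exact: dom1.
exists d => // x y hx hy; apply: (hd (x, y)).
by rewrite prod_normE/= gt_max hx hy.
Qed.

Lemma gexp_increment e : 0 < e -> exists2 d : R, 0 < d & forall x y : V,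
  `|x| < d -> `|y| < d ->
  `|glog ((gexp G x)^-1 * gexp G y)%g - (y - x)| <= e * `|y - x|.
Proof.
move=> e0; have e2 : 0 < e / 2 by rewrite divr_gt0.
have [M bM hM] := gdiff_lincr (gdiff_gexp (sdiff_id (0 : V)) (gdom0 G)).
have [d1 d10 hd1] := hM _ e2.
have /near_distP[d2 d20 hd2] : \forall z \near (0 : V), gdom G z.
  by apply: open_nbhs_nbhs; split; [exact: gdom_open | exact: gdom0].
(* The derivative of [gexp] in left increments is the identity up to e/2: test it on increments
   based at 0, where [glog] undoes [gexp]. *)
have Mid w : `|M w - w| <= e / 2 * `|w|.
  have [->|w0] := eqVneq w 0; first by rewrite (bl0 bM) subr0 normr0 mulr0.
  have wp : 0 < `|w| by rewrite normr_gt0.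
  pose h := Num.min d1 d2 / 2 / `|w|.
  have m0 : 0 < Num.min d1 d2 by rewrite lt_min d10.
  have h0 : 0 < h by rewrite !divr_gt0.
  have hv : `|h *: w| < Num.min d1 d2.
    by rewrite normrZ gtr0_norm// /h divfK ?gt_eqF// ltr_pdivrMr// ltr_pMr// ltr1n.
  move: hv; rewrite lt_min => /andP[v1 v2].
  have := hd1 0 (h *: w); rewrite subr0 normr0 => /(_ d10).
  rewrite subr0 => /(_ v1); rewrite gexp0 invg1 mul1g gexpK; last first.
    by apply: hd2; rewrite subr0.
  rewrite (blZ _ _ bM) -scalerBr !(normrZ h) (gtr0_norm h0) [leRHS]mulrCA ler_pM2l//.
  by rewrite distrC.
exists d1 => // x y hx hy.
have := hd1 x y; rewrite !subr0 => /(_ hx hy) k1.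
set z := glog _ in k1 *.
have -> : z - (y - x) = (z - M (y - x)) + (M (y - x) - (y - x)).
  by rewrite addrA subrK.
by rewrite (le_trans (ler_normD _ _))// [e]splitr mulrDl lerD.
Qed.

Lemma gexp_increment_qn e : 0 < e -> exists2 d : R, 0 < d & forall x y : V,
  `|x| < d -> `|y| < d ->
  qn (glog ((gexp G x)^-1 * gexp G y)%g) <= (1 + e) * qn (y - x).
Proof.
move=> e0; have [K K0 hK] := qn_le hgm; have [L L0 hL] := norm_le_qn.
have [d d0 hd] := gexp_increment (divr_gt0 e0 (mulr_gt0 K0 L0)).
exists d => // x y hx hy; have := hd x y hx hy; set z := glog _ => h.
rewrite -[z](subrK (y - x)) (le_trans (form_normD (metric_psd hgm) _ _))//.
rewrite mulrDl mul1r addrC lerD2l.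
apply: (le_trans (hK _)); apply: (le_trans (ler_wpM2l (ltW K0) h)).
have KL : 0 <= e / (K * L) by rewrite ltW// divr_gt0// mulr_gt0.
apply: (le_trans (ler_wpM2l (ltW K0) (ler_wpM2l KL (hL (y - x))))).
rewrite le_eqVlt; apply/orP; left; apply/eqP; field.
by rewrite !gt_eqF.
Qed.

Lemma dist1_gexp e : 0 < e -> exists2 d0 : R, 0 < d0 & forall z : V, `|z| < d0 ->
  (d (gexp G z) <= ((1 + e) * qn z)%:E)%E.
Proof.
move=> e0; have [d1 d10 hd1] := gexp_increment_qn e0.
have /near_distP[d2 d20 hd2] : \forall z \near (0 : V), gdom G z.
  by apply: open_nbhs_nbhs; split; [exact: gdom_open | exact: gdom0].
exists (Num.min d1 d2) => [|z]; first by rewrite lt_min d10.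
rewrite lt_min => /andP[z1 z2].
(* A curve has to be C^1 on the whole line, and a straight line through 0 would leave the chart. The
   cosine goes from 1 to 0 on [0, 1] and keeps |p t z| <= |z| everywhere. *)
pose p (t : R) : R := cos (t * (pi / 2)).
pose p' (t : R) : R := - sin (t * (pi / 2)) * (pi / 2).
have dl (t : R) : is_derive t (1 : R) (fun t : R => t * (pi / 2)) (pi / 2).
  have := @is_deriveM R R^o id (cst (pi / 2)) t 1 1 0 (is_derive_id _ _) (is_derive_cst _ _ _).
  by rewrite scaler0 add0r [_ *: _]mulr1.
have dp (t : R) : is_derive t (1 : R) p (p' t) by apply: is_derive1_comp.
have pc (t : R) : {for t, continuous p'}.
  have ds : is_derive t (1 : R) (fun t : R => sin (t * (pi / 2))) (cos (t * (pi / 2)) * (pi / 2)).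
    exact: (@is_derive1_comp R sin).
  have [+ _] := is_deriveM (is_deriveN ds) (is_derive_cst (pi / 2 : R) t (1 : R)).
  by move=> /derivable1_diffP/differentiable_continuous.
have pz t x : `|z| < x -> `|p t *: z| < x.
  by apply: le_lt_trans; rewrite normrZ ler_piMl// cos_max.
pose c (t : R) := gexp G (p t *: z).
have hc : C1_curve c.
  apply/C1_curveP => t.
  have bz : @bounded_linear R R^o V (fun h => h *: z).
    split; first by move=> a u v; rewrite scalerDl scalerA.
    exists (`|z| + 1) => [|h]; first by rewrite ltr_wpDl.
    by rewrite normrZ mulrC ler_wpM2r// lerDl.
  have h1 := sdiff_comp (sdiff_real dp (pc t)) (sdiff_linear _ bz).
  by apply: (gdiff_gexp h1); apply: hd2; rewrite subr0; exact: pz.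
have c0 : c 0 = gexp G z by rewrite /c /p mul0r cos0 scale1r.
have c1 : c 1 = 1%g by rewrite /c /p mul1r cos_pihalf scale0r gexp0.
have pi0 : (0 : R) < pi / 2 by rewrite divr_gt0// pi_gt0.
have sp t : 0 <= t <= 1 -> speed c t <= (1 + e) * qn z * (- p' t).
  move=> /andP[t0 t1]; apply: (speed_le hc) => eta eta0.
  have B0 : 0 < (1 + e) * qn z + 1 by rewrite ltr_wpDl// mulr_ge0 ?sqrtr_ge0//; lra.
  have [dd dd0 hdd] := is_derive_near (dp t) (divr_gt0 eta0 B0).
  exists dd => // s hs.
  have := hd1 (p t *: z) (p s *: z) (pz _ _ z1) (pz _ _ z1).
  rewrite -scalerBl (form_normZ (metric_psd hgm)) => /le_trans; apply.
  rewrite mulrCA.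
  have p'0 : p' t <= 0.
    rewrite /p' mulNr oppr_le0 mulr_ge0 ?(ltW pi0)// sin_ge0_pi// mulr_ge0 ?(ltW pi0)//=.
    rewrite (le_trans (_ : _ <= 1 * (pi / 2)))// ?ler_wpM2r ?(ltW pi0)// mul1r.
    by rewrite ler_pdivrMr// ler_peMr ?ler1n// ltW// pi_gt0.
  have hp : `|p s - p t| <= (- p' t + eta / ((1 + e) * qn z + 1)) * `|s - t|.
    rewrite -[p s - p t](subrK ((s - t) * p' t)) (le_trans (ler_normD _ _))//.
    rewrite [leLHS]addrC [leRHS]mulrDl lerD ?hdd// normrM mulrC.
    by rewrite -(ler0_norm p'0).
  have Q0 : 0 <= (1 + e) * qn z by rewrite mulr_ge0 ?sqrtr_ge0//; lra.
  rewrite mulrC (le_trans (ler_wpM2l Q0 hp))// mulrA mulrDr ler_wpM2r// lerD2l.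
  by rewrite mulrA ler_pdivrMr// mulrC ler_wpM2l ?(ltW eta0)// lerDl.
have [F [dF lF]] := length_primitive hc.
have hp : piecewise_length gm (gexp G z) 1%g (F 1 - F 0)%:E.
  rewrite -lF -c0 -[curve_length _ _]adde0; apply: PLcons => //.
  by rewrite c1; exact: PLnil.
apply: (le_trans (dist1_le hp)); rewrite lee_fin.
have dP (t : R) : is_derive t (1 : R) (fun t => - ((1 + e) * qn z) * p t) ((1 + e) * qn z * (- p' t)).
  have := @is_deriveZ R R^o R^o p (- ((1 + e) * qn z)) t 1 _ (dp t).
  by rewrite mulrN -mulNr.
have := @le_is_derive R F _ _ _ 0 1 ler01 (fun t ht => And3 (dF t ht) (dP t) (sp t ht)).
by rewrite /p mul0r mul1r cos0 cos_pihalf mulr0 mulr1 sub0r opprK.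
Qed.

(** A Gronwall argument along curves: a local logarithmic Lipschitz bound integrates to an
    exponential in the distance. [Kl] converts chart norms into lengths. *)
Lemma dist1_growth (u : G -> R) (K Kl d0 : R) : 0 <= K -> 0 < d0 -> 0 <= Kl ->
  (forall g, 0 <= u g) -> (forall z : V, `|z| <= Kl * qn z) ->
  (forall g (z : V), `|z| < d0 -> u g <= expR (K * `|z|) * u (g * gexp G z)%g) ->
  forall g a, (d g < a%:E)%E -> u g <= expR (K * Kl * a + 1) * u 1%g.
Proof.
move=> K0 d00 Kl0 u0 hKl hu.
have KKl : 0 <= K * Kl by rewrite mulr_ge0.
(* An arbitrary error e is allowed so that it can be halved at each concatenation of curves; in the
   end e = 1, which is the constant 1 in the exponent. *)
suff step x y L : piecewise_length gm x y L -> forall l e, L = l%:E -> 0 < e ->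
    u x <= expR (K * Kl * l + e) * u y.
  move=> g a /dist1_lt[l la /step/(_ _ 1 erefl ltr01)] h; apply: (le_trans h).
  by rewrite ler_wpM2r// ler_expR lerD2r ler_wpM2l// ltW.
elim=> [z l e [<-] e0|c z M hc hM ih l e].
  by rewrite mulr0 add0r ler_peMl// -expR0 ler_expR ltW.
have [m m0 Mm] := piecewise_real hM; have [F [dF ->]] := length_primitive hc.
rewrite Mm -EFinD => -[<-] e0; have e2 : 0 < e / 2 by rewrite divr_gt0.
have -> : K * Kl * (F 1 - F 0 + m) + e =
   (K * Kl * (F 1 - F 0) + e / 2) + (K * Kl * m + e / 2).
  by rewrite {1}[e]splitr mulrDr addrACA.
rewrite expRD -mulrA; apply: le_trans (ler_wpM2l (expR_ge0 _) (ih _ _ Mm e2)).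
set e' := e / 2 in e2 *.
have := @local_ndecr R (fun t => expR (K * Kl * F t + e' * t) * u (c t)) 0 1 ler01.
suff H : forall t : R, 0 <= t <= 1 -> exists2 d1 : R, 0 < d1 & forall s s' : R,
    0 <= s -> s <= t -> t <= s' -> s' <= 1 -> s' - s < d1 ->
    expR (K * Kl * F s + e' * s) * u (c s) <= expR (K * Kl * F s' + e' * s') * u (c s').
  move=> /(_ H); rewrite mulr0 addr0 mulr1 => h.
  have -> : K * Kl * (F 1 - F 0) + e' = (K * Kl * F 1 + e') - K * Kl * F 0.
    by rewrite mulrBr addrAC.
  by rewrite expRD expRN mulrAC ler_pdivlMr ?expR_gt0// mulrC.
move=> t ht; have [w spw hw] := curve_increment hinv t hc.
have e4 : 0 < e' / 2 by rewrite divr_gt0.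
have k1 : 0 < K + 1 by rewrite ltr_wpDl.
have k2 : 0 < K * Kl + 1 by rewrite ltr_wpDl.
have [d1 d10 hd1] := hw _ (divr_gt0 e4 k1).
have [d2 d20 hd2] := is_derive_near (dF t ht) (divr_gt0 e4 k2).
have [d3 d30 hd3] := gdiff_quotient_dom ((C1_curveP c).1 hc t).
set eta := e' / 2 / (K + 1) in hd1.
have eta0 : 0 < eta by rewrite divr_gt0.
have W0 : 0 < `|w| + eta by rewrite ltr_wpDl.
exists (Num.min (Num.min d1 d2) (Num.min d3 (d0 / (`|w| + eta)))).
  by rewrite !lt_min d10 d20 d30 divr_gt0.
move=> s s' s0 st ts' s'1; rewrite !lt_min => /andP[/andP[h1 h2] /andP[h3 h4]].
have ss' : 0 <= s' - s by rewrite subr_ge0 (le_trans st).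
have ns q : s' - s < q -> `|s - t| < q /\ `|s' - t| < q.
  move=> hq; rewrite ler0_norm ?subr_le0// ger0_norm ?subr_ge0// opprB; split.
    by apply: le_lt_trans hq; rewrite lerD2r.
  by apply: le_lt_trans hq; rewrite lerD2l lerN2.
have [a1 b1] := ns _ h1; have [a2 b2] := ns _ h2; have [a3 b3] := ns _ h3.
set z' := glog ((c s)^-1 * c s')%g.
have cz : c s' = (c s * gexp G z')%g.
  by rewrite /z' glogK ?mulVKg//; exact: hd3.
have nz : `|z'| <= (`|w| + eta) * (s' - s).
  have := hd1 s' s b1 a1; rewrite -/z' => h.
  rewrite -[z'](subrK ((s' - s) *: w)) (le_trans (ler_normD _ _))//.
  rewrite normrZ (ger0_norm ss') in h *.
  by rewrite [leLHS]addrC [leRHS]mulrDl lerD// mulrC.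
have z'd : `|z'| < d0 by rewrite (le_lt_trans nz)// mulrC -ltr_pdivlMr.
rewrite cz; apply: (le_trans (ler_wpM2l (expR_ge0 _) (hu _ _ z'd))).
rewrite mulrA -expRD ler_wpM2r// ler_expR.
have f1 : (speed c t - e' / 2 / (K * Kl + 1)) * (s' - s) <= F s' - F s.
  have := hd2 s a2; have := hd2 s' b2.
  rewrite (ger0_norm (_ : 0 <= s' - t)) ?subr_ge0//.
  rewrite (ler0_norm (_ : s - t <= 0)) ?subr_le0// !ler_norml.
  set q := e' / 2 / _; move=> /andP[q1 _] /andP[_ q2].
  by rewrite mulrBl; clear - q1 q2; lra.
have f2 : K * `|z'| <= (K * Kl * speed c t + e' / 2) * (s' - s).
  apply: (le_trans (ler_wpM2l K0 nz)); rewrite mulrA ler_wpM2r// mulrDr lerD//.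
    by rewrite -mulrA ler_wpM2l// spw.
  rewrite /eta mulrA ler_pdivrMr// mulrC ler_wpM2l ?(ltW e4)//.
  by rewrite lerDl.
have f3 : K * Kl * ((speed c t - e' / 2 / (K * Kl + 1)) * (s' - s)) <= K * Kl * (F s' - F s).
  by rewrite ler_wpM2l.
have f4 : K * Kl * (e' / 2 / (K * Kl + 1)) * (s' - s) <= e' / 2 * (s' - s).
  rewrite ler_wpM2r// mulrA ler_pdivrMr// mulrC ler_wpM2l ?(ltW e4)//.
  by rewrite lerDl.
set q := e' / 2 / _ in f3 f4; set sp := speed c t in f2 f3.
move: (F s) (F s') `|z'| f2 f3 f4 => a b y1; clear; lra.
Qed.

End Distance.

(** * Lebesgue measure, translations and the modular function *)

Lemma pushforward_exists d d' (R : realType) (T1 : measurableType d)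
    (T2 : measurableType d') (m : {measure set T1 -> \bar R}) (f : T1 -> T2) : measurable_fun [set: T1] f ->
  exists m' : {measure set T2 -> \bar R}, forall A, m' A = m (f @^-1` A).
Proof.
by move=> mf; exists (measure_function_pushforward__canonical__measure_function_Measure m mf).
Qed.

(** Nonnegativity makes g monotone, so N g(x) and N x g(1) both lie within one g(1) of k g(1), with
    k the integer part of N x; then let N grow. *)
Lemma additive_real (R : realType) (g : R -> R) : (forall x, 0 <= x -> 0 <= g x) ->
  (forall x y, 0 <= x -> 0 <= y -> g (x + y) = g x + g y) ->
  forall x, 0 <= x -> g x = x * g 1.
Proof.
move=> g0 gD; have g00 : g 0 = 0.
  by have := gD 0 0 (lexx _) (lexx _); rewrite addr0 => /eqP; rewrite -subr_eq subrr eq_sym => /eqP.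
have gn (k : nat) x : 0 <= x -> g (k%:R * x) = k%:R * g x.
  move=> x0; elim: k => [|k ih]; first by rewrite !mul0r g00.
  by rewrite -natr1 !mulrDl !mul1r gD ?ih// mulr_ge0.
have gm x y : 0 <= x -> x <= y -> g x <= g y.
  by move=> x0 xy; rewrite -(subrK x y) gD ?subr_ge0// lerDr g0// subr_ge0.
move=> x x0; apply/eqP; rewrite -subr_eq0 -normr_le0 leNgt; apply/negP => p0.
have [N hN] : exists N : nat, g 1 < N%:R * `|g x - x * g 1|.
  exists (Num.bound (g 1 / `|g x - x * g 1|)).
  by rewrite -ltr_pdivrMr// archi_boundP// divr_ge0 ?g0// ltW.
pose k := Num.trunc (N%:R * x).
have Nx : 0 <= N%:R * x by rewrite mulr_ge0.
have /andP[k1 k2] := truncn_itv Nx.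
move: hN; apply/negP; rewrite -leNgt -[N%:R]ger0_norm// -normrM mulrBr -gn// mulrA.
have h1 : k%:R * g 1 <= g (N%:R * x) by rewrite -gn// gm// mulr1.
have h2 : g (N%:R * x) <= k%:R * g 1 + g 1.
  by rewrite -{2}[g 1]mul1r -mulrDl natr1 -gn// gm// mulr1 ltW.
have h3 : k%:R * g 1 <= N%:R * x * g 1 by rewrite ler_wpM2r// g0.
have h4 : N%:R * x * g 1 <= k%:R * g 1 + g 1.
  by rewrite -[X in _ + X]mul1r -mulrDl natr1 ler_wpM2r ?g0// ltW.
rewrite ler_distl; apply/andP; split; first by rewrite lerBlDr (le_trans h4)// lerD2r.
by rewrite (le_trans h2)// lerD2r.
Qed.

Section LinearScaling.
Context (R : realType) (n : nat).
Local Notation V := 'rV[R]_n.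
Local Notation bset := (set V).
Implicit Types (a b x y w : V) (A : bset) (M N : 'M[R]_n).
Local Notation bmeasurable := (@measurable _ (borel V)).

Definition set_coord x i (t : R) : V := \row_j (if j == i then t else x 0 j).

Lemma box_split w i s t : 0 <= s -> 0 <= t ->
  box 0 (set_coord w i (s + t)) = box 0 (set_coord w i s) `|`
    [set x | box 0 (set_coord w i t) (x - s *: delta_mx 0 i)].
Proof.
move=> s0 t0; apply/seteqP; split=> x /=.
  move=> h; have := h i; rewrite !mxE eqxx => /andP[x0 xst].
  have [xs|sx] := ltP (x 0 i) s; [left|right] => j; have := h j; rewrite !mxE.
    by case: (eqVneq j i) => [->|//]; rewrite x0 xs.
  rewrite eqxx/=; case: (eqVneq j i) => [->|ji]; last by rewrite mulr0 subr0.
  by rewrite mulr1 subr_ge0 sx ltrBlDl xst.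
case=> h j; have := h j; rewrite !mxE; case: (eqVneq j i) => [->|ji] //.
- by move=> /andP[-> /lt_le_trans]; apply; rewrite lerDl.
- by rewrite eqxx mulr1 subr_ge0 ltrBlDl => /andP[/(le_trans s0) -> ->].
- by rewrite eqxx/= mulr0 subr0.
Qed.

(** The measure of a box is additive in each side length separately, hence linear in each of
    them. *)
Lemma invariant_box (m : {measure set (borel V) -> \bar R}) :
  (forall a b w, m [set x | box a b (x + w)] = m (box a b)) ->
  (forall a b, (m (box a b) < +oo)%E) ->
  forall a b, (forall i, a 0 i <= b 0 i) ->
  m (box a b) = ((\prod_(i < n) (b 0 i - a 0 i)) * fine (m (box 0 (const_mx 1))))%:E.
Proof.
move=> mT mfin.
have mF a b : m (box a b) = (fine (m (box a b)))%:E.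
  by rewrite fineK// ge0_fin_numE ?measure_ge0.
pose F w := fine (m (box 0 w)).
have Fadd w i s t : 0 <= s -> 0 <= t ->
    F (set_coord w i (s + t)) = F (set_coord w i s) + F (set_coord w i t).
  move=> s0 t0; apply: EFin_inj; rewrite EFinD -!mF box_split//.
  rewrite measureU; [by congr (_ + _)%E; exact: mT | exact: box_measurable | | ].
    exact: (translate_measurable (- (s *: delta_mx 0 i)) (box_measurable 0 (set_coord w i t))).
  apply/seteqP; split=> // x [/= h1 h2].
  have := h1 i; have := h2 i; rewrite !mxE !eqxx mulr1 subr_ge0 => /andP[h3 _] /andP[_ h4].
  by have := lt_le_trans h4 h3; rewrite ltxx.
have Fcoord w i : 0 <= w 0 i -> F w = w 0 i * F (set_coord w i 1).
  move=> wi; rewrite -(@additive_real R (fun t => F (set_coord w i t))) //; last first.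
  - by move=> s t s0 t0; exact: Fadd.
  - by move=> t _; exact/fine_ge0/measure_ge0.
  by congr F; apply/rowP => j; rewrite mxE; case: eqVneq => [->|].
have Fprod w (s : seq 'I_n) : (forall i, 0 <= w 0 i) -> uniq s ->
    F w = \prod_(i <- s) w 0 i * F (\row_j (if j \in s then 1 else w 0 j)).
  move=> w0; elim: s => [_|i s ih /= /andP[is_ us]].
    by rewrite big_nil mul1r; congr F; apply/rowP => j; rewrite mxE.
  pose w' : V := \row_j (if j \in s then 1 else w 0 j).
  have wi : w' 0 i = w 0 i by rewrite mxE (negbTE is_).
  rewrite ih// big_cons -/w' (Fcoord w' i) ?wi// mulrA [_ * w 0 i]mulrC; congr (_ * F _).
  apply/rowP => j; rewrite !mxE in_cons; case: eqVneq => //=.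
move=> a b ab.
have -> : m (box a b) = m (box 0 (b - a)).
  rewrite -(mT 0 (b - a) (- a)) translate_box; congr (m (box _ _)).
    by rewrite sub0r opprK.
  by rewrite opprK subrK.
rewrite mF; congr EFin.
rewrite -/(F _) (Fprod (b - a) (index_enum 'I_n)); last exact: index_enum_uniq.
  congr (_ * F _); first by apply: eq_bigr => i _; rewrite !mxE.
  by apply/rowP => j; rewrite !mxE mem_index_enum.
by move=> i; rewrite !mxE subr_ge0.
Qed.

Variable lam : {measure set (borel V) -> \bar R}.
Hypothesis hlam : is_lebesgue lam.

Lemma leb_translate w A : bmeasurable A -> lam [set x | A (x + w)] = lam A.
Proof.
move=> mA; have [m mE] := pushforward_exists lam (borel_continuous (@translate_continuous R n w)).
have tb a b : m (box a b) = lam (box (a - w) (b - w)) by rewrite mE -translate_box.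
rewrite -[LHS]mE; apply: box_measure_unique => // a b; rewrite tb; last exact: leb_box_fin.
have [ab|/existsNP[i /negP]] := pselect (forall i, a 0 i <= b 0 i).
  rewrite !leb_box//; last by move=> i; rewrite !mxE lerD2r.
  by congr EFin; apply: eq_bigr => i _; rewrite !mxE opprB addrA subrK.
rewrite -ltNge => /ltW h; rewrite (box_empty h) (box_empty (i := i))//.
by rewrite !mxE lerD2r.
Qed.

Lemma bl_mulmx k (M : 'M[R]_(n, k)) : bounded_linear (fun x : V => x *m M).
Proof.
split; first by move=> a u v; rewrite mulmxDl -scalemxAl.
pose K := \sum_i \sum_j `|M i j|.
have K0 : 0 <= K by apply: sumr_ge0 => i _; exact: sumr_ge0.
exists (K + 1) => [|v]; first by rewrite ltr_wpDl.
rewrite mulrDl mul1r ler_wpDr//; apply: norm_rV_le; first exact: mulr_ge0.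
move=> j; rewrite mxE (le_trans (ler_norm_sum _ _ _))// mulr_suml ler_sum// => i _.
rewrite normrM mulrC ler_pM// ?norm_coord//.
by rewrite (bigD1 j)//= lerDl sumr_ge0.
Qed.

Lemma mulmx_continuous (M : 'M[R]_n) : continuous (fun x : V => x *m M).
Proof. by move=> x; exact: sdiff_continuous (sdiff_linear x (bl_mulmx M)). Qed.

Definition lin_preim (M : 'M[R]_n) A : bset := [set x | A (x *m M)].

Lemma lin_preim_measurable M A : bmeasurable A -> bmeasurable (lin_preim M A).
Proof.
move=> mA; rewrite -[X in measurable X]setTI.
exact: (borel_continuous (@mulmx_continuous M)).
Qed.

(** The image of [lam] under M is translation invariant, and finite on boxes because M^-1 is
    bounded; such a measure is a multiple of [lam]. *)
Lemma lin_scaling M : M \in unitmx -> exists2 c : R, 0 <= c &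
  forall A, bmeasurable A -> lam (lin_preim M A) = (c%:E * lam A)%E.
Proof.
move=> uM; have [m mE] := pushforward_exists lam (borel_continuous (@mulmx_continuous M)).
have mfin a b : (m (box a b) < +oo)%E.
  rewrite mE; have [_ [K K0 hK]] := bl_mulmx (invmx M).
  pose r := K * (`|a| + `|b|) + 1.
  apply: (le_lt_trans _ (leb_box_fin hlam (const_mx (- r)) (const_mx r))).
  apply: le_measure; rewrite ?inE; [exact: lin_preim_measurable (box_measurable a b)|exact: box_measurable|].
  move=> x /= hx.
  have xM : `|x *m M| <= `|a| + `|b|.
    apply: norm_rV_le => [|i]; first exact: addr_ge0.
    have /andP[h1 h2] := hx i; rewrite ler_norml; apply/andP; split.
      rewrite (le_trans _ h1)//; have := norm_coord a i; rewrite ler_norml => /andP[h3 _].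
      by rewrite (le_trans _ h3)// lerN2 lerDl.
    rewrite (le_trans (ltW h2))//; have := norm_coord b i; rewrite ler_norml => /andP[_ h3].
    by rewrite (le_trans h3)// lerDr.
  have : `|x| < r.
    rewrite -(mulmxK uM x) (le_lt_trans (hK _))// /r ltr_pwDr// ler_wpM2l//.
    exact: ltW.
  by move=> xr i; rewrite !mxE; have := le_lt_trans (norm_coord x i) xr;
    rewrite ltr_norml => /andP[/ltW -> ->].
have mT a b w : m [set x | box a b (x + w)] = m (box a b).
  rewrite !mE -(leb_translate (w *m invmx M) (lin_preim_measurable M (box_measurable a b))).
  by congr (lam _); apply/seteqP; split=> x; rewrite /lin_preim /= mulmxDl mulmxKV.
exists (fine (m (box 0 (const_mx 1)))); first exact/fine_ge0/measure_ge0.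
move=> A mA; set c := fine _.
have c0 : 0 <= c by exact/fine_ge0/measure_ge0.
rewrite -[LHS]mE -[c]/((NngNum c0)%:num) -/(mscale (NngNum c0) lam A).
apply: box_measure_unique mA => // a b.
have [ab|/existsNP[i /negP]] := pselect (forall i, a 0 i <= b 0 i).
  rewrite (invariant_box mT mfin)//.
  transitivity (c%:E * lam (box a b))%E; last by [].
  by rewrite (leb_box hlam)// mulrC; exact: EFinM.
by rewrite -ltNge => /ltW h; rewrite (box_empty h) !measure0.
Qed.

Let cube : bset := rect 0 (const_mx 1).

Let cube_measurable : bmeasurable cube.
Proof. exact: rect_measurable. Qed.

Lemma leb_rect a b : (forall i, a 0 i <= b 0 i) ->
  lam (rect a b) = (\prod_(i < n) (b 0 i - a 0 i))%:E.
Proof. exact: hlam. Qed.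

Let lam_cube : lam cube = 1%E.
Proof.
rewrite /cube leb_rect; last by move=> i; rewrite !mxE.
by congr EFin; rewrite big1// => i _; rewrite !mxE subr0.
Qed.

(** Equal to |det M|^-1 by [lin_factor_det], since [lin_preim] takes preimages. *)
Definition lin_factor M : R := fine (lam (lin_preim M cube)).

Lemma lin_factorE M A : M \in unitmx -> bmeasurable A ->
  lam (lin_preim M A) = ((lin_factor M)%:E * lam A)%E.
Proof.
move=> uM mA; have [c c0 hc] := lin_scaling uM.
by rewrite /lin_factor !hc// lam_cube mule1.
Qed.

Lemma lin_factorM M N : M \in unitmx -> N \in unitmx ->
  lin_factor (M *m N) = lin_factor M * lin_factor N.
Proof.
move=> uM uN; have -> : lin_factor (M *m N) = fine (lam (lin_preim M (lin_preim N cube))).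
  congr (fine (lam _)); apply/seteqP.
  by split=> x; rewrite /lin_preim/= mulmxA.
rewrite !lin_factorE//; last exact: lin_preim_measurable.
by rewrite lam_cube mule1.
Qed.

Lemma lin_factor1 : lin_factor 1%:M = 1.
Proof.
rewrite /lin_factor; have -> : lin_preim 1%:M cube = cube.
  by apply/seteqP; split=> x; rewrite /lin_preim/= mulmx1.
by rewrite lam_cube.
Qed.

(** M maps the cube with sides [e, 1 - e] into the unit cube. *)
Lemma lin_factor_near M e : M \in unitmx -> 0 <= e -> 2 * e <= 1 ->
  (forall x, `|x *m M - x| <= e * `|x|) -> 1 - n%:R * (2 * e) <= lin_factor M.
Proof.
move=> uM e0 e1 hM.
have e21 : 0 <= 2 * e <= 1 by rewrite e1 mulr_ge0.
apply: (le_trans (bernoulli_ineq n e21)).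
have ee : e <= 1 - e by rewrite lerBrDr -mulr2n -mulr_natl.
have e11 : e <= 1 by rewrite (le_trans ee)// gerBl.
rewrite -lee_fin; have -> : ((1 - 2 * e) ^+ n)%:E = lam (rect (const_mx e) (const_mx (1 - e))).
  rewrite leb_rect; last by move=> i; rewrite !mxE.
  congr EFin; rewrite -[n in LHS]card_ord -prodr_const; apply: eq_bigr => i _.
  by rewrite !mxE; ring.
rewrite /lin_factor fineK; last by rewrite lin_factorE// lam_cube mule1.
apply: le_measure; rewrite ?inE; [exact: rect_measurable|exact: lin_preim_measurable|].
move=> x hx; have x1 : `|x| <= 1.
  apply: norm_rV_le => // i; have := hx i; rewrite !mxE => /andP[h1 h2].
  rewrite ler_norml (le_trans h2) ?gerBl// andbT (le_trans _ h1)//.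
  by rewrite (le_trans _ e0)// oppr_le0.
have xM : `|x *m M - x| <= e.
  by rewrite (le_trans (hM x))// ler_piMr.
move=> i; have := hx i; have := norm_coord (x *m M - x) i; rewrite !mxE.
move=> /le_trans/(_ xM); rewrite ler_distl => /andP[h1 h2] /andP[h3 h4].
apply/andP; split; first by rewrite (le_trans _ h1)// subr_ge0.
by rewrite (le_trans h2)// -lerBrDr.
Qed.

(** Conjugation by the diagonal matrix of powers de^(wt j) does not change the factor, and
    multiplies each nonzero off-diagonal entry by a positive power of de. So M may be assumed close
    to the identity, where the factor and that of the inverse are at least nearly 1. The weight [wt]
    covers lower and upper triangular matrices alike. *)
Lemma lin_factor_unitriangular M (wt : 'I_n -> nat) :
  (forall i j, M i j != 0 -> i != j -> (wt j < wt i)%N) ->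
  (forall i, M i i = 1) -> M \in unitmx -> lin_factor M = 1.
Proof.
move=> hM M1 uM.
pose K := \sum_i \sum_j `|M i j|.
have K0 : 0 <= K by apply: sumr_ge0 => i _; exact: sumr_ge0.
have key e : 0 < e -> 2 * e <= 1 -> exists2 N, N \in unitmx /\ lin_factor N = lin_factor M &
    forall x, `|x *m N - x| <= e * `|x|.
  move=> e0 e1.
  pose de := Num.min 1 (e / (K + 1)).
  have K1 : 0 < K + 1 by rewrite ltr_wpDl.
  have de0 : 0 < de by rewrite lt_min ltr01 divr_gt0.
  have de1 : de <= 1 by rewrite ge_min lexx.
  have deK : de * K <= e.
    have : de <= e / (K + 1) by rewrite ge_min lexx orbT.
    rewrite ler_pdivlMr// => h; apply: le_trans h; rewrite ler_wpM2l ?(ltW de0)//.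
    by rewrite lerDl.
  pose D : 'M[R]_n := diag_mx (\row_j de ^+ wt j).
  pose D' : 'M[R]_n := diag_mx (\row_j de ^- wt j).
  have DD : D *m D' = 1%:M.
    rewrite mulmx_diag -diag_const_mx; congr diag_mx; apply/rowP => j.
    by rewrite !mxE divff// expf_neq0// gt_eqF.
  have uD : D \in unitmx by case/mulmx1_unit: DD.
  have uD' : D' \in unitmx by case/mulmx1_unit: DD.
  exists (D *m M *m D').
    split; first by rewrite !unitmx_mul uD uM.
    rewrite !lin_factorM ?unitmx_mul ?uD// mulrAC -lin_factorM// DD lin_factor1.
    by rewrite mul1r.
  move=> x; apply: norm_rV_le; first by rewrite mulr_ge0// ltW.
  move=> j.
  have -> : (x *m (D *m M *m D') - x) 0 j =
      \sum_(i | i != j) x 0 i * (de ^+ wt i * M i j * de ^- wt j).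
    have Nij i : (D *m M *m D') i j = de ^+ wt i * M i j * de ^- wt j.
      by rewrite mul_mx_diag mul_diag_mx !mxE.
    rewrite mxE [X in X + _]mxE [X in _ + X]mxE (bigD1 j)//= Nij M1 mulr1.
    rewrite divff ?expf_neq0 ?gt_eqF// mulr1 addrAC subrr add0r.
    by apply: eq_bigr => i _; rewrite Nij.
  rewrite (le_trans (ler_norm_sum _ _ _))// (le_trans _ (ler_wpM2r _ deK))//.
  have -> : de * K * `|x| = \sum_i \sum_j de * `|M i j| * `|x|.
    rewrite mulr_sumr mulr_suml; apply: eq_bigr => i _.
    by rewrite mulr_sumr mulr_suml.
  rewrite [leRHS](bigID (fun i => i != j))/= ler_wpDr//.
    by apply: sumr_ge0 => i _; apply: sumr_ge0 => k _; rewrite !mulr_ge0// ltW.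
  apply: ler_sum => i ij; rewrite (bigD1 j)//= ler_wpDr//.
    by apply: sumr_ge0 => k _; rewrite !mulr_ge0// ltW.
  rewrite normrM mulrC ler_pM// ?norm_coord//.
  have [->|Mij] := eqVneq (M i j) 0; first by rewrite mulr0 mul0r normr0 mulr0.
  have := hM i j Mij ij => wji.
  rewrite mulrAC normrM ler_wpM2r// ger0_norm; last first.
    by rewrite divr_ge0// exprn_ge0// ltW.
  rewrite ler_pdivrMr ?exprn_gt0// -exprS ler_wiXn2l// ltW//.
have lb N e : N \in unitmx -> 0 < e -> 4 * e <= 1 ->
    (forall x, `|x *m N - x| <= e * `|x|) ->
    1 - n%:R * (4 * e) <= lin_factor N /\ lin_factor N * (1 - n%:R * (4 * e)) <= 1.
  move=> uN e0 e1 hN; split.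
    apply: le_trans (lin_factor_near uN (ltW e0) _ hN); last by lra.
    by rewrite lerD2l lerN2 ler_wpM2l//; lra.
  have uN' : invmx N \in unitmx by rewrite unitmx_inv.
  have h2e : forall x, `|x *m invmx N - x| <= (2 * e) * `|x|.
    move=> x; set y := x *m invmx N; have xy : x = y *m N by rewrite mulmxKV.
    have h := hN y; rewrite -xy in h; rewrite distrC (le_trans h)//.
    have : `|y| <= `|x| + e * `|y|.
      by rewrite -{1}[y](subrK x) addrC (le_trans (ler_normD _ _))// lerD2l distrC.
    have : e * `|y| <= 4^-1 * `|y| by rewrite ler_wpM2r//; lra.
    have := normr_ge0 y => y0 h1 h2.
    have -> : 2 * e * `|x| = e * (2 * `|x|) by ring.
    by rewrite ler_wpM2l ?(ltW e0)//; lra.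
  have := lin_factor_near uN' (mulr_ge0 (ler0n _ 2) (ltW e0)) _ h2e.
  have -> : 2 * (2 * e) = 4 * e by ring.
  move=> /(_ e1) h.
  have f0 : 0 <= lin_factor N by exact/fine_ge0/measure_ge0.
  apply: (le_trans (ler_wpM2l f0 h)).
  by rewrite -lin_factorM// mulmxV// lin_factor1.
have f0 : 0 <= lin_factor M by exact/fine_ge0/measure_ge0.
have main e : 0 < e -> 4 * e <= 1 ->
    1 - n%:R * (4 * e) <= lin_factor M /\ lin_factor M * (1 - n%:R * (4 * e)) <= 1.
  move=> e0 e1; have [|N [uN <-] hN] := key e e0; first by lra.
  exact: lb.
have n1 : 0 < n%:R * 4 + 1 :> R by rewrite ltr_wpDl// mulr_ge0.
apply/eqP; rewrite eq_le; apply/andP; split; apply: le_addgt0P => e e0.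
  pose q := Num.min 4^-1 (e / (n%:R * 4 + 1) / (lin_factor M + 1)).
  have M1' : 0 < lin_factor M + 1 by rewrite ltr_wpDl.
  have q0 : 0 < q by rewrite lt_min invr_gt0 ltr0n !divr_gt0.
  have q4 : 4 * q <= 1 by rewrite -ler_pdivlMl// mulr1 ge_min lexx.
  have [_] := main q q0 q4; rewrite mulrBr mulr1 lerBlDr => h; apply: (le_trans h).
  rewrite lerD2l.
  have : q <= e / (n%:R * 4 + 1) / (lin_factor M + 1) by rewrite ge_min lexx orbT.
  rewrite ler_pdivlMr// ler_pdivlMr// => h2; apply: le_trans h2.
  have -> : lin_factor M * (n%:R * (4 * q)) = q * lin_factor M * (n%:R * 4) by ring.
  apply: ler_pM; rewrite ?mulr_ge0 ?(ltW q0)//; last by rewrite lerDl.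
  by rewrite ler_wpM2l ?(ltW q0)// lerDl.
pose q := Num.min 4^-1 (e / (n%:R * 4 + 1)).
have q0 : 0 < q by rewrite lt_min invr_gt0 ltr0n !divr_gt0.
have q4 : 4 * q <= 1 by rewrite -ler_pdivlMl// mulr1 ge_min lexx.
have [+ _] := main q q0 q4; rewrite lerBlDr => h; apply: (le_trans h).
rewrite lerD2l.
have : q <= e / (n%:R * 4 + 1) by rewrite ge_min lexx orbT.
rewrite ler_pdivlMr// => h2; apply: le_trans h2.
by rewrite mulrA mulrC ler_wpM2l ?(ltW q0)// lerDl.
Qed.

Lemma lin_factor_diag (u : V) : (forall i, u 0 i != 0) ->
  lin_factor (diag_mx u) * `|\prod_i u 0 i| = 1.
Proof.
move=> u0.
pose a : V := \row_i (if 0 < u 0 i then 0 else (u 0 i)^-1).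
pose b : V := \row_i (if 0 < u 0 i then (u 0 i)^-1 else 0).
have -> : lin_factor (diag_mx u) = fine (lam (rect a b)).
  congr (fine (lam _)); apply/seteqP; split=> x /= h i; have := h i;
    rewrite mul_mx_diag !mxE; case: ltrP => ui.
  - by rewrite pmulr_lge0// -ler_pdivlMr// mul1r.
  - have {}ui : u 0 i < 0 by rewrite lt_neqAle u0.
    by rewrite nmulr_lge0// -ler_ndivrMr// mul1r andbC.
  - by rewrite pmulr_lge0// -ler_pdivlMr// mul1r.
  - have {}ui : u 0 i < 0 by rewrite lt_neqAle u0.
    by rewrite nmulr_lge0// -ler_ndivrMr// mul1r andbC.
rewrite leb_rect/=; last first.
  move=> i; rewrite !mxE; case: ltrP => ui; first by rewrite invr_ge0 ltW.
  by rewrite invr_le0.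
rewrite normr_prod -big_split/= big1// => i _; rewrite !mxE; case: ltrP => ui.
  by rewrite subr0 gtr0_norm// mulVf.
by rewrite sub0r ler0_norm// mulrNN mulVf.
Qed.

Lemma lin_factor_perm (s : perm.perm_of 'I_n) : lin_factor (perm_mx s) = 1.
Proof.
rewrite /lin_factor; suff -> : lin_preim (perm_mx s) cube = cube by rewrite lam_cube.
have e x i : (x *m perm_mx s) 0 (perm.fun_of_perm s i) = x 0 i.
  rewrite mxE (bigD1 i)//= !mxE eqxx mulr1 big1 ?addr0// => k ki.
  by rewrite !mxE (inj_eq (@perm.perm_inj _ s)) (negbTE ki) mulr0.
apply/seteqP; split=> x h i.
  by have := h (perm.fun_of_perm s i); rewrite e !mxE.
have [j <-] : exists j, perm.fun_of_perm s j = i by eexists; exact: perm.permKV.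
by rewrite e; have := h j; rewrite !mxE.
Qed.

End LinearScaling.

(** LUP decomposition: permutation and unitriangular matrices have factor 1, and U is a diagonal
    matrix times a unitriangular one. [cormen_lup] speaks of positive sizes, so n = 0 is treated
    first. *)
Lemma lin_factor_det (R : realType) (n : nat)
    (lam : {measure set (borel 'rV[R]_n) -> \bar R}) (M : 'M[R]_n) :
  is_lebesgue lam -> M \in unitmx -> lin_factor lam M * `|\det M| = 1.
Proof.
case: n => [|n] in lam M *; move=> hlam uM.
  have -> : M = 1%:M by apply/matrixP => -[].
  by rewrite det1 normr1 mulr1 lin_factor1.
have := cormen_lup_correct M; have := cormen_lup_perm M; have := cormen_lup_detL M.
have := cormen_lup_lower M; have := cormen_lup_upper M.
case: (cormen_lup M) => [[P L] U] /= hU hL dL /is_perm_mxP[s ->] e.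
have uL : L \in unitmx by rewrite unitmxE dL unitr1.
have uU : U \in unitmx.
  have : perm_mx s *m M \in unitmx by rewrite unitmx_mul unitmx_perm.
  by rewrite [_ *m _]e unitmx_mul => /andP[].
have fL : lin_factor lam L = 1.
  apply: (lin_factor_unitriangular hlam (wt := fun i => i)) => //.
    move=> i j + ij; rewrite ltnNge; apply: contra => hij.
    by rewrite hL// (negbTE ij).
  by move=> i; rewrite hL// eqxx.
have tU : \det U = \prod_i U i i.
  rewrite -det_tr det_trig; first by apply: eq_bigr => i _; rewrite mxE.
  by apply/is_trig_mxP => i j ij; rewrite mxE hU.
have U0 i : U i i != 0.
  move: uU; rewrite unitmxE tU unitfE; apply: contra => /eqP Ui.
  by rewrite (bigD1 i)//= Ui mul0r.
pose u : 'rV[R]_n.+1 := \row_i U i i.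
pose D' : 'M[R]_n.+1 := diag_mx (\row_i (U i i)^-1).
have DD : D' *m diag_mx u = 1%:M.
  rewrite mulmx_diag -diag_const_mx; congr diag_mx; apply/rowP => j.
  by rewrite !mxE mulVf.
have [uD' uD] := mulmx1_unit DD.
have UE : U = diag_mx u *m (D' *m U) by rewrite mulmxA (mulmx1C DD) mul1mx.
have uDU : D' *m U \in unitmx by rewrite unitmx_mul uD'.
have fU' : lin_factor lam (D' *m U) = 1.
  apply: (lin_factor_unitriangular hlam (wt := fun i => (n - i)%N)) => //.
    move=> i j + ij; rewrite mul_diag_mx !mxE => h.
    have ij' : (i < j)%N.
      rewrite ltn_neqAle ij leqNgt; apply: contra h => ji.
      by rewrite (hU _ _ ji) mulr0.
    by rewrite ltn_sub2l// (leq_trans ij')// -ltnS.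
  by move=> i; rewrite mul_diag_mx !mxE mulVf.
have fU : lin_factor lam U * `|\det U| = 1.
  rewrite UE lin_factorM// fU' mulr1 -UE tU.
  have <- : \prod_i u 0 i = \prod_i U i i by apply: eq_bigr => i _; rewrite mxE.
  by apply: lin_factor_diag => // i; rewrite mxE.
have := congr1 determinant e; rewrite !det_mulmx dL mul1r det_perm => dE.
have -> : `|\det M| = `|\det U| by rewrite -dE normrM normrX normrN1 expr1n mul1r.
rewrite -fU; congr (_ * _).
have := lin_factorM hlam (unitmx_perm R s) uM.
by rewrite [_ *m _]e (lin_factorM hlam uL uU) fL mul1r lin_factor_perm// mul1r.
Qed.

Section BoxComparison.
Context (R : realType) (n : nat).
Local Notation V := 'rV[R]_n.
Implicit Types (a b c x y w : V).
Variables m1 m2 : {measure set (borel V) -> \bar R}.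

Lemma box_cut a b i (t : R) : a 0 i <= t <= b 0 i ->
  box a b = box a (set_coord b i t) `|` box (set_coord a i t) b /\
  box a (set_coord b i t) `&` box (set_coord a i t) b = set0.
Proof.
move=> /andP[at_ tb]; split; apply/seteqP; split=> x.
- move=> h; have [xt|tx] := ltP (x 0 i) t; [left|right] => j; have := h j; rewrite mxE;
    case: (eqVneq j i) => [->|//].
    by rewrite xt => /andP[->].
  by rewrite tx => /andP[_ ->].
- case=> h j; have := h j; rewrite mxE; case: (eqVneq j i) => [->|//].
    by move=> /andP[-> /lt_le_trans ->].
  by move=> /andP[/(le_trans at_) -> ->].
- by move=> [h1 h2]; have := h1 i; have := h2 i; rewrite !mxE eqxx => /andP[h3 _] /andP[_ h4];
    have := lt_le_trans h4 h3; rewrite ltxx.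
- by [].
Qed.

Lemma box_halve_coord a b i : (forall j, a 0 j <= b 0 j) ->
  (m2 (box a b) < m1 (box a b))%E -> exists a' b' : V,
  [/\ forall j, a 0 j <= a' 0 j, forall j, b' 0 j <= b 0 j,
     forall j, b' 0 j - a' 0 j = (if j == i then (b 0 j - a 0 j) / 2 else b 0 j - a 0 j)
   & (m2 (box a' b') < m1 (box a' b'))%E].
Proof.
move=> ab; pose t := (a 0 i + b 0 i) / 2.
have [tl th] : a 0 i <= t /\ t <= b 0 i by rewrite /t; have := ab i; split; lra.
have [-> dj] := box_cut (introT andP (conj tl th)).
rewrite !measureU//; try exact: box_measurable.
move=> h; have [h1|] := boolP (m2 (box a (set_coord b i t)) < m1 (box a (set_coord b i t)))%E.
  exists a, (set_coord b i t); split=> // j; rewrite ?mxE; case: eqVneq => [->|_] //.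
  by rewrite /t; lra.
rewrite -leNgt => h1; exists (set_coord a i t), b; split=> // [j|j|].
- by rewrite mxE; case: eqVneq => [->|_].
- by rewrite mxE; case: eqVneq => [->|_] //; rewrite /t; lra.
- rewrite ltNge; apply/negP => h2; move: h; apply/negP; rewrite -leNgt.
  exact: leeD.
Qed.

Lemma box_halve a b : (forall j, a 0 j <= b 0 j) ->
  (m2 (box a b) < m1 (box a b))%E -> exists a' : V,
  [/\ forall j, a 0 j <= a' 0 j, forall j, a' 0 j + (b 0 j - a 0 j) / 2 <= b 0 j
   & (m2 (box a' (a' + 2^-1 *: (b - a))) < m1 (box a' (a' + 2^-1 *: (b - a))))%E].
Proof.
move=> ab h.
have main (s : seq 'I_n) : uniq s -> exists a' b' : V,
  [/\ forall j, a 0 j <= a' 0 j, forall j, b' 0 j <= b 0 j,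
     forall j, b' 0 j - a' 0 j = (if j \in s then (b 0 j - a 0 j) / 2 else b 0 j - a 0 j)
   & (m2 (box a' b') < m1 (box a' b'))%E].
  elim: s => [_|i s ih /= /andP[is_ us]]; first by exists a, b; split.
  have [a1 [b1 [h1 h2 h3 h4]]] := ih us.
  have ab1 j : a1 0 j <= b1 0 j.
    rewrite -subr_ge0 h3; case: ifP => _; rewrite ?divr_ge0 ?subr_ge0//; exact: ab.
  have [a2 [b2 [k1 k2 k3 k4]]] := box_halve_coord i ab1 h4.
  exists a2, b2; split=> // j; first exact: le_trans (k1 j).
    exact: le_trans (h2 j).
  rewrite k3 in_cons; case: eqVneq => [->|_] //=; rewrite h3 ?(negbTE is_)//.
have [a' [b' [h1 h2 h3 h4]]] := main (index_enum 'I_n) (index_enum_uniq _).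
have e : b' = a' + 2^-1 *: (b - a).
  apply/rowP => j; have := h3 j; rewrite mem_index_enum !mxE mulrC => <-.
  by rewrite addrC subrK.
exists a'; split=> // [j|]; last by rewrite -e.
by have := h2 j; rewrite e !mxE mulrC.
Qed.

(* Bisection: the comparison is only needed for small dyadic copies of the box
   near each point, so no change of variables formula is involved. *)
Lemma box_compare a b : (forall j, a 0 j <= b 0 j) ->
  (forall y, rect a b y -> exists2 d : R, 0 < d & forall c k,
     rect c (c + 2^-1 ^+ k *: (b - a)) y ->
     rect c (c + 2^-1 ^+ k *: (b - a)) `<=` rect a b ->
     2^-1 ^+ k * `|b - a| < d ->
     (m1 (box c (c + 2^-1 ^+ k *: (b - a))) <= m2 (box c (c + 2^-1 ^+ k *: (b - a))))%E) ->
  (m1 (box a b) <= m2 (box a b))%E.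
Proof.
move=> ab H; rewrite leNgt; apply/negP => h0.
pose w k : V := 2^-1 ^+ k *: (b - a).
have w0 k j : 0 <= w k 0 j by rewrite !mxE mulr_ge0 ?exprn_ge0 ?invr_ge0// subr_ge0.
pose P k c := [/\ forall j, a 0 j <= c 0 j, forall j, c 0 j + w k 0 j <= b 0 j
   & (m2 (box c (c + w k)) < m1 (box c (c + w k)))%E].
have P0 : P 0%N a.
  have e : a + w 0%N = b by rewrite /w expr0 scale1r addrC subrK.
  split=> // [j|]; last by rewrite e.
  by have /rowP/(_ j) := e; rewrite mxE => ->.
have /choice[F hF] : forall p : nat * V, exists c', P p.1 p.2 ->
    [/\ P p.1.+1 c', forall j, p.2 0 j <= c' 0 j &
        forall j, c' 0 j + w p.1.+1 0 j <= p.2 0 j + w p.1 0 j].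
  move=> [k c]; have [[h1 h2 h3]|nP] := pselect (P k c); last by exists 0.
  have cw j : c 0 j <= (c + w k) 0 j by rewrite mxE lerDl.
  have [c' [k1 k2 k3]] := box_halve cw h3.
  have we : 2^-1 *: ((c + w k) - c) = w k.+1.
    by rewrite addrC addKr /w scalerA exprS.
  have wj j : ((c + w k) 0 j - c 0 j) / 2 = w k.+1 0 j.
    by rewrite mxE addrC addKr -we addrC addKr [RHS]mxE mulrC.
  exists c' => _ /=; rewrite we in k3; have k2' j : c' 0 j + w k.+1 0 j <= c 0 j + w k 0 j.
    by have := k2 j; rewrite wj [X in _ <= X]mxE.
  split=> //; split=> // j; first exact: le_trans (k1 j).
  exact: le_trans (k2' j) (h2 j).
pose fix c k : V := if k is k'.+1 then F (k', c k') else a.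
have cP k : P k (c k).
  by elim: k => [|k ih] //=; have [] := hF (k, c k) ih.
have cS k : (forall j, c k 0 j <= c k.+1 0 j) /\
    (forall j, c k.+1 0 j + w k.+1 0 j <= c k 0 j + w k 0 j).
  by have [] := hF (k, c k) (cP k).
have cmono k l j : (k <= l)%N -> c k 0 j <= c l 0 j /\ c l 0 j + w l 0 j <= c k 0 j + w k 0 j.
  elim: l => [|l ih]; first by rewrite leqn0 => /eqP ->.
  rewrite leq_eqVlt => /predU1P[->//|/ih[h1 h2]]; split.
    exact: le_trans h1 ((cS l).1 j).
  exact: le_trans ((cS l).2 j) h2.
have ccross k l j : c k 0 j <= c l 0 j + w l 0 j.
  have [kl|/ltnW lk] := leqP k l.
    by rewrite (le_trans (cmono k l j kl).1)// lerDl.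
  by apply: le_trans (cmono l k j lk).2; rewrite lerDl.
pose y : V := \row_j sup [set c k 0 j | k in [set: nat]].
have hs j : has_sup [set c k 0 j | k in [set: nat]].
  split; first by exists (c 0%N 0 j); exists 0%N.
  by exists (c 0%N 0 j + w 0%N 0 j) => _ [k _ <-]; exact: ccross.
have yk k : rect (c k) (c k + w k) y.
  move=> j; rewrite !mxE; apply/andP; split.
    by apply: ub_le_sup; [case: (hs j) | exists k].
  apply: ge_sup; first by case: (hs j).
  by move=> _ [l _ <-]; have := ccross l k j; rewrite !mxE.
have yab : rect a b y.
  move=> j; have [h1 h2 _] := cP 0%N; have /andP[h3 h4] := yk 0%N j.
  apply/andP; split; first exact: le_trans (h1 j) h3.
  by apply: le_trans (h2 j); move: h4; rewrite [X in _ <= X]mxE.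
have [d d0 hd] := H y yab.
have [k hk] : exists k, 2^-1 ^+ k * `|b - a| < d.
  have [k hk] : exists k : nat, `|b - a| / d < k%:R.
    by exists (Num.bound (`|b - a| / d)); apply: archi_boundP; rewrite divr_ge0// ltW.
  exists k; rewrite exprVn mulrC ltr_pdivrMr ?exprn_gt0// -ltr_pdivrMl// mulrC.
  apply: (lt_trans hk); rewrite -natrX ltr_nat; exact: ltn_expl.
have [h1 h2 h3] := cP k.
move: h3; apply/negP; rewrite -leNgt; apply: hd => //.
move=> x hx j; have := hx j; rewrite mxE => /andP[k1 k2].
by rewrite (le_trans (h1 j))//= (le_trans k2).
Qed.

End BoxComparison.

Section ImageOfBoxes.
Context (R : realType) (n : nat) (lam : {measure set (borel 'rV[R]_n) -> \bar R}).
Hypothesis hlam : is_lebesgue lam.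
Local Notation V := 'rV[R]_n.
Local Notation bmeasurable := (@measurable _ (borel V)).
Implicit Types (c p q x y w : V) (A B : set V) (M N : 'M[R]_n).

Lemma affine_measurable N p q A : bmeasurable A ->
  bmeasurable [set z | A ((z - p) *m N + q)].
Proof.
move=> mA.
have -> : [set z | A ((z - p) *m N + q)] =
    lin_preim N [set u | A (u + (q - p *m N))].
  by apply/seteqP; split=> z; rewrite /lin_preim/= mulmxBl -addrA [q - _]addrC.
apply: lin_preim_measurable.
exact: (translate_measurable (q - p *m N) mA).
Qed.

Lemma leb_affine M p q A : M \in unitmx -> bmeasurable A ->
  lam [set z | A ((z - p) *m invmx M + q)] = (`|\det M|%:E * lam A)%E.
Proof.
move=> uM mA; have uN : invmx M \in unitmx by rewrite unitmx_inv.
have -> : [set z | A ((z - p) *m invmx M + q)] =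
    lin_preim (invmx M) [set u | A (u + (q - p *m invmx M))].
  by apply/seteqP; split=> z; rewrite /lin_preim/= mulmxBl -addrA [q - _]addrC.
rewrite (lin_factorE hlam)//; last exact: translate_measurable.
rewrite (leb_translate hlam)//; congr (_%:E * _)%E.
have := lin_factor_det hlam uN; rewrite det_inv normfV => h.
have d0 : `|\det M| != 0 by rewrite normr_eq0 -unitfE -unitmxE.
by rewrite -[RHS]mul1r -h mulfVK.
Qed.

Lemma positive_min w : (forall i, 0 < w 0 i) ->
  exists2 r : R, 0 < r & forall i, r <= w 0 i.
Proof.
move=> w0; apply: (@fin_uniform R 'I_n (fun i r => r <= w 0 i)).
- by move=> i d d' hd _ dd'; exact: le_trans hd.
- by move=> i; exists (w 0 i).
Qed.

Lemma rect_dist c w x y : (forall i, 0 <= w 0 i) -> rect c (c + w) x ->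
  rect c (c + w) y -> `|x - y| <= `|w|.
Proof.
move=> w0 hx hy; apply: norm_rV_le => // i.
have := hx i; have := hy i; have := norm_coord w i; rewrite !mxE ger0_norm//.
move=> h /andP[h1 h2] /andP[h3 h4]; rewrite ler_norml; apply/andP; split; lra.
Qed.

Variables (phi psi : V -> V) (y w : V) (M : 'M[R]_n).
Hypothesis uM : M \in unitmx.
Hypothesis w0 : forall i, 0 < w 0 i.
Hypothesis hphi : sdiff phi y (fun v => v *m M).

Let shrunk k i : 0 <= (2^-1 ^+ k *: w) 0 i.
Proof. by rewrite mxE mulr_ge0 ?exprn_ge0 ?invr_ge0// ltW. Qed.

(** The image of a small box around y lies in the affine image of the box enlarged by e times each
    side, which has volume (1 + 2 e)^n times larger. The boxes are all proportional to the fixed w,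
    so an error small against |w| is small against each side. *)
Lemma image_box_le e : 0 < e -> exists2 d : R, 0 < d & forall c k,
  rect c (c + 2^-1 ^+ k *: w) y -> 2^-1 ^+ k * `|w| < d ->
  forall B, bmeasurable B -> B `<=` phi @` box c (c + 2^-1 ^+ k *: w) ->
  (lam B <= (`|\det M| * (1 + 2 * e) ^+ n)%:E * lam (box c (c + 2^-1 ^+ k *: w)))%E.
Proof.
move=> e0; have [r r0 hr] := positive_min w0.
have [_ [K K0 hK]] := bl_mulmx (invmx M).
have W0 : 0 < K * (`|w| + 1) by rewrite mulr_gt0// ltr_wpDl.
have [d d0 hd] := hphi.2 _ (divr_gt0 (mulr_gt0 e0 r0) W0).
exists d => // c k; set t := 2^-1 ^+ k => hy ht B mB hB.
have t0 : 0 < t by rewrite exprn_gt0// invr_gt0.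
pose eta : V := \row_i (e * (t * w 0 i)).
have eta0 i : 0 <= e * (t * w 0 i) by rewrite !mulr_ge0// ltW.
pose A := rect (c - eta) (c + t *: w + eta).
have mA : bmeasurable A by exact: rect_measurable.
apply: (@le_trans _ _ (lam [set z | A ((z - phi y) *m invmx M + y)])).
  apply: le_measure; rewrite ?inE//; first exact: affine_measurable.
  move=> z /hB[x hx <-].
  have hx' : rect c (c + t *: w) x.
    by move=> i; have /andP[-> /ltW ->] := hx i.
  have xy : `|x - y| <= t * `|w|.
    rewrite (le_trans (rect_dist (shrunk k) hx' hy))// normrZ gtr0_norm//.
  have xy' : `|x - y| < d by exact: le_lt_trans ht.
  have := hd x y xy'; rewrite subrr normr0 => /(_ d0) h.
  have h2 : `|(phi x - phi y) *m invmx M - (x - y)| <= e * (t * r).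
    rewrite -[x - y](mulmxK uM) -mulmxBl (le_trans (hK _))//.
    apply: (le_trans (ler_wpM2l (ltW K0) h)).
    apply: (@le_trans _ _ (K * (e * r / (K * (`|w| + 1)) * (t * (`|w| + 1))))).
      rewrite ler_wpM2l ?(ltW K0)// ler_wpM2l ?divr_ge0 ?mulr_ge0 ?(ltW e0) ?(ltW r0) ?(ltW K0)// ?addr_ge0//.
      by rewrite (le_trans xy)// ler_wpM2l ?(ltW t0)// lerDl.
    rewrite le_eqVlt; apply/orP; left; apply/eqP; field.
    by rewrite gt_eqF ?ltr_wpDl// gt_eqF.
  move=> i; have := le_trans (norm_coord _ i) h2; have := hx' i.
  set u := (phi x - phi y) *m invmx M; rewrite !mxE => /andP[k1 k2].
  have k3 : e * (t * r) <= e * (t * w 0 i) by rewrite !ler_wpM2l ?(ltW e0) ?(ltW t0).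
  move=> /le_trans/(_ k3); rewrite ler_norml => /andP[k4 k5].
  move: (e * (t * w 0 i)) (u 0 i) k1 k2 k4 k5 => q v.
  by move: (x 0 i) (y 0 i) (c 0 i) (t * _) => x' y' c' t'; clear; move=> *; apply/andP; split; lra.
rewrite leb_affine// /A leb_rect//; last first.
  by move=> i; rewrite !mxE; have := eta0 i; have := shrunk k i; rewrite mxE -/t; lra.
rewrite (leb_box hlam); last by move=> i; have := shrunk k i; rewrite !mxE lerDl.
rewrite -!EFinM lee_fin -mulrA ler_wpM2l// le_eqVlt; apply/orP; left; apply/eqP.
rewrite -[n in _ ^+ n]card_ord -prodr_const -big_split/=; apply: eq_bigr => i _.
by rewrite !mxE; ring.
Qed.

Hypothesis hpsi : sdiff psi (phi y) (fun v => v *m invmx M).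
Hypothesis psiy : psi (phi y) = y.
Hypothesis phiK : \forall z \near phi y, phi (psi z) = z.

(** Conversely, the affine image of the shrunk box is contained in the image of the box; the
    preimages are supplied by the local inverse [psi]. *)
Lemma le_image_box e : 0 < e -> 2 * e <= 1 -> exists2 d : R, 0 < d & forall c k,
  rect c (c + 2^-1 ^+ k *: w) y -> 2^-1 ^+ k * `|w| < d ->
  forall B, bmeasurable B -> phi @` box c (c + 2^-1 ^+ k *: w) `<=` B ->
  ((`|\det M| * (1 - 2 * e) ^+ n)%:E * lam (box c (c + 2^-1 ^+ k *: w)) <= lam B)%E.
Proof.
move=> e0 e1; have [r r0 hr] := positive_min w0.
have [_ [K K0 hK]] := bl_mulmx M.
have W0 : 0 < K * (`|w| + 1) by rewrite mulr_gt0// ltr_wpDl.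
have [d1 d10 hd1] := hpsi.2 _ (divr_gt0 (divr_gt0 (mulr_gt0 e0 r0) W0) (ltr0n _ 2)).
have [d2 d20 hd2] := (near_distP _ _).1 phiK.
pose d := Num.min d1 d2 / K.
have m0 : 0 < Num.min d1 d2 by rewrite lt_min d10.
exists d => [|c k]; first by rewrite divr_gt0.
set t := 2^-1 ^+ k => hy ht B mB hB.
have t0 : 0 < t by rewrite exprn_gt0// invr_gt0.
pose eta : V := \row_i (e * (t * w 0 i)).
have eta0 i : 0 < e * (t * w 0 i) by rewrite !mulr_gt0.
pose A := rect (c + eta) (c + t *: w - eta).
have mA : bmeasurable A by exact: rect_measurable.
apply: (@le_trans _ _ (lam [set z | A ((z - phi y) *m invmx M + y)])); last first.
  apply: le_measure; rewrite ?inE//; first exact: affine_measurable.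
  move=> z; rewrite /= => hA; apply: hB.
  set x := (z - phi y) *m invmx M + y in hA.
  have hx' : rect c (c + t *: w) x.
    move=> i; have := hA i; have := eta0 i; rewrite !mxE => h /andP[h1 h2].
    by apply/andP; split; lra.
  have xy : `|x - y| <= t * `|w|.
    by rewrite (le_trans (rect_dist (shrunk k) hx' hy))// normrZ gtr0_norm.
  have zE : z - phi y = (x - y) *m M by rewrite /x addrK mulmxKV.
  have zd : `|z - phi y| < Num.min d1 d2.
    rewrite zE (le_lt_trans (hK _))// mulrC -ltr_pdivlMr//.
    exact: le_lt_trans ht.
  move: zd; rewrite lt_min => /andP[zd1 zd2].
  have := hd1 z (phi y) zd1; rewrite subrr normr0 => /(_ d10) h.
  exists (psi z); last exact: hd2.
  have h2 : `|psi z - x| <= e * (t * r) / 2.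
    have -> : psi z - x = psi z - psi (phi y) - (z - phi y) *m invmx M.
      by rewrite psiy /x opprD addrA addrAC.
    apply: (le_trans h); rewrite zE.
    have q0 : 0 <= e * r / (K * (`|w| + 1)) / 2 by rewrite !divr_ge0 ?mulr_ge0 ?(ltW e0) ?(ltW r0) ?(ltW K0)// addr_ge0.
    apply: (@le_trans _ _ (e * r / (K * (`|w| + 1)) / 2 * (K * (t * (`|w| + 1))))).
      rewrite ler_wpM2l// (le_trans (hK _))// ler_wpM2l ?(ltW K0)//.
      by rewrite (le_trans xy)// ler_wpM2l ?(ltW t0)// lerDl.
    rewrite le_eqVlt; apply/orP; left; apply/eqP; field.
    by rewrite gt_eqF ?ltr_wpDl// gt_eqF.
  move=> i; have := le_trans (norm_coord _ i) h2; have := hA i.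
  rewrite !mxE -/(x 0 i) => /andP[k1 k2].
  have k3 : e * (t * r) / 2 <= e * (t * w 0 i) / 2 by rewrite ler_wpM2r// !ler_wpM2l ?(ltW e0) ?(ltW t0).
  move=> /le_trans/(_ k3); rewrite ler_norml => /andP[k4 k5]; have := eta0 i.
  move: (e * (t * w 0 i)) k1 k2 k4 k5 => q; move: (x 0 i) => x'.
  move: (psi z 0 i) (c 0 i) (t * _) => y' c' t'; clear.
  by move=> *; apply/andP; split; lra.
rewrite leb_affine// /A leb_rect//; last first.
  move=> i; rewrite !mxE.
  have : 2 * e * (t * w 0 i) <= 1 * (t * w 0 i) by rewrite ler_wpM2r// mulr_ge0// ltW.
  by rewrite mul1r -mulrA; lra.
rewrite (leb_box hlam); last by move=> i; have := shrunk k i; rewrite !mxE lerDl.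
rewrite -!EFinM lee_fin -mulrA ler_wpM2l// le_eqVlt; apply/orP; left; apply/eqP.
rewrite -[n in _ ^+ n]card_ord -prodr_const -big_split/=; apply: eq_bigr => i _.
by rewrite !mxE; ring.
Qed.

End ImageOfBoxes.

Section Jacobians.
Context (R : realType).

Lemma sdiff_J m k (f : 'rV[R]_m -> 'rV[R]_k) x L : sdiff f x L ->
  sdiff f x (fun v => v *m 'J f x).
Proof. by move=> hf; suff <- : L = (fun v => v *m 'J f x); [|apply/funext => v; rewrite (sdiff_jacobian v hf)]. Qed.

Lemma mulmx_rV_inj m k (A B : 'M[R]_(m, k)) :
  (forall v : 'rV[R]_m, v *m A = v *m B) -> A = B.
Proof. by move=> h; apply/row_matrixP => i; rewrite !rowE. Qed.

Lemma J_inverse m (f g : 'rV[R]_m -> 'rV[R]_m) x (A B : 'M[R]_m) :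
  sdiff f x (fun v => v *m A) -> sdiff g (f x) (fun v => v *m B) ->
  (\forall z \near x, g (f z) = z) -> A *m B = 1%:M.
Proof.
move=> hf hg gf; apply: mulmx_rV_inj => v; rewrite mulmx1 mulmxA.
apply: (sdiff_uniq (sdiff_comp hf hg) (M := id)).
by apply: (sdiff_near _ (sdiff_id x)); apply: filterS gf => z /= ->.
Qed.

Lemma J_unit m (f g : 'rV[R]_m -> 'rV[R]_m) x (A B : 'M[R]_m) :
  sdiff f x (fun v => v *m A) -> sdiff g (f x) (fun v => v *m B) ->
  (\forall z \near x, g (f z) = z) -> A \in unitmx.
Proof. by move=> hf hg gf; have [] := mulmx1_unit (J_inverse hf hg gf). Qed.

Lemma J_square m (f1 f2 g1 g2 : 'rV[R]_m -> 'rV[R]_m) x (A B C D : 'M[R]_m) :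
  sdiff f1 x (fun v => v *m A) -> sdiff f2 (f1 x) (fun v => v *m B) ->
  sdiff g1 x (fun v => v *m C) -> sdiff g2 (g1 x) (fun v => v *m D) ->
  (\forall z \near x, g2 (g1 z) = f2 (f1 z)) -> A *m B = C *m D.
Proof.
move=> hf1 hf2 hg1 hg2 e; apply: mulmx_rV_inj => v; rewrite !mulmxA.
exact: (sdiff_uniq (sdiff_comp hf1 hf2) (sdiff_near e (sdiff_comp hg1 hg2))).
Qed.

End Jacobians.

Section LeftIncrements.
Context (R : realType) (n : nat) (G : lieGroupType R n).
Local Notation V := 'rV[R]_n.
Implicit Types (a b g k x : G) (y z : V).

Definition left_increment a y z : V := glog ((chart_inv a y)^-1 * chart_inv a z)%g.
(** The matrix at y of the left Maurer-Cartan form in the chart a. *)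
Definition increment_jac a y : 'M[R]_n := 'J (left_increment a y) y.

Lemma left_increment_dom a y : chart_img a y ->
  \forall z \near y, chart_dom (1%g : G) ((chart_inv a y)^-1 * chart_inv a z)%g.
Proof.
move=> hy; have h : gdiff (fun z => (chart_inv a y)^-1 * chart_inv a z)%g y.
  by apply: gdiffM; [exact: gdiff_cst | exact: gdiff_chart_inv (sdiff_id y) hy].
by apply: chart_dom_near h.1 _; rewrite mulVg; exact: dom1.
Qed.

Lemma sdiff_increment a y : chart_img a y ->
  sdiff (left_increment a y) y (fun v => v *m increment_jac a y).
Proof.
move=> hy; have h : gdiff (fun z => (chart_inv a y)^-1 * chart_inv a z)%g y.
  by apply: gdiffM; [exact: gdiff_cst | exact: gdiff_chart_inv (sdiff_id y) hy].
have [|L hL] := sdiff_glog h; first by rewrite mulVg; exact: dom1.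
exact: sdiff_J hL.
Qed.

Lemma left_increment_self a y : left_increment a y y = 0.
Proof. by rewrite /left_increment mulVg glog1. Qed.

Lemma increment_unit a y : chart_img a y -> increment_jac a y \in unitmx.
Proof.
move=> hy; have [h1 h2] := chart_imgP hy; set x := chart_inv a y in h1 h2.
have hg : gdiff (fun u => x * gexp G u)%g (left_increment a y y).
  rewrite left_increment_self; apply: gdiffM; first exact: gdiff_cst.
  by apply: (gdiff_gexp (sdiff_id _)); exact: gdom0.
have [|L hL] := gdiff_chart (a := a) hg.
  by rewrite left_increment_self gexp0 mulg1.
apply: (J_unit (sdiff_increment hy) (sdiff_J hL)).
have hi : \forall z \near y, chart_img a z.
  by apply: open_nbhs_nbhs; split=> //; exact: chart_img_open.
have := left_increment_dom hy; apply: filterS2 hi => z hz1 hz2.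
by rewrite /left_increment glogK// mulVKg; have [] := chart_imgP hz1.
Qed.

(** The matrix of Ad(k^-1) on the tangent space at 1. *)
Definition conj_jac k : 'M[R]_n := 'J (fun u => glog (k^-1 * gexp G u * k)%g) 0.

Lemma sdiff_conj k :
  sdiff (fun u => glog (k^-1 * gexp G u * k)%g) 0 (fun v => v *m conj_jac k).
Proof.
have h : gdiff (fun u => k^-1 * gexp G u * k)%g 0.
  apply: gdiffM; last exact: gdiff_cst.
  apply: gdiffM; first exact: gdiff_cst.
  by apply: (gdiff_gexp (sdiff_id _)); exact: gdom0.
have [|L hL] := sdiff_glog h; first by rewrite gexp0 mulg1 mulVg; exact: dom1.
exact: sdiff_J hL.
Qed.

Definition translation_in_charts a b g k y : V :=
  chart b (g * chart_inv a y * k)%g.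

Lemma gdiff_translation a g k y : chart_img a y ->
  gdiff (fun z => g * chart_inv a z * k)%g y.
Proof.
move=> hy; apply: gdiffM; last exact: gdiff_cst.
by apply: gdiffM; [exact: gdiff_cst | exact: gdiff_chart_inv (sdiff_id y) hy].
Qed.

Lemma sdiff_translation a b g k y : chart_img a y ->
  chart_dom b (g * chart_inv a y * k)%g ->
  sdiff (translation_in_charts a b g k) y
    (fun v => v *m 'J (translation_in_charts a b g k) y).
Proof.
move=> hy hb; have [L hL] := gdiff_chart (gdiff_translation g k hy) hb.
exact: sdiff_J hL.
Qed.

(** (g y k)^-1 (g z k) = k^-1 (y^-1 z) k: the left factor disappears from increments and the right
    factor conjugates them. *)
Lemma translation_jac a b g k y : chart_img a y ->
  chart_dom b (g * chart_inv a y * k)%g ->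
  'J (translation_in_charts a b g k) y *m
    increment_jac b (translation_in_charts a b g k y) =
  increment_jac a y *m conj_jac k.
Proof.
move=> hy hb; set phi := translation_in_charts a b g k.
have hphi : chart_img b (phi y) by exact: chart_img_self.
have c0 := sdiff_conj k; rewrite -(left_increment_self a y) in c0.
apply: (J_square (sdiff_translation hy hb) (sdiff_increment hphi) (sdiff_increment hy) c0).
have hdom := left_increment_dom hy.
have hb' := chart_dom_near (gdiff_translation g k hy).1 hb.
apply: filterS2 hdom hb' => z h3 h4 /=.
rewrite /left_increment /phi /translation_in_charts glogK// !chartK//.
by rewrite !invgM !mulgA mulgVK.
Qed.

Context (gm : G -> 'M[R]_n).
Hypothesis hgm : is_riemannian_metric gm.
Hypothesis hinv : left_invariant_metric gm.

Lemma gram_increment a y : chart_img a y ->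
  gram_in_chart gm a y = increment_jac a y *m gm 1%g *m (increment_jac a y)^T.
Proof.
move=> hy; set x := chart_inv a y.
have hP : gdiff (chart_inv a) y by exact: gdiff_chart_inv (sdiff_id y) hy.
have [L hL] := gdiff_chart hP (chart_dom_self x).
have hv := left_chart erefl hP hL (sdiff_increment hy).
have JE : 'J (fun z => chart x (chart_inv a z)) y =
    increment_jac a y *m left_jacobian x.
  by apply: mulmx_rV_inj => v; rewrite (sdiff_jacobian v hL) hv mulmxA.
rewrite /gram_in_chart -/x JE -(left_jacobian_metric hinv x) trmx_mul.
by rewrite !mulmxA.
Qed.

Definition density a y : R := Num.sqrt (\det (gram_in_chart gm a y)).

Lemma densityE a y : chart_img a y ->
  density a y = `|\det (increment_jac a y)| * Num.sqrt (\det (gm 1%g)).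
Proof.
move=> hy; rewrite /density gram_increment// !det_mulmx det_tr mulrAC -expr2.
by rewrite sqrtrM ?sqr_ge0// sqrtr_sqr.
Qed.

Lemma density_translation a b g k y : chart_img a y ->
  chart_dom b (g * chart_inv a y * k)%g ->
  density b (translation_in_charts a b g k y) *
    `|\det ('J (translation_in_charts a b g k) y)| =
  `|\det (conj_jac k)| * density a y.
Proof.
move=> hy hb; rewrite !densityE//; last exact: chart_img_self.
have := translation_jac hy hb.
move: ('J _ _) (increment_jac b _) (increment_jac a _) (conj_jac k) => A B C D e.
have h : `|\det A| * `|\det B| = `|\det C| * `|\det D|.
  by rewrite -!normrM -!det_mulmx e.
rewrite mulrAC [_ * `|\det A|]mulrC h.
by move: `|\det C| `|\det D| (Num.sqrt _) => *; ring.
Qed.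

Lemma continuous_det (T : topologicalType) (F : T -> 'M[R]_n) (x : T) :
  (forall i j, {for x, continuous (fun t => F t i j)}) ->
  {for x, continuous (fun t => \det (F t))}.
Proof.
move=> h; rewrite /determinant.
apply: cvg_big => [|s _]; first exact: add_continuous.
apply: cvgM; first exact: cvg_cst.
by apply: cvg_big => [|i _]; [exact: mul_continuous | exact: h].
Qed.

Lemma density_continuous a y : chart_img a y -> {for y, continuous (density a)}.
Proof.
move=> hy; apply: (@continuous_comp _ _ _ (fun y => \det (gram_in_chart gm a y)) Num.sqrt).
  apply: continuous_det => i j.
  by have [+ _] := Defs.metric_smooth hgm a i j 0%N; apply.
exact: sqrt_continuous.
Qed.

Context (X : 'I_n -> V) (hX : is_orthonormal_basis gm X).

Lemma det_metric_gt0 : 0 < \det (gm 1%g).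
Proof.
pose A := \matrix_i X i.
have e : A *m gm 1%g *m A^T = 1%:M.
  apply/matrixP => i j; rewrite [RHS]mxE -(hX.2 i j).
  have -> : X i *m gm 1%g *m (X j)^T = row i (A *m gm 1%g) *m (row j A)^T.
    by rewrite row_mul !rowK.
  by rewrite !mxE; apply: eq_bigr => l _; rewrite !mxE.
have := congr1 determinant e; rewrite !det_mulmx det_tr det1 mulrAC -expr2 => h.
rewrite ltNge; apply/negP => h0.
have : \det A ^+ 2 * \det (gm 1%g) <= 0 by rewrite mulr_ge0_le0// sqr_ge0.
by rewrite h ler10.
Qed.

Lemma density_gt0 a y : chart_img a y -> 0 < density a y.
Proof.
move=> hy; rewrite densityE// mulr_gt0// ?sqrtr_gt0 ?det_metric_gt0//.
by rewrite normr_gt0 -unitfE -unitmxE increment_unit.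
Qed.

End LeftIncrements.

Section MeasureUniqueness.
Context (R : realType) (T : ptopologicalType).
Local Notation bmeasurable := (@measurable _ (borel T)).

Lemma measure_unique_cover (m1 m2 : {measure set (borel T) -> \bar R})
    (U : nat -> set T) : (forall k, bmeasurable (U k)) ->
  \bigcup_k U k = [set: T] ->
  (forall k A, bmeasurable A -> A `<=` U k -> m1 A = m2 A) ->
  forall A, bmeasurable A -> m1 A = m2 A.
Proof.
move=> mU cU h A mA; pose F k := A `&` seqDU U k.
have mF k : bmeasurable (F k).
  by apply: measurableI => //; exact: (@seqDU_measurable _ (borel T)).
have AF : A = \bigcup_k F k.
  by rewrite /F -setI_bigcupr -seqDU_bigcup_eq cU setIT.
have tF : trivIset [set: nat] F by exact/trivIset_setIl/trivIset_seqDU.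
have mUF : bmeasurable (\bigcup_k F k) by rewrite -AF.
rewrite AF !measure_semi_bigcup//; apply: eq_eseriesr => k _.
by apply: (h k) => // x -[_ hx]; exact: subset_seqDU hx.
Qed.

(** Local equality is enough: countably many basic open sets on which the measures agree cover the
    space, and their differences are disjoint. *)
Lemma second_countable_unique (m1 m2 : {measure set (borel T) -> \bar R}) :
  @second_countable T ->
  (forall x, exists2 U : set T, open U /\ U x &
     forall A, bmeasurable A -> A `<=` U -> m1 A = m2 A) ->
  forall A, bmeasurable A -> m1 A = m2 A.
Proof.
move=> [B cB [oB bB]] h.
pose P (U : set T) := open U /\ forall A, bmeasurable A -> A `<=` U -> m1 A = m2 A.
have [f hf] : exists f : nat -> set T, forall W, B W -> exists k, f k = W.
  have /pfcard_geP[->|[f]] := cB.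
    by exists (fun=> set0).
  exists f => W BW; have [k _ kW] := @surj _ _ _ _ f W BW.
  by exists k.
pose U k := if `[< P (f k) >] then f k else set0.
apply: (@measure_unique_cover _ _ U).
- move=> k; rewrite /U; case: asboolP => [[Uo _]|_]; first exact: borel_open.
  exact: measurable0.
- apply/seteqP; split=> // x _; have [N0 [oO Ox] hO] := h x.
  have [W [BW Wx] WO] : filter_from [set V | B V /\ V x] id N0.
    by apply: (bB x); exact: open_nbhs_nbhs.
  have [k fk] := hf W BW; exists k => //; rewrite /U fk; case: asboolP => // -[].
  by split; [exact: oB | move=> A mA AW; apply: hO => //; exact: subset_trans AW WO].
- move=> k A mA; rewrite /U; case: asboolP => [[_ hk] Ak|_ A0]; first exact: hk.
  have -> : A = set0 by apply/seteqP; split.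
  by rewrite !measure0.
Qed.

End MeasureUniqueness.

(** The arithmetic of [local_comparison]: rho and rho' are the densities at a point and at its
    image, D the Jacobian, p and q the Lebesgue volumes of a box and of its image. *)
Lemma comparison_arith (R : realType) (e de rho rho' D chi p q a b : R) :
  0 <= e -> 0 <= 1 - e -> 0 <= 1 + de -> 0 <= rho -> 0 <= rho' -> 0 <= chi -> 0 <= p ->
  (1 + e) * b <= (1 + de) * (1 - e) -> 1 + e <= (1 + de) * ((1 - e) * a) ->
  rho' * D = chi * rho -> q <= D * b * p -> D * a * p <= q ->
  (1 + e) * rho' * q <= (1 + de) * chi * ((1 - e) * rho * p) /\
  chi * ((1 + e) * rho * p) <= (1 + de) * ((1 - e) * rho' * q).
Proof.
move=> e0 e1 de1 r0 r'0 c0 p0 h1 h2 dE b1 b2; split.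
  have e1' : 0 <= (1 + e) * rho' by rewrite mulr_ge0// addr_ge0.
  apply: (le_trans (ler_wpM2l e1' b1)).
  have -> : (1 + e) * rho' * (D * b * p) = (1 + e) * b * (rho' * D * p) by ring.
  have -> : (1 + de) * chi * ((1 - e) * rho * p) = (1 + de) * (1 - e) * (chi * rho * p) by ring.
  by rewrite dE ler_wpM2r// !mulr_ge0.
apply: (@le_trans _ _ ((1 + de) * ((1 - e) * a) * (chi * rho * p))).
  have -> : chi * ((1 + e) * rho * p) = (1 + e) * (chi * rho * p) by ring.
  by rewrite ler_wpM2r// !mulr_ge0.
rewrite -dE.
have -> : (1 + de) * ((1 - e) * a) * (rho' * D * p) =
  (1 + de) * ((1 - e) * rho' * (D * a * p)) by ring.
by rewrite ler_wpM2l// ler_wpM2l// mulr_ge0.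
Qed.

Section HaarMeasure.
Context (R : realType) (n : nat) (G : lieGroupType R n).
Local Notation V := 'rV[R]_n.
Local Notation bmeasurable := (@measurable _ (borel G)).
Local Notation vmeasurable := (@measurable _ (borel V)).
Implicit Types (a b g k x : G) (y z c w : V).

Definition chart_piece a (B : set V) : set G := chart_dom a `&` chart a @^-1` B.

Lemma chart_piece_measurable a B : vmeasurable B -> bmeasurable (chart_piece a B).
Proof.
move=> mB; apply: (borel_preimage (T' := 'rV[R]_n)) mB; first exact: chart_dom_open.
by move=> x; exact: chart_continuous.
Qed.

Lemma chart_piece_image a B : B `<=` chart_img a -> chart a @` chart_piece a B = B.
Proof.
move=> Bi; apply/seteqP; split=> [_ [x [_ h] <-] //|y By].
by have [x hx e] := Bi y By; exists x => //; split=> //=; rewrite e.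
Qed.

Lemma chart_image_measurable a (A : set G) : bmeasurable A -> A `<=` chart_dom a ->
  vmeasurable (chart a @` A).
Proof.
move=> mA Ad.
have -> : chart a @` A = chart_img a `&` chart_inv a @^-1` A.
  rewrite -chart_image_setI; congr (_ @` _); apply/seteqP.
  by split=> [x Ax|x []]; [split=> //; exact: Ad|].
apply: (borel_preimage (T' := G)) mA; first exact: chart_img_open.
by move=> y; exact: chart_inv_continuous.
Qed.

Lemma chart_pieceK a (A : set G) : A `<=` chart_dom a ->
  chart_piece a (chart a @` A) = A.
Proof.
move=> Ad; apply/seteqP; split=> [x [xd [x' Ax' e]]|x Ax].
  have e1 : chart_inv a (chart a x) = x by rewrite chartK.
  by rewrite -e1 -e chartK//; exact: Ad.
by split; [exact: Ad | exists x].
Qed.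

Lemma chart_measure a (m : {measure set (borel G) -> \bar R}) (D : set V) :
  vmeasurable D -> exists m' : {measure set (borel V) -> \bar R},
  forall B, m' B = m (chart_piece a (B `&` D)).
Proof.
move=> mD; have mP := chart_piece_measurable a mD.
(* The value 0 off the piece is arbitrary; it is discarded because the measure is restricted to the
   piece before it is pushed forward. *)
pose h (x : G) : V := if x \in chart_piece a D then chart a x else 0.
have mh : measurable_fun [set: borel G] (h : borel G -> borel V).
  move=> _ B mB; rewrite setTI.
  have -> : h @^-1` B = chart_piece a (B `&` D) `|`
      (~` chart_piece a D `&` [set _ | B 0]).
    apply/seteqP; split=> x; rewrite /h/=; case: ifPn => [/set_mem xP|/negP xD] Bx.
    - by left; case: xP.
    - by right; split=> // /mem_set.
    - by case: Bx => [[_ [Bc _]] //|[nP _]]; exfalso; apply: nP.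
    - by case: Bx => [[xd [_ Dx]]|[_ B0] //]; exfalso; apply: xD; exact: mem_set.
  apply: measurableU; first by apply: chart_piece_measurable; exact: measurableI.
  apply: measurableI; first exact: measurableC.
  have [B0|B0] := pselect (B 0).
    by have -> : [set _ : G | B 0] = setT by apply/seteqP; split.
  by have -> : [set _ : G | B 0] = set0 by apply/seteqP; split.
have [m' hm'] := pushforward_exists (mrestr m mP : {measure set _ -> \bar R}) mh.
exists m' => B; rewrite hm' /= /mrestr; congr (m _).
apply/seteqP; split=> x.
  by rewrite /h/= => -[+ xP]; rewrite (mem_set xP) => Bx; case: xP => xd Dx.
by move=> [xd [Bx Dx]]; have xP : chart_piece a D x by []; split=> //=; rewrite /h (mem_set xP).
Qed.

Context (gm : G -> 'M[R]_n).
Hypothesis hgm : is_riemannian_metric gm.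
Hypothesis hinv : left_invariant_metric gm.
Context (X : 'I_n -> V) (hX : is_orthonormal_basis gm X).
Context (lam : {measure set (borel V) -> \bar R}) (hlam : is_lebesgue lam).
Context (mu : {measure set (borel G) -> \bar R}).
Hypothesis hmu : forall a (A : set (borel G)), measurable A -> A `<=` chart_dom a ->
  mu A = (\int[lam]_(y in chart a @` A) (density gm a y)%:E)%E.

Lemma density_bounds a y e : chart_img a y -> 0 < e ->
  exists2 d : R, 0 < d & forall B, vmeasurable B -> (forall z, B z -> `|z - y| < d) ->
  [/\ B `<=` chart_img a,
     (((1 - e) * density gm a y)%:E * lam B <= mu (chart_piece a B))%E &
     (mu (chart_piece a B) <= ((1 + e) * density gm a y)%:E * lam B)%E].
Proof.
move=> hy e0; have r0 := density_gt0 hinv hX hy.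
have /(@continuous_distP R V R^o)/(_ _ (mulr_gt0 e0 r0))[d1 d10 hd1] :=
  density_continuous hgm hy.
have [d2 d20 hd2] := (near_distP _ _).1 (open_nbhs_nbhs (conj (chart_img_open a) hy)).
exists (Num.min d1 d2) => [|B mB hB]; first by rewrite lt_min d10.
have Bi : B `<=` chart_img a.
  by move=> z /hB; rewrite lt_min => /andP[_]; exact: hd2.
have mP := chart_piece_measurable a mB.
have bd z : B z -> (1 - e) * density gm a y <= density gm a z <= (1 + e) * density gm a y.
  move=> /hB; rewrite lt_min => /andP[/hd1/ltW + _]; rewrite ler_distl.
  by rewrite !mulrDl mulNr !mul1r.
have mf : measurable_fun (B : set (borel V)) (density gm a : borel V -> R).
  apply: (measurable_funS _ Bi).
    by apply: borel_open; exact: chart_img_open.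
  by apply: borel_continuous_on_real; [exact: chart_img_open|move=> z; exact: density_continuous].
have d_ge0 z : (0 <= (density gm a z)%:E)%E by rewrite lee_fin sqrtr_ge0.
have muE : mu (chart_piece a B) = (\int[lam]_(z in B) (density gm a z)%:E)%E.
  by rewrite (hmu (a := a))// ?chart_piece_image// => x [].
have mfE := (@measurable_realfun.measurable_EFinP _ (borel V) R B (density gm a)).2 mf.
have ic (r : R) : (\int[lam]_(z in B) r%:E)%E = (r%:E * lam B)%E.
  exact: (integral_cst lam mB r%:E).
split=> [//||]; rewrite muE -ic; last first.
  apply: ge0_le_integral => [|z _|||z /bd /andP[_ h]].
  - exact: mB.
  - exact: d_ge0.
  - exact: mfE.
  - exact: measurable_cst.
  - by rewrite lee_fin.
(* For e > 1 the lower bound is nonpositive and holds by positivity. *)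
have [e1|e1] := leP 0 ((1 - e) * density gm a y).
  apply: ge0_le_integral => [|z _|||z /bd /andP[h _]].
  - exact: mB.
  - by rewrite lee_fin.
  - exact: measurable_cst.
  - exact: mfE.
  - by rewrite lee_fin.
have i0 : (0 <= \int[lam]_(z in B) (density gm a z)%:E)%E.
  by apply: integral_ge0 => z _; exact: d_ge0.
apply: (le_trans _ i0); rewrite ic; apply: mule_le0_ge0; last exact: measure_ge0.
by rewrite lee_fin ltW.
Qed.

Lemma small_error (de : R) : 0 < de -> exists e : R,
  [/\ 0 < e, 2 * e <= 1 & 1 + e <= (1 + de) * ((1 - e) * (1 - 2 * e) ^+ n)].
Proof.
move=> de0; pose N : R := 2 * n%:R + 2.
have N2 : 2 <= N by rewrite /N lerDr mulr_ge0.
have q0 : 0 < (1 + de) * N by rewrite mulr_gt0//; lra.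
pose e := Num.min 2^-1 (de / ((1 + de) * N)).
have e0 : 0 < e by rewrite lt_min invr_gt0 ltr0n divr_gt0.
have e2 : 2 * e <= 1 by rewrite -ler_pdivlMl// mulr1 ge_min lexx.
have ed : e * ((1 + de) * N) <= de by rewrite -ler_pdivlMr// ge_min lexx orbT.
exists e; split=> //.
have b := @bernoulli_ineq R (2 * e) n.
have {}b : 1 - n%:R * (2 * e) <= (1 - 2 * e) ^+ n by apply: b; rewrite e2 mulr_ge0// ltW.
have h1 : (1 - e) * (1 - n%:R * (2 * e)) <= (1 - e) * (1 - 2 * e) ^+ n.
  by rewrite ler_wpM2l//; lra.
have d1 : 0 <= 1 + de by lra.
apply: le_trans (ler_wpM2l d1 h1).
have h2 : 0 <= (1 + de) * (n%:R * (2 * (e * e))).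
  by rewrite !mulr_ge0// ltW.
have h3 : 0 <= de * e by rewrite mulr_ge0// ltW.
move: ed h2 h3; rewrite /N; clearbody e; move: (n%:R : R) => v *; lra.
Qed.

Variables g k : G.
Let Th x : G := (g * x * k)%g.
Let Thi x : G := (g^-1 * x * k^-1)%g.
Local Notation chi := (`|\det (conj_jac k)|).

Let ThK x : Thi (Th x) = x.
Proof. by rewrite /Thi /Th !mulgA mulVg mul1g mulgK. Qed.

Let ThiK x : Th (Thi x) = x.
Proof. by rewrite /Thi /Th !mulgA mulgV mul1g mulgVK. Qed.

Lemma translation_continuous (g1 k1 : G) : continuous (fun x => g1 * x * k1)%g.
Proof.
move=> x.
have h1 : {for x, continuous (fun x => g1 * x)%g}.
  apply: (@continuous_comp _ _ _ (fun x => (g1, x)) (fun z : G * G => (z.1 * z.2)%g)).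
    by apply: cvg_pair; [exact: cvg_cst | exact: cvg_id].
  exact: lie_mul_continuous.
apply: (@continuous_comp _ _ _ (fun x => (g1 * x, k1))%g (fun z : G * G => (z.1 * z.2)%g)).
  by apply: cvg_pair; [exact: h1 | exact: cvg_cst].
exact: lie_mul_continuous.
Qed.

Let Thi_measurable : measurable_fun [set: borel G] (Thi : borel G -> borel G).
Proof. by apply: borel_continuous; exact: translation_continuous. Qed.

(** The transformation rule up to a factor 1 + de, on small boxes around one point. It combines the
    volume estimates for images of boxes, the continuity of the two densities and
    [density_translation]. *)
Lemma local_comparison a y w de : chart_img a y -> (forall i, 0 < w 0 i) -> 0 < de ->
  exists2 d : R, 0 < d & forall c j,
    rect c (c + 2^-1 ^+ j *: w) y -> 2^-1 ^+ j * `|w| < d ->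
    let Q := chart_piece a (box c (c + 2^-1 ^+ j *: w)) in
    (mu (Thi @^-1` Q) <= ((1 + de) * chi)%:E * mu Q)%E /\
    (chi%:E * mu Q <= (1 + de)%:E * mu (Thi @^-1` Q))%E.
Proof.
move=> hy w0 de0; have [e [e0 e2 he]] := small_error de0.
have [ya yE] := chart_imgP hy.
pose b := Th (chart_inv a y); pose phi := translation_in_charts a b g k.
have hb : chart_dom b (g * chart_inv a y * k)%g by exact: chart_dom_self.
have hphi := sdiff_translation hy hb; rewrite -/phi in hphi.
have py : chart_img b (phi y) by exact: chart_img_self.
have pyE : chart_inv b (phi y) = b by rewrite /phi /translation_in_charts chartK.
pose psi := translation_in_charts b a (g^-1)%g (k^-1)%g.
have ha : chart_dom a (g^-1 * chart_inv b (phi y) * k^-1)%g.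
  by rewrite pyE -/(Thi _) ThK.
have hpsi := sdiff_translation py ha; rewrite -/psi in hpsi.
have psiy : psi (phi y) = y.
  by rewrite /psi /translation_in_charts pyE -/(Thi _) ThK.
have near_psi : \forall z \near y, psi (phi z) = z.
  have h1 : \forall z \near y, chart_img a z.
    by apply: open_nbhs_nbhs; split=> //; exact: chart_img_open.
  have := chart_dom_near (gdiff_translation g k hy).1 hb; apply: filterS2 h1 => z h1 h2.
  rewrite /psi /phi /translation_in_charts chartK// -/(Th _) -/(Thi _) ThK.
  by have [] := chart_imgP h1.
have near_phi : \forall z \near phi y, phi (psi z) = z.
  have h1 : \forall z \near phi y, chart_img b z.
    by apply: open_nbhs_nbhs; split=> //; exact: chart_img_open.
  have := chart_dom_near (gdiff_translation (g^-1)%g (k^-1)%g py).1 ha; apply: filterS2 h1 => z h1 h2.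
  rewrite /psi /phi /translation_in_charts chartK// -/(Thi _) -/(Th _) ThiK.
  by have [] := chart_imgP h1.
have dE := density_translation hinv hy hb; rewrite -/phi in dE.
move: ('J phi y) ('J psi (phi y)) hphi hpsi dE => M M' hphi hpsi dE.
have MM : M *m M' = 1%:M by exact: J_inverse hphi hpsi near_psi.
have [uM _] := mulmx1_unit MM.
have M'E : M' = invmx M by rewrite -[M'](mulKmx uM) MM mulmx1.
rewrite M'E in hpsi.
have [d1 d10 hd1] := image_box_le hlam uM w0 hphi e0.
have [d2 d20 hd2] := le_image_box hlam uM w0 hpsi psiy near_phi e0 e2.
have [d3 d30 hd3] := density_bounds hy e0.
have [d4 d40 hd4] := density_bounds py e0.
have phic := sdiff_continuous hphi.
have [d5 d50 hd5] := (continuous_distP _ _).1 phic d4 d40.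
have [d6 d60 hd6] := (near_distP _ _).1 (chart_dom_near (gdiff_translation g k hy).1 hb).
exists (Num.min (Num.min d1 d2) (Num.min d3 (Num.min d5 d6))).
  by rewrite !lt_min d10 d20 d30 d50 d60.
move=> c j hc; rewrite !lt_min => /andP[/andP[t1 t2] /andP[t3 /andP[t5 t6]]] Q.
pose W := box c (c + 2^-1 ^+ j *: w); have mW : vmeasurable W by exact: box_measurable.
have Wy z : W z -> `|z - y| <= 2^-1 ^+ j * `|w|.
  move=> hz; have -> : 2^-1 ^+ j * `|w| = `|2^-1 ^+ j *: w|.
    by rewrite normrZ ger0_norm ?exprn_ge0 ?invr_ge0.
  apply: (rect_dist (c := c)) => //.
    by move=> i; rewrite mxE mulr_ge0 ?exprn_ge0 ?invr_ge0// ltW.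
  by move=> i; have /andP[-> /ltW ->] := hz i.
have [Wa lo up] := hd3 W mW (fun z hz => le_lt_trans (Wy z hz) t3).
pose E := Thi @^-1` Q.
have mQ : bmeasurable Q by exact: chart_piece_measurable.
have mE : bmeasurable E by rewrite -[E]setTI; exact: Thi_measurable.
have Eb : E `<=` chart_dom b.
  move=> x [xa xW]; have := hd6 _ (le_lt_trans (Wy _ xW) t6).
  by rewrite chartK// -/(Th _) ThiK.
pose B := chart b @` E.
have mB : vmeasurable B by exact: chart_image_measurable.
have BE : B = phi @` W.
  apply/seteqP; split=> [_ [x [xa xW] <-]|_ [z Wz <-]].
    exists (chart a (Thi x)) => //.
    by rewrite /phi /translation_in_charts chartK// -/(Th _) ThiK.
  exists (Th (chart_inv a z)) => //; rewrite /E/= ThK.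
  by have [h1 h2] := chart_imgP (Wa z Wz); split=> //=; rewrite h2.
have [_ lo' up'] : [/\ B `<=` chart_img b,
    (((1 - e) * density gm b (phi y))%:E * lam B <= mu (chart_piece b B))%E &
    (mu (chart_piece b B) <= ((1 + e) * density gm b (phi y))%:E * lam B)%E].
  apply: hd4 => // z; rewrite BE => -[z' Wz' <-].
  by apply: hd5; exact: le_lt_trans (Wy z' Wz') t5.
have EE : chart_piece b B = E by exact: chart_pieceK.
rewrite EE in lo' up'.
have b1 := hd1 c j hc t1 B mB _; have b2 := hd2 c j hc t2 B mB _.
rewrite -/W BE in b1 b2; have {}b1 := b1 (@subset_refl _ _); have {}b2 := b2 (@subset_refl _ _).
rewrite -BE in b1 b2.
have [p p0 pE] : exists2 p : R, 0 <= p & lam W = p%:E.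
  exists (fine (lam W)); first exact/fine_ge0/measure_ge0.
  by rewrite fineK// ge0_fin_numE ?measure_ge0// leb_box_fin.
rewrite pE -EFinM in b1 b2 lo up.
have [q q0 qE] : exists2 q : R, 0 <= q & lam B = q%:E.
  exists (fine (lam B)); first exact/fine_ge0/measure_ge0.
  by rewrite fineK// ge0_fin_numE ?measure_ge0// (le_lt_trans b1)// ltry.
rewrite qE -?EFinM ?lee_fin in b1 b2 lo' up'.
set rho := density gm a y in lo up dE; set rho' := density gm b (phi y) in lo' up' dE.
have rho0 : 0 <= rho by exact: sqrtr_ge0.
have rho'0 : 0 <= rho' by exact: sqrtr_ge0.
have chi0 : 0 <= chi by [].
have e1 : 0 <= 1 - 2 * e by rewrite subr_ge0.
have e1' : 0 <= 1 - e.
  by rewrite subr_ge0 (le_trans _ e2)// ler_peMl ?ler1n// ltW.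
have de1 : 0 <= 1 + de by rewrite addr_ge0// ltW.
have pn0 : 0 <= (1 - 2 * e) ^+ n by exact: exprn_ge0.
have bn0 : 0 <= (1 + 2 * e) ^+ n by rewrite exprn_ge0// addr_ge0// mulr_ge0// ltW.
have h1 : (1 + e) * (1 + 2 * e) ^+ n <= (1 + de) * (1 - e).
  apply: (@le_trans _ _ ((1 + de) * ((1 - e) * (1 - 2 * e) ^+ n) * (1 + 2 * e) ^+ n)).
    by rewrite ler_wpM2r.
  rewrite -!mulrA ler_wpM2l// ler_piMr// -exprMn exprn_ile1//.
    by rewrite mulr_ge0// addr_ge0// mulr_ge0// ltW.
  have -> : (1 - 2 * e) * (1 + 2 * e) = 1 - (2 * e) ^+ 2 by ring.
  by rewrite gerBl sqr_ge0.
have [k1 k2] := comparison_arith (ltW e0) e1' de1 rho0 rho'0 chi0 p0 h1 he dE b1 b2.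
split.
  apply: (le_trans up').
  apply: (@le_trans _ _ (((1 + de) * chi)%:E * ((1 - e) * rho * p)%:E)%E); last first.
    by apply: lee_wpmul2l => //; rewrite lee_fin mulr_ge0.
  by rewrite -EFinM lee_fin.
apply: (@le_trans _ _ (chi%:E * ((1 + e) * rho * p)%:E)%E).
  by apply: lee_wpmul2l => //; rewrite lee_fin.
apply: (@le_trans _ _ ((1 + de)%:E * ((1 - e) * rho' * q)%:E)%E); last first.
  by apply: lee_wpmul2l => //; rewrite lee_fin.
by rewrite -!EFinM lee_fin.
Qed.

(** On boxes inside a small cube [B0], [box_compare] extends the local inequalities with factor 1 +
    de to the whole box. Letting de tend to 0 gives equality on these boxes, and boxes determine the
    measure. *)
Lemma local_haar x : exists2 U : set G, open U /\ U x &
  forall A, bmeasurable A -> A `<=` U -> mu (Thi @^-1` A) = (chi%:E * mu A)%E.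
Proof.
pose y := chart x x; have hy : chart_img x y by apply: chart_img_self; exact: chart_dom_self.
have [d d0 hd] := density_bounds hy ltr01.
have d2 : 0 < d / 2 by rewrite divr_gt0.
have dd : d / 2 < d by rewrite ltr_pdivrMr// ltr_pMr// ltr1n.
pose a0 : V := y - const_mx (d / 2); pose b0 : V := y + const_mx (d / 2).
have rect_d z : rect a0 b0 z -> `|z - y| < d.
  move=> hz; apply: le_lt_trans dd; apply: norm_rV_le; first exact: ltW.
  by move=> i; have := hz i; rewrite !mxE ler_distl.
pose B0 := box a0 b0; pose D := chart_piece x B0.
have mB0 : vmeasurable B0 by exact: box_measurable.
have mD : bmeasurable D by exact: chart_piece_measurable.
have rect_img : rect a0 b0 `<=` chart_img x.
  by have [] := hd _ (rect_measurable a0 b0) rect_d.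
have [nu nuE] := pushforward_exists mu Thi_measurable.
have [m1 m1E] := chart_measure x nu mB0; have [m2 m2E] := chart_measure x mu mB0.
have B0d z : B0 z -> `|z - y| < d.
  by move=> hz; apply: rect_d => i; have /andP[-> /ltW ->] := hz i.
have Doo : (mu D < +oo)%E.
  have [_ _ h] := hd _ mB0 B0d; apply: (le_lt_trans h).
  rewrite -(fineK (_ : lam B0 \is a fin_num)) ?ltry//.
  by rewrite ge0_fin_numE ?measure_ge0// leb_box_fin.
have m2fin c e : (m2 (box c e) < +oo)%E.
  rewrite m2E; apply: le_lt_trans Doo; apply: le_measure; rewrite ?inE//.
    by apply: chart_piece_measurable; apply: measurableI => //; exact: box_measurable.
  by move=> z [zd [_ hz]].
have m1Q c e : rect c e `<=` rect a0 b0 -> (forall i, c 0 i <= e 0 i) ->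
    box c e `&` B0 = box c e.
  move=> ce_ab ce; apply/seteqP; split=> [z []//|z hz]; split=> // i.
  have h1 : rect c e c by move=> j; rewrite lexx ce.
  have h2 : rect c e e by move=> j; rewrite lexx ce.
  have /andP[h3 _] := ce_ab _ h1 i; have /andP[_ h4] := ce_ab _ h2 i.
  by have /andP[h5 h6] := hz i; rewrite (le_trans h3 h5)/= (lt_le_trans h6 h4).
have cmp c e de : rect c e `<=` rect a0 b0 -> (forall i, c 0 i < e 0 i) -> 0 < de ->
    (m1 (box c e) <= ((1 + de) * chi)%:E * m2 (box c e))%E /\
    (chi%:E * m2 (box c e) <= (1 + de)%:E * m1 (box c e))%E.
  move=> ce_ab ce de0; have ce' i : c 0 i <= e 0 i by exact: ltW.
  have w0 i : 0 < (e - c) 0 i by rewrite !mxE subr_gt0.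
  have s0 : 0 <= (1 + de) * chi by rewrite mulr_ge0// addr_ge0// ltW.
  have s1 : 0 <= 1 + de by rewrite addr_ge0// ltW.
  have s2 : 0 <= chi by [].
  have lc z : rect c e z -> exists2 d' : R, 0 < d' & forall c' j,
      rect c' (c' + 2^-1 ^+ j *: (e - c)) z ->
      rect c' (c' + 2^-1 ^+ j *: (e - c)) `<=` rect c e ->
      2^-1 ^+ j * `|e - c| < d' ->
      let Q := box c' (c' + 2^-1 ^+ j *: (e - c)) in
      (m1 Q <= ((1 + de) * chi)%:E * m2 Q)%E /\ (chi%:E * m2 Q <= (1 + de)%:E * m1 Q)%E.
    move=> hz; have zi : chart_img x z by exact/rect_img/ce_ab.
    have [d' d'0 hd'] := local_comparison zi w0 de0; exists d' => // c' j h1 h2 h3 /=.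
    rewrite m1E m2E nuE m1Q ?h2//; first exact: hd'.
      by move=> u /h2/ce_ab.
    by move=> i; rewrite !mxE lerDl mulr_ge0 ?exprn_ge0 ?invr_ge0// subr_ge0 ce'.
  split.
    apply: (@box_compare R n m1 (mscale (NngNum s0) m2) c e ce') => z /lc[d' d'0 h].
    by exists d' => // c' j h1 h2 h3; have [] := h c' j h1 h2 h3.
  apply: (@box_compare R n (mscale (NngNum s2) m2) (mscale (NngNum s1) m1) c e ce') => z /lc[d' d'0 h].
  by exists d' => // c' j h1 h2 h3; have [] := h c' j h1 h2 h3.
have eqb c e : rect c e `<=` rect a0 b0 -> (forall i, c 0 i < e 0 i) ->
    m1 (box c e) = (chi%:E * m2 (box c e))%E.
  move=> ce_ab ce.
  have [q q0 qE] : exists2 q : R, 0 <= q & m2 (box c e) = q%:E.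
    exists (fine (m2 (box c e))); first exact/fine_ge0/measure_ge0.
    by rewrite fineK// ge0_fin_numE ?measure_ge0.
  have [h1 _] := cmp c e 1 ce_ab ce ltr01.
  have [p p0 pE] : exists2 p : R, 0 <= p & m1 (box c e) = p%:E.
    exists (fine (m1 (box c e))); first exact/fine_ge0/measure_ge0.
    by rewrite fineK// ge0_fin_numE ?measure_ge0// (le_lt_trans h1)// qE ltry.
  have {}cmp de : 0 < de -> p <= (1 + de) * chi * q /\ chi * q <= (1 + de) * p.
    by move=> /(cmp c e _ ce_ab ce); rewrite pE qE -!EFinM !lee_fin.
  rewrite pE qE -EFinM; congr EFin; apply/eqP; rewrite eq_le.
  apply/andP; split; apply: le_addgt0P => t t0.
    have s0 : 0 < chi * q + 1 by rewrite ltr_wpDl// mulr_ge0.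
    have [h _] := cmp _ (divr_gt0 t0 s0); apply: (le_trans h).
    rewrite -mulrA mulrDl mul1r lerD2l mulrAC ler_pdivrMr// ler_wpM2l ?(ltW t0)//.
    by rewrite lerDl.
  have s0 : 0 < p + 1 by rewrite ltr_wpDl.
  have [_ h] := cmp _ (divr_gt0 t0 s0); apply: (le_trans h).
  rewrite mulrDl mul1r lerD2l mulrAC ler_pdivrMr// ler_wpM2l ?(ltW t0)//.
  by rewrite lerDl.
have chi0 : 0 <= chi by [].
(* Both measures live on [B0], so a box may first be intersected with it; the result is empty or has
   positive sides and satisfies [eqb]. *)
have m12 B : vmeasurable B -> m1 B = mscale (NngNum chi0) m2 B.
  move=> mB; apply: box_measure_unique mB => c e; last first.
    rewrite m1E nuE; have : (m1 B0 < +oo)%E.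
      rewrite (eqb a0 b0)//; last by move=> i; rewrite !mxE; move: d2; lra.
      by rewrite lte_mul_pinfty// m2fin.
    apply: le_lt_trans; rewrite m1E setIid nuE; apply: le_measure; rewrite ?inE.
    - rewrite -[X in measurable X]setTI; apply: Thi_measurable => //.
      by apply: chart_piece_measurable; apply: measurableI => //; exact: box_measurable.
    - by rewrite -[X in measurable X]setTI; exact: Thi_measurable.
    - by move=> z [zd [_ hz]].
  have e1 : box c e `&` B0 = box (\row_i Num.max (c 0 i) (a0 0 i)) (\row_i Num.min (e 0 i) (b0 0 i)).
    exact: boxI.
  set c' := \row_i _ in e1; set e' := \row_i _ in e1.
  have m1' : m1 (box c e) = m1 (box c' e') by rewrite !m1E -e1 -setIA setIid.
  have m2' : m2 (box c e) = m2 (box c' e') by rewrite !m2E -e1 -setIA setIid.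
  transitivity (chi%:E * m2 (box c e))%E; last by [].
  rewrite m1' m2'.
  have [ce|/existsNP[i /negP]] := pselect (forall i, c' 0 i < e' 0 i).
    apply: eqb => // z hz i; have := hz i; rewrite [c' 0 i]mxE [e' 0 i]mxE.
    by rewrite ge_max le_min => /andP[/andP[_ ->] /andP[_ ->]].
  by rewrite -leNgt => h; rewrite (box_empty h) !measure0 mule0.
exists (chart_piece x [set z | `|z - y| < d / 2]).
  split; last by split; [exact: chart_dom_self | rewrite /= subrr normr0].
  rewrite openE => z [zd zb]; apply: filterI.
    by apply: open_nbhs_nbhs; split=> //; exact: chart_dom_open.
  have cz : {for z, continuous (chart x)} by exact: chart_continuous.
  suff : \forall u \near chart x z, `|u - y| < d / 2 by exact: cz.
  apply/near_distP.
  exists (d / 2 - `|chart x z - y|); first by rewrite subr_gt0.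
  move=> u; rewrite ltrBrDr => /(le_lt_trans _); apply.
  by rewrite -[u - y](subrKA (chart x z)) ler_normD.
move=> A mA AU.
have Ad : A `<=` chart_dom x by move=> z /AU[].
have AB : chart x @` A `<=` B0.
  move=> _ [z /AU[_ hz] <-] i; have := le_lt_trans (norm_coord _ i) hz.
  by rewrite !mxE ltr_distl => /andP[/ltW -> ->].
have := m12 _ (chart_image_measurable mA Ad).
rewrite m1E nuE setIidl// chart_pieceK// => ->.
transitivity (chi%:E * m2 [set chart x x0 | x0 in A])%E; first by [].
by rewrite m2E setIidl// chart_pieceK.
Qed.

End HaarMeasure.

(** The factor is |det Ad(k)|, the modular function; k = 1 gives the left invariance of the
    Riemannian measure. *)
Theorem haar_translation (R : realType) (n : nat) (G : lieGroupType R n)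
    (gm : G -> 'M[R]_n) (hgm : is_riemannian_metric gm)
    (hinv : left_invariant_metric gm) (X : 'I_n -> 'rV[R]_n)
    (hX : is_orthonormal_basis gm X)
    (mu : {measure set (borel G) -> \bar R}) (hmu : is_riemannian_measure gm mu)
    (g k : G) (A : set G) : @measurable _ (borel G) A ->
  mu [set x | A (g * x * k)%g] = (`|\det (conj_jac k^-1%g)|%:E * mu A)%E.
Proof.
move=> mA; have [lam hlam hmu'] := hmu.
have mT : measurable_fun [set: borel G] ((fun x => g * x * k)%g : borel G -> borel G).
  by apply: borel_continuous; exact: translation_continuous.
have [nu nuE] := pushforward_exists mu mT.
have chi0 : 0 <= `|\det (conj_jac k^-1%g)| by [].
transitivity (nu A); first by rewrite nuE.
transitivity (mscale (NngNum chi0) mu A); last by [].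
apply: (second_countable_unique _ _ mA); first exact: (@lie_second_countable R n G).
move=> x; have [U UO hU] := local_haar hgm hinv hX hlam hmu' g^-1%g k^-1%g x.
exists U => // B mB BU; rewrite nuE -[RHS]/(_ * _)%E -hU//.
by rewrite !invgK.
Qed.

(** * Symmetry of second derivatives; determinants near the identity *)

Section SecondDerivatives.
Context (R : realType) (V W : normedModType R).

Lemma second_difference (f : V -> W) (U : set V) p u v L : open U -> U p ->
  (forall x, U x -> derivable f x v) -> sdiff (fun x => 'D_v f x) p L ->
  forall e, 0 < e -> exists2 d : R, 0 < d & forall h : R, 0 < h -> h < d ->
  `|f (p + h *: u + h *: v) - f (p + h *: u) - (f (p + h *: v) - f p) - h ^+ 2 *: L u|
    <= e * h ^+ 2.
Proof.
move=> oU Up df [bL hL] e e0.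
have U1 : 0 < `|u| + `|v| + 1 by rewrite ltr_wpDl// addr_ge0.
have u1 : 0 < `|u| + 1 by rewrite ltr_wpDl.
have [d1 d10 hd1] := hL _ (divr_gt0 e0 u1).
have [d2 d20 hd2] := (near_distP _ _).1 (open_nbhs_nbhs (conj oU Up)).
exists (Num.min d1 d2 / (`|u| + `|v| + 1)); first by rewrite divr_gt0// lt_min d10.
move=> h h0; rewrite ltr_pdivlMr// => hm.
have small s t : 0 <= s <= h -> 0 <= t <= h -> `|p + s *: u + t *: v - p| < Num.min d1 d2.
  move=> /andP[s0 sh] /andP[t0 th].
  have -> : p + s *: u + t *: v - p = s *: u + t *: v.
    by rewrite addrAC [p + _]addrC addrK.
  rewrite (le_lt_trans (ler_normD _ _))//.
  apply: le_lt_trans hm; rewrite !normrZ !ger0_norm// !mulrDr mulr1 ler_wpDr ?(ltW h0)//.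
  by rewrite lerD// ler_wpM2r.
have small' s t : 0 <= s <= h -> 0 <= t <= h ->
    `|p + s *: u + t *: v - p| < d1 /\ U (p + s *: u + t *: v).
  move=> hs ht; have := small s t hs ht; rewrite lt_min => /andP[h1 h2].
  by split=> //; exact: hd2.
pose g (t : R) : W := f (p + h *: u + t *: v) - f (p + t *: v) - t *: (h *: L u).
have -> : f (p + h *: u + h *: v) - f (p + h *: u) - (f (p + h *: v) - f p) - h ^+ 2 *: L u
   = g h - g 0.
  rewrite /g !scale0r !addr0 subr0 scalerA -expr2 [RHS]addrAC; congr (_ - _).
  by rewrite !opprB addrACA [RHS]addrACA [- f (p + h *: u) - _]addrC.
have hh : 0 <= h <= h by rewrite lexx ltW.
have h00 : 0 <= (0 : R) <= h by rewrite lexx ltW.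
have -> : e * h ^+ 2 = e * h * (h - 0) by rewrite subr0 expr2 mulrA.
apply: (le_norm_derive (ltW h0)) => t th.
have [a1 b1] := small' h t hh th; have [a2 b2] := small' 0 t h00 th.
rewrite scale0r addr0 in a2 b2.
have D1 := derive_line (df _ b1); have D2 := derive_line (df _ b2).
have D3 : is_derive t (1 : R) (fun t : R => t *: (h *: L u)) (h *: L u).
  have bl (w : W) : @bounded_linear R R^o W (fun t => t *: w).
    split; first by move=> a x y; rewrite scalerDl scalerA.
    exists (`|w| + 1) => [|x]; first by rewrite ltr_wpDl.
    by rewrite normrZ mulrC ler_wpM2r// lerDl.
  by have := sdiff_derive (1 : R^o) (sdiff_linear (t : R^o) (bl (h *: L u))); rewrite scale1r.
have [k1 k2] : is_derive t (1 : R) g ('D_v f (p + h *: u + t *: v) - 'D_v f (p + t *: v) - h *: L u).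
  exact: (is_deriveB (is_deriveB D1 D2) D3).
split=> //; rewrite k2.
have := hd1 _ _ a1 a2.
have -> : p + h *: u + t *: v - (p + t *: v) = h *: u.
  by rewrite opprD addrACA subrr addr0 addrAC subrr add0r.
rewrite (blZ _ _ bL) => /le_trans; apply; rewrite normrZ gtr0_norm// mulrCA mulrC.
by rewrite ler_wpM2r ?(ltW h0)// mulrAC ler_pdivrMr// ler_wpM2l ?(ltW e0)// lerDl.
Qed.

(** The second difference with steps h u and h v is symmetric in u and v, and is close to both h^2 L
    u and h^2 M v. *)
Lemma schwarz (f : V -> W) (U : set V) p u v L M : open U -> U p ->
  (forall x, U x -> derivable f x u) -> (forall x, U x -> derivable f x v) ->
  sdiff (fun x => 'D_v f x) p L -> sdiff (fun x => 'D_u f x) p M -> L u = M v.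
Proof.
move=> oU Up du dv hL hM; apply/eqP; rewrite -subr_eq0 -normr_le0.
apply: le_addgt0P => e e0; rewrite add0r.
have e2 : 0 < e / 2 by rewrite divr_gt0.
have [d1 d10 h1] := second_difference u oU Up dv hL e2.
have [d2 d20 h2] := second_difference v oU Up du hM e2.
pose h := Num.min d1 d2 / 2.
have m0 : 0 < Num.min d1 d2 by rewrite lt_min d10.
have h0 : 0 < h by rewrite divr_gt0.
have : h < Num.min d1 d2 by rewrite /h ltr_pdivrMr// ltr_pMr// ltr1n.
rewrite lt_min => /andP[hh1 hh2].
have k1 := h1 h h0 hh1; have k2 := h2 h h0 hh2.
have hp : 0 < h ^+ 2 by rewrite exprn_gt0.
rewrite -(ler_pM2l hp) -{1}(gtr0_norm hp) -normrZ scalerBr.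
set x := h ^+ 2 *: L u in k1 *; set y := h ^+ 2 *: M v in k2 *.
rewrite [p + h *: v + _]addrAC in k2.
set a := f _ in k1 k2; set b := f (p + h *: u) in k1 k2; set c := f (p + h *: v) in k1 k2.
have e1 : a - b - (c - f p) = a - c - (b - f p).
  by rewrite !opprB addrACA [RHS]addrACA [- b - c]addrC.
rewrite e1 in k1; set q := a - c - _ in k1 k2.
have -> : x - y = (q - y) - (q - x) by rewrite opprB [RHS]addrC addrA subrK.
rewrite (le_trans (ler_normB _ _))// (le_trans (lerD k2 k1))//.
by rewrite -mulrDl -splitr mulrC.
Qed.

End SecondDerivatives.

Section DeterminantNearIdentity.
Import mathcomp.fingroup.perm.
Context (R : realType) (n : nat).
Implicit Types E : 'M[R]_n.

Lemma prod_near1 (s : seq 'I_n) (x : 'I_n -> R) q : 0 <= q -> q <= 1 ->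
  (forall i, `|x i| <= q) ->
  [/\ `|\prod_(i <- s) (1 + x i) - 1 - \sum_(i <- s) x i| <= 4 ^+ size s * q ^+ 2,
      `|\prod_(i <- s) (1 + x i) - 1| <= 2 ^+ size s * q &
      `|\prod_(i <- s) (1 + x i)| <= 2 ^+ size s].
Proof.
move=> q0 q1 hx; elim: s => [|i s [ih1 ih2 ih3]].
  by rewrite !big_nil subrr subr0 !normr0 normr1 expr0 !mul1r sqr_ge0.
have x1 : `|1 + x i| <= 2.
  by rewrite (le_trans (ler_normD _ _))// normr1 -[2]/(1 + 1) lerD2l (le_trans (hx i)).
rewrite !big_cons /=; set P := \prod_(j <- s) _ in ih1 ih2 ih3 *; set S := \sum_(j <- s) _ in ih1 *.
split.
- have -> : (1 + x i) * P - 1 - (x i + S) = (P - 1 - S) + x i * (P - 1) by ring.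
  rewrite (le_trans (ler_normD _ _))//.
  apply: (@le_trans _ _ (4 ^+ size s * q ^+ 2 + q * (4 ^+ size s * q))).
    rewrite lerD// normrM ler_pM//; apply: (le_trans ih2); rewrite ler_wpM2r//.
    by rewrite lerXn2r ?nnegrE// ler_nat.
  have -> : 4 ^+ size s * q ^+ 2 + q * (4 ^+ size s * q) = 2 * (4 ^+ size s * q ^+ 2) by ring.
  by rewrite [4 ^+ _.+1]exprS -mulrA ler_wpM2r ?ler_nat// mulr_ge0 ?sqr_ge0// exprn_ge0.
- have -> : (1 + x i) * P - 1 = (P - 1) + x i * P by ring.
  rewrite (le_trans (ler_normD _ _))// exprS.
  have -> : 2 * 2 ^+ size s * q = 2 ^+ size s * q + q * 2 ^+ size s by ring.
  by rewrite lerD// normrM ler_pM.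
- by rewrite normrM exprS ler_pM.
Qed.

(** A permutation other than the identity moves some i and also its image, so its product has two
    off-diagonal factors and is of order q^2. *)
Lemma det_near1 : exists2 K : R, 0 < K & forall E q, 0 <= q -> q <= 1 ->
  (forall i j, `|E i j| <= q) -> `|\det (1%:M + E) - 1 - \tr E| <= K * q ^+ 2.
Proof.
exists (4 ^+ n + #|{: {perm 'I_n}}|%:R * 2 ^+ n).
  by rewrite ltr_pwDl ?exprn_gt0// mulr_ge0// exprn_ge0.
move=> E q q0 q1 hE; rewrite /determinant (bigD1 (perm_one 'I_n))//=.
have -> : odd_perm (perm_one 'I_n) = false := odd_perm1 _.
rewrite expr0 mul1r.
have -> : \prod_(i < n) (1%:M + E) i (perm_one 'I_n i) = \prod_(i < n) (1 + E i i).
  by apply: eq_bigr => i _; rewrite permE !mxE eqxx.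
have [h1 _ _] := prod_near1 (index_enum 'I_n) q0 q1 (fun i => hE i i).
set P := \prod_(i < n) _ in h1 *; set S := \sum_(_ | _) _.
have hs : size (index_enum 'I_n) = n by rewrite /index_enum -enumT size_enum_ord.
rewrite hs in h1.
have e2 i j : `|(1%:M + E) i j| <= 2.
  rewrite !mxE (le_trans (ler_normD _ _))// -[2]/(1 + 1) lerD//; last exact: le_trans (hE i j) q1.
  by case: eqP => _; rewrite ?normr1 ?normr0.
have hS : `|S| <= #|{: {perm 'I_n}}|%:R * 2 ^+ n * q ^+ 2.
  rewrite (le_trans (ler_norm_sum _ _ _))//.
  have -> : #|{: {perm 'I_n}}|%:R * 2 ^+ n * q ^+ 2 = \sum_(s : {perm 'I_n}) 2 ^+ n * q ^+ 2.
    by rewrite sumr_const mulr_natl -mulrnAl.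
  rewrite [leRHS](bigID (fun s => s != perm_one 'I_n))/= ler_wpDr//.
    by apply: sumr_ge0 => s _; rewrite mulr_ge0 ?sqr_ge0// exprn_ge0.
  apply: ler_sum => s s1.
  have [i si] : exists i, s i != i.
    apply/existsP; apply: contraNT s1 => /existsPn h; apply/eqP/permP => i.
    by rewrite permE; apply/eqP; have := h i; rewrite negbK.
  rewrite normrM normrX normrN1 expr1n mul1r normr_prod.
  rewrite (bigD1 i)//= (bigD1 (s i))//=.
  have o j : s j != j -> `|(1%:M + E) j (s j)| <= q.
    by move=> sj; rewrite !mxE eq_sym (negbTE sj) add0r.
  have ssi : s (s i) != s i by rewrite (inj_eq perm_inj).
  rewrite mulrA [2 ^+ n * _]mulrC expr2 ler_pM ?mulr_ge0//.
  - by apply: prodr_ge0.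
  - by rewrite ler_pM ?o.
  - apply: (@le_trans _ _ (\prod_(j | (j != i) && (j != s i)) 2)).
      by apply: ler_prod => j _; rewrite normr_ge0 e2.
    by rewrite prodr_const ler_weXn2l ?ler1n// -[leqRHS]card_ord max_card.
have -> : P + S - 1 - \tr E = (P - 1 - \sum_(i <- index_enum 'I_n) E i i) + S.
  by rewrite /mxtrace; ring.
by rewrite (le_trans (ler_normD _ _))// mulrDl lerD.
Qed.

End DeterminantNearIdentity.

(** * Exponential weights, Haar integrals and the modular function *)

Section Weights.
Context (R : realType) (n : nat) (G : lieGroupType R n) (gm : G -> 'M[R]_n).
Hypothesis hgm : is_riemannian_metric gm.
Hypothesis hinv : left_invariant_metric gm.
Context (X : 'I_n -> 'rV[R]_n) (hX : is_orthonormal_basis gm X).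
Local Notation V := 'rV[R]_n.
Local Notation qn := (form_norm (metric_form gm)).
Local Notation d := (dist1 gm).
Implicit Types (x y z g : G) (C a : R).

Lemma near1_gexp (P : G -> Prop) (r : R) : 0 < r ->
  (forall u : V, `|u| < r -> P (gexp G u)) -> \forall x \near (1%g : G), P x.
Proof.
move=> r0 h.
have h1 : \forall x \near (1%g : G), chart_dom (1%g : G) x.
  by apply: open_nbhs_nbhs; split; [exact: chart_dom_open | exact: dom1].
have h2 : \forall x \near (1%g : G), `|glog x| < r.
  have c : {for (1%g : G), continuous (@glog R n G)} by apply: glog_continuous; exact: dom1.
  have n0 : \forall u \near glog (1%g : G), `|u| < r.
    by apply/near_distP; exists r => // u; rewrite glog1 subr0.
  exact: (c _ n0).
by apply: filterS2 h1 h2 => x hx hr; rewrite -(glogK hx); exact: h.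
Qed.

Lemma dist1_near1 a : 0 < a -> exists2 r : R, 0 < r &
  forall u : V, `|u| < r -> (d (gexp G u) <= a%:E)%E.
Proof.
move=> a0; have [K K0 hK] := qn_le hgm.
have [r r0 hr] := dist1_gexp hgm hinv hX ltr01.
exists (Num.min r (a / (2 * K))) => [|u]; first by rewrite lt_min r0 divr_gt0// mulr_gt0.
rewrite lt_min => /andP[u1 u2]; apply: (le_trans (hr u u1)); rewrite lee_fin.
rewrite (le_trans (ler_wpM2l _ (hK u)))//.
by rewrite mulrA mulrC -ler_pdivlMr ?mulr_gt0// ltW.
Qed.

(** A real number even where the distance is infinite; for C > 0 it is 0 there, by [weight_oo]. *)
Definition weight C g : R := fine (expeR (- (C%:E * d g))).

Lemma weightE C g : 0 < C -> expeR (- (C%:E * d g)) = (weight C g)%:E.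
Proof.
move=> C0; rewrite /weight; have := dist1_ge0 hgm hinv g.
case: (d g) => [r||] // _; last by rewrite mulry gtr0_sg// mul1e.
Qed.

Lemma weight_fin C g a : d g = a%:E -> weight C g = expR (- (C * a)).
Proof. by rewrite /weight => ->. Qed.

Lemma weight_oo C g : 0 < C -> d g = +oo%E -> weight C g = 0.
Proof. by move=> C0; rewrite /weight => ->; rewrite mulry gtr0_sg// mul1e. Qed.

Lemma weight_ge0 C g : 0 <= weight C g.
Proof. by apply: fine_ge0; exact: expeR_ge0. Qed.

Lemma weight_le C y z a : 0 < C -> (d y <= a%:E + d z)%E ->
  weight C z <= expR (C * a) * weight C y.
Proof.
move=> C0; have := dist1_ge0 hgm hinv z; have := dist1_ge0 hgm hinv y.
case ez : (d z) => [s||] // + _; last first.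
  by move=> _ _; rewrite (weight_oo C0 ez) mulr_ge0 ?expR_ge0// weight_ge0.
case ey : (d y) => [t||] // _.
rewrite -EFinD lee_fin => tas; rewrite (weight_fin C ez) (weight_fin C ey) -expRD ler_expR.
by rewrite -mulrBr -mulrN ler_wpM2l ?(ltW C0)// lerNl opprB lerBlDr addrC.
Qed.

Lemma weightMl C x y a : 0 < C -> (d x <= a%:E)%E ->
  weight C (x * y)%g <= expR (C * a) * weight C y /\
  weight C y <= expR (C * a) * weight C (x * y)%g.
Proof.
move=> C0 xa; split; apply: weight_le => //.
  have -> : d y = d (x^-1 * (x * y))%g by rewrite mulKg.
  apply: (le_trans (dist1M hgm hinv _ _)); rewrite (dist1V hgm hinv).
  by rewrite leeD2r.
by apply: (le_trans (dist1M hgm hinv _ _)); rewrite leeD2r.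
Qed.

Lemma weightMr C x y a : 0 < C -> (d x <= a%:E)%E ->
  weight C (y * x)%g <= expR (C * a) * weight C y /\
  weight C y <= expR (C * a) * weight C (y * x)%g.
Proof.
move=> C0 xa; split; apply: weight_le => //.
  have -> : d y = d ((y * x) * x^-1)%g by rewrite mulgK.
  apply: (le_trans (dist1M hgm hinv _ _)); rewrite (dist1V hgm hinv).
  by rewrite addeC leeD2r.
by apply: (le_trans (dist1M hgm hinv _ _)); rewrite addeC leeD2r.
Qed.

Lemma weight1 C : weight C 1%g = 1.
Proof. by rewrite (weight_fin C (dist1_one hgm hinv)) mulr0 oppr0 expR0. Qed.

Lemma log_lipschitz_continuous (f : G -> R) C : 0 < C -> (forall g, 0 <= f g) ->
  (forall x y a, (d x <= a%:E)%E -> 0 <= a -> a <= 1 -> f (x * y)%g <= expR (C * a) * f y /\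
     f y <= expR (C * a) * f (x * y)%g) -> continuous f.
Proof.
move=> C0 f0 hf g; apply/cvgrPdistC_le => e e0.
pose M := (expR C * f g) + 1.
have M0 : 0 < M by rewrite ltr_wpDl// mulr_ge0 ?expR_ge0.
have [a [a0 a1 ha]] : exists a, [/\ 0 < a, a <= 1 & (expR (C * a) - 1) * M <= e].
  have c : {for 0, continuous (@expR R)} by exact: continuous_expR.
  have [r r0 hr] := (@continuous_distP R R^o R^o _ _).1 c _ (divr_gt0 e0 M0).
  exists (Num.min 1 (r / 2 / C)); split.
  - by rewrite lt_min ltr01 !divr_gt0.
  - by rewrite ge_min lexx.
  set a := Num.min _ _.
  have a0 : 0 < a by rewrite lt_min ltr01 !divr_gt0.
  have Ca : C * a < r.
    apply: (@le_lt_trans _ _ (r / 2)); last by rewrite ltr_pdivrMr// ltr_pMr// ltr1n.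
    by rewrite mulrC -ler_pdivlMr// ge_min lexx orbT.
  have := hr (C * a); rewrite subr0 expR0 gtr0_norm ?mulr_gt0// => /(_ Ca).
  by rewrite ltr_pdivlMr// => /ltW; apply: le_trans; rewrite ler_wpM2r ?(ltW M0)// ler_norm.
have [r r0 hr] := dist1_near1 a0.
have near1 := @near1_gexp (fun x => (d x <= a%:E)%E) r r0 hr.
have cg : {for g, continuous (fun x => x * g^-1)%g}.
  have := @translation_continuous R n G 1%g g^-1%g g.
  by under [X in continuous_at _ X]eq_fun do rewrite mul1g.
have : \forall x \near g, (d (x * g^-1)%g <= a%:E)%E.
  by apply: (cg [set x | (d x <= a%:E)%E]); rewrite /= mulgV.
apply: filterS => x dx.
have [h1 h2] := hf _ g a dx (ltW a0) a1; rewrite mulgVK in h1 h2.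
have ea : 1 <= expR (C * a) by rewrite -expR0 ler_expR mulr_ge0// ltW.
have eC : expR (C * a) <= expR C by rewrite ler_expR ler_piMr// ltW.
have fx : f x <= M.
  by rewrite (le_trans h1)// /M ler_wpDr// ler_wpM2r.
have fg : f g <= M.
  by rewrite (le_trans _ (ler_wpDr ler01 (lexx _)))// ler_peMl// (le_trans ea).
rewrite ler_norml; apply/andP; split.
  rewrite lerNl opprB lerBlDr (le_trans h2)// -lerBlDr -{2}[f x]mul1r -mulrBl.
  by apply: le_trans ha; rewrite ler_wpM2l// subr_ge0.
rewrite lerBlDr (le_trans h1)// -lerBlDr -{2}[f g]mul1r -mulrBl.
by apply: le_trans ha; rewrite ler_wpM2l// subr_ge0.
Qed.

Lemma weight_continuous C : 0 < C -> continuous (weight C).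
Proof.
move=> C0; apply: (log_lipschitz_continuous C0); first exact: weight_ge0.
by move=> x y a xa _ _; exact: weightMl.
Qed.

Context (mu : {measure set (borel G) -> \bar R}) (hmu : is_riemannian_measure gm mu).

Lemma gexp_image (B : set V) : B `<=` gdom G ->
  gexp G @` B = chart_piece (1%g : G) [set y | B (y - chart (1%g : G) 1%g)].
Proof.
move=> Bd; apply/seteqP; split=> [_ [u Bu <-]|x [xd /= Bx]].
  split; first exact/gexp_dom/Bd.
  by have := gexpK (Bd u Bu); rewrite /glog /= => ->.
by exists (glog x) => //; rewrite glogK.
Qed.

(** Near 1 the density is at least half of its value at 1, which allows integrals on the group to be
    bounded below by Lebesgue integrals over sets of small vectors. *)
Lemma measure_near1 : exists r c : R, [/\ 0 < r, 0 < c &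
  exists2 lam : {measure set (borel V) -> \bar R}, is_lebesgue lam &
  forall B, @measurable _ (borel V) B -> (forall u, B u -> `|u| < r) ->
     [/\ B `<=` gdom G, @measurable _ (borel G) (gexp G @` B),
       (c%:E * lam B <= mu (gexp G @` B))%E & (mu (gexp G @` B) < +oo)%E]].
Proof.
have [lam hlam hmu'] := hmu; set z0 := chart (1%g : G) 1%g.
have h1 : chart_img (1%g : G) z0 by exact/chart_img_self/dom1.
have e0 : 0 < 2^-1 :> R by rewrite invr_gt0.
have [r1 r10 hr1] := density_bounds hgm hinv hX hmu' h1 e0.
have rho0 := density_gt0 hinv hX h1.
exists r1, ((1 - 2^-1) * density gm (1%g : G) z0); split=> //.
  by rewrite mulr_gt0//; lra.
exists lam => // B mB Br; set B' := [set y | B (y - z0)].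
have mB' : @measurable _ (borel V) B' by exact: translate_measurable.
have lB' : lam B' = lam B by exact: (leb_translate hlam).
have [k1 k2 k3] := hr1 B' mB' (fun (z : V) hz => Br _ hz).
have Bd : B `<=` gdom G.
  by move=> u Bu; apply: k1; rewrite /B' /= addrC addKr.
rewrite (gexp_image Bd) -/z0 -/B' -lB'; split=> //; first exact: chart_piece_measurable.
apply: (le_lt_trans k3); rewrite lB'.
have lB : (lam B < +oo)%E.
  apply: le_lt_trans (leb_box_fin hlam (const_mx (- r1)) (const_mx r1)).
  apply: le_measure; rewrite ?inE//; first exact: box_measurable.
  move=> u /Br ur i; rewrite !mxE; have := le_lt_trans (norm_coord u i) ur.
  by rewrite ltr_norml => /andP[/ltW -> ->].
rewrite -(fineK (_ : lam B \is a fin_num)) ?ltry//.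
by rewrite ge0_fin_numE ?measure_ge0.
Qed.

End Weights.

Section HaarIntegral.
Context (R : realType) (n : nat) (G : lieGroupType R n) (gm : G -> 'M[R]_n).
Hypothesis hgm : is_riemannian_metric gm.
Hypothesis hinv : left_invariant_metric gm.
Context (X : 'I_n -> 'rV[R]_n) (hX : is_orthonormal_basis gm X).
Context (mu : {measure set (borel G) -> \bar R}) (hmu : is_riemannian_measure gm mu).
Local Notation d := (dist1 gm).

Lemma haar_integral (g k : G) (F : G -> \bar R) :
  measurable_fun [set: borel G] (F : borel G -> \bar R) -> (forall x, (0 <= F x)%E) ->
  (\int[mu]_x F (g * x * k)%g = `|\det (conj_jac k^-1%g)|%:E * \int[mu]_x F x)%E.
Proof.
move=> mF F0.
have mT : measurable_fun [set: borel G] ((fun x => g * x * k)%g : borel G -> borel G).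
  by apply: borel_continuous; exact: translation_continuous.
have chi0 : 0 <= `|\det (conj_jac k^-1%g)| by [].
rewrite -(ge0_integral_mscale mu measurableT (NngNum chi0))//.
pose nu := measure_function_pushforward__canonical__measure_function_Measure mu mT.
transitivity (\int[nu]_x F x)%E.
  by rewrite (ge0_integral_pushforward mT mu measurableT mF).
by apply: eq_measure_integral => A mA _; exact: (haar_translation hgm hinv hX hmu g k mA).
Qed.

Lemma conj_jac1 : conj_jac (1%g : G) = 1%:M.
Proof.
apply: mulmx_rV_inj => v; rewrite mulmx1.
apply: (sdiff_uniq (sdiff_conj (1%g : G)) (M := id)).
apply: (sdiff_near _ (sdiff_id 0)).
have : \forall z \near (0 : 'rV[R]_n), gdom G z.
  by apply: open_nbhs_nbhs; split; [exact: gdom_open | exact: gdom0].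
by apply: filterS => z hz /=; rewrite invg1 mul1g mulg1 gexpK.
Qed.

Lemma haar_integral_left (g : G) (F : G -> \bar R) :
  measurable_fun [set: borel G] (F : borel G -> \bar R) -> (forall x, (0 <= F x)%E) ->
  (\int[mu]_x F (g * x)%g = \int[mu]_x F x)%E.
Proof.
move=> mF F0; have := haar_integral g 1%g mF F0.
rewrite invg1 conj_jac1 det1 normr1 mul1e => <-.
by apply: eq_integral => x _; rewrite mulg1.
Qed.

Lemma integral_near1_gt0 (f : G -> R) (c r : R) : 0 < c -> 0 < r ->
  measurable_fun [set: borel G] (f : borel G -> R) -> (forall g, 0 <= f g) ->
  (forall u, `|u| < r -> c <= f (gexp G u)) -> (0 < \int[mu]_g (f g)%:E)%E.
Proof.
move=> c0 r10 mf f0 hf.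
have [r' [c' [r0 c'0 [lam hlam hr]]]] := measure_near1 hgm hinv hX hmu.
pose e := Num.min r' r / 2.
have m0 : 0 < Num.min r' r by rewrite lt_min r0.
have e0 : 0 < e by rewrite divr_gt0.
have em : e < Num.min r' r by rewrite /e ltr_pdivrMr// ltr_pMr// ltr1n.
pose B := box (const_mx (- e)) (const_mx e) : set 'rV[R]_n.
have mB : @measurable _ (borel 'rV[R]_n) B by exact: box_measurable.
have hB u : B u -> `|u| < r' /\ `|u| < r.
  move=> hu; have : `|u| <= e.
    apply: norm_rV_le; first exact: ltW.
    by move=> i; have := hu i; rewrite !mxE ler_norml => /andP[-> /ltW ->].
  by move=> /le_lt_trans/(_ em); rewrite lt_min => /andP[].
have [Bd mE lo up] := hr B mB (fun u hu => (hB u hu).1).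
have lB : lam B = ((e + e) ^+ n)%:E.
  rewrite (leb_box hlam); last by move=> i; rewrite !mxE; lra.
  congr EFin; rewrite -[n in RHS]card_ord -prodr_const; apply: eq_bigr => i _.
  by rewrite !mxE opprK.
have mu0 : (0 < mu (gexp G @` B))%E.
  by apply: lt_le_trans lo; rewrite lB -EFinM lte_fin mulr_gt0// exprn_gt0// addr_gt0.
apply: (@lt_le_trans _ _ (c%:E * mu (gexp G @` B))%E); first by rewrite mule_gt0.
rewrite -(integral_cst mu mE).
apply: (@le_trans _ _ (\int[mu]_(g in gexp G @` B) (f g)%:E)%E).
  apply: ge0_le_integral => //.
  - by move=> x _; rewrite lee_fin ltW.
  - by apply/measurable_EFinP; apply: measurable_funS mf.
  - by move=> x [u /hB[_ /hf hu] <-]; rewrite lee_fin.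
apply: ge0_subset_integral => //.
- exact/measurable_EFinP.
- by move=> x _; rewrite lee_fin.
Qed.

Context (C : R) (C0 : 0 < C).
Hypothesis hC : (\int[mu]_g expeR (- (C%:E * dist1 gm g)) < +oo)%E.
Local Notation wt := (weight gm C).

Lemma weight_measurable : measurable_fun [set: borel G] (wt : borel G -> R).
Proof. by apply: borel_continuous_real; exact: (weight_continuous hgm hinv hX C0). Qed.

Lemma weight_integralE :
  (\int[mu]_g expeR (- (C%:E * dist1 gm g)) = \int[mu]_g (wt g)%:E)%E.
Proof. by apply: eq_integral => g _; exact: weightE. Qed.

Lemma weight_integral_gt0 : (0 < \int[mu]_g (wt g)%:E)%E.
Proof.
have [r r0 hr] := dist1_near1 hgm hinv hX ltr01.
apply: (@integral_near1_gt0 wt (expR (- C)) r); rewrite ?expR_gt0//.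
- exact: weight_measurable.
- exact: weight_ge0.
move=> u /hr hu; have := weight_le hgm hinv C0 (y := gexp G u) (z := 1%g) (a := 1).
rewrite (dist1_one hgm hinv) adde0 => /(_ hu).
by rewrite weight1// mulr1 -ler_pdivrMl ?expR_gt0// mulr1 -expRN.
Qed.

(** Right translation by k^-1 multiplies the integral of the weight by |det Ad(k^-1)|, while the
    weight itself changes by a factor at most exp(C a); the integral is positive and finite. This is
    how integrability of exp(-C d) controls the modular function. *)
Lemma conj_jac_le (k : G) a : (d k <= a%:E)%E -> `|\det (conj_jac k)| <= expR (C * a).
Proof.
move=> ka; have mw : measurable_fun [set: borel G] (fun x : borel G => (wt x)%:E).
  by apply/measurable_EFinP; exact: weight_measurable.
have w0 (x : G) : (0 <= (wt x)%:E)%E by rewrite lee_fin weight_ge0.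
have := haar_integral 1%g k^-1%g mw w0; rewrite invgK => h.
have fin : (\int[mu]_g (wt g)%:E)%E \is a fin_num.
  by rewrite ge0_fin_numE ?integral_ge0// -weight_integralE.
have : (\int[mu]_x (wt (1 * x * k^-1)%g)%:E <= (expR (C * a))%:E * \int[mu]_x (wt x)%:E)%E.
  rewrite -ge0_integralZl ?lee_fin ?expR_ge0//.
  apply: ge0_le_integral => //.
  - apply: (measurableT_comp mw).
    by apply: borel_continuous; exact: translation_continuous.
  - by apply/measurable_EFinP; apply: measurable_funM => //; exact: weight_measurable.
  - move=> x _; rewrite -EFinM lee_fin mul1g.
    have ka' : (d k^-1%g <= a%:E)%E by rewrite (dist1V hgm hinv).
    by have [] := weightMr hgm hinv x C0 ka'.
have := weight_integral_gt0; rewrite h -(fineK fin) -!EFinM lte_fin lee_fin => i0.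
by rewrite ler_pM2r.
Qed.

End HaarIntegral.

Lemma det_expansion (R : realType) (n : nat) (M : R -> 'M[R]_n) (N : 'M[R]_n) :
  (forall e, 0 < e -> exists2 d : R, 0 < d & forall t, `|t| < d ->
     forall i j, `|M t i j - (i == j)%:R - t * N i j| <= e * `|t|) ->
  forall e, 0 < e -> exists2 d : R, 0 < d & forall t, `|t| < d ->
     `|\det (M t) - 1 - t * \tr N| <= e * `|t|.
Proof.
move=> hM e e0; have [K K0 hK] := det_near1 R n.
pose A : R := \sum_i \sum_j `|N i j| + 1.
have A1 : 1 <= A by rewrite /A lerDr; apply: sumr_ge0 => i _; exact: sumr_ge0.
have A0 : 0 < A by exact: lt_le_trans A1.
have NA i j : `|N i j| <= A.
  rewrite /A (bigD1 i)//= (bigD1 j)//= -!addrA lerDl !addr_ge0//.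
    exact: sumr_ge0.
  by apply: sumr_ge0 => k _; exact: sumr_ge0.
pose e1 := Num.min 1 (e / 2 / (n%:R + 1)).
have n1 : 0 < n%:R + 1 :> R by rewrite ltr_wpDl.
have e10 : 0 < e1 by rewrite lt_min ltr01 !divr_gt0.
have e11 : e1 <= 1 by rewrite ge_min lexx.
have en : n%:R * e1 <= e / 2.
  have : e1 <= e / 2 / (n%:R + 1) by rewrite ge_min lexx orbT.
  rewrite ler_pdivlMr// => h; apply: le_trans h; rewrite mulrC ler_wpM2l ?(ltW e10)//.
  by rewrite lerDl.
have [d d0 hd] := hM e1 e10.
have A2 : 0 < K * (A + 1) ^+ 2 by rewrite mulr_gt0// exprn_gt0// addr_gt0.
exists (Num.min d (Num.min (A + 1)^-1 (e / 2 / (K * (A + 1) ^+ 2)))).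
  by rewrite !lt_min d0 invr_gt0 addr_gt0//= !divr_gt0.
move=> t; rewrite !lt_min => /and3P[t1 t2 t3].
have {}hd := hd t t1.
pose E := M t - 1%:M; pose q := `|t| * (A + 1).
have q0 : 0 <= q by rewrite mulr_ge0// addr_ge0// ltW.
have A10 : 0 < A + 1 by rewrite addr_gt0.
have q1 : q <= 1 by rewrite /q -[leRHS](mulVf (lt0r_neq0 A10)); apply: ler_wpM2r; apply: ltW.
have Eq i j : `|E i j| <= q.
  have -> : E i j = (M t i j - (i == j)%:R - t * N i j) + t * N i j.
    by rewrite !mxE subrK.
  rewrite (le_trans (ler_normD _ _))// /q mulrDr mulr1 addrC lerD//.
    by rewrite normrM ler_wpM2l.
  by rewrite (le_trans (hd i j))// ler_piMl.
have := hK E q q0 q1 Eq; have -> : 1%:M + E = M t by rewrite /E addrC subrK.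
move=> h.
have trE : `|\tr E - t * \tr N| <= e / 2 * `|t|.
  have -> : \tr E - t * \tr N = \sum_i (M t i i - (i == i)%:R - t * N i i).
    by rewrite /mxtrace mulr_sumr -sumrB; apply: eq_bigr => i _; rewrite !mxE.
  rewrite (le_trans (ler_norm_sum _ _ _))//.
  apply: (@le_trans _ _ (\sum_(i < n) e1 * `|t|)); first by apply: ler_sum.
  by rewrite sumr_const card_ord -[leLHS]mulr_natl mulrA ler_wpM2r.
have -> : \det (M t) - 1 - t * \tr N = (\det (M t) - 1 - \tr E) + (\tr E - t * \tr N).
  by rewrite addrA subrK.
rewrite (le_trans (ler_normD _ _))// [e]splitr mulrDl lerD// (le_trans h)//.
have -> : K * q ^+ 2 = K * (A + 1) ^+ 2 * `|t| * `|t| by rewrite /q; ring.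
by rewrite ler_wpM2r// mulrC -ler_pdivlMr// ltW.
Qed.

(** Comparison of logarithmic derivatives at 0, where both functions are 1, done on first-order
    expansions at one small time; the signs s = 1 and s = -1 treat the two sides of 0. *)
Lemma rate_bound (R : realType) (f g : R -> R) (a b k : R) : 0 <= k ->
  (forall e, 0 < e -> exists2 d : R, 0 < d & forall t, `|t| < d ->
     [/\ `|f t - 1 - t * a| <= e * `|t|, `|g t - 1 - t * b| <= e * `|t| &
         `|g t| <= expR ((k + e) * `|t|) * `|f t|]) ->
  `|b - a| <= k.
Proof.
move=> k0 H.
suff key (s : R) : `|s| = 1 -> s * (b - a) <= k.
  rewrite ler_norml; apply/andP; split; last by have := key 1; rewrite normr1 mul1r => ->.
  by have := key (-1); rewrite normrN1 mulN1r lerNl => ->.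
move=> s1; apply: le_addgt0P => e e0.
pose e1 := Num.min 1 (e / 8).
have e10 : 0 < e1 by rewrite lt_min ltr01 divr_gt0.
have e11 : e1 <= 1 by rewrite ge_min lexx.
have e8 : 8 * e1 <= e by rewrite mulrC -ler_pdivlMr// ge_min lexx orbT.
have [d d0 hd] := H e1 e10.
have de : is_derive 0 (1 : R) (fun h => expR ((k + e1) * h)) (k + e1).
  have h1 : is_derive 0 (1 : R) (fun h : R => (k + e1) * h) (k + e1).
    have := @is_deriveM R R^o (cst (k + e1)) id 0 1 0 1 (is_derive_cst _ _ _) (is_derive_id _ _).
    by rewrite scaler0 addr0 [_ *: _]mulr1.
  have := @is_derive1_comp R expR (fun h : R => (k + e1) * h) 0 (expR ((k + e1) * 0)) (k + e1) (is_derive_expR _) h1.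
  by rewrite mulr0 expR0 mul1r.
have [d' d'0 hd'] := is_derive_near de e10.
pose q := (k + 2) * (`|a| + 1).
have q0 : 0 < q by rewrite mulr_gt0 ?ltr_wpDl.
pose m := Num.min d (Num.min d' (Num.min 1 (e1 / q))).
have m0 : 0 < m by rewrite !lt_min d0 d'0 ltr01 divr_gt0.
pose h := m / 2; have h0 : 0 < h by rewrite divr_gt0.
have : h < m by rewrite /h ltr_pdivrMr// ltr_pMr// ltr1n.
rewrite !lt_min => /and4P[hh1 hh2 hh3 hh4].
clearbody h.
have nt : `|s * h| = h by rewrite normrM s1 mul1r gtr0_norm.
have [] := hd (s * h); rewrite nt//.
rewrite !ler_distl => /andP[f1 f2] /andP[g1 _] gf.
have := hd' h; rewrite subr0 gtr0_norm// mulr0 expR0 => /(_ hh2).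
rewrite ler_distl => /andP[_ x2].
clear H hd hd' de.
have hq : h * q <= e1 by rewrite -ler_pdivlMr// ltW.
have aq : `|a| + 1 <= q by rewrite ler_peMl ?addr_ge0// (le_trans (ler1n _ 2))// lerDr.
have ha : `|s * h * a| <= h * q - h.
  rewrite normrM nt; have := ler_wpM2l (ltW h0) aq; clear; lra.
have fa : `|f (s * h)| <= 1 + s * h * a + e1 * h.
  move: ha; rewrite !ler_norml => /andP[p1 p2]; by apply/andP; split; lra.
have fb : 1 + s * h * b - e1 * h <= (1 + (k + 2 * e1) * h) * (1 + s * h * a + e1 * h).
  apply: (@le_trans _ _ (expR ((k + e1) * h) * `|f (s * h)|)).
    by apply: le_trans gf; apply: le_trans (ler_norm _); move: g1; clear; lra.
  by apply: ler_pM => //; move: x2; clear; lra.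
have kq : (k + 2 * e1) * (s * h * a + e1 * h) <= e1.
  apply: le_trans hq; rewrite /q mulrCA.
  apply: (@le_trans _ _ ((k + 2 * e1) * (h * (`|a| + 1)))).
    apply: ler_wpM2l; first by move: k0 e10; clear; lra.
    apply: (@le_trans _ _ (`|s * h * a| + h)).
      by apply: lerD; [exact: ler_norm | rewrite ler_piMl// ltW].
    by rewrite mulrDr mulr1 lerD2r normrM nt.
  by apply: ler_wpM2r; [rewrite mulr_ge0 ?addr_ge0// ltW | move: e11; clear; lra].
rewrite -(ler_pM2l h0); have := ler_wpM2l (ltW h0) kq; have := ler_wpM2l (ltW h0) e8.
move: fb (mulr_gt0 e10 h0); clear; lra.
Qed.

(** * The trace of ad as the derivative of the modular function *)

Section TraceAd.
Context (R : realType) (n : nat) (G : lieGroupType R n).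
Local Notation V := 'rV[R]_n.
Let z0 : V := chart (1%g : G) 1%g.
Let p0 : V * V := (z0, z0).
Let U : set (V * V) := mul_dom (1%g : G) 1%g 1%g.

Definition chart_mul (p : V * V) : V :=
  chart (1%g : G) (chart_inv (1%g : G) p.1 * chart_inv (1%g : G) p.2)%g.

Let iz0 : chart_inv (1%g : G) z0 = 1%g.
Proof. by rewrite /z0 chartK//; exact: dom1. Qed.

Let hz0 : chart_img (1%g : G) z0.
Proof. exact/chart_img_self/dom1. Qed.

Lemma mul_dom_right y : chart_img (1%g : G) y -> U (y, z0).
Proof. by move=> hy; split=> //=; rewrite iz0 mulg1; have [] := chart_imgP hy. Qed.

Lemma mul_dom_left y : chart_img (1%g : G) y -> U (z0, y).
Proof. by move=> hy; split=> //=; rewrite iz0 mul1g; have [] := chart_imgP hy. Qed.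

Lemma sdiff_chart_mul p : U p -> sdiff chart_mul p (fun v => 'D_v chart_mul p).
Proof.
move=> hp; have [|L hL] := sdiff_C1_row
    (coordinates_prod (coordinates_rV R n) (coordinates_rV R n)) _ hp
    (lie_mul_smooth (1%g : G) 1%g 1%g 1%N).
  exact: mul_dom_open.
suff -> : (fun v => 'D_v chart_mul p) = L by [].
by apply/funext => v; have [_ ->] := sdiff_derive v hL.
Qed.

(** The Hessian of multiplication at (1, 1); antisymmetrising its mixed part gives the Lie bracket
    ([lie_bracketE]). *)
Definition mul_hessian (u v : V * V) : V := 'D_u (fun p => 'D_v chart_mul p) p0.

Lemma sdiff_derive_mul v :
  sdiff (fun p => 'D_v chart_mul p) p0 (fun u => mul_hessian u v).
Proof.
have hC : Ck_on 1 U (fun p => 'D_v chart_mul p).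
  by have [_ /(_ v)[_ hC]] := lie_mul_smooth (1%g : G) 1%g 1%g 2%N.
have [|L hL] := sdiff_C1_row
    (coordinates_prod (coordinates_rV R n) (coordinates_rV R n)) _
    (mul_dom_right hz0 : U p0) hC.
  exact: mul_dom_open.
suff -> : (fun u => mul_hessian u v) = L by [].
by apply/funext => u; rewrite /mul_hessian; have [_ ->] := sdiff_derive u hL.
Qed.

Lemma mul_hessianC u v : mul_hessian u v = mul_hessian v u.
Proof.
have d w p : U p -> derivable chart_mul p w.
  by move=> hp; have [] := sdiff_derive w (sdiff_chart_mul hp).
have h := @schwarz R (V * V)%type V chart_mul U p0 u v (mul_hessian^~ v) (mul_hessian^~ u)
  (@mul_dom_open R n G 1%g 1%g 1%g) (mul_dom_right hz0) (d u) (d v) (sdiff_derive_mul v) (sdiff_derive_mul u).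
exact: h.
Qed.

Lemma mul_hessianD a u v w :
  mul_hessian (a *: u + v) w = a *: mul_hessian u w + mul_hessian v w.
Proof. exact: (sdiff_bl (sdiff_derive_mul w)).1. Qed.

Lemma sdiff_pairl (y : V) (w : V) :
  sdiff (fun z : V => (z, w)) y (fun h => (h, 0)).
Proof. exact: sdiff_pair (sdiff_id y) (sdiff_cst _ _). Qed.

Lemma sdiff_pairr (y : V) (w : V) :
  sdiff (fun z : V => (w, z)) y (fun h => (0, h)).
Proof. exact: sdiff_pair (sdiff_cst _ _) (sdiff_id y). Qed.

Lemma sdiff_mul_right y : chart_img (1%g : G) y ->
  sdiff (fun z => chart_mul (y, z)) z0 (fun h => 'D_(0, h) chart_mul (y, z0)).
Proof.
by move=> hy; exact: sdiff_comp (sdiff_pairr z0 y) (sdiff_chart_mul (mul_dom_right hy)).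
Qed.

Lemma sdiff_mul_left y : chart_img (1%g : G) y ->
  sdiff (fun z => chart_mul (z, y)) z0 (fun h => 'D_(h, 0) chart_mul (z0, y)).
Proof.
by move=> hy; exact: sdiff_comp (sdiff_pairl z0 y) (sdiff_chart_mul (mul_dom_left hy)).
Qed.

Lemma left_fieldE Y y : chart_img (1%g : G) y ->
  left_field G Y y = 'D_(0, Y) chart_mul (y, z0).
Proof. by move=> /sdiff_mul_right /(sdiff_derive Y)[_ <-]. Qed.

Lemma chart_img_near0 : \forall y \near z0, chart_img (1%g : G) y.
Proof. by apply: open_nbhs_nbhs; split=> //; exact: chart_img_open. Qed.

Lemma lie_bracketE X Y :
  lie_bracket G X Y = mul_hessian (X, 0) (0, Y) - mul_hessian (Y, 0) (0, X).
Proof.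
have h (A B : V) : 'D_A (left_field G B) z0 = mul_hessian (A, 0) (0, B).
  have s := sdiff_comp (sdiff_pairl z0 z0) (sdiff_derive_mul (0, B)).
  have s' : sdiff (left_field G B) z0 (fun u => mul_hessian (u, 0) (0, B)).
    apply: (sdiff_near _ s); apply: filterS chart_img_near0 => y hy /=.
    by rewrite left_fieldE.
  by have [_ ->] := sdiff_derive A s'.
by rewrite /lie_bracket (h X Y) (h Y X).
Qed.

Lemma lie_bracket_linearl (a : R) X Y Z :
  lie_bracket G (a *: X + Y) Z = a *: lie_bracket G X Z + lie_bracket G Y Z.
Proof.
have pl (u v : V) : (a *: u + v, 0 : V) = a *: (u, 0) + (v, 0).
  by congr pair; rewrite /= ?scaler0 ?addr0.
have pr (u v : V) : (0 : V, a *: u + v) = a *: (0, u) + (0, v).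
  by congr pair; rewrite /= ?scaler0 ?addr0.
rewrite !lie_bracketE !(mul_hessianC (Z, 0)) pl pr !mul_hessianD.
move: (mul_hessian (X, 0) _) (mul_hessian (Y, 0) _) (mul_hessian (0, X) _) (mul_hessian (0, Y) _) => A B C D.
by rewrite scalerBr opprD addrACA.
Qed.

Lemma trace_lin1 (f : V -> V) : \tr (lin1_mx f) = \sum_i f (delta_mx 0 i) 0 i.
Proof. by apply: eq_bigr => i _; rewrite mxE. Qed.

Lemma trace_lin1D (a : R) (f g h : V -> V) : (forall v, h v = a *: f v + g v) ->
  \tr (lin1_mx h) = a * \tr (lin1_mx f) + \tr (lin1_mx g).
Proof.
by move=> e; rewrite !trace_lin1 mulr_sumr -big_split/=; apply: eq_bigr => i _; rewrite e !mxE.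
Qed.

Lemma trace_rowsB (f g h : 'I_n -> V) : (forall i, h i = f i - g i) ->
  \sum_i h i 0 i = \tr (\matrix_i f i) - \tr (\matrix_i g i).
Proof. by move=> e; rewrite /mxtrace -sumrB; apply: eq_bigr => i _; rewrite e !mxE. Qed.

Lemma tr_ad_linear (a : R) X Y : tr_ad G (a *: X + Y) = a * tr_ad G X + tr_ad G Y.
Proof. by apply: trace_lin1D => v; exact: lie_bracket_linearl. Qed.

(** Differential at z = 1 of z |-> y z, where the right factor varies; in [left_mul_jac] the left
    factor of z y varies. *)
Definition right_mul_jac y : 'M[R]_n := \matrix_i 'D_(0, delta_mx 0 i) chart_mul (y, z0).
Definition left_mul_jac y : 'M[R]_n := \matrix_i 'D_(delta_mx 0 i, 0) chart_mul (z0, y).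

Let mulmx_derive (L : V -> V) : bounded_linear L ->
  forall v, L v = v *m \matrix_i L (delta_mx 0 i).
Proof.
move=> bL v; rewrite {1}(row_sum_delta v) mulmx_sum_row.
elim/big_rec2: _ => [|i x y _ <-]; first by rewrite bl0.
by rewrite blD// blZ// rowK.
Qed.

Lemma sdiff_right_mul_jac y : chart_img (1%g : G) y ->
  sdiff (fun z => chart_mul (y, z)) z0 (fun h => h *m right_mul_jac y).
Proof.
move=> hy; have h := sdiff_mul_right hy.
suff -> : (fun h => h *m right_mul_jac y) = (fun h => 'D_(0, h) chart_mul (y, z0)) by [].
by apply/funext => v; rewrite (mulmx_derive (sdiff_bl h)).
Qed.

Lemma sdiff_left_mul_jac y : chart_img (1%g : G) y ->
  sdiff (fun z => chart_mul (z, y)) z0 (fun h => h *m left_mul_jac y).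
Proof.
move=> hy; have h := sdiff_mul_left hy.
suff -> : (fun h => h *m left_mul_jac y) = (fun h => 'D_(h, 0) chart_mul (z0, y)) by [].
by apply/funext => v; rewrite (mulmx_derive (sdiff_bl h)).
Qed.

(** z k = k (k^-1 z k), so the two differentials differ by an adjoint matrix. *)
Lemma left_mul_jacE y : chart_img (1%g : G) y ->
  left_mul_jac y = conj_jac (chart_inv (1%g : G) y) *m right_mul_jac y.
Proof.
move=> hy; set k := chart_inv (1%g : G) y.
have t0 : sdiff (fun u : V => z0 + u) 0 id.
  have -> : (fun u : V => z0 + u) = (fun u => u + z0) by apply/funext => u; rewrite addrC.
  exact: sdiff_translate (sdiff_id _).
have t1 : sdiff (fun u : V => z0 + u) 0 (fun v => v *m 1%:M).
  by suff -> : (fun v : V => v *m 1%:M) = id by []; apply/funext => v; rewrite mulmx1.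
have l := sdiff_left_mul_jac hy; rewrite -{1}[z0]addr0 in l.
have c := sdiff_translate z0 (sdiff_conj k).
have c0 : glog (k^-1 * gexp G (0 : V) * k)%g + z0 = z0.
  by rewrite gexp0 mulg1 mulVg glog1 add0r.
have r := sdiff_right_mul_jac hy; rewrite -{1}c0 in r.
rewrite -[LHS]mul1mx; apply: (J_square t1 l c r).
have hg : gdiff (fun u => k^-1 * gexp G u * k)%g (0 : V).
  apply: gdiffM; last exact: gdiff_cst.
  apply: gdiffM; first exact: gdiff_cst.
  by apply: (gdiff_gexp (sdiff_id _)); exact: gdom0.
have : \forall u \near (0 : V), chart_dom (1%g : G) (k^-1 * gexp G u * k)%g.
  by apply: chart_dom_near hg.1 _; rewrite gexp0 mulg1 mulVg; exact: dom1.
apply: filterS => u hu; rewrite /chart_mul/= -/k addrC -/(gexp G _) glogK//.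
by rewrite !mulgA mulgV mul1g.
Qed.

Lemma right_mul_jac0 : right_mul_jac z0 = 1%:M.
Proof.
apply: mulmx_rV_inj => v; rewrite mulmx1.
apply: (sdiff_uniq (sdiff_right_mul_jac hz0) (M := id)).
apply: (sdiff_near _ (sdiff_id z0)); apply: filterS chart_img_near0 => y hy.
by rewrite /chart_mul/= iz0 mul1g; have [_ ->] := chart_imgP hy.
Qed.

Lemma left_mul_jac0 : left_mul_jac z0 = 1%:M.
Proof.
apply: mulmx_rV_inj => v; rewrite mulmx1.
apply: (sdiff_uniq (sdiff_left_mul_jac hz0) (M := id)).
apply: (sdiff_near _ (sdiff_id z0)); apply: filterS chart_img_near0 => y hy.
by rewrite /chart_mul/= iz0 mulg1; have [_ ->] := chart_imgP hy.
Qed.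

Context (gm : G -> 'M[R]_n).
Hypothesis hgm : is_riemannian_metric gm.
Hypothesis hinv : left_invariant_metric gm.
Context (X : 'I_n -> V) (hX : is_orthonormal_basis gm X).
Context (mu : {measure set (borel G) -> \bar R}) (hmu : is_riemannian_measure gm mu).
Context (C : R) (C0 : 0 < C).
Hypothesis hC : (\int[mu]_g expeR (- (C%:E * dist1 gm g)) < +oo)%E.

Let expand_line (M : V -> 'M[R]_n) (L : 'I_n -> V -> V) Y :
  (forall i, sdiff (fun y => row i (M y)) z0 (L i)) -> M z0 = 1%:M ->
  forall e, 0 < e -> exists2 d : R, 0 < d & forall t, `|t| < d -> forall i j,
    `|M (z0 + t *: Y) i j - (i == j)%:R - t * (\matrix_i L i Y) i j| <= e * `|t|.
Proof.
move=> hM M1 e e0; have y1 : 0 < `|Y| + 1 by rewrite ltr_wpDl.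
have /choice[d hd] i : exists d : R, 0 < d /\ forall y, `|y - z0| < d ->
    `|row i (M y) - row i (M z0) - L i (y - z0)| <= e / (`|Y| + 1) * `|y - z0|.
  have [d d0 hd] := (hM i).2 _ (divr_gt0 e0 y1); exists d; split=> // y hy.
  by apply: hd => //; rewrite subrr normr0.
have [m m0 hm] : exists2 m : R, 0 < m & forall i, m <= d i.
  apply: (@fin_uniform R 'I_n (fun i r => r <= d i)).
    by move=> i r1 r2 h _ r12; exact: le_trans h.
  by move=> i; exists (d i) => //; have [] := hd i.
exists (m / (`|Y| + 1)); first by rewrite divr_gt0.
move=> t; rewrite ltr_pdivlMr// => ht i j.
have [_ /(_ (z0 + t *: Y))] := hd i; rewrite addrAC subrr add0r normrZ => /(_ _) h.
have {}h := h _; have /h{}h : `|t| * `|Y| < d i.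
  apply: lt_le_trans (hm i); apply: le_lt_trans ht.
  by rewrite ler_wpM2l// lerDl.
have -> : M (z0 + t *: Y) i j - (i == j)%:R - t * (\matrix_i L i Y) i j =
    (row i (M (z0 + t *: Y)) - row i (M z0) - L i (t *: Y)) 0 j.
  by rewrite (blZ _ _ (sdiff_bl (hM i))) M1 !mxE.
apply: (le_trans (norm_coord _ _)); apply: (le_trans h).
have -> : e / (`|Y| + 1) * (`|t| * `|Y|) = e * `|t| * (`|Y| / (`|Y| + 1)) by ring.
rewrite ler_piMr ?mulr_ge0 ?(ltW e0)//.
by rewrite ler_pdivrMr// mul1r lerDl.
Qed.

(* Compare, to first order along Y, the determinants of the Jacobians of left
   and right multiplication: their quotient is the modular function, at most
   exp(C d), and their logarithmic derivatives differ by tr ad Y. *)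
Lemma tr_ad_bound Y : `|tr_ad G Y| <= C * form_norm (metric_form gm) Y.
Proof.
pose q := form_norm (metric_form gm) Y; have q0 : 0 <= q by exact: form_norm_ge0.
pose LA i u := mul_hessian (u, 0) (0, delta_mx 0 i).
pose LB i u := mul_hessian (0, u) (delta_mx 0 i, 0).
have sA i : sdiff (fun y => row i (right_mul_jac y)) z0 (LA i).
  have -> : (fun y => row i (right_mul_jac y)) = (fun y => 'D_(0, delta_mx 0 i) chart_mul (y, z0)).
    by apply/funext => y; rewrite rowK.
  exact: sdiff_comp (sdiff_pairl z0 z0) (sdiff_derive_mul (0, delta_mx 0 i)).
have sB i : sdiff (fun y => row i (left_mul_jac y)) z0 (LB i).
  have -> : (fun y => row i (left_mul_jac y)) = (fun y => 'D_(delta_mx 0 i, 0) chart_mul (z0, y)).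
    by apply/funext => y; rewrite rowK.
  exact: sdiff_comp (sdiff_pairr z0 z0) (sdiff_derive_mul (delta_mx 0 i, 0)).
(* The diagonal entries of ad Y are differences of mixed second derivatives; the symmetry of the
   Hessian brings each into the form of a derivative in the direction Y of one of the two
   Jacobians. *)
have -> : tr_ad G Y = \tr (\matrix_i LA i Y) - \tr (\matrix_i LB i Y).
  rewrite /tr_ad trace_lin1; apply: trace_rowsB => i.
  by rewrite /LA /LB -[mul_hessian (0, Y) _]mul_hessianC; exact: lie_bracketE.
rewrite distrC; apply: (@rate_bound R (fun t => \det (right_mul_jac (z0 + t *: Y)))
  (fun t => \det (left_mul_jac (z0 + t *: Y)))); first by rewrite mulr_ge0// ltW.
move=> e e0.
have [d1 d10 h1] := det_expansion (expand_line Y sA right_mul_jac0) e0.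
have [d2 d20 h2] := det_expansion (expand_line Y sB left_mul_jac0) e0.
have cq : 0 < C * q + 1 by rewrite ltr_wpDl// mulr_ge0// ltW.
have [d3 d30 h3] := dist1_gexp hgm hinv hX (divr_gt0 e0 cq).
have /near_distP[d4 d40 h4] := chart_img_near0.
have y1 : 0 < `|Y| + 1 by rewrite ltr_wpDl.
exists (Num.min (Num.min d1 d2) (Num.min d3 d4 / (`|Y| + 1))).
  by rewrite !lt_min d10 d20 divr_gt0// lt_min d30.
move=> t; rewrite !lt_min ltr_pdivlMr// lt_min => /andP[/andP[t1 t2] /andP[t3 t4]].
have nY : `|t *: Y| <= `|t| * (`|Y| + 1) by rewrite normrZ ler_wpM2l// lerDl.
split; [exact: h1|exact: h2|].
have hy : chart_img (1%g : G) (z0 + t *: Y).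
  by apply: h4; rewrite addrC addKr; exact: le_lt_trans t4.
rewrite left_mul_jacE// det_mulmx normrM ler_wpM2r//.
have := h3 _ (le_lt_trans nY t3); rewrite /gexp -/z0 (form_normZ (metric_psd hgm)) -/q.
move=> /(conj_jac_le hgm hinv hX hmu C0 hC) h; apply: le_trans h _.
rewrite ler_expR.
have -> : C * ((1 + e / (C * q + 1)) * (`|t| * q)) = (C * q + C * q / (C * q + 1) * e) * `|t|.
  by field; rewrite gt_eqF.
rewrite ler_wpM2r// lerD2l ler_piMl ?(ltW e0)// ler_pdivrMr// mul1r lerDl.
exact: ler01.
Qed.

End TraceAd.

(** * Mollifying the weight *)

Section BumpOnRows.
Context (R : realType) (n : nat).
Local Notation V := 'rV[R]_n.

Lemma sdiff_square_pos (x : R) :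
  @sdiff R R^o R^o (fun y => Num.max 0 y ^+ 2) x (fun h => h * (2 * Num.max 0 x)).
Proof.
split.
  split; first by move=> a u v; rewrite mulrDl -mulrA.
  exists (`|2 * Num.max 0 x| + 1) => [|v]; first by rewrite ltr_wpDl.
  by rewrite normrM mulrC ler_wpM2r// lerDl.
have tay (y z : R) : 0 <= Num.max 0 y ^+ 2 - Num.max 0 z ^+ 2 - 2 * Num.max 0 z * (y - z)
    <= (y - z) ^+ 2.
  have y2 := sqr_ge0 y; have z2 := sqr_ge0 z; have yz2 := sqr_ge0 (y - z).
  have [y0|y0] := leP y 0; have [z0|z0] := leP z 0.
  - by rewrite expr0n/= !(subrr, mulr0, mul0r, lexx).
  - have yz : y * z <= 0 by rewrite mulrC pmulr_rle0.
    by apply/andP; split; lra.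
  - have yz : y * z <= 0 by rewrite pmulr_rle0.
    by apply/andP; split; lra.
  - by apply/andP; split; lra.
have lip (y z : R) : `|Num.max 0 y - Num.max 0 z| <= `|y - z|.
  rewrite ler_norml; have := ler_norm (y - z); have := ler_norm (z - y); rewrite (distrC z).
  by have [y0|y0] := leP y 0; have [z0|z0] := leP z 0; move=> *; apply/andP; split; lra.
move=> e e0; have e4 : 0 < e / 4 by rewrite divr_gt0.
exists (e / 4) => // y z hy hz.
have -> : Num.max 0 y ^+ 2 - Num.max 0 z ^+ 2 - (y - z) * (2 * Num.max 0 x) =
   (Num.max 0 y ^+ 2 - Num.max 0 z ^+ 2 - 2 * Num.max 0 z * (y - z)) +
   2 * (Num.max 0 z - Num.max 0 x) * (y - z) by ring.
have /andP[h1 h2] := tay y z.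
apply: (le_trans (ler_normD _ _)); rewrite ger0_norm//.
have d1 : `|y - z| <= e / 2.
  by have := ler_distD x y z; rewrite (distrC x); move: hy hz; lra.
have d2 : `|2 * (Num.max 0 z - Num.max 0 x) * (y - z)| <= e / 2 * `|y - z|.
  rewrite normrM ler_wpM2r// normrM gtr0_norm//; have := lip z x; move: hz; lra.
have d3 : (y - z) ^+ 2 <= e / 2 * `|y - z|.
  by rewrite -[_ ^+ 2]real_normK ?num_real// expr2 ler_wpM2r.
by move: (le_trans h2 d3) d2; lra.
Qed.

(** The square of a positive part has just one derivative, which is as much as the mollified weight
    is asked for. *)
Definition bump_row (rho : R) (z : V) : R := Num.max 0 (rho ^+ 2 - \sum_i z 0 i ^+ 2) ^+ 2.

Lemma sdiff_bump_row rho z : exists L, sdiff (bump_row rho : V -> R^o) z L.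
Proof.
have bq : bounded_linear (fun h : V => - (\sum_i 2 * z 0 i * h 0 i) : R^o).
  split.
    have sc (c x : R) : c *: (x : R^o) = c * x by [].
    move=> a u v; rewrite sc mulrN mulr_sumr -opprD -big_split/=.
    by congr (- _); apply: eq_bigr => i _; rewrite !mxE; ring.
  exists (\sum_i `|2 * z 0 i| + 1); first by rewrite ltr_wpDl// sumr_ge0.
  move=> h; rewrite normrN (le_trans (ler_norm_sum _ _ _))// mulrDl ler_wpDr ?mul1r//.
  by rewrite mulr_suml ler_sum// => i _; rewrite normrM ler_wpM2l// norm_coord.
have sq : sdiff (fun y : V => (rho ^+ 2 - \sum_i y 0 i ^+ 2) : R^o) z
    (fun h => - (\sum_i 2 * z 0 i * h 0 i)).
  split=> // e e0; have n1 : 0 < 2 * n%:R + 1 :> R by rewrite ltr_wpDl// mulr_ge0.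
  exists (e / (2 * n%:R + 1)); first by rewrite divr_gt0.
  move=> y w hy hw.
  have -> : rho ^+ 2 - \sum_i y 0 i ^+ 2 - (rho ^+ 2 - \sum_i w 0 i ^+ 2) -
      - (\sum_i 2 * z 0 i * (y - w) 0 i) =
      - \sum_i ((y - z) 0 i + (w - z) 0 i) * (y - w) 0 i.
    have -> : \sum_i ((y - z) 0 i + (w - z) 0 i) * (y - w) 0 i =
        \sum_i y 0 i ^+ 2 - \sum_i w 0 i ^+ 2 - \sum_i 2 * z 0 i * (y - w) 0 i.
      by rewrite -!sumrB; apply: eq_bigr => i _; rewrite !mxE; ring.
    by ring.
  rewrite normrN (le_trans (ler_norm_sum _ _ _))//.
  apply: (@le_trans _ _ (\sum_(i < n) 2 * (e / (2 * n%:R + 1)) * `|y - w|)).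
    apply: ler_sum => i _; rewrite normrM ler_pM ?norm_coord// (le_trans (ler_normD _ _))//.
    rewrite mulr_natl mulr2n lerD// (le_trans (norm_coord _ _))// ltW//.
  rewrite sumr_const card_ord -[leLHS]mulr_natl mulrA ler_wpM2r//.
  have -> : n%:R * (2 * (e / (2 * n%:R + 1))) = e * (2 * n%:R / (2 * n%:R + 1)) by ring.
  by rewrite ler_piMr ?(ltW e0)// ler_pdivrMr// mul1r lerDl.
eexists; exact: sdiff_comp sq (sdiff_square_pos _).
Qed.

Lemma bump_row_ge0 rho z : 0 <= bump_row rho z.
Proof. by rewrite /bump_row exprn_ge0// le_max lexx. Qed.

Lemma bump_row_le rho z : bump_row rho z <= (rho ^+ 2) ^+ 2.
Proof.
rewrite /bump_row lerXn2r ?nnegrE ?le_max ?lexx ?sqr_ge0// ge_max sqr_ge0 lerBlDr lerDl/=.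
by apply: sumr_ge0 => i _; exact: sqr_ge0.
Qed.

Lemma bump_row_support rho z : 0 <= rho -> bump_row rho z != 0 -> `|z| <= rho.
Proof.
move=> rho0; have [h|h] := leP (rho ^+ 2 - \sum_i z 0 i ^+ 2) 0.
  by rewrite /bump_row; move/max_idPl: h => ->; rewrite expr0n eqxx.
move=> _; apply: norm_rV_le => // i.
rewrite -(@ler_pXn2r _ 2)// ?nnegrE// real_normK ?num_real//.
rewrite subr_gt0 in h; apply: le_trans (ltW h).
by rewrite (bigD1 i)//= lerDl; apply: sumr_ge0 => j _; exact: sqr_ge0.
Qed.

Lemma bump_row_gt0 rho : 0 < rho -> exists2 d : R, 0 < d &
  forall z, `|z| < d -> 0 < bump_row rho z.
Proof.
move=> rho0; have n1 : 0 < n%:R + 1 :> R by rewrite ltr_wpDl.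
exists (Num.min 1 (rho ^+ 2 / (n%:R + 1))); first by rewrite lt_min ltr01 divr_gt0// exprn_gt0.
move=> z; rewrite lt_min => /andP[z1 z2].
have h : \sum_i z 0 i ^+ 2 < rho ^+ 2.
  apply: (@le_lt_trans _ _ ((n%:R + 1) * `|z|)); last by rewrite mulrC -ltr_pdivlMr.
  rewrite mulrDl ler_wpDr ?mul1r// mulr_natl -[n in _ *+ n]card_ord -sumr_const ler_sum// => i _.
  rewrite -[_ ^+ 2]real_normK ?num_real// expr2.
  by apply: (@le_trans _ _ (`|z| * 1)); [rewrite ler_pM ?norm_coord// (le_trans (norm_coord _ _))// ltW | rewrite mulr1].
by rewrite /bump_row exprn_gt0// lt_max subr_gt0 h orbT.
Qed.

Lemma compact_row_ball (rho : R) : compact [set u : V | `|u| <= rho].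
Proof.
apply: bounded_closed_compact.
  by exists rho; split; [exact: num_real | move=> x hx u hu; exact: le_trans hu (ltW hx)].
have -> : [set u : V | `|u| <= rho] = closed_ball_ Num.Def.normr 0 rho.
  by apply/seteqP; split=> u /=; rewrite /closed_ball_ /= sub0r normrN.
exact: closed_closed_ball_.
Qed.

(** States, uniformly on a compact set, that the derivative is linear in the direction, but in terms
    of increments: such an inequality passes through the integral defining the mollified weight
    without differentiating it. *)
Lemma sdiff_additive_uniform (I : finType) (phi : V * V -> R^o) (K : set V) (X : I -> V) :
  compact K -> (forall u, K u -> exists L, sdiff phi (0, u) L) ->
  forall e, 0 < e -> exists2 d : R, 0 < d & forall t u (a : I -> R), `|t| < d -> K u ->
    (forall j, `|a j| <= 1) ->
    `|phi (t *: \sum_j a j *: X j, u) - phi (0, u) -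
      \sum_j a j * (phi (t *: X j, u) - phi (0, u))| <= e * `|t|.
Proof.
move=> /compact_near_coveringP cK hphi e e0; pose M := \sum_j `|X j| + 1.
have M0 : 0 < M by rewrite ltr_wpDl// sumr_ge0.
have XM j : `|X j| <= M by rewrite /M (bigD1 j)//= -addrA lerDl addr_ge0// sumr_ge0.
have SM (a : I -> R) : (forall j, `|a j| <= 1) -> `|\sum_j a j *: X j| <= M.
  move=> ha; rewrite (le_trans (ler_norm_sum _ _ _))// /M ler_wpDr// ler_sum// => j _.
  by rewrite normrZ ler_piMl.
pose P (d : R) (u : V) := forall t (a : I -> R), `|t| < d -> (forall j, `|a j| <= 1) ->
    `|phi (t *: \sum_j a j *: X j, u) - phi (0, u) -
      \sum_j a j * (phi (t *: X j, u) - phi (0, u))| <= e * `|t|.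
(* Compactness in its near-covering form. [P d] is vacuous for d <= 0, so a full neighbourhood of 0
   may be asked for. *)
suff : \forall d \near (0 : R), K `<=` P d.
  move=> /(@near_distP R R^o)[d d0 hd]; exists (d / 2); first by rewrite divr_gt0.
  move=> t u a ht Ku ha; apply: (hd (d / 2)) => //.
  by rewrite subr0 gtr0_norm ?divr_gt0// ltr_pdivrMr// ltr_pMr// ltr1n.
apply: (cK R (nbhs (0 : R)) P) => u0 /hphi[L [bL hL]].
have N0 : 0 < #|I|%:R + 1 :> R by rewrite ltr_wpDl.
have e2 : 0 < e / ((#|I|%:R + 1) * M) by rewrite divr_gt0// mulr_gt0.
have [d d0 hd] := hL _ e2.
have near_u : \forall u \near u0, `|u - u0| < d by apply/near_distP; exists d.
have near_d : \forall q \near (0 : R), q < d / M.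
  apply/(@near_distP R R^o); exists (d / M); first by rewrite divr_gt0.
  by move=> y; rewrite subr0; apply: le_lt_trans; exact: ler_norm.
exists ([set u | `|u - u0| < d], [set q | q < d / M]) => //= -[u q] /= [hu hq] t a ht ha.
have tM : `|t| * M < d by rewrite -ltr_pdivlMr// (lt_trans ht).
have est (z : V) : `|z| <= M ->
    `|phi (t *: z, u) - phi (0, u) - t * L (z, 0)| <= e / (#|I|%:R + 1) * `|t|.
  move=> zM; have tz : `|t *: z| < d by rewrite normrZ (le_lt_trans _ tM)// ler_wpM2l.
  have := hd (t *: z, u) (0, u); rewrite !prod_normE/= !subr0 subrr normr0 !gt_max.
  rewrite tz hu d0/= => /(_ isT isT).
  have -> : (t *: z, u) - (0, u) = t *: (z, 0) :> V * V.
    by congr pair; rewrite /= ?subr0 ?subrr ?scaler0.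
  rewrite blZ// => h; apply: (le_trans h).
  rewrite max_l// normrZ mulrCA [leLHS]mulrC ler_wpM2r//.
  have -> : e / ((#|I|%:R + 1) * M) * `|z| = e / (#|I|%:R + 1) * (`|z| / M).
    by field; rewrite !gt_eqF.
  by rewrite ler_piMr ?divr_ge0 ?(ltW e0) ?(ltW N0)// ler_pdivrMr// mul1r.
have Lsum : t * L (\sum_j a j *: X j, 0) = \sum_j a j * (t * L (X j, 0)).
  have -> : (\sum_j a j *: X j, 0) = \sum_j a j *: (X j, 0) :> V * V.
    apply: (big_ind2 (fun (x : V) (y : V * V) => (x, 0) = y)) => //.
      by move=> x1 _ x2 _ <- <-; congr pair; rewrite /= addr0.
    by move=> j _; congr pair; rewrite /= scaler0.
  elim/big_rec2: _ => [|j x y _ <-]; first by rewrite bl0// mulr0.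
  by rewrite blD// blZ// mulrDr; congr (_ + _); exact: mulrCA.
have -> : phi (t *: \sum_j a j *: X j, u) - phi (0, u) -
      \sum_j a j * (phi (t *: X j, u) - phi (0, u)) =
    (phi (t *: \sum_j a j *: X j, u) - phi (0, u) - t * L (\sum_j a j *: X j, 0)) -
    \sum_j a j * (phi (t *: X j, u) - phi (0, u) - t * L (X j, 0)).
  rewrite Lsum; under [X in _ = _ - X]eq_bigr => j _ do rewrite mulrBr.
  by rewrite sumrB opprB addrA subrK.
apply: (le_trans (ler_normB _ _)).
apply: (@le_trans _ _ (e / (#|I|%:R + 1) * `|t| + \sum_(j : I) e / (#|I|%:R + 1) * `|t|)).
  apply: lerD; first exact/est/SM.
  apply: (le_trans (ler_norm_sum _ _ _)); apply: ler_sum => j _.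
  by rewrite normrM -[leRHS]mul1r ler_pM// est.
rewrite sumr_const -[_ *+ #|_|]mulr_natl [leLHS]addrC.
have -> : #|I|%:R * (e / (#|I|%:R + 1) * `|t|) + e / (#|I|%:R + 1) * `|t| = e * `|t|.
  by field; rewrite gt_eqF.
by [].
Qed.

End BumpOnRows.

(** A single d gives both the radius and the constant d^-1, so that compactness, applied as d tends
    to 0, delivers both at once. *)
Lemma sdiff_lip_uniform (R : realType) (V W : normedModType R) (phi : V * V -> W) (K : set V) :
  compact K -> (forall u, K u -> exists L, sdiff phi (0, u) L) ->
  exists2 d : R, 0 < d & forall z u, `|z| < d -> K u ->
    `|phi (z, u) - phi (0, u)| <= d^-1 * `|z|.
Proof.
move=> /compact_near_coveringP cK hphi.
pose P (d : R) (u : V) := 0 < d -> forall z, `|z| < d ->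
  `|phi (z, u) - phi (0, u)| <= d^-1 * `|z|.
suff : \forall d \near (0 : R), K `<=` P d.
  move=> /(@near_distP R R^o)[d d0 hd]; exists (d / 2); first by rewrite divr_gt0.
  move=> z u hz Ku; apply: (hd (d / 2)) => //; last by rewrite divr_gt0.
  by rewrite subr0 gtr0_norm ?divr_gt0// ltr_pdivrMr// ltr_pMr// ltr1n.
apply: (cK R (nbhs (0 : R)) P) => u0 /hphi[L /sdiff_lip[k k0 [d d0 hd]]].
have near_u : \forall u \near u0, `|u - u0| < d by apply/near_distP; exists d.
have near_d : \forall q \near (0 : R), q < Num.min d k^-1.
  apply/(@near_distP R R^o); exists (Num.min d k^-1); first by rewrite lt_min d0 invr_gt0.
  by move=> y; rewrite subr0; apply: le_lt_trans; exact: ler_norm.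
exists ([set u | `|u - u0| < d], [set q | q < Num.min d k^-1]) => //= -[u q] /= [hu].
rewrite lt_min => /andP[q1 q2] q0 z hz.
have := hd (z, u) (0, u); rewrite !prod_normE/= !subr0 !subrr !normr0 !gt_max.
rewrite (lt_trans hz q1) hu d0/= => /(_ isT isT) h; apply: (le_trans h).
rewrite max_l// ler_wpM2r//.
by rewrite -[k]invrK lef_pV2 ?posrE ?invr_gt0// ltW.
Qed.

Section GroupBump.
Context (R : realType) (n : nat) (G : lieGroupType R n).
Local Notation V := 'rV[R]_n.

Lemma sdiff_gexp_mul (p : V * V) : gdom G p.1 -> gdom G p.2 ->
  chart_dom (1%g : G) (gexp G p.1 * gexp G p.2)%g ->
  exists L, sdiff (fun p : V * V => glog (gexp G p.1 * gexp G p.2)%g) p L.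
Proof.
move=> h1 h2 h3; apply: sdiff_glog h3; apply: gdiffM.
  by apply: (gdiff_gexp (sdiff_linear _ (bl_fst _ _))).
by apply: (gdiff_gexp (sdiff_linear _ (bl_snd _ _))).
Qed.

Lemma gexp_mul_near0 : exists2 d : R, 0 < d & forall z u : V, `|z| < d -> `|u| < d ->
  [/\ gdom G z, gdom G u, chart_dom (1%g : G) (gexp G z * gexp G u)%g,
      chart_dom (1%g : G) ((gexp G z)^-1 * gexp G u)%g &
      `|glog ((gexp G z)^-1 * gexp G u)%g - u| <= d^-1 * `|z|].
Proof.
have /near_distP[d1 d10 h1] : \forall z \near (0 : V), gdom G z.
  by apply: open_nbhs_nbhs; split; [exact: gdom_open | exact: gdom0].
have g1 : gdiff (fun p : V * V => gexp G p.1) (0, 0).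
  by apply: (gdiff_gexp (sdiff_linear _ (bl_fst _ _))); exact: gdom0.
have g2 : gdiff (fun p : V * V => gexp G p.2) (0, 0).
  by apply: (gdiff_gexp (sdiff_linear _ (bl_snd _ _))); exact: gdom0.
have gM := gdiffM g1 g2; have gD := gdiffM (gdiffV g1) g2.
have /near_distP[d2 d20 h2] : \forall p \near ((0, 0) : V * V),
    chart_dom (1%g : G) (gexp G p.1 * gexp G p.2)%g.
  by apply: (chart_dom_near gM.1); rewrite /= !gexp0 mulg1; exact: dom1.
have dd : chart_dom (1%g : G) ((gexp G (0 : V))^-1 * gexp G (0 : V))%g.
  by rewrite mulVg; exact: dom1.
have /near_distP[d3 d30 h3] : \forall p \near ((0, 0) : V * V),
    chart_dom (1%g : G) ((gexp G p.1)^-1 * gexp G p.2)%g.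
  exact: (chart_dom_near gD.1).
have [L /sdiff_lip[k k0 [d4 d40 h4]]] := sdiff_glog gD dd.
pose d := Num.min (Num.min d1 d2) (Num.min d3 (Num.min d4 k^-1)).
have d0 : 0 < d by rewrite !lt_min d10 d20 d30 d40 invr_gt0.
exists d => // z u hz hu.
have hm q : `|z| < q -> `|u| < q -> `|(z, u) - (0, 0) : V * V| < q.
  by move=> a b; rewrite prod_normE/= !subr0 gt_max a.
have : d <= d1 by rewrite /d !ge_min lexx.
have : d <= d2 by rewrite /d !ge_min lexx orbT.
have : d <= d3 by rewrite /d !ge_min lexx !orbT.
have : d <= d4 by rewrite /d !ge_min lexx !orbT.
have : d <= k^-1 by rewrite /d !ge_min lexx !orbT.
move=> e5 e4 e3 e2 e1; split.
- by apply: h1; rewrite subr0 (lt_le_trans hz).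
- by apply: h1; rewrite subr0 (lt_le_trans hu).
- by apply: (h2 (z, u)); apply: hm; [exact: lt_le_trans hz _ | exact: lt_le_trans hu _].
- by apply: (h3 (z, u)); apply: hm; [exact: lt_le_trans hz _ | exact: lt_le_trans hu _].
have := h4 (z, u) (0, u); rewrite /= gexp0 invg1 mul1g gexpK; last first.
  by apply: h1; rewrite subr0 (lt_le_trans hu).
move=> h; apply: le_trans (h _ _) _.
- by apply: hm; [exact: lt_le_trans hz _ | exact: lt_le_trans hu _].
- by rewrite prod_normE/= !subr0 normr0 gt_max d40 (lt_le_trans hu).
rewrite prod_normE/= subr0 subrr normr0 max_l// ler_wpM2r//.
by rewrite -[k]invrK lef_pV2 ?posrE ?invr_gt0.
Qed.

Lemma lie_bump (I : finType) (X : I -> V) (r0 : R) : 0 < r0 ->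
  exists (eta : G -> R) (rho M d0 : R), let K := gexp G @` [set u | `|u| <= rho] in
  [/\ [/\ 0 < rho, rho < r0, 0 < d0 & 0 < M],
      [/\ measurable_fun [set: borel G] (eta : borel G -> R),
          forall y, 0 <= eta y <= M,
          exists2 d : R, 0 < d & forall u, `|u| < d -> 0 < eta (gexp G u) &
          forall y, ~ K y -> eta y = 0],
      forall z y, `|z| < d0 -> ~ K y -> eta (gexp G z * y)%g = 0,
      forall z y, `|z| < d0 -> K y -> `|eta (gexp G z * y)%g - eta y| <= M * `|z| &
      forall e, 0 < e -> exists2 d : R, 0 < d & forall t y (a : I -> R), `|t| < d -> K y ->
        (forall j, `|a j| <= 1) ->
        `|eta (gexp G (t *: \sum_j a j *: X j) * y)%g - eta y -
          \sum_j a j * (eta (gexp G (t *: X j) * y)%g - eta y)| <= e * `|t|].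
Proof.
move=> r00; have [r1 r10 hr1] := gexp_mul_near0.
(* The bump is supported in the smaller ball of radius [sig], so that its small left translates are
   still supported in the ball of radius [rho]. *)
pose rho := Num.min r0 r1 / 2; pose sig := rho / 2.
have m0 : 0 < Num.min r0 r1 by rewrite lt_min r00.
have rho0 : 0 < rho by rewrite divr_gt0.
have sig0 : 0 < sig by rewrite divr_gt0.
have sr : sig < rho by rewrite /sig ltr_pdivrMr// ltr_pMr// ltr1n.
have : rho < Num.min r0 r1 by rewrite /rho ltr_pdivrMr// ltr_pMr// ltr1n.
rewrite lt_min => /andP[rr0 rr1].
pose eta : G -> R := (fun y => bump_row sig (glog y)) \_ (chart_dom (1%g : G)).
have etaE y : chart_dom (1%g : G) y -> eta y = bump_row sig (glog y).
  by move=> hy; rewrite /eta patchE mem_set.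
have eta_supp y : eta y != 0 -> chart_dom (1%g : G) y /\ `|glog y| <= sig.
  rewrite /eta patchE; case: ifPn => [/set_mem hy h|_]; last by rewrite eqxx.
  by split=> //; exact: bump_row_support (ltW sig0) h.
have eta_mul z u : `|z| < r1 -> `|u| < r1 ->
    eta (gexp G z * gexp G u)%g = bump_row sig (glog (gexp G z * gexp G u)%g).
  by move=> hz hu; have [_ _ h _ _] := hr1 z u hz hu; rewrite etaE.
pose phi (p : V * V) : R^o := bump_row sig (glog (gexp G p.1 * gexp G p.2)%g).
have cK := @compact_row_ball R n rho.
have sphi u : `|u| <= rho -> exists L, sdiff phi (0, u) L.
  move=> hu; have [] := hr1 0 u _ (le_lt_trans hu rr1); first by rewrite normr0.
  move=> h1 h2 h3 _ _; have [L hL] := @sdiff_gexp_mul (0, u) h1 h2 h3.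
  have [M hM] := sdiff_bump_row sig (glog (gexp G (0 : V) * gexp G u)%g).
  by eexists; exact: sdiff_comp hL hM.
have phiE z u : `|z| < r1 -> `|u| <= rho ->
    eta (gexp G z * gexp G u)%g = phi (z, u) /\ eta (gexp G u) = phi (0, u).
  move=> hz hu; have u1 := le_lt_trans hu rr1; split; first by rewrite eta_mul.
  by rewrite /phi/= -eta_mul ?normr0// gexp0 mul1g.
have [d1 d10 hd1] := sdiff_lip_uniform cK sphi.
pose d0 := Num.min (Num.min r1 d1) (sig * r1).
have d00 : 0 < d0 by rewrite !lt_min r10 d10 mulr_gt0.
exists eta, rho, ((sig ^+ 2) ^+ 2 + d1^-1), d0; split.
- by split=> //; rewrite ltr_wpDl ?invr_gt0// exprn_ge0// sqr_ge0.
- split.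
  + apply/(measurable_restrictT _ (borel_open (chart_dom_open (1%g : G)))).
    apply: (borel_continuous_on_real (chart_dom_open (1%g : G))).
    move=> y hy; have [L hL] := sdiff_bump_row sig (glog y).
    by apply: continuous_comp; [exact: glog_continuous | exact: sdiff_continuous hL].
  + move=> y; rewrite /eta patchE; case: ifPn => _; last first.
      rewrite lexx/= addr_ge0//; first by rewrite exprn_ge0// sqr_ge0.
      by rewrite invr_ge0 ltW.
    by rewrite bump_row_ge0/= (le_trans (bump_row_le _ _))// lerDl invr_ge0 ltW.
  + have [d d0' hd] := bump_row_gt0 n sig0; exists (Num.min d r1); first by rewrite lt_min d0'.
    move=> u; rewrite lt_min => /andP[u1 u2].
    have [] := hr1 u u u2 u2 => hu _ _ _ _.
    by rewrite etaE; [rewrite gexpK//; exact: hd | exact: gexp_dom].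
  + move=> y nK; apply: contra_notP nK => /eqP /eta_supp[h1 h2].
    by exists (glog y); [exact: le_trans h2 (ltW sr) | rewrite glogK].
- move=> z y; rewrite !lt_min => /andP[/andP[z1 z2] z3] nK.
  apply: contra_notP nK => /eqP /eta_supp[h1 h2].
  set w := glog (gexp G z * y)%g in h2.
  have yE : y = ((gexp G z)^-1 * gexp G w)%g by rewrite /w glogK// mulKg.
  have w1 : `|w| < r1 by rewrite (le_lt_trans h2)// (lt_trans sr).
  have [_ _ _ hd hb] := hr1 z w z1 w1; rewrite -yE in hd hb.
  exists (glog y); last by rewrite glogK.
  rewrite /= -[glog y](subrK w) (le_trans (ler_normD _ _))// (le_trans (lerD hb h2))//.
  have -> : rho = sig + sig by rewrite /sig -splitr.
  by rewrite lerD2r mulrC ler_pdivrMr// ltW.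
- move=> z y; rewrite !lt_min => /andP[/andP[z1 z2] z3] [u hu <-].
  have [-> ->] := phiE z u z1 hu; apply: (le_trans (hd1 _ _ z2 hu)).
  by rewrite ler_wpM2r// lerDr exprn_ge0// sqr_ge0.
move=> e e0; have [d d0' hd] := sdiff_additive_uniform X cK sphi e0.
pose S := \sum_j `|X j| + 1; have S0 : 0 < S by rewrite ltr_wpDl// sumr_ge0.
exists (Num.min d (r1 / S)); first by rewrite lt_min d0' divr_gt0.
move=> t y a; rewrite lt_min ltr_pdivlMr// => /andP[t1 t2] [u hu <-] ha.
have small (z : V) : `|z| <= S -> `|t *: z| < r1.
  by move=> zS; rewrite normrZ (le_lt_trans _ t2)// ler_wpM2l.
have h1 : `|t *: \sum_j a j *: X j| < r1.
  apply: small; rewrite (le_trans (ler_norm_sum _ _ _))// /S ler_wpDr// ler_sum// => j _.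
  by rewrite normrZ ler_piMl.
have h2 j : `|t *: X j| < r1.
  by apply: small; rewrite /S (bigD1 j)//= -addrA lerDl addr_ge0// sumr_ge0.
have [-> ->] := phiE _ _ h1 hu.
have -> : \sum_j a j * (eta (gexp G (t *: X j) * gexp G u)%g - phi (0, u)) =
    \sum_j a j * (phi (t *: X j, u) - phi (0, u)).
  by apply: eq_bigr => j _; have [-> _] := phiE (t *: X j) u (h2 j) hu.
exact: hd.
Qed.

End GroupBump.

(** * Real-valued integrals and convolution with a bump *)

Section RealValuedIntegrals.
Context (R : realType) (d : measure_display) (T : measurableType d).
Context (mu : {measure set T -> \bar R}).
Implicit Types f g : T -> R.

Definition L1 f := mu.-integrable [set: T] (EFin \o f).
Definition Rint f : R := Rintegral mu [set: T] f.

Lemma L1_measurable f : L1 f -> measurable_fun [set: T] f.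
Proof. by move=> /integrableP[mf _]; apply/measurable_EFinP. Qed.

Lemma L1_le f g : measurable_fun [set: T] f -> (forall x, `|f x| <= g x) -> L1 g -> L1 f.
Proof.
move=> mf fg hg; apply: (le_integrable measurableT (g := EFin \o g)) => //.
  exact/measurable_EFinP.
by move=> x _; rewrite /= lee_fin (le_trans (fg x))// ler_norm.
Qed.

Lemma L1_ge0 f : measurable_fun [set: T] f -> (forall x, 0 <= f x) ->
  (\int[mu]_x (f x)%:E < +oo)%E -> L1 f.
Proof.
move=> mf f0 h; apply/integrableP; split; first exact/measurable_EFinP.
by rewrite (eq_integral (fun x => (f x)%:E))// => x _ /=; rewrite ger0_norm.
Qed.

Lemma L1D f g : L1 f -> L1 g -> L1 (fun x => f x + g x).
Proof. exact: integrableD. Qed.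

Lemma L1Z (a : R) f : L1 f -> L1 (fun x => a * f x).
Proof. exact: integrableZl. Qed.

Lemma L1_indic (A : set T) : measurable A -> (mu A < +oo)%E -> L1 (\1_A).
Proof.
move=> mA fA; apply: L1_ge0; first exact: measurable_indic.
  by move=> x; rewrite indicE.
by rewrite integral_indic// setIT.
Qed.

Lemma L1_sum (I : Type) (s : seq I) (F : I -> T -> R) :
  (forall i, L1 (F i)) -> L1 (fun x => \sum_(i <- s) F i x).
Proof.
move=> hF; elim: s => [|i s ih].
  have -> : (fun x => \sum_(i <- [::]) F i x) = (cst 0 : T -> R).
    by apply/funext => x; rewrite big_nil.
  exact: integrable0.
have -> : (fun x => \sum_(j <- i :: s) F j x) = (fun x => F i x + \sum_(j <- s) F j x).
  by apply/funext => x; rewrite big_cons.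
exact: L1D.
Qed.

Lemma eq_Rint f g : (forall x, f x = g x) -> Rint f = Rint g.
Proof. by move=> e; apply: eq_Rintegral => x _; exact: e. Qed.

Lemma RintE f : L1 f -> (\int[mu]_x (f x)%:E)%E = (Rint f)%:E.
Proof. by move=> hf; rewrite /Rint /Rintegral fineK//; exact: integrable_fin_num. Qed.

Lemma RintD f g : L1 f -> L1 g -> Rint (fun x => f x + g x) = Rint f + Rint g.
Proof. exact: RintegralD. Qed.

Lemma RintZ (a : R) f : L1 f -> Rint (fun x => a * f x) = a * Rint f.
Proof. exact: RintegralZl. Qed.

Lemma Rint_sum (I : Type) (s : seq I) (F : I -> T -> R) :
  (forall i, L1 (F i)) -> Rint (fun x => \sum_(i <- s) F i x) = \sum_(i <- s) Rint (F i).
Proof.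
move=> hF; elim: s => [|i s ih].
  rewrite big_nil -[RHS](mul0r (Rint (cst 0))) -RintZ; last exact: integrable0.
  by apply: eq_Rint => x; rewrite big_nil mul0r.
rewrite big_cons -ih -RintD//; last exact: L1_sum.
by apply: eq_Rint => x; rewrite big_cons.
Qed.

Lemma le_Rint f g : L1 f -> L1 g -> (forall x, f x <= g x) -> Rint f <= Rint g.
Proof. by move=> hf hg fg; exact: le_Rintegral. Qed.

Lemma Rint_ge0 f : (forall x, 0 <= f x) -> 0 <= Rint f.
Proof. by move=> f0; exact: Rintegral_ge0. Qed.

Lemma Rint_indic (A : set T) : measurable A -> Rint (\1_A) = fine (mu A).
Proof. by move=> mA; rewrite /Rint /Rintegral integral_indic// setIT. Qed.

Lemma Rint_combination_le (I : Type) (s : seq I) (a : I -> R) (F : I -> T -> R) g :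
  (forall i, L1 (F i)) -> L1 g -> (forall x, `|\sum_(i <- s) a i * F i x| <= g x) ->
  `|\sum_(i <- s) a i * Rint (F i)| <= Rint g.
Proof.
move=> hF hg h; have hs := L1_sum s (fun i => L1Z (a i) (hF i)).
have -> : \sum_(i <- s) a i * Rint (F i) = Rint (fun x => \sum_(i <- s) a i * F i x).
  rewrite Rint_sum; last by move=> i; exact: L1Z.
  by apply: eq_bigr => i _; rewrite RintZ.
rewrite ler_norml; apply/andP; split; last first.
  by apply: le_Rint => // x; exact: le_trans (ler_norm _) (h x).
rewrite -mulN1r -RintZ//; apply: le_Rint => //; first exact: L1Z.
by move=> x; rewrite mulN1r; have := h x; rewrite ler_norml => /andP[].
Qed.

End RealValuedIntegrals.

Section Smoothing.
Context (R : realType) (n : nat) (G : lieGroupType R n) (gm : G -> 'M[R]_n).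
Hypothesis hgm : is_riemannian_metric gm.
Hypothesis hinv : left_invariant_metric gm.
Context (X : 'I_n -> 'rV[R]_n) (hX : is_orthonormal_basis gm X).
Context (mu : {measure set (borel G) -> \bar R}) (hmu : is_riemannian_measure gm mu).
Local Notation V := 'rV[R]_n.
Context (eta : G -> R) (K : set G) (M d0 : R).
Hypothesis M0 : 0 < M.
Hypothesis mK : @measurable _ (borel G) K.
Hypothesis fK : (mu K < +oo)%E.
Hypothesis meta : measurable_fun [set: borel G] (eta : borel G -> R).
Hypothesis eta_bound : forall y, 0 <= eta y <= M.
Hypothesis eta_supp : forall y, ~ K y -> eta y = 0.
Hypothesis eta_supp_near : forall z y, `|z| < d0 -> ~ K y -> eta (gexp G z * y)%g = 0.
Hypothesis eta_lip : forall z y, `|z| < d0 -> K y ->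
  `|eta (gexp G z * y)%g - eta y| <= M * `|z|.
Hypothesis eta_additive : forall e, 0 < e -> exists2 d : R, 0 < d &
  forall t y (a : 'I_n -> R), `|t| < d -> K y -> (forall j, `|a j| <= 1) ->
    `|eta (gexp G (t *: \sum_j a j *: X j) * y)%g - eta y -
      \sum_j a j * (eta (gexp G (t *: X j) * y)%g - eta y)| <= e * `|t|.

Context (p : G -> R) (A : R).
Hypothesis mp : measurable_fun [set: borel G] (p : borel G -> R).
Hypothesis p0 : forall g, 0 <= p g.
Hypothesis A0 : 0 < A.
Hypothesis pA : forall y g, K y -> p (y^-1 * g)%g <= A * p g /\ p g <= A * p (y^-1 * g)%g.

(** The convolution of eta with p. By left invariance a left translation of the argument falls on
    eta, so increments of the result are controlled by those of eta, whatever the regularity of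
    p. *)
Definition smoothing (g : G) : R := Rint mu (fun y : borel G => eta y * p (y^-1 * g)%g).

Let mpy g : measurable_fun [set: borel G] (fun y : borel G => p (y^-1 * g)%g).
Proof.
have c : continuous (fun y : G => y^-1 * g)%g.
  have -> : (fun y : G => y^-1 * g)%g = (fun x : G => 1 * x * g)%g \o (fun y : G => y^-1)%g.
    by apply/funext => y /=; rewrite mul1g.
  move=> y; apply: continuous_comp; first exact: lie_inv_continuous.
  exact: translation_continuous.
by apply: (measurableT_comp mp (borel_continuous c)).
Qed.

Let bound_L1 g B : L1 mu (fun y : borel G => B * (\1_K y * (A * p g))).
Proof.
have -> : (fun y : borel G => B * (\1_K y * (A * p g))) =
    (fun y : borel G => (B * (A * p g)) * \1_K y).
  by apply/funext => y; ring.
by apply: L1Z; exact: L1_indic.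
Qed.

Let dominated_L1 (f : G -> R) g B : measurable_fun [set: borel G] (f : borel G -> R) ->
  0 <= B -> (forall y, `|f y| <= B * \1_K y) -> L1 mu (fun y : borel G => f y * p (y^-1 * g)%g).
Proof.
move=> mf B0 hf; apply: (L1_le _ _ (bound_L1 g B)); first exact: measurable_funM mf (mpy g).
move=> y; rewrite normrM (ger0_norm (p0 _)) [in leRHS]mulrA; have := hf y; rewrite indicE.
have [/set_mem Ky|nK] := boolP (y \in K).
  by rewrite !mulr1 => h; apply: ler_pM => //; have [] := pA g Ky.
by rewrite mulr0 !mul0r => h; rewrite (le_anti (introT andP (conj h (normr_ge0 _)))) mul0r.
Qed.

Let bound_Rint g B : Rint mu (fun y : borel G => B * (\1_K y * (A * p g))) =
  B * (fine (mu K) * A) * p g.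
Proof.
have -> : (fun y : borel G => B * (\1_K y * (A * p g))) =
    (fun y : borel G => (B * (A * p g)) * \1_K y).
  by apply/funext => y; ring.
by rewrite RintZ ?Rint_indic//; [ring | exact: L1_indic].
Qed.

Let eta_translate_le z y : `|z| < d0 -> `|eta (gexp G z * y)%g| <= M * \1_K y.
Proof.
move=> hz; rewrite indicE; have [/set_mem Ky|nK] := boolP (y \in K).
  by rewrite mulr1; have /andP[h1 h2] := eta_bound (gexp G z * y)%g; rewrite ger0_norm.
rewrite eta_supp_near ?normr0 ?mulr0//.
by move=> Ky; move: nK; rewrite notin_setE.
Qed.

Let meta_translate h : measurable_fun [set: borel G] (fun y : borel G => eta (h * y)%g).
Proof.
have c : continuous (fun y : G => h * y)%g.
  move=> y; have := @translation_continuous R n G h 1%g y.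
  by under [X in continuous_at _ X]eq_fun do rewrite mulg1.
by apply: (measurableT_comp meta (borel_continuous c)).
Qed.

Let translate_L1 z g : `|z| < d0 ->
  L1 mu (fun y : borel G => eta (gexp G z * y)%g * p (y^-1 * g)%g).
Proof.
by move=> hz; apply: (@dominated_L1 _ g M) => //; [exact: ltW | move=> y; exact: eta_translate_le].
Qed.

Lemma smoothing_translate h g :
  smoothing (h * g)%g = Rint mu (fun y : borel G => eta (h * y)%g * p (y^-1 * g)%g).
Proof.
have := haar_integral_left hgm hinv hX hmu h
  (F := fun y => (eta y * p (y^-1 * (h * g))%g)%:E).
rewrite /smoothing /Rint /Rintegral => <-.
- congr fine; apply: eq_integral => y _; congr (_ * p _)%:E.
  by rewrite invgM -mulgA mulKg.
- apply/measurable_EFinP; apply: measurable_funM => //; exact: mpy.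
- by move=> y; rewrite lee_fin mulr_ge0//; have /andP[] := eta_bound y.
Qed.

Hypothesis d00 : 0 < d0.

Lemma smoothing_L1 g : L1 mu (fun y : borel G => eta y * p (y^-1 * g)%g).
Proof.
have := @translate_L1 0 g; rewrite normr0 gexp0 => /(_ d00).
by congr L1; apply/funext => y; rewrite mul1g.
Qed.

Lemma smoothing_compare (E : R) g g' :
  (forall y, K y -> p (y^-1 * g)%g <= E * p (y^-1 * g')%g) -> smoothing g <= E * smoothing g'.
Proof.
move=> h; rewrite /smoothing -RintZ; last exact: smoothing_L1.
apply: le_Rint; [exact: smoothing_L1 | apply: L1Z; exact: smoothing_L1 | move=> y /=].
have [Ky|nK] := pselect (K y); last by rewrite eta_supp// !mul0r mulr0.
by rewrite mulrCA; apply: ler_wpM2l; [have /andP[] := eta_bound y | exact: h].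
Qed.

Lemma smoothing_ge0 g : 0 <= smoothing g.
Proof. by apply: Rint_ge0 => y; rewrite mulr_ge0//; have /andP[] := eta_bound y. Qed.

Lemma smoothing_le g : smoothing g <= M * (fine (mu K) * A) * p g.
Proof.
rewrite -bound_Rint; apply: le_Rint; [exact: smoothing_L1 | exact: bound_L1 |].
move=> y; rewrite indicE; have [/set_mem Ky|nK] := boolP (y \in K).
  rewrite mul1r; have /andP[h1 h2] := eta_bound y; apply: ler_pM => //.
  by have [] := pA g Ky.
by rewrite eta_supp ?mul0r ?mulr0// => Ky; move: nK; rewrite notin_setE.
Qed.

Lemma smoothing_ge g : Rint mu (eta : borel G -> R) / A * p g <= smoothing g.
Proof.
have eL : L1 mu (eta : borel G -> R).
  apply: (L1_le meta _ (L1Z M (L1_indic mK fK))) => y.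
  by have := @eta_translate_le 0 y; rewrite normr0 gexp0 mul1g; exact.
rewrite mulrAC ler_pdivrMr// mulrC -RintZ// mulrC -RintZ; last exact: smoothing_L1.
apply: le_Rint; [exact: L1Z | apply: L1Z; exact: smoothing_L1 | move=> y /=].
have /andP[h1 _] := eta_bound y.
have [Ky|nK] := pselect (K y); last by rewrite eta_supp// mul0r !mulr0.
rewrite mulrCA mulrC ler_wpM2l//; by have [] := pA g Ky.
Qed.

Lemma smoothing_lip z g : `|z| < d0 ->
  `|smoothing (gexp G z * g)%g - smoothing g| <= M * (fine (mu K) * A) * p g * `|z|.
Proof.
move=> hz; rewrite smoothing_translate -[smoothing g]mul1r.
pose F (b : bool) (y : borel G) := if b then eta (gexp G z * y)%g * p (y^-1 * g)%g
  else eta y * p (y^-1 * g)%g.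
have := @Rint_combination_le _ _ _ mu bool [:: true; false] (fun b => if b then 1 else -1) F
  (fun y => M * `|z| * (\1_K y * (A * p g))).
rewrite !big_cons !big_nil /= bound_Rint.
move=> h; apply: (le_trans (le_trans _ (h _ _ _))).
- by rewrite /F /smoothing addr0 !mul1r mulN1r.
- by case; [exact: translate_L1 | exact: smoothing_L1].
- exact: bound_L1.
- move=> y; rewrite !big_cons !big_nil addr0 /F mul1r mulN1r -mulrBl normrM (ger0_norm (p0 _)) indicE.
  have [/set_mem Ky|nK] := boolP (y \in K).
    by rewrite mul1r; apply: ler_pM => //; [exact: eta_lip | have [] := pA g Ky].
  have nK' : ~ K y by move=> Ky; move: nK; rewrite notin_setE.
  by rewrite eta_supp_near// eta_supp// subrr normr0 !mul0r mulr0.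
by rewrite -!mulrA [`|z| * _]mulrC -!mulrA.
Qed.

Lemma smoothing_additive e : 0 < e -> exists2 d : R, 0 < d &
  forall t g (a : 'I_n -> R), `|t| < d -> (forall j, `|a j| <= 1) ->
    `|smoothing (gexp G (t *: \sum_j a j *: X j) * g)%g - smoothing g -
      \sum_j a j * (smoothing (gexp G (t *: X j) * g)%g - smoothing g)| <= e * p g * `|t|.
Proof.
move=> e0; pose k := fine (mu K) * A + 1.
have k0 : 0 < k by rewrite ltr_wpDl// mulr_ge0 ?(ltW A0)// fine_ge0.
have [d d1 hd] := eta_additive (divr_gt0 e0 k0).
pose S := \sum_j `|X j| + 1; have S0 : 0 < S by rewrite ltr_wpDl// sumr_ge0.
exists (Num.min d (d0 / S)); first by rewrite lt_min d1 divr_gt0.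
move=> t g a; rewrite lt_min ltr_pdivlMr// => /andP[t1 t2] ha.
have small (z : V) : `|z| <= S -> `|t *: z| < d0.
  by move=> zS; rewrite normrZ (le_lt_trans _ t2)// ler_wpM2l.
have h1 : `|t *: \sum_j a j *: X j| < d0.
  apply: small; rewrite (le_trans (ler_norm_sum _ _ _))// /S ler_wpDr// ler_sum// => j _.
  by rewrite normrZ ler_piMl.
have h2 j : `|t *: X j| < d0.
  by apply: small; rewrite /S (bigD1 j)//= -addrA lerDl addr_ge0// sumr_ge0.
(* All terms are indexed by one type, so that the whole combination is bounded under a single
   integral; [c] collects the coefficients, that of the undisplaced term being sum a_j - 1. *)
pose F (i : option (option 'I_n)) (y : borel G) := match i with
  | None => eta (gexp G (t *: \sum_j a j *: X j) * y)%g * p (y^-1 * g)%g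
  | Some None => eta y * p (y^-1 * g)%g
  | Some (Some j) => eta (gexp G (t *: X j) * y)%g * p (y^-1 * g)%g end.
pose c (i : option (option 'I_n)) := match i with
  | None => 1 | Some None => \sum_j a j - 1 | Some (Some j) => - a j end.
have sumE (f : option (option 'I_n) -> R) :
    \sum_(i <- None :: Some None :: [seq Some (Some j) | j <- index_enum 'I_n]) c i * f i =
    f None - f (Some None) - \sum_j a j * (f (Some (Some j)) - f (Some None)).
  have -> : \sum_j a j * (f (Some (Some j)) - f (Some None)) =
      \sum_j a j * f (Some (Some j)) - (\sum_j a j) * f (Some None).
    by rewrite mulr_suml -sumrB; apply: eq_bigr => j _; rewrite mulrBr.
  rewrite !big_cons big_map /=.
  have -> : \sum_j - a j * f (Some (Some j)) = - \sum_j a j * f (Some (Some j)).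
    by rewrite -sumrN; apply: eq_bigr => j _; rewrite mulNr.
  by ring.
have := @Rint_combination_le _ _ _ mu _
  (None :: Some None :: [seq Some (Some j) | j <- index_enum 'I_n]) c F
  (fun y => e / k * `|t| * (\1_K y * (A * p g))).
rewrite sumE bound_Rint /= => h.
have -> : smoothing (gexp G (t *: \sum_j a j *: X j) * g)%g - smoothing g -
      \sum_j a j * (smoothing (gexp G (t *: X j) * g)%g - smoothing g) =
   Rint mu (F None) - Rint mu (F (Some None)) -
      \sum_j a j * (Rint mu (F (Some (Some j))) - Rint mu (F (Some None))).
  rewrite smoothing_translate; congr (_ - _ - _); apply: eq_bigr => j _.
  by rewrite smoothing_translate.
apply: le_trans (h _ _ _) _.
- by case=> [[j|]|]; [exact: translate_L1 | exact: smoothing_L1 | exact: translate_L1].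
- exact: bound_L1.
- move=> y; rewrite sumE /F.
  have -> : eta (gexp G (t *: \sum_j a j *: X j) * y)%g * p (y^-1 * g)%g -
     eta y * p (y^-1 * g)%g - \sum_j a j * (eta (gexp G (t *: X j) * y)%g * p (y^-1 * g)%g -
     eta y * p (y^-1 * g)%g) = (eta (gexp G (t *: \sum_j a j *: X j) * y)%g - eta y -
     \sum_j a j * (eta (gexp G (t *: X j) * y)%g - eta y)) * p (y^-1 * g)%g.
    rewrite !mulrBl mulr_suml; congr (_ - _ - _); apply: eq_bigr => j _.
    by rewrite -mulrBl mulrA.
  rewrite normrM (ger0_norm (p0 _)) indicE.
  have [/set_mem Ky|nK] := boolP (y \in K).
    by rewrite mul1r; apply: ler_pM => //; [exact: hd | have [] := pA g Ky].
  have nK' : ~ K y by move=> Ky; move: nK; rewrite notin_setE.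
  rewrite eta_supp_near// eta_supp// subrr big1; first by rewrite subrr normr0 !mul0r mulr0.
  by move=> j _; rewrite eta_supp_near// subrr mulr0.
have -> : e / k * `|t| * (fine (mu K) * A) * p g = e * p g * `|t| * (fine (mu K) * A / k).
  by field; rewrite gt_eqF.
rewrite ler_piMr ?mulr_ge0 ?(ltW e0)// ler_pdivrMr// mul1r /k lerDl.
exact: ler01.
Qed.

End Smoothing.

Section WeightSmoothing.
Context (R : realType) (n : nat) (G : lieGroupType R n) (gm : G -> 'M[R]_n).
Hypothesis hgm : is_riemannian_metric gm.
Hypothesis hinv : left_invariant_metric gm.
Context (X : 'I_n -> 'rV[R]_n) (hX : is_orthonormal_basis gm X).
Context (mu : {measure set (borel G) -> \bar R}) (hmu : is_riemannian_measure gm mu).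
Local Notation V := 'rV[R]_n.
Local Notation d := (dist1 gm).
Local Notation qn := (form_norm (metric_form gm)).

Lemma qn_combination (a : 'I_n -> R) : qn (\sum_j a j *: X j) = Num.sqrt (\sum_j a j ^+ 2).
Proof.
rewrite /form_norm (form_suml (metric_psd hgm)); congr Num.sqrt; apply: eq_bigr => i _.
rewrite (formZl (metric_psd hgm)) (form_sym (metric_psd hgm)) (form_suml (metric_psd hgm)).
rewrite (bigD1 i)//= (formZl (metric_psd hgm)) {1}/metric_form hX.2 eqxx mulr1.
rewrite big1 ?addr0// => j ji.
by rewrite (formZl (metric_psd hgm)) {1}/metric_form hX.2 (negbTE ji) mulr0.
Qed.

Lemma dist1_gexp_conj (k : R) : 1 < k -> exists2 e : R, 0 < e & forall u z : V,
  `|u| < e -> `|z| < e -> (d ((gexp G u)^-1 * gexp G z * gexp G u)%g <= (k * qn z)%:E)%E.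
Proof.
move=> k1; have [K1 K10 hK1] := qn_le hgm; have [K2 K20 hK2] := norm_le_qn hgm hX.
have c0 : 0 < 1 + 2 * (K1 * K2) by rewrite addr_gt0// !mulr_gt0.
(* Chosen so that (1 + e) (1 + e K1 K2) <= k: one factor for the distance near 1, the other for
   conjugation. *)
pose e := Num.min 1 ((k - 1) / (1 + 2 * (K1 * K2))).
have e0 : 0 < e by rewrite lt_min ltr01 divr_gt0// subr_gt0.
have e1 : e <= 1 by rewrite ge_min lexx.
have ek : e * (1 + 2 * (K1 * K2)) <= k - 1 by rewrite -ler_pdivlMr// ge_min lexx orbT.
have [d1 d10 h1] := gexp_conj G e0; have [d2 d20 h2] := dist1_gexp hgm hinv hX e0.
have g1 : gdiff (fun p : V * V => (gexp G p.1)^-1 * gexp G p.2 * gexp G p.1)%g (0, 0).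
  have a1 : gdiff (fun p : V * V => gexp G p.1) (0, 0).
    by apply: (gdiff_gexp (sdiff_linear _ (bl_fst _ _))); exact: gdom0.
  have a2 : gdiff (fun p : V * V => gexp G p.2) (0, 0).
    by apply: (gdiff_gexp (sdiff_linear _ (bl_snd _ _))); exact: gdom0.
  exact: (gdiffM (gdiffM (gdiffV a1) a2) a1).
have /near_distP[d3 d30 h3] : \forall p \near ((0, 0) : V * V),
    chart_dom (1%g : G) ((gexp G p.1)^-1 * gexp G p.2 * gexp G p.1)%g.
  by apply: (chart_dom_near g1.1); rewrite /= gexp0 invg1 !mulg1; exact: dom1.
exists (Num.min (Num.min d1 (d2 / 2)) d3); first by rewrite !lt_min d10 divr_gt0.
move=> u z; rewrite !lt_min => /andP[/andP[u1 u2] u3] /andP[/andP[z1 z2] z3].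
set w := ((gexp G u)^-1 * gexp G z * gexp G u)%g.
have hw : chart_dom (1%g : G) w.
  by apply: (h3 (u, z)); rewrite prod_normE/= !subr0 gt_max u3.
have wz := h1 u z u1 z1; rewrite -/w in wz.
have wd : `|glog w| < d2.
  rewrite -[glog w](subrK z) (le_lt_trans (ler_normD _ _))//.
  have : e * `|z| <= `|z| by rewrite ler_piMl.
  by move: wz z2; lra.
have := h2 _ wd; rewrite (glogK hw) => h; apply: (le_trans h); rewrite lee_fin.
have qw : qn (glog w) <= (1 + e * (K1 * K2)) * qn z.
  rewrite -[glog w](subrK z) [X in form_norm _ X]addrC (le_trans (form_normD (metric_psd hgm) _ _))//.
  rewrite mulrDl mul1r lerD2l (le_trans (hK1 _))//.
  have -> : e * (K1 * K2) * qn z = K1 * (e * (K2 * qn z)) by ring.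
  by rewrite ler_wpM2l ?(ltW K10)// (le_trans wz)// ler_wpM2l ?(ltW e0).
apply: (@le_trans _ _ ((1 + e) * ((1 + e * (K1 * K2)) * qn z))).
  by rewrite ler_wpM2l// addr_ge0// ltW.
rewrite mulrA ler_wpM2r ?sqrtr_ge0//.
have : e * e * (K1 * K2) <= e * (K1 * K2) by rewrite ler_wpM2r ?mulr_ge0 ?(ltW K10) ?(ltW K20)// ler_piMl// ltW.
by move: ek; lra.
Qed.

Lemma smoothing_data (r0 : R) : 0 < r0 -> exists (eta : G -> R) (rho M d0 : R),
  let K := gexp G @` [set u | `|u| <= rho] in
  [/\ [/\ 0 < rho, rho < r0, 0 < d0 & 0 < M],
      @measurable _ (borel G) K /\ (mu K < +oo)%E,
      [/\ measurable_fun [set: borel G] (eta : borel G -> R),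
          forall y, 0 <= eta y <= M, 0 < Rint mu (eta : borel G -> R) &
          forall y, ~ K y -> eta y = 0],
      (forall z y, `|z| < d0 -> ~ K y -> eta (gexp G z * y)%g = 0) /\
      (forall z y, `|z| < d0 -> K y -> `|eta (gexp G z * y)%g - eta y| <= M * `|z|) &
      forall e, 0 < e -> exists2 d : R, 0 < d & forall t y (a : 'I_n -> R), `|t| < d -> K y ->
        (forall j, `|a j| <= 1) ->
        `|eta (gexp G (t *: \sum_j a j *: X j) * y)%g - eta y -
          \sum_j a j * (eta (gexp G (t *: X j) * y)%g - eta y)| <= e * `|t|].
Proof.
move=> r00; have [r [c [rp cp [lam hlam hr]]]] := measure_near1 hgm hinv hX hmu.
have m0 : 0 < Num.min r0 r by rewrite lt_min r00.
have [eta [rho [M [d0 [[rho0 rhor d00 M0] [h1 h2 h3 h4] h5 h6 h7]]]]] := @lie_bump R n G _ X _ m0.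
have [r1 r2] : rho < r0 /\ rho < r by move: rhor; rewrite lt_min => /andP[].
have mB : @measurable _ (borel V) [set u : V | `|u| <= rho].
  apply: borel_closed; have -> : [set u : V | `|u| <= rho] = closed_ball_ Num.Def.normr 0 rho.
    by apply/seteqP; split=> u /=; rewrite /closed_ball_ /= sub0r normrN.
  exact: closed_closed_ball_.
have [Bd mK _ fK] := hr _ mB (fun u hu => le_lt_trans hu r2).
exists eta, rho, M, d0; split=> //; split=> //.
have etaL : L1 mu (eta : borel G -> R).
  apply: (L1_le h1 _ (L1Z M (L1_indic mK fK))) => y; have /andP[e0 eM] := h2 y.
  rewrite ger0_norm// indicE; have [/set_mem Ky|nK] := boolP (y \in _); first by rewrite mulr1.
  by rewrite mulr0 h4// => Ky; move: nK; rewrite notin_setE.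
rewrite -lte_fin -RintE//.
have K1 : (gexp G @` [set u | `|u| <= rho]) 1%g.
  by exists 0; rewrite ?gexp0//= normr0 ltW.
have e1 : 0 < eta 1%g by have [q q0 hq] := h3; have := hq 0; rewrite normr0 gexp0; exact.
apply: (@integral_near1_gt0 _ _ _ _ hgm hinv _ hX _ hmu eta (eta 1%g / 2) (Num.min d0 (eta 1%g / 2 / M))) => //.
- by rewrite divr_gt0.
- by rewrite lt_min d00 !divr_gt0.
- by move=> g; have /andP[] := h2 g.
move=> u; rewrite lt_min ltr_pdivlMr// => /andP[u1 u2].
by have := h6 u 1%g u1 K1; rewrite mulg1 mulrC ler_distl => /andP[+ _]; move: u2; lra.
Qed.

(* Averaging over left translates by y in a small K makes the weight
   differentiable; conjugation by y distorts d near 1 by a factor close to 1,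
   which is what the gap between S and S' pays for. *)
Lemma weight_smoothing (S S' : R) : 0 < S -> S < S' ->
  exists (Psi : G -> R) (c1 c2 : R),
  [/\ measurable_fun [set: borel G] (Psi : borel G -> R),
      0 < c1 /\ 0 < c2,
      forall g, c1 * weight gm S g <= Psi g <= c2 * weight gm S g &
      exists2 e : R, 0 < e & forall t g (a : 'I_n -> R), `|t| < e ->
       `|\sum_j a j * (Psi (gexp G (t *: X j) * g)%g - Psi g)| <=
         S' * `|t| * Num.sqrt (\sum_j a j ^+ 2) * Psi g].
Proof.
move=> S0 SS'; pose Sm := (S + S') / 2; pose p := weight gm S.
have Sm0 : 0 < Sm by rewrite divr_gt0// addr_gt0// (lt_trans S0).
have k1 : 1 < Sm / S by rewrite ltr_pdivlMr// mul1r /Sm; lra.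
have [d1 d10 h1] := dist1_gexp_conj k1.
have [d2 d20 h2] := dist1_near1 hgm hinv hX ltr01.
have m0 : 0 < Num.min d1 d2 by rewrite lt_min d10.
have [eta [rho [M [d0 [[rho0 rhor d00 M0] [mK fK] [meta eb ei es] [el1 el2] ea]]]]] :=
  smoothing_data m0.
have [r1 r2] : rho < d1 /\ rho < d2 by move: rhor; rewrite lt_min => /andP[].
set K := gexp G @` _ in mK fK es el1 el2 ea.
pose A := expR (S * 1); have A0 : 0 < A by exact: expR_gt0.
have p0 g : 0 <= p g by exact: weight_ge0.
have mp : measurable_fun [set: borel G] (p : borel G -> R).
  exact: (weight_measurable hgm hinv hX).
have pA y g : K y -> p (y^-1 * g)%g <= A * p g /\ p g <= A * p (y^-1 * g)%g.
  move=> [u hu <-]; apply: (weightMl hgm hinv) => //; rewrite (dist1V hgm hinv).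
  exact: h2 _ (le_lt_trans hu r2).
pose Psi := smoothing mu eta p.
have Psi0 g : 0 <= Psi g by exact: (smoothing_ge0 mu eb).
have cmp (E : R) g g' : (forall y, K y -> p (y^-1 * g)%g <= E * p (y^-1 * g')%g) ->
    Psi g <= E * Psi g'.
  exact: (smoothing_compare M0 mK fK meta eb es el1 mp p0 pA d00).
have lo g : Rint mu (eta : borel G -> R) / A * p g <= Psi g.
  exact: (smoothing_ge M0 mK fK meta eb es el1 mp p0 A0 pA d00).
set c1 := Rint mu (eta : borel G -> R) / A in lo.
have c10 : 0 < c1 by rewrite divr_gt0.
exists Psi, c1, (M * (fine (mu K) * A) + 1); split=> //.
(* Right translation of the argument of [Psi] passes to the weight under the integral, whereas
   [log_lipschitz_continuous] speaks of left translation; hence the inverse. *)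
- have cv : continuous (fun g : G => Psi g^-1%g).
    apply: (log_lipschitz_continuous hgm hinv hX S0) => [g|x y a xa a0 a1]; first exact: Psi0.
    have xa' : (d x^-1%g <= a%:E)%E by rewrite (dist1V hgm hinv).
    rewrite invgM; split; apply: cmp => w _; rewrite mulgA.
      by have [] := weightMr hgm hinv (w^-1 * y^-1)%g S0 xa'.
    by have [] := weightMr hgm hinv (w^-1 * y^-1)%g S0 xa'.
  apply: borel_continuous_real.
  have -> : Psi = (fun g => Psi g^-1%g) \o (fun g : G => g^-1%g).
    by apply/funext => g /=; rewrite invgK.
  by move=> g; apply: continuous_comp; [exact: lie_inv_continuous | exact: cv].
- by split=> //; rewrite ltr_wpDl// !mulr_ge0 ?(ltW M0) ?fine_ge0// ltW.
- move=> g; rewrite lo/=; apply: (le_trans (smoothing_le M0 mK fK meta eb es el1 mp p0 pA d00 g)).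
  by rewrite ler_wpM2r// lerDl.
(* [Sm] is the midpoint of S and S'. The second half of the gap is spent twice by e1: on expanding
   the exponential and on replacing the sum of increments by one increment. *)
pose e1 := (S' - S) / 4; have e10 : 0 < e1 by rewrite divr_gt0// subr_gt0.
have SmE : Sm + e1 + e1 = S' by rewrite /Sm /e1; field.
have [d3 d30 h3] := smoothing_additive hgm hinv hX hmu M0 mK fK meta eb es el1 ea mp p0 A0 pA d00
  (mulr_gt0 c10 e10).
have de : is_derive 0 (1 : R) (fun h => expR (Sm * h)) Sm.
  have q1 : is_derive 0 (1 : R) (fun h : R => Sm * h) Sm.
    have := @is_deriveM R R^o (cst Sm) id 0 1 0 1 (is_derive_cst _ _ _) (is_derive_id _ _).
    by rewrite scaler0 addr0 [_ *: _]mulr1.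
  have := @is_derive1_comp R expR (fun h : R => Sm * h) 0 (expR (Sm * 0)) Sm (is_derive_expR _) q1.
  by rewrite mulr0 expR0 mul1r.
have [d4 d40 h4] := is_derive_near de e10.
pose N := \sum_j `|X j| + 1; have N0 : 0 < N by rewrite ltr_wpDl// sumr_ge0.
exists (Num.min (Num.min d3 d4) (d1 / N)); first by rewrite !lt_min d30 d40 divr_gt0.
move=> t g a; rewrite !lt_min ltr_pdivlMr// => /andP[/andP[t3 t4] t1].
pose sg := Num.sqrt (\sum_j a j ^+ 2); rewrite -/sg.
have sa0 : 0 <= \sum_j a j ^+ 2 by apply: sumr_ge0 => j _; exact: sqr_ge0.
have asg j : `|a j| <= sg.
  rewrite -(@ler_pXn2r _ 2)// ?nnegrE ?sqrtr_ge0// sqr_sqrtr// real_normK ?num_real//.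
  by rewrite (bigD1 j)//= lerDl sumr_ge0// => i _; exact: sqr_ge0.
have [sg0|sgn] := eqVneq sg 0.
  rewrite sg0 mulr0 mul0r big1 ?normr0// => j _.
  by have := asg j; rewrite sg0 normr_le0 => /eqP ->; rewrite mul0r.
have sgp : 0 < sg by rewrite lt_neqAle eq_sym sgn sqrtr_ge0.
(* After normalisation z = t sum b_j X_j has metric length |t|, so the sum is close to the single
   increment of [Psi] along z, which the triangle inequality for d controls. This gives the
   euclidean norm of a and no factor n. *)
pose b j := a j / sg.
have b1 j : `|b j| <= 1 by rewrite normrM normfV (gtr0_norm sgp) ler_pdivrMr// mul1r.
have -> : \sum_j a j * (Psi (gexp G (t *: X j) * g)%g - Psi g) =
    sg * \sum_j b j * (Psi (gexp G (t *: X j) * g)%g - Psi g).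
  by rewrite mulr_sumr; apply: eq_bigr => j _; rewrite mulrA /b [sg * _]mulrC divfK.
rewrite normrM (gtr0_norm sgp) mulrAC mulrC ler_pM2r//.
set z := t *: \sum_j b j *: X j.
have qz : qn z = `|t|.
  rewrite /z (form_normZ (metric_psd hgm)) qn_combination.
  have -> : \sum_j b j ^+ 2 = 1.
    under eq_bigr => j _ do rewrite expr_div_n.
    by rewrite -mulr_suml -{1}(sqr_sqrtr sa0) -/sg divff// expf_neq0.
  by rewrite sqrtr1 mulr1.
have nz : `|z| < d1.
  rewrite normrZ (le_lt_trans _ t1)// ler_wpM2l// (le_trans (ler_norm_sum _ _ _))// /N ler_wpDr//.
  by apply: ler_sum => j _; rewrite normrZ ler_piMl.
have E1 : expR (Sm * `|t|) <= 1 + (Sm + e1) * `|t|.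
  have := h4 `|t|; rewrite subr0 normr_id mulr0 expR0 => /(_ t4).
  rewrite ler_distl => /andP[_ h]; rewrite -lerBlDl (le_trans h)// mulrDl.
  by rewrite [`|t| * Sm]mulrC.
have conj y : K y -> (d (y^-1 * gexp G z * y)%g <= (Sm / S * `|t|)%:E)%E.
  by move=> [u hu <-]; rewrite -qz; apply: h1 => //; exact: le_lt_trans hu r1.
have SE : S * (Sm / S * `|t|) = Sm * `|t| by field; rewrite gt_eqF.
have up : Psi (gexp G z * g)%g <= expR (Sm * `|t|) * Psi g.
  apply: cmp => y /conj hy; have [+ _] := weightMl hgm hinv (y^-1 * g)%g S0 hy.
  by rewrite SE !mulgA mulgK.
have dn : Psi g <= expR (Sm * `|t|) * Psi (gexp G z * g)%g.
  apply: cmp => y /conj hy; have [_] := weightMl hgm hinv (y^-1 * g)%g S0 hy.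
  by rewrite SE !mulgA mulgK.
have E0 : 0 <= (Sm + e1) * `|t| by rewrite mulr_ge0// addr_ge0// ltW.
have close : `|Psi (gexp G z * g)%g - Psi g| <= (Sm + e1) * `|t| * Psi g.
  have {}up := le_trans up (ler_wpM2r (Psi0 g) E1).
  have {}dn := le_trans dn (ler_wpM2r (Psi0 _) E1).
  rewrite ler_distl; apply/andP; split; last by move: up; rewrite mulrDl mul1r addrC.
  have [le|lt] := leP (Psi g) (Psi (gexp G z * g)%g).
    by apply: le_trans le; rewrite lerBlDr lerDl mulr_ge0.
  rewrite lerBlDr; apply: (le_trans dn); rewrite mulrDl mul1r lerD2l ler_wpM2l// ltW//.
have add := h3 t g b t3 b1; rewrite -/Psi -/z in add.
set Q := \sum_j b j * _ in add *.
rewrite -[Q](subrK (Psi (gexp G z * g)%g - Psi g)) (le_trans (ler_normD _ _))// distrC.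
apply: (le_trans (lerD add close)); rewrite -SmE.
have -> : (Sm + e1 + e1) * `|t| * Psi g = e1 * `|t| * Psi g + (Sm + e1) * `|t| * Psi g by ring.
rewrite lerD2r; have -> : c1 * e1 * p g * `|t| = e1 * `|t| * (c1 * p g) by ring.
by rewrite ler_wpM2l// mulr_ge0// ltW.
Qed.

End WeightSmoothing.

(** * Exponential growth of the representation *)

Section GrowthRate.
Context (R : realType) (n : nat) (G : lieGroupType R n) (gm : G -> 'M[R]_n).
Hypothesis hgm : is_riemannian_metric gm.
Hypothesis hinv : left_invariant_metric gm.
Context (X : 'I_n -> 'rV[R]_n) (hX : is_orthonormal_basis gm X).
Context (mu : {measure set (borel G) -> \bar R}) (hmu : is_riemannian_measure gm mu).
Context (E : completeNormedModType R) (pi : G -> E -> E) (hpi : is_banach_rep pi).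
Local Notation V := 'rV[R]_n.
Local Notation d := (dist1 gm).
Local Notation qn := (form_norm (metric_form gm)).

Lemma repZ g (a : R) v : pi g (a *: v) = a *: pi g v.
Proof.
have h0 : pi g 0 = 0.
  have := rep_linear hpi g 1 0 0; rewrite !scale1r addr0 => e.
  by apply: (@addrI _ (pi g 0)); rewrite addr0 -e.
by rewrite -[a *: v]addr0 (rep_linear hpi g a v 0) h0 addr0.
Qed.

Lemma rep_continuous_left v : continuous (fun g => pi g v).
Proof.
move=> g; apply: (continuous_comp (f := fun g : G => (g, v)) (g := fun z : G * E => pi z.1 z.2)).
  by apply: cvg_pair; [exact: cvg_id | exact: cvg_cst].
exact: (rep_continuous hpi).
Qed.

(** Joint continuity at (1, 0) bounds pi(g) v for g near 1 and v small; homogeneity does the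
    rest. *)
Lemma rep_locally_bounded : exists r M : R, [/\ 0 < r, 0 < M & forall u v, `|u| < r ->
  `|pi (gexp G u) v| <= M * `|v| /\ `|pi (gexp G u)^-1%g v| <= M * `|v|].
Proof.
have [[A B] [/= nA nB] hAB] : nbhs (1%g : G, 0 : E) [set z | `|pi z.1 z.2| < 1].
  have := @rep_continuous _ _ _ _ _ hpi (1%g, 0).
  move=> /cvgrPdist_lt/(_ 1 ltr01); apply: filterS => z /=.
  by rewrite (rep_one hpi) sub0r normrN.
have [b b0 hb] := (near_distP 0 B).1 nB.
have g0 : gdiff (gexp G : V -> G) 0 by exact: (gdiff_gexp (sdiff_id _) (gdom0 G)).
have c1 := g0.1; have c2 := (gdiffV g0).1.
have n1 : \forall u \near (0 : V), A (gexp G u) by apply: (c1 A); rewrite gexp0.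
have n2 : \forall u \near (0 : V), A (gexp G u)^-1%g by apply: (c2 A); rewrite gexp0 invg1.
have [r r0 hr] := (near_distP 0 _).1 (filterI n1 n2).
exists r, (2 / b); split; rewrite ?divr_gt0//.
move=> u v hu; have [a1 a2] : A (gexp G u) /\ A (gexp G u)^-1%g by apply: hr; rewrite subr0.
have key g : A g -> `|pi g v| <= 2 / b * `|v|.
  move=> Ag; have [->|v0] := eqVneq v 0.
    by rewrite -[X in pi g X](scale0r (0 : E)) repZ scale0r !normr0 mulr0.
  have vp : 0 < `|v| by rewrite normr_gt0.
  pose k := b / 2 / `|v|; have k0 : 0 < k by rewrite !divr_gt0.
  have kv : `|k *: v| < b.
    by rewrite normrZ (gtr0_norm k0) /k divfK ?gt_eqF// ltr_pdivrMr// ltr_pMr// ltr1n.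
  have := hAB (g, k *: v); rewrite /= repZ normrZ (gtr0_norm k0) => /(_ _) h.
  have {}h : k * `|pi g v| < 1 by apply: h; split=> //=; apply: hb; rewrite subr0.
  have -> : 2 / b * `|v| = k^-1 by rewrite /k; field; rewrite !gt_eqF.
  by rewrite -[leRHS]mulr1 mulrC ler_pdivlMr ?invr_gt0// mulrC ltW.
by split; exact: key.
Qed.

(* |pi g v| need not be Lipschitz in g, but its average over a small
   neighbourhood is comparable to it and log-Lipschitz, so it grows at most
   exponentially along curves. *)
Lemma growth_rate_finite : exists c C : R, [/\ 0 < c, 0 < C &
  forall g, (opnorm (pi g) <= C%:E * expeR (c%:E * d g))%E].
Proof.
have [r [A [r0 A0 hr]]] := rep_locally_bounded.
have [eta [rho [M [d0 [[rho0 rhor d00 M0] [mK fK] [meta eb ei es] [el1 el2] ea]]]]] :=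
  smoothing_data hgm hinv hX hmu r0.
set K := gexp G @` _ in mK fK es el1 el2 ea.
pose p v (g : G) := `|pi g v|.
have p0 v g : 0 <= p v g by exact: normr_ge0.
have mp v : measurable_fun [set: borel G] (p v : borel G -> R).
  apply: borel_continuous_real => g.
  by apply: continuous_comp; [exact: rep_continuous_left | exact: norm_continuous].
have pA v y g : K y -> p v (y^-1 * g)%g <= A * p v g /\ p v g <= A * p v (y^-1 * g)%g.
  move=> [u hu <-]; have ur := le_lt_trans hu rhor; split.
    by rewrite /p (rep_mul hpi); have [] := hr u (pi g v) ur.
  rewrite /p -{1}[g](mulVKg (gexp G u)) (rep_mul hpi).
  by have [] := hr u (pi ((gexp G u)^-1 * g)%g v) ur.
pose c1 := Rint mu (eta : borel G -> R) / A; have c10 : 0 < c1 by rewrite divr_gt0.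
pose c2 := M * (fine (mu K) * A).
have c20 : 0 <= c2 by rewrite !mulr_ge0 ?fine_ge0 ?(ltW M0)// ltW.
have lo v g : c1 * p v g <= smoothing mu eta (p v) g.
  exact: (smoothing_ge M0 mK fK meta eb es el1 (mp v) (p0 v) A0 (pA v) d00).
have hi v g : smoothing mu eta (p v) g <= c2 * p v g.
  exact: (smoothing_le M0 mK fK meta eb es el1 (mp v) (p0 v) (pA v) d00).
have lip v z g : `|z| < d0 ->
    smoothing mu eta (p v) (gexp G z * g)%g <= expR (c2 / c1 * `|z|) * smoothing mu eta (p v) g.
  move=> hz; have := smoothing_lip hgm hinv hX hmu M0 mK fK meta eb es el1 el2 (mp v) (p0 v)
    (pA v) d00 g hz.
  rewrite -/c2 ler_distl => /andP[_ h]; apply: (le_trans h).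
  apply: (@le_trans _ _ ((1 + c2 / c1 * `|z|) * smoothing mu eta (p v) g)); last first.
    by rewrite ler_wpM2r ?expR_ge1Dx//; exact: (smoothing_ge0 mu eb (p0 v)).
  rewrite mulrDl mul1r lerD2l.
  have -> : c2 / c1 * `|z| * smoothing mu eta (p v) g =
      c2 * (smoothing mu eta (p v) g / c1) * `|z| by ring.
  by rewrite ler_wpM2r// ler_wpM2l// ler_pdivlMr// mulrC.
have [Kl Kl0 hKl] := norm_le_qn hgm hX.
have k0 : 0 <= c2 / c1 by rewrite divr_ge0// ltW.
pose c := c2 / c1 * Kl + 1; have cp : 0 < c by rewrite ltr_wpDl// mulr_ge0// ltW.
have growth v g a : d g = a%:E -> `|pi g v| <= c2 / c1 * expR (c + 1) * expR (c * a) * `|v|.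
  move=> da; have a0 : 0 <= a by rewrite -lee_fin -da; exact: dist1_ge0.
  (* The smoothed norm is controlled under left translation and [dist1_growth] moves on the right,
     hence the inverse; a + 1 is a strict upper bound for the distance. *)
  have := dist1_growth hgm hinv (u := fun x => smoothing mu eta (p v) x^-1%g) k0 d00 (ltW Kl0).
  move=> /(_ _ hKl _ g^-1%g (a + 1)); rewrite (dist1V hgm hinv) da lte_fin ltrDl ltr01 invgK invg1.
  move=> h; have {}h : smoothing mu eta (p v) g <=
      expR (c2 / c1 * Kl * (a + 1) + 1) * smoothing mu eta (p v) 1%g.
    apply: h => //.
    - by move=> x; exact: (smoothing_ge0 mu eb (p0 v)).
    - by move=> x z hz; have := lip v z (x * gexp G z)^-1%g hz; rewrite invgM mulVKg.
  have h1 : smoothing mu eta (p v) 1%g <= c2 * `|v| by have := hi v 1%g; rewrite /p (rep_one hpi).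
  rewrite -(ler_pM2l c10); apply: (le_trans (lo v g)); apply: (le_trans h).
  have e0 := expR_ge0 (c2 / c1 * Kl * (a + 1) + 1).
  apply: (le_trans (ler_wpM2l e0 h1)).
  have -> : c1 * (c2 / c1 * expR (c + 1) * expR (c * a) * `|v|) =
      expR (c + 1) * expR (c * a) * (c2 * `|v|) by field; rewrite gt_eqF.
  apply: ler_wpM2r; first exact: mulr_ge0.
  rewrite -expRD ler_expR /c.
  by move: (mulr_ge0 k0 (ltW Kl0)) a0; lra.
exists c, (c2 / c1 * expR (c + 1) + 1); split=> //.
  by rewrite ltr_wpDl// mulr_ge0// expR_ge0.
move=> g; have := dist1_ge0 hgm hinv g; case da : (d g) => [a||]// _; last first.
  by rewrite gt0_muley ?lte_fin//= gt0_muley ?leey// lte_fin ltr_wpDl// mulr_ge0// expR_ge0.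
have -> : expeR (c%:E * a%:E) = (expR (c * a))%:E by [].
rewrite -EFinM; apply: ge_ereal_sup => _ [v /= v1 <-]; rewrite lee_fin.
apply: (le_trans (growth v g a da)).
apply: (@le_trans _ _ (c2 / c1 * expR (c + 1) * expR (c * a))).
  by apply: ler_piMr v1; rewrite mulr_ge0 ?expR_ge0// mulr_ge0 ?expR_ge0.
by rewrite ler_wpM2r ?expR_ge0// lerDl.
Qed.

End GrowthRate.

(** * The form attached to a functional *)

Section CkLinear.
Context (R : realType) (V W : normedModType R).

Lemma Ck_on_ext k (U : set V) (f g : V -> W) : open U -> (forall x, U x -> f x = g x) ->
  Ck_on k U f -> Ck_on k U g.
Proof.
move=> oU.
have near_e (f1 f2 : V -> W) x : (forall x, U x -> f1 x = f2 x) -> U x -> \forall y \near x, f1 y = f2 y.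
  by move=> e Ux; have := open_nbhs_nbhs (conj oU Ux); apply: filterS => y /e.
have cont (f1 f2 : V -> W) x : (forall x, U x -> f1 x = f2 x) -> U x ->
    {for x, continuous f1} -> {for x, continuous f2}.
  move=> e Ux c1; have h : f2 @ x --> f2 x; last exact: h.
  by rewrite -(e x Ux); apply: cvg_trans c1; apply: near_eq_cvg; exact: near_e.
elim: k f g => [|k ih] f g e [cf df]; split=> //; do ?by move=> x Ux; exact: cont (cf x Ux).
move=> v; have [d1 d2] := df v; split=> [x Ux|].
  exact: (near_eq_derivable (near_e _ _ x e Ux) (d1 x Ux)).
apply: ih d2 => x Ux; exact: near_eq_derive (near_e _ _ x e Ux).
Qed.

Lemma Ck_on_linear k (U : set V) (f g : V -> W) (a : R) : open U ->
  Ck_on k U f -> Ck_on k U g -> Ck_on k U (fun x => a *: f x + g x).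
Proof.
move=> oU; elim: k f g => [|k ih] f g [cf df] [cg dg].
  by split=> // x Ux; apply: cvgD; [apply: cvgZr; exact: cf | exact: cg].
split=> [x Ux|v]; first by apply: cvgD; [apply: cvgZr; exact: cf | exact: cg].
have [d1 d2] := df v; have [e1 e2] := dg v; split=> [x Ux|].
  by apply: derivableD; [apply: derivableZ; exact: d1 | exact: e1].
apply: (Ck_on_ext oU _ (ih _ _ d2 e2)) => x Ux.
by rewrite deriveD ?deriveZ//; [exact: d1 | apply: derivableZ; exact: d1 | exact: e1].
Qed.

End CkLinear.

Section DerivedRepresentation.
Context (R : realType) (n : nat) (G : lieGroupType R n) (gm : G -> 'M[R]_n).
Hypothesis hgm : is_riemannian_metric gm.
Hypothesis hinv : left_invariant_metric gm.
Context (X : 'I_n -> 'rV[R]_n) (hX : is_orthonormal_basis gm X).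
Context (U : algType R) (iota : 'rV[R]_n -> U) (hU : lie_hom G iota).
Context (E : completeNormedModType R) (pi : G -> E -> E) (hpi : is_banach_rep pi).
Context (dpi : U -> E -> E) (hdpi : is_derived_rep pi iota dpi).
Local Notation V := 'rV[R]_n.
Local Notation P := (smooth_vector pi).

Lemma smooth_linear (a : R) u v : P u -> P v -> P (a *: u + v).
Proof.
move=> hu hv k c; have := Ck_on_linear a (chart_img_open c) (hu k c) (hv k c).
by congr Ck_on; apply/funext => y; rewrite (rep_linear hpi).
Qed.

Lemma smooth0 : P 0.
Proof.
move=> k c; have z0 g : pi g 0 = 0.
  by rewrite -(scale0r (0 : E)) (repZ hpi) !scale0r.
have -> : (fun y => pi (chart_inv c y) 0) = cst 0 by apply/funext => y.
elim: k => [|k ih]; first by split=> // x _; exact: cst_continuous.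
split=> [x _|v]; first exact: cst_continuous.
split=> [x _|]; first exact: derivable_cst.
by have -> : (fun x => 'D_v (cst 0) x) = cst 0 :> (V -> E) by apply/funext => x; rewrite derive_cst.
Qed.

Lemma dpi0 v : P v -> dpi 0 v = 0.
Proof.
move=> hv; have := dpi_linearl hdpi 1 0 0 hv; rewrite !scale1r addr0 => e.
by apply: (@addrI _ (dpi 0 v)); rewrite addr0 -e.
Qed.

Lemma dpiD u u' v : P v -> dpi (u + u') v = dpi u v + dpi u' v.
Proof. by move=> hv; rewrite -[u in LHS]scale1r (dpi_linearl hdpi)// scale1r. Qed.

Lemma dpiZ a u v : P v -> dpi (a *: u) v = a *: dpi u v.
Proof. by move=> hv; rewrite -[a *: u in LHS]addr0 (dpi_linearl hdpi)// dpi0// addr0. Qed.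

Lemma dpi_sum (I : Type) (s : seq I) (F : I -> U) v : P v ->
  dpi (\sum_(i <- s) F i) v = \sum_(i <- s) dpi (F i) v.
Proof.
move=> hv; elim: s => [|i s ih]; first by rewrite !big_nil dpi0.
by rewrite !big_cons dpiD// ih.
Qed.

Definition lie_derive (i : 'I_n) (v : E) : E := dpi (iota (X i)) v.

Lemma iota_sum (I : Type) (s : seq I) (c : I -> R) (Y : I -> V) :
  iota (\sum_(i <- s) c i *: Y i) = \sum_(i <- s) c i *: iota (Y i).
Proof.
have i0 : iota 0 = 0.
  have := hU.1 1 0 0; rewrite !scale1r addr0 => e.
  by apply: (@addrI _ (iota 0)); rewrite addr0 -e.
elim: s => [|i s ih]; first by rewrite !big_nil.
by rewrite !big_cons hU.1 ih.
Qed.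

Definition structure_constant i j k : R := metric_form gm (lie_bracket G (X i) (X j)) (X k).

Lemma iota_comm i j : iota (X i) * iota (X j) - iota (X j) * iota (X i) =
  \sum_k structure_constant i j k *: iota (X k).
Proof. by rewrite -hU.2 {1}(basis_expand hgm hX (lie_bracket G (X i) (X j))) iota_sum. Qed.

Lemma lie_derive_comm i j v : P v ->
  lie_derive i (lie_derive j v) - lie_derive j (lie_derive i v) =
  \sum_k structure_constant i j k *: lie_derive k v.
Proof.
move=> hv; rewrite /lie_derive -!(dpi_mul hdpi)// -[- dpi _ _]scaleN1r -dpiZ// -dpiD// scaleN1r.
by rewrite iota_comm dpi_sum//; apply: eq_bigr => k _; rewrite dpiZ.
Qed.

Lemma rep_sdiff v : P v ->
  sdiff (fun z => pi (gexp G z) v) 0 (fun z => dpi (iota z) v).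
Proof.
move=> hv; pose z0 : V := chart (1%g : G) 1%g.
have h0 : chart_img (1%g : G) z0 by exact/chart_img_self/dom1.
have h := sdiff_C1 (coordinates_rV R n) (chart_img_open (1%g : G)) h0 (hv 1%N (1%g : G)).
have t0 : sdiff (fun u : V => u + z0) 0 id by exact: sdiff_translate (sdiff_id _).
rewrite -[z0 in X in sdiff _ X _]add0r in h.
have := sdiff_comp t0 h; congr sdiff.
  by apply/funext => u; rewrite /= addrC.
apply/funext => z; rewrite (dpi_lie hdpi)// -/z0; rewrite add0r in h.
by have [_ ->] := sdiff_derive z h.
Qed.

Lemma rep_increment v (e : R) : P v -> 0 < e -> exists2 d : R, 0 < d & forall z, `|z| < d ->
  `|pi (gexp G z) v - v - \sum_j metric_form gm z (X j) *: lie_derive j v| <= e * `|z|.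
Proof.
move=> hv e0; have [d d0 hd] := (rep_sdiff hv).2 e e0; exists d => // z hz.
have := hd z 0; rewrite !subr0 normr0 gexp0 (rep_one hpi) => /(_ hz d0).
by rewrite {2}(basis_expand hgm hX z) iota_sum dpi_sum//; under eq_bigr => j _ do rewrite dpiZ//.
Qed.

Lemma rep_increment_basis v j (e : R) : P v -> 0 < e -> exists2 d : R, 0 < d &
  forall t, `|t| < d -> `|pi (gexp G (t *: X j)) v - v - t *: lie_derive j v| <= e * `|t|.
Proof.
move=> hv e0; have x1 : 0 < `|X j| + 1 by rewrite ltr_wpDl.
have [d d0 hd] := (rep_sdiff hv).2 _ (divr_gt0 e0 x1).
exists (d / (`|X j| + 1)) => [|t]; first by rewrite divr_gt0.
rewrite ltr_pdivlMr// => ht.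
have hz : `|t *: X j| < d by rewrite normrZ (le_lt_trans _ ht)// ler_wpM2l// lerDl.
have := hd (t *: X j) 0; rewrite !subr0 normr0 gexp0 (rep_one hpi) => /(_ hz d0) h.
have e1 : dpi (iota (t *: X j)) v = t *: lie_derive j v.
  exact: (blZ t (X j) (sdiff_bl (rep_sdiff hv))).
rewrite -e1; apply: (le_trans h); rewrite normrZ.
have -> : e / (`|X j| + 1) * (`|t| * `|X j|) = e * `|t| * (`|X j| / (`|X j| + 1)) by ring.
rewrite ler_piMr ?mulr_ge0 ?(ltW e0)//.
by rewrite ler_pdivrMr// mul1r lerDl.
Qed.

End DerivedRepresentation.

Section BilinearIncrement.
Context (R : realType) (E : normedModType R) (Q : E -> E -> R) (B : R).
Hypothesis Qlin : forall a u v w, Q (a *: u + v) w = a * Q u w + Q v w.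
Hypothesis Qsym : forall u v, Q u v = Q v u.
Hypothesis Qbound : forall u v, `|Q u v| <= B * `|u| * `|v|.

(** Product rule for a bounded symmetric bilinear form along two paths of which only the expansions
    at 0 are known. *)
Lemma form_increment (w v w' v' : E) (wt vt : R -> E) : 0 <= B ->
  (forall e, 0 < e -> exists2 d : R, 0 < d & forall t, `|t| < d ->
     `|wt t - w - t *: w'| <= e * `|t|) ->
  (forall e, 0 < e -> exists2 d : R, 0 < d & forall t, `|t| < d ->
     `|vt t - v - t *: v'| <= e * `|t|) ->
  forall e, 0 < e -> exists2 d : R, 0 < d & forall t, `|t| < d ->
    `|Q (wt t) (vt t) - Q w v - t * (Q w' v + Q w v')| <= e * `|t|.
Proof.
move=> B0 hw hv e e0; pose W := `|w| + `|v| + `|w'| + `|v'| + 1.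
have w0 := normr_ge0 w; have v0 := normr_ge0 v.
have w'0 := normr_ge0 w'; have v'0 := normr_ge0 v'.
have W1 : 1 <= W by rewrite /W; lra.
have BW0 : 0 <= 3 * B * W ^+ 2 by rewrite mulr_ge0 ?sqr_ge0// mulr_ge0.
have c0 : 0 < 3 * B * W ^+ 2 + 1 by rewrite ltr_wpDl.
pose e1 := Num.min 1 (e / (3 * B * W ^+ 2 + 1)).
have e10 : 0 < e1 by rewrite lt_min ltr01 divr_gt0.
have e11 : e1 <= 1 by rewrite ge_min lexx.
have e1e : e1 * (3 * B * W ^+ 2) <= e.
  apply: (@le_trans _ _ (e1 * (3 * B * W ^+ 2 + 1))); first by rewrite ler_wpM2l ?(ltW e10)// lerDl.
  by rewrite -ler_pdivlMr// ge_min lexx orbT.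
clearbody e1; have [d1 d10 h1] := hw e1 e10; have [d2 d20 h2] := hv e1 e10.
exists (Num.min e1 (Num.min d1 d2)); first by rewrite !lt_min e10 d10.
move=> t; rewrite !lt_min => /and3P[t0 t1 t2].
have {}h1 := h1 t t1; have {}h2 := h2 t t2.
set r1 := wt t - w - t *: w' in h1; set r2 := vt t - v - t *: v' in h2.
have QDl x y z : Q (x + y) z = Q x z + Q y z by rewrite -[x]scale1r Qlin mul1r scale1r.
have QDr x y z : Q z (x + y) = Q z x + Q z y by rewrite !(Qsym z) QDl.
have Q0l z : Q 0 z = 0 by have := QDl 0 0 z; rewrite addr0 => h; apply: (@addrI _ (Q 0 z)); rewrite addr0.
have QZl a x z : Q (a *: x) z = a * Q x z by rewrite -[a *: x]addr0 Qlin Q0l addr0.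
have QZr a x z : Q z (a *: x) = a * Q z x by rewrite !(Qsym z) QZl.
have ew : wt t = w + (t *: w' + r1) by rewrite /r1 subrKC addrC subrK.
have ev : vt t = v + (t *: v' + r2) by rewrite /r2 subrKC addrC subrK.
clearbody r1 r2.
have q1 : Q w (vt t) = Q w v + (t * Q w v' + Q w r2) by rewrite ev !QDr QZr.
have q2 : Q w' (vt t) = Q w' v + Q w' (t *: v' + r2) by rewrite ev QDr.
have -> : Q (wt t) (vt t) - Q w v - t * (Q w' v + Q w v') =
    Q w r2 + Q r1 (vt t) + t * Q w' (t *: v' + r2).
  by rewrite ew QDl QDl QZl q1 q2; ring.
have nv : `|t *: v' + r2| <= e1 * W.
  rewrite (le_trans (ler_normD _ _))// normrZ /W.
  have : `|t| * `|v'| <= e1 * `|v'| by rewrite ler_wpM2r// ltW.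
  have : e1 * `|t| <= e1 by rewrite ler_piMr ?(ltW e10)// (le_trans (ltW t0)).
  have := mulr_ge0 (ltW e10) w0; have := mulr_ge0 (ltW e10) v0; have := mulr_ge0 (ltW e10) w'0.
  move: h2; lra.
have nvt : `|vt t| <= W.
  have h : `|t *: v' + r2| <= `|t| * `|v'| + e1 * `|t|.
    by rewrite (le_trans (ler_normD _ _))// normrZ lerD2l.
  have : `|t| * `|v'| <= `|v'| by rewrite ler_piMl// (le_trans (ltW t0)).
  have : e1 * `|t| <= 1 by rewrite -[leRHS]mul1r ler_pM ?(ltW e10)// (le_trans (ltW t0)).
  by rewrite ev; have := ler_normD v (t *: v' + r2); rewrite /W; lra.
have b1 : `|Q w r2| <= B * W * (e1 * `|t|) .
  apply: (le_trans (Qbound _ _)); apply: ler_pM => //; first by rewrite mulr_ge0.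
  by rewrite ler_wpM2l// /W; lra.
have b2 : `|Q r1 (vt t)| <= B * W * (e1 * `|t|).
  apply: (le_trans (Qbound _ _)); rewrite mulrAC; apply: ler_pM => //; first by rewrite mulr_ge0.
  by rewrite ler_wpM2l.
have b3 : `|t * Q w' (t *: v' + r2)| <= `|t| * (B * W * (e1 * W)).
  rewrite normrM ler_wpM2l//; apply: (le_trans (Qbound _ _)); apply: ler_pM => //.
    by rewrite mulr_ge0.
  by rewrite ler_wpM2l// /W; lra.
apply: (le_trans (ler_normD _ _)); apply: (le_trans (lerD (ler_normD _ _) (lexx _))).
apply: (le_trans (lerD (lerD b1 b2) b3)).
have h3 : B * W * e1 <= B * W * e1 * W.
  by rewrite ler_peMr// !mulr_ge0 ?(ltW e10)// (le_trans _ W1).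
have := ler_wpM2r (normr_ge0 t) e1e; have := ler_wpM2r (normr_ge0 t) h3.
by rewrite expr2; lra.
Qed.

End BilinearIncrement.

Section WeightedForm.
Context (R : realType) (n : nat) (G : lieGroupType R n) (gm : G -> 'M[R]_n).
Hypothesis hgm : is_riemannian_metric gm.
Hypothesis hinv : left_invariant_metric gm.
Context (X : 'I_n -> 'rV[R]_n) (hX : is_orthonormal_basis gm X).
Context (mu : {measure set (borel G) -> \bar R}) (hmu : is_riemannian_measure gm mu).
Context (E : completeNormedModType R) (pi : G -> E -> E) (hpi : is_banach_rep pi).
Local Notation V := 'rV[R]_n.
Local Notation d := (dist1 gm).
Context (Psi : G -> R) (c C C0 c2 : R).
Hypothesis c0 : 0 < c.
Hypothesis Cp : 0 < C.
Hypothesis C00 : 0 < C0.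
Hypothesis c20 : 0 < c2.
Hypothesis growth : forall g, (opnorm (pi g) <= C%:E * expeR (c%:E * d g))%E.
Hypothesis hC0 : (\int[mu]_g expeR (- (C0%:E * dist1 gm g)) < +oo)%E.
Hypothesis mPsi : measurable_fun [set: borel G] (Psi : borel G -> R).
Hypothesis Psi_ge0 : forall g, 0 <= Psi g.
Hypothesis Psi_le : forall g, Psi g <= c2 * weight gm (2 * c + C0) g.

Lemma rep_growth g a v : d g = a%:E -> `|pi g v| <= C * expR (c * a) * `|v|.
Proof.
move=> da; have [->|v0] := eqVneq v 0.
  by rewrite -(scale0r (0 : E)) (repZ hpi) !scale0r !normr0 mulr0.
have vp : 0 < `|v| by rewrite normr_gt0.
have := growth g; rewrite da.
have -> : expeR (c%:E * a%:E) = (expR (c * a))%:E by [].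
rewrite -EFinM => h; rewrite -ler_pdivrMr//.
have -> : `|pi g v| / `|v| = `|pi g (`|v|^-1 *: v)|.
  by rewrite (repZ hpi) normrZ gtr0_norm ?invr_gt0// mulrC.
rewrite -lee_fin; apply: le_trans h; apply: ereal_sup_ubound.
exists (`|v|^-1 *: v) => //=.
by rewrite normrZ gtr0_norm ?invr_gt0// mulVf// gt_eqF.
Qed.

Context (l : E -> R).
Hypothesis l_lin : forall a u v, l (a *: u + v) = a * l u + l v.
Hypothesis l_bound : forall v, `|l v| <= `|v|.

(** Because of the inverse, applying pi(h) to v is a left translation of the coefficient, under
    which the measure is invariant. *)
Definition matrix_coeff (v : E) (g : G) : R := l (pi g^-1%g v).
Local Notation f := matrix_coeff.
Definition weighted_form (u v : E) : R := Rint mu (fun g : borel G => f u g * f v g * Psi g).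
Local Notation Q := weighted_form.

Lemma functional_continuous : continuous l.
Proof.
move=> v; apply/(@continuous_distP R E R^o) => e e0.
have lB u w : l (u - w) = l u - l w.
  by have := l_lin (-1) w u; rewrite scaleN1r mulN1r addrC => ->; rewrite addrC.
by exists e => // w hw; rewrite -lB (le_lt_trans (l_bound _)).
Qed.

Lemma matrix_coeff_linear a u v g : f (a *: u + v) g = a * f u g + f v g.
Proof. by rewrite /f (rep_linear hpi) l_lin. Qed.

Lemma matrix_coeff_continuous v : continuous (f v).
Proof.
move=> g; apply: (continuous_comp (f := fun g : G => g^-1%g) (g := fun g => l (pi g v))).
  exact: lie_inv_continuous.
apply: continuous_comp; first exact: (rep_continuous_left hpi).
exact: functional_continuous.
Qed.

Lemma matrix_coeff_measurable v : measurable_fun [set: borel G] (f v : borel G -> R).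
Proof. by apply: borel_continuous_real; exact: matrix_coeff_continuous. Qed.

(** The two coefficients grow like exp(2 c d), so the decay 2 c + C0 of [Psi] leaves the integrable
    weight exp(-C0 d). Where d is infinite, [Psi] vanishes. *)
Lemma matrix_coeff_weight u v g :
  `|f u g * f v g * Psi g| <= C ^+ 2 * c2 * `|u| * `|v| * weight gm C0 g.
Proof.
rewrite normrM (ger0_norm (Psi_ge0 g)).
have cs : 0 < 2 * c + C0 by rewrite addr_gt0// mulr_gt0.
have := dist1_ge0 hgm hinv g; case da : (d g) => [a||]// _; last first.
  have P0 : Psi g = 0.
    apply/eqP; rewrite eq_le Psi_ge0 andbT (le_trans (Psi_le g))//.
    by rewrite (weight_oo cs da) mulr0.
  by rewrite P0 (weight_oo C00 da) !mulr0.
have fb w : `|f w g| <= C * expR (c * a) * `|w|.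
  by rewrite (le_trans (l_bound _))//; apply: rep_growth; rewrite (dist1V hgm hinv).
have h1 : `|f u g * f v g| <= (C * expR (c * a) * `|u|) * (C * expR (c * a) * `|v|).
  by rewrite normrM ler_pM.
have := ler_pM (normr_ge0 _) (Psi_ge0 g) h1 (Psi_le g).
rewrite !(weight_fin _ da) => h; apply: (le_trans h).
have -> : expR (- ((2 * c + C0) * a)) = (expR (c * a) * expR (c * a))^-1 * expR (- (C0 * a)).
  by rewrite -expRD -expRN -expRD; congr expR; ring.
rewrite le_eqVlt; apply/orP; left; apply/eqP; field.
by rewrite gt_eqF// expR_gt0.
Qed.

Let weight_L1 : L1 mu (weight gm C0 : borel G -> R).
Proof.
apply: L1_ge0; [exact: (weight_measurable hgm hinv hX) | exact: weight_ge0 |].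
by rewrite -(weight_integralE hgm hinv).
Qed.

Lemma form_L1 u v : L1 mu (fun g : borel G => f u g * f v g * Psi g).
Proof.
apply: (L1_le _ _ (L1Z (C ^+ 2 * c2 * `|u| * `|v|) weight_L1)).
  by apply: measurable_funM => //; apply: measurable_funM; exact: matrix_coeff_measurable.
by move=> g; exact: matrix_coeff_weight.
Qed.

(** Independent of the functional l. *)
Definition form_bound : R := C ^+ 2 * c2 * Rint mu (weight gm C0 : borel G -> R).

Lemma form_bound_ge0 : 0 <= form_bound.
Proof.
rewrite mulr_ge0 ?Rint_ge0//; last by move=> g; exact: weight_ge0.
by rewrite mulr_ge0 ?sqr_ge0// ltW.
Qed.

Lemma weighted_form_bound u v : `|Q u v| <= form_bound * `|u| * `|v|.
Proof.
have := @Rint_combination_le _ _ _ mu unit [:: tt] (fun=> 1)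
  (fun _ (g : borel G) => f u g * f v g * Psi g)
  (fun g => C ^+ 2 * c2 * `|u| * `|v| * weight gm C0 g).
rewrite !big_seq1 mul1r RintZ; last exact: weight_L1.
move=> h; apply: (le_trans (h _ _ _)).
- by move=> _; exact: form_L1.
- by apply: L1Z; exact: weight_L1.
- by move=> g; rewrite big_seq1 mul1r; exact: matrix_coeff_weight.
by rewrite /form_bound; rewrite le_eqVlt; apply/orP; left; apply/eqP; ring.
Qed.

Lemma weighted_form_psd : psd_form Q.
Proof.
split.
- move=> a u v w; rewrite /Q -RintZ; last exact: form_L1.
  rewrite -RintD; [|by apply: L1Z; exact: form_L1 | exact: form_L1].
  by apply: eq_Rint => g; rewrite matrix_coeff_linear; ring.
- by move=> u v; apply: eq_Rint => g; rewrite [f u g * _]mulrC.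
- by move=> v; apply: Rint_ge0 => g; rewrite -expr2 mulr_ge0// sqr_ge0.
Qed.

(** Invariance is known for nonnegative functions, and F is the difference of |F| + F and |F|. *)
Lemma Rint_left (h : G) (F : G -> R) : L1 mu (F : borel G -> R) ->
  L1 mu (fun g : borel G => F (h * g)%g) /\
  Rint mu (fun g : borel G => F (h * g)%g) = Rint mu (F : borel G -> R).
Proof.
move=> hF; have mF := L1_measurable hF.
have cl : continuous (fun y : G => h * y)%g.
  move=> y; have := @translation_continuous R n G h 1%g y.
  by under [X in continuous_at _ X]eq_fun do rewrite mulg1.
have mT (F' : G -> R) : measurable_fun [set: borel G] (F' : borel G -> R) ->
    measurable_fun [set: borel G] (fun g : borel G => F' (h * g)%g).
  by move=> m; apply: (measurableT_comp m (borel_continuous cl)).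
have pos (F' : G -> R) : L1 mu (F' : borel G -> R) -> (forall g, 0 <= F' g) ->
    L1 mu (fun g : borel G => F' (h * g)%g) /\
    Rint mu (fun g : borel G => F' (h * g)%g) = Rint mu (F' : borel G -> R).
  move=> hF' F0; have m := L1_measurable hF'.
  have e := haar_integral_left hgm hinv hX hmu h (F := fun g => (F' g)%:E) _ _.
  have {}e : (\int[mu]_x (F' (h * x)%g)%:E = \int[mu]_x (F' x)%:E)%E.
    by apply: e; [exact/measurable_EFinP | move=> x; rewrite lee_fin].
  split; last by rewrite /Rint /Rintegral e.
  apply: L1_ge0; [exact: mT | by [] |].
  by rewrite e RintE// ltry.
have hA : L1 mu (fun g : borel G => `|F g|) by have h' := integrable_abse hF; exact: h'.
have [a1 a2] := pos _ hA (fun g => normr_ge0 _).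
have [|b1 b2] := pos _ (L1D hA hF).
  by move=> g; have := ler_norm (- F g); rewrite normrN; lra.
have e g : F g = (`|F g| + F g) + (-1) * `|F g| by ring.
split.
  have := L1D b1 (L1Z (-1) a1); congr L1; apply/funext => g; rewrite -e//.
transitivity (Rint mu (fun g : borel G => (`|F (h * g)%g| + F (h * g)%g) + (-1) * `|F (h * g)%g|)).
  by apply: eq_Rint => g; rewrite -e.
rewrite RintD ?RintZ//; last by exact: L1Z.
rewrite a2 b2 -RintZ// -RintD//; [|exact: L1D | exact: L1Z].
by apply: eq_Rint => g; rewrite -e.
Qed.

Lemma weighted_form_translate h u v :
  L1 mu (fun g : borel G => f u g * f v g * Psi (h * g)%g) /\
  Q (pi h u) (pi h v) = Rint mu (fun g : borel G => f u g * f v g * Psi (h * g)%g).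
Proof.
have [h1 h2] := Rint_left h (form_L1 (pi h u) (pi h v)).
have e g w : f (pi h w) (h * g)%g = f w g.
  by rewrite /f -(rep_mul hpi) invgM mulgVK.
split.
  by move: h1; congr L1; apply/funext => g; rewrite !e.
by rewrite /Q -h2; apply: eq_Rint => g; rewrite !e.
Qed.

Context (U : algType R) (iota : 'rV[R]_n -> U) (hU : lie_hom G iota).
Context (dpi : U -> E -> E) (hdpi : is_derived_rep pi iota dpi).
Local Notation P := (smooth_vector pi).
Local Notation D := (lie_derive X iota dpi).
Context (s' : R).
Hypothesis Psi_derive : exists2 e : R, 0 < e & forall t g (a : 'I_n -> R), `|t| < e ->
  `|\sum_j a j * (Psi (gexp G (t *: X j) * g)%g - Psi g)| <=
    2 * s' * `|t| * Num.sqrt (\sum_j a j ^+ 2) * Psi g.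

(* Differentiate Q (pi h u) (pi h v), the integral of f_u f_v Psi(h g), at
   h = 1; the derivatives of Psi are controlled in the euclidean norm. *)
Lemma weighted_form_almost_skew : 0 <= s' -> almost_skew P D s' Q.
Proof.
move=> s'0 w v th hw hv th0; have [e e0 he] := Psi_derive.
have [Qlin Qsym Qge0] := weighted_form_psd.
set rhs := s' * _; set S := \sum_j _.
suff key (q : R) : 0 < q -> `|S| <= rhs + q by apply: le_addgt0P.
move=> q0; have n1 : 0 < n%:R + 1 :> R by rewrite ltr_wpDl.
have inc j u (hu : P u) (e' : R) (e'0 : 0 < e') := rep_increment_basis X hpi hdpi j hu e'0.
have hj j := form_increment Qlin Qsym weighted_form_bound form_bound_ge0
  (inc j _ (hw j)) (inc j _ hv) (divr_gt0 q0 n1).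
have [d1 d10 hd1] : exists2 d1 : R, 0 < d1 & forall j t, `|t| < d1 ->
   `|Q (pi (gexp G (t *: X j)) (w j)) (pi (gexp G (t *: X j)) v) - Q (w j) v -
     t * (Q (D j (w j)) v + Q (w j) (D j v))| <= q / (n%:R + 1) * `|t|.
  apply: (@fin_uniform R 'I_n (fun j d1 => forall t, `|t| < d1 -> _ <= q / (n%:R + 1) * `|t|)).
    by move=> i r r' h _ rr' t ht; apply: h; exact: lt_le_trans rr'.
  by move=> j; exact: hj.
pose t := Num.min e d1 / 2; have m0 : 0 < Num.min e d1 by rewrite lt_min e0.
have t0 : 0 < t by rewrite divr_gt0.
have : t < Num.min e d1 by rewrite /t ltr_pdivrMr// ltr_pMr// ltr1n.
rewrite lt_min => /andP[te td]; clearbody t.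
have nt : `|t| = t by rewrite gtr0_norm.
pose T := \sum_j (Q (pi (gexp G (t *: X j)) (w j)) (pi (gexp G (t *: X j)) v) - Q (w j) v).
have nearT : `|T - t * S| <= q * t.
  rewrite /T /S mulr_sumr -sumrB (le_trans (ler_norm_sum _ _ _))//.
  apply: (@le_trans _ _ (\sum_(j < n) q / (n%:R + 1) * t)).
    by apply: ler_sum => j _; have := hd1 j t; rewrite nt; exact.
  rewrite sumr_const card_ord -[leLHS]mulr_natl.
  have -> : n%:R * (q / (n%:R + 1) * t) = q * t * (n%:R / (n%:R + 1)) by ring.
  by rewrite ler_piMr ?mulr_ge0 ?(ltW q0) ?(ltW t0)// ler_pdivrMr// mul1r lerDl.
have small : `|T| <= rhs * t.
  pose F j (g : borel G) := f (w j) g * f v g * Psi (gexp G (t *: X j) * g)%g +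
     (-1) * (f (w j) g * f v g * Psi g).
  have FL j : L1 mu (F j).
    by apply: L1D; [exact: (weighted_form_translate _ _ _).1 | apply: L1Z; exact: form_L1].
  pose q2 (g : borel G) := s' * t * (th * (f v g * f v g * Psi g) +
     th^-1 * \sum_j f (w j) g * f (w j) g * Psi g).
  have sumL : L1 mu (fun g : borel G => \sum_j f (w j) g * f (w j) g * Psi g).
    by apply: L1_sum => j; exact: form_L1.
  have q2L : L1 mu q2.
    by apply: L1Z; apply: L1D; apply: L1Z; [exact: form_L1 | exact: sumL].
  have -> : T = \sum_j 1 * Rint mu (F j).
    apply: eq_bigr => j _; have [h1 h2] := weighted_form_translate (gexp G (t *: X j)) (w j) v.
    by rewrite h2 mul1r RintD//; [rewrite RintZ ?mulN1r//; exact: form_L1 | apply: L1Z; exact: form_L1].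
  have -> : rhs * t = Rint mu q2.
    rewrite /q2 RintZ; last by apply: L1D; apply: L1Z; [exact: form_L1 | exact: sumL].
    rewrite RintD; [|by apply: L1Z; exact: form_L1 | exact: L1Z].
    rewrite !RintZ ?Rint_sum//; [rewrite /rhs /Q; ring | by move=> j; exact: form_L1 | exact: form_L1].
  apply: Rint_combination_le => // g.
  have -> : \sum_j 1 * F j g = f v g * \sum_j f (w j) g * (Psi (gexp G (t *: X j) * g)%g - Psi g).
    by rewrite mulr_sumr; apply: eq_bigr => j _; rewrite /F; ring.
  rewrite normrM; have := he t g (fun j => f (w j) g); rewrite nt => /(_ te) h.
  apply: (le_trans (ler_wpM2l (normr_ge0 _) h)); rewrite /q2.
  set y := Num.sqrt _; have y2 : y ^+ 2 = \sum_j f (w j) g ^+ 2.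
    by rewrite sqr_sqrtr// sumr_ge0// => j _; exact: sqr_ge0.
  have -> : \sum_j f (w j) g * f (w j) g * Psi g = y ^+ 2 * Psi g.
    by rewrite y2 mulr_suml; apply: eq_bigr => j _; rewrite expr2.
  (* The inequality of arithmetic and geometric means weighted by th, which produces the right-hand
     side of [almost_skew]. *)
  have am : 2 * `|f v g| * y <= th * `|f v g| ^+ 2 + th^-1 * y ^+ 2.
    rewrite -subr_ge0; have -> : th * `|f v g| ^+ 2 + th^-1 * y ^+ 2 - 2 * `|f v g| * y =
      th * (`|f v g| - th^-1 * y) ^+ 2 by field; rewrite gt_eqF.
    by rewrite mulr_ge0 ?sqr_ge0// ltW.
  have k0 : 0 <= s' * t * Psi g by rewrite !mulr_ge0// ltW.
  have := ler_wpM2l k0 am; rewrite real_normK ?num_real//; lra.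
rewrite -(ler_pM2r t0) mulrDl.
have -> : `|S| * t = `|t * S| by rewrite normrM nt mulrC.
rewrite distrC in nearT; rewrite -[t * S](subrK T) [leRHS]addrC.
by apply: (le_trans (ler_normD _ _)); exact: lerD.
Qed.

End WeightedForm.

(** * Local Sobolev inequality *)

(** Integrates |a'| <= - phi' over [x, y] for a function a that is known through its increments and
    need not be differentiable. *)
Lemma decay_compare (R : realType) (a phi phi' : R -> R) (x y : R) : x <= y ->
  (forall t : R, x <= t <= y -> is_derive t (1 : R) phi (phi' t)) ->
  (forall t, x <= t <= y -> forall e, 0 < e -> exists2 d : R, 0 < d & forall s,
     x <= s <= y -> `|s - t| < d -> `|a s - a t| <= (e - phi' t) * `|s - t|) ->
  a x <= a y + (phi x - phi y).
Proof.
move=> xy dphi ha; apply: le_addgt0P => e0 e00.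
pose e := e0 / (y - x + 1); have yx1 : 0 < y - x + 1 by rewrite ltr_wpDl// subr_ge0.
have e1 : 0 < e by rewrite divr_gt0.
have ee : e * (y - x) <= e0.
  rewrite /e mulrAC ler_pdivrMr// ler_pM2l// lerDl; exact: ler01.
have := @local_ndecr R (fun t => a t - phi t + e * t) x y xy.
move=> h; suff key : a x - phi x + e * x <= a y - phi y + e * y by move: key ee; lra.
apply: h => t ht; have e4 : 0 < e / 4 by rewrite divr_gt0.
have [d1 d10 h1] := ha t ht _ e4; have [d2 d20 h2] := is_derive_near (dphi t ht) e4.
exists (Num.min d1 d2); first by rewrite lt_min d10.
move=> s s' xs st ts' s'y; rewrite lt_min => /andP[hd1 hd2].
have ns q : s' - s < q -> `|s - t| < q /\ `|s' - t| < q.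
  move=> hq; rewrite ler0_norm ?subr_le0// ger0_norm ?subr_ge0//.
  by split; apply: le_lt_trans hq; move: st ts'; clear; lra.
have [a1 b1] := ns _ hd1; have [a2 b2] := ns _ hd2.
have i1 : x <= s <= y by rewrite xs (le_trans st)// (le_trans ts').
have i2 : x <= s' <= y by rewrite s'y andbT (le_trans xs)// (le_trans st).
have := h1 s i1 a1; have := h1 s' i2 b1; have := h2 s a2; have := h2 s' b2.
rewrite (ger0_norm (_ : 0 <= s' - t)) ?subr_ge0// (ler0_norm (_ : s - t <= 0)) ?subr_le0//.
rewrite !ler_norml; move: e1 st ts'; clear; move=> e1 st ts'.
move=> /andP[p1 p2] /andP[p3 p4] /andP[p5 p6] /andP[p7 p8].
have : 0 <= e * (s' - s) by rewrite mulr_ge0 ?(ltW e1)// subr_ge0 (le_trans st).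
by move: p1 p2 p3 p4 p5 p6 p7 p8; lra.
Qed.

Lemma leb_scale (R : realType) (n : nat) (lam : {measure set (borel 'rV[R]_n) -> \bar R})
    (tau : R) (F : 'rV[R]_n -> \bar R) : is_lebesgue lam -> 0 < tau ->
  measurable_fun [set: borel 'rV[R]_n] (F : borel 'rV[R]_n -> \bar R) ->
  (forall z, (0 <= F z)%E) ->
  (\int[lam]_z F (tau *: z) = (tau ^- n)%:E * \int[lam]_z F z)%E.
Proof.
move=> hlam t0 mF F0; pose M : 'M[R]_n := tau%:M.
have uM : M \in unitmx by rewrite unitmxE det_scalar unitrX// unitfE gt_eqF.
have tE z : tau *: z = z *m M by rewrite /M mul_mx_scalar.
have mT : measurable_fun [set: borel 'rV[R]_n] ((fun z => tau *: z) : borel 'rV[R]_n -> borel 'rV[R]_n).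
  have -> : (fun z : 'rV[R]_n => tau *: z) = (fun z => z *m M) by apply/funext.
  by apply: borel_continuous; exact: mulmx_continuous.
have k0 : 0 <= tau ^- n by rewrite invr_ge0 exprn_ge0// ltW.
rewrite -(ge0_integral_mscale lam measurableT (NngNum k0))//.
pose nu := measure_function_pushforward__canonical__measure_function_Measure lam mT.
transitivity (\int[nu]_z F z)%E; first by rewrite (ge0_integral_pushforward mT lam measurableT mF).
apply: eq_measure_integral => A mA _.
have -> : nu A = lam (lin_preim M A).
  by congr (lam _); apply/seteqP; split=> z; rewrite /lin_preim/= tE.
rewrite (lin_factorE hlam uM mA) /=; congr ((_)%:E * _)%E.
have := lin_factor_det hlam uM; rewrite det_scalar gtr0_norm ?exprn_gt0// => h.
by rewrite -[LHS](mulfK (lt0r_neq0 (exprn_gt0 n t0))) h div1r.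
Qed.

Section MatrixCoefficientIncrement.
Context (R : realType) (n : nat) (G : lieGroupType R n) (gm : G -> 'M[R]_n).
Hypothesis hgm : is_riemannian_metric gm.
Context (X : 'I_n -> 'rV[R]_n) (hX : is_orthonormal_basis gm X).
Context (E : completeNormedModType R) (pi : G -> E -> E) (hpi : is_banach_rep pi).
Context (U : algType R) (iota : 'rV[R]_n -> U) (hU : lie_hom G iota).
Context (dpi : U -> E -> E) (hdpi : is_derived_rep pi iota dpi).
Local Notation V := 'rV[R]_n.
Local Notation P := (smooth_vector pi).
Local Notation D := (lie_derive X iota dpi).
Local Notation qn := (form_norm (metric_form gm)).

(** With gexp w = gexp x (gexp y)^-1 one has pi(gexp y)^-1 = pi(gexp x)^-1 pi(gexp w), so the
    expansion of pi(gexp w) v in w gives the increment in terms of derivatives evaluated at x. The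
    radius and the constant precede l and v; d alone depends on them. *)
Lemma matrix_coeff_increment : exists r C : R, [/\ 0 < r, 0 < C &
  forall (l : E -> R), (forall a u v, l (a *: u + v) = a * l u + l v) ->
    (forall v, `|l v| <= `|v|) -> forall v, P v -> forall e, 0 < e ->
  exists2 d : R, 0 < d & forall x y : V, `|x| < r -> `|y| < r -> `|y - x| < d ->
    `|matrix_coeff pi l v (gexp G y) - matrix_coeff pi l v (gexp G x)| <=
      C * `|y - x| * (\sum_j `|matrix_coeff pi l (D j v) (gexp G x)| + e)].
Proof.
have [r1 [M [r10 M0 hM]]] := rep_locally_bounded hpi.
have [K K0 hK] := qn_le hgm.
have g0 : gdiff (gexp G : V -> G) 0 by exact: (gdiff_gexp (sdiff_id _) (gdom0 G)).
have [N [Nlin [KN KN0 hN]] hinc] := gdiff_rincr g0.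
have [r2 r20 h2] := hinc 1 ltr01.
have gD : gdiff (fun p : V * V => gexp G p.1 * (gexp G p.2)^-1)%g (0, 0).
  have a1 : gdiff (fun p : V * V => gexp G p.1) (0, 0).
    by apply: (gdiff_gexp (sdiff_linear _ (bl_fst _ _))); exact: gdom0.
  have a2 : gdiff (fun p : V * V => gexp G p.2) (0, 0).
    by apply: (gdiff_gexp (sdiff_linear _ (bl_snd _ _))); exact: gdom0.
  exact: (gdiffM a1 (gdiffV a2)).
have /near_distP[r3 r30 h3] : \forall p \near ((0, 0) : V * V),
    chart_dom (1%g : G) (gexp G p.1 * (gexp G p.2)^-1)%g.
  by apply: (chart_dom_near gD.1); rewrite /= mulgV; exact: dom1.
have k1 : 0 < KN + 1 by rewrite addr_gt0.
have k2 : 0 < K + 1 by rewrite addr_gt0.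
exists (Num.min r1 (Num.min r2 r3)), ((KN + 1) * (K + 1)); split.
- by rewrite !lt_min r10 r20.
- by rewrite mulr_gt0.
move=> l llin lb v hv e e0.
have [d1 d10 h1] := rep_increment hgm hX hU hpi hdpi hv (divr_gt0 e0 M0).
exists (d1 / (KN + 1)); first by rewrite divr_gt0.
move=> x y; rewrite !lt_min => /and3P[x1 x2 x3] /and3P[y1 y2 y3]; rewrite ltr_pdivlMr// => xy.
set w := glog (gexp G x * (gexp G y)^-1)%g.
have hw : gexp G w = (gexp G x * (gexp G y)^-1)%g.
  by apply: glogK; apply: (h3 (x, y)); rewrite prod_normE/= !subr0 gt_max x3.
have nw : `|w| <= (KN + 1) * `|y - x|.
  have := h2 y x; rewrite !subr0 => /(_ y2 x2); rewrite -/w mul1r => h.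
  rewrite -[w](subrK (N (x - y))) (le_trans (ler_normD _ _))// mulrDl mul1r addrC.
  by rewrite (distrC y); apply: lerD h.
have wd : `|w| < d1 by rewrite (le_lt_trans nw)// mulrC.
have lsum (I : Type) (s : seq I) (c : I -> R) (F : I -> E) :
    l (\sum_(i <- s) c i *: F i) = \sum_(i <- s) c i * l (F i).
  elim: s => [|i s ih]; last by rewrite !big_cons llin ih.
  rewrite !big_nil; have := llin 1 0 0; rewrite scale1r addr0 mul1r => h.
  by apply: (@addrI _ (l 0)); rewrite addr0 -h.
have lB u u' : l (u - u') = l u - l u'.
  by have := llin (-1) u' u; rewrite scaleN1r mulN1r addrC => ->; rewrite addrC.
have plin g (I : Type) (s : seq I) (c : I -> R) (F : I -> E) :
    pi g (\sum_(i <- s) c i *: F i) = \sum_(i <- s) c i *: pi g (F i).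
  elim: s => [|i s ih]; last by rewrite !big_cons (rep_linear hpi) ih.
  by rewrite !big_nil -(scale0r (0 : E)) (repZ hpi) !scale0r.
have pB g u u' : pi g (u - u') = pi g u - pi g u'.
  have -> : u - u' = (-1) *: u' + u by rewrite scaleN1r addrC.
  by rewrite (rep_linear hpi) scaleN1r addrC.
set gx := gexp G x in hw *; set gy := gexp G y in hw *.
pose rem := pi (gexp G w) v - v - \sum_j metric_form gm w (X j) *: D j v.
have -> : matrix_coeff pi l v gy - matrix_coeff pi l v gx =
    \sum_j metric_form gm w (X j) * matrix_coeff pi l (D j v) gx + l (pi gx^-1%g rem).
  rewrite /matrix_coeff /rem !pB !lB plin lsum hw -(rep_mul hpi) mulKg; ring.
have cw j : `|metric_form gm w (X j)| <= K * `|w|.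
  rewrite (le_trans (form_cauchy (metric_psd hgm) _ _))// (qn_basis hX) mulr1.
  exact: hK.
have lr : `|l (pi gx^-1%g rem)| <= e * `|w|.
  rewrite (le_trans (lb _))//; have [_ h] := hM x rem x1; apply: (le_trans h).
  have := h1 w wd; rewrite -/rem => h'; rewrite mulrC -ler_pdivlMr//.
  by apply: (le_trans h'); rewrite mulrAC.
rewrite (le_trans (ler_normD _ _))//.
have S0 : 0 <= \sum_j `|matrix_coeff pi l (D j v) gx| by exact: sumr_ge0.
have h5 : `|\sum_j metric_form gm w (X j) * matrix_coeff pi l (D j v) gx| <=
    K * `|w| * \sum_j `|matrix_coeff pi l (D j v) gx|.
  rewrite (le_trans (ler_norm_sum _ _ _))// mulr_sumr; apply: ler_sum => j _.
  by rewrite normrM ler_wpM2r.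
apply: (le_trans (lerD h5 lr)).
have -> : (KN + 1) * (K + 1) * `|y - x| * (\sum_j `|matrix_coeff pi l (D j v) gx| + e) =
  (K + 1) * (\sum_j `|matrix_coeff pi l (D j v) gx| + e) * ((KN + 1) * `|y - x|) by ring.
apply: (@le_trans _ _ ((K + 1) * (\sum_j `|matrix_coeff pi l (D j v) gx| + e) * `|w|)); last first.
  by rewrite ler_wpM2l// mulr_ge0 ?(ltW k2)// addr_ge0// ltW.
have := mulr_ge0 (mulr_ge0 (ltW K0) (ltW e0)) (normr_ge0 w); have := mulr_ge0 S0 (normr_ge0 w).
by move=> _ _; rewrite [K * _ * _]mulrAC -mulrDl ler_wpM2r// mulrDr; apply: lerD; [rewrite ler_wpM2r// lerDl | rewrite ler_peMl ?(ltW e0)// lerDr ltW].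
Qed.

End MatrixCoefficientIncrement.

Section LocalAverage.
Context (R : realType) (n : nat) (G : lieGroupType R n).
Context (E : completeNormedModType R) (pi : G -> E -> E) (hpi : is_banach_rep pi).
Local Notation V := 'rV[R]_n.
Local Notation P := (smooth_vector pi).
Context (D : 'I_n -> E -> E).
Hypothesis PD : forall j v, P v -> P (D j v).
Context (lam : {measure set (borel V) -> \bar R}) (hlam : is_lebesgue lam).
Context (l : E -> R).
Hypothesis llin : forall a u v, l (a *: u + v) = a * l u + l v.
Hypothesis lb : forall v, `|l v| <= `|v|.
Context (r C M rho : R).
Hypothesis C0 : 0 < C.
Hypothesis M0 : 0 < M.
Hypothesis rho0 : 0 < rho.
Hypothesis rhor : rho < r.
Hypothesis hdom : forall z, `|z| < r -> gdom G z.
Hypothesis hM : forall u v, `|u| < r -> `|pi (gexp G u)^-1%g v| <= M * `|v|.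
Local Notation F v z := (matrix_coeff pi l v (gexp G z)).
Hypothesis hinc : forall v, P v -> forall e, 0 < e ->
  exists2 d : R, 0 < d & forall x y : V, `|x| < r -> `|y| < r -> `|y - x| < d ->
    `|F v y - F v x| <= C * `|y - x| * (\sum_j `|F (D j v) x| + e).

Definition cube_around0 : set V := box (const_mx (- rho)) (const_mx rho).
Local Notation B := cube_around0.

Lemma cube_around0_le z : B z -> `|z| <= rho.
Proof.
move=> hz; apply: norm_rV_le; first exact: ltW.
by move=> i; have := hz i; rewrite !mxE ler_norml => /andP[-> /ltW].
Qed.

Lemma cube_around0_measurable : @measurable _ (borel V) B.
Proof. exact: box_measurable. Qed.

Lemma cube_around0_volume : lam B = ((rho + rho) ^+ n)%:E.
Proof.
rewrite (leb_box hlam); last by move=> i; rewrite !mxE; move: rho0; lra.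
congr EFin; rewrite -[n in RHS]card_ord -prodr_const; apply: eq_bigr => i _.
by rewrite !mxE opprK.
Qed.

(* The average of |F v| over the cube shrunk by tau^2: with tau^2 rather than
   tau, the power weights met in the iteration below have odd exponents, so no
   logarithm appears. *)
Definition dilated (v : E) (tau : R) : V -> R := (fun z => `|F v (tau ^+ 2 *: z)|) \_ B.
Definition average v tau : R := Rint lam (dilated v tau : borel V -> R).

Lemma dilatedE v tau z : B z -> dilated v tau z = `|F v (tau ^+ 2 *: z)|.
Proof. by move=> hz; rewrite /dilated patchE mem_set. Qed.

Lemma dilated_out v tau z : ~ B z -> dilated v tau z = 0.
Proof. by move=> hz; rewrite /dilated patchE memNset. Qed.

Lemma dilated_ge0 v tau z : 0 <= dilated v tau z.
Proof.
have [hz|hz] := pselect (B z); first by rewrite dilatedE.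
by rewrite dilated_out.
Qed.

Let sq01 (tau : R) : 0 <= tau <= 1 -> 0 <= tau ^+ 2 <= 1.
Proof. by move=> /andP[t0 t1]; rewrite sqr_ge0/= exprn_ile1. Qed.

Lemma dilate_small (tau : R) (z : V) : 0 <= tau <= 1 -> `|z| <= rho -> `|tau ^+ 2 *: z| <= rho.
Proof.
by move=> /sq01 /andP[t0 t1] hz; rewrite normrZ ger0_norm// (le_trans _ hz)// ler_piMl.
Qed.

Lemma coeff_le v z : `|z| <= rho -> `|F v z| <= M * `|v|.
Proof. by move=> hz; rewrite (le_trans (lb _))// hM// (le_lt_trans hz). Qed.

Lemma dilated_measurable v tau : 0 <= tau <= 1 ->
  measurable_fun [set: borel V] (dilated v tau : borel V -> R).
Proof.
move=> ht; apply/(measurable_restrictT _ cube_around0_measurable).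
pose O := [set z : V | gdom G (tau ^+ 2 *: z)].
have cs : continuous (fun z : V => tau ^+ 2 *: z) by exact: scaler_continuous.
have oO : open O by apply: open_comp; [move=> z _; exact: cs | exact: gdom_open].
have mO : measurable_fun (O : set (borel V)) ((fun z => `|F v (tau ^+ 2 *: z)|) : borel V -> R).
  apply: borel_continuous_on_real => // z Oz.
  apply: (continuous_comp (f := fun z : V => F v (tau ^+ 2 *: z)) (g := fun x : R => `|x|)); last exact: norm_continuous.
  apply: (continuous_comp (f := fun z : V => tau ^+ 2 *: z) (g := fun z => F v z)); first exact: cs.
  apply: (continuous_comp (f := gexp G) (g := matrix_coeff pi l v)); first exact: gexp_continuous.
  exact: (matrix_coeff_continuous hpi llin lb).
apply: measurable_funS mO; first exact: (borel_open oO).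
move=> z /cube_around0_le hz; apply: hdom.
exact: le_lt_trans (dilate_small ht hz) rhor.
Qed.

Lemma indic_cube_L1 : L1 lam (\1_B : borel V -> R).
Proof.
by apply: L1_indic; [exact: cube_around0_measurable | rewrite cube_around0_volume ltry].
Qed.

Lemma dilated_L1 v tau : 0 <= tau <= 1 -> L1 lam (dilated v tau : borel V -> R).
Proof.
move=> ht; apply: (L1_le (dilated_measurable v ht) _ (L1Z (M * `|v|) indic_cube_L1)) => z.
rewrite ger0_norm ?dilated_ge0// indicE; have [/set_mem hz|hz] := boolP (z \in B).
  by rewrite mulr1 dilatedE// coeff_le// dilate_small// cube_around0_le.
by rewrite mulr0 dilated_out// => hz'; move: hz; rewrite notin_setE.
Qed.

Lemma average_ge0 v tau : 0 <= average v tau.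
Proof. by apply: Rint_ge0 => z; exact: dilated_ge0. Qed.

Lemma average0 v : average v 0 = (rho + rho) ^+ n * `|l v|.
Proof.
have -> : average v 0 = Rint lam (fun z : borel V => `|l v| * \1_B z).
  apply: eq_Rint => z; rewrite indicE; have [/set_mem hz|hz] := boolP (z \in B).
    rewrite dilatedE// expr0n/= scale0r mulr1 gexp0 /matrix_coeff invg1.
    by rewrite (rep_one hpi).
  by rewrite mulr0 dilated_out// => hz'; move: hz; rewrite notin_setE.
rewrite RintZ; last exact: indic_cube_L1.
rewrite Rint_indic; last exact: cube_around0_measurable.
by rewrite cube_around0_volume mulrC.
Qed.

(** Up to tau^(-2 n), [average v tau] is the integral over the cube shrunk by tau^2, which is part
    of the full cube. *)
Lemma average_dilation v tau : 0 < tau <= 1 ->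
  average v tau <= (tau^-1) ^+ (2 * n) * average v 1.
Proof.
move=> /andP[t0 t1]; have ht : 0 <= tau <= 1 by rewrite ltW.
have h1 : 0 <= (1 : R) <= 1 by rewrite ler01 lexx.
rewrite -lee_fin EFinM -!RintE; [|exact: dilated_L1|exact: dilated_L1].
have -> : tau^-1 ^+ (2 * n) = (tau ^+ 2) ^- n by rewrite exprVn exprM.
rewrite -(leb_scale (F := fun z => (dilated v 1 z)%:E) hlam); last 3 first.
- by rewrite exprn_gt0.
- by apply/measurable_EFinP; exact: dilated_measurable.
- by move=> z; rewrite lee_fin dilated_ge0.
apply: ge0_le_integral.
- exact: measurableT.
- by move=> z _; rewrite lee_fin dilated_ge0.
- by apply/measurable_EFinP; exact: dilated_measurable.
- apply/measurable_EFinP.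
  have cs : continuous (fun z : V => tau ^+ 2 *: z) by exact: scaler_continuous.
  exact: (measurableT_comp (dilated_measurable v h1) (borel_continuous cs)).
move=> z _; rewrite lee_fin; have [hz|hz] := pselect (B z); last first.
  by rewrite dilated_out// dilated_ge0.
have hz' : B (tau ^+ 2 *: z).
  move=> i; have := hz i; rewrite !mxE => /andP[z1 z2].
  have /andP[s0 s1] := sq01 ht; have s00 : 0 < tau ^+ 2 by rewrite exprn_gt0.
  have := ler_wpM2l s0 z1; have : tau ^+ 2 * z 0 i < tau ^+ 2 * rho by rewrite ltr_pM2l.
  have : tau ^+ 2 * rho <= rho by rewrite ler_piMl// ltW.
  by move=> *; apply/andP; split; lra.
by rewrite !dilatedE// expr1n scale1r.
Qed.

Local Notation K := (C * rho).

(** The point tau^2 z moves with velocity 2 tau z, and |z| <= rho on the cube: hence the factor 2 t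
    C rho. *)
Lemma average_increment v t e : P v -> 0 <= t <= 1 -> 0 < e ->
  exists2 d : R, 0 < d & forall s, 0 <= s <= 1 -> `|s - t| < d ->
    `|average v s - average v t| <= (2 * t * K * \sum_j average (D j v) t + e) * `|s - t|.
Proof.
move=> hv ht e0; have K0 : 0 < K by rewrite mulr_gt0.
pose L := (rho + rho) ^+ n; have L0 : 0 < L by rewrite exprn_gt0// addr_gt0.
pose A := \sum_j average (D j v) t.
have A0 : 0 <= A by apply: sumr_ge0 => j _; exact: average_ge0.
pose e1 := e / (4 * K); have e10 : 0 < e1 by rewrite divr_gt0// mulr_gt0.
have [d1 d10 h1] := hinc hv (divr_gt0 e10 L0).
have [c c0 cE] : exists2 c : R, 0 < c & c = 2 * K * (A + e1).
  by exists (2 * K * (A + e1)) => //; rewrite mulr_gt0 ?mulr_gt0// ltr_wpDl.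
exists (Num.min (d1 / (2 * rho)) (e / c)); first by rewrite lt_min !divr_gt0// mulr_gt0.
move=> s hs; rewrite lt_min => /andP[]; rewrite !ltr_pdivlMr ?mulr_gt0// => sd se.
have /andP[t0 t1] := ht; have /andP[s0 s1] := hs.
have st2 : `|s ^+ 2 - t ^+ 2| = `|s - t| * (s + t).
  by rewrite subr_sqr normrM (ger0_norm (addr_ge0 s0 t0)).
pose g (z : borel V) := K * `|s ^+ 2 - t ^+ 2| * (\sum_j dilated (D j v) t z + e1 / L * \1_B z).
have dL j : L1 lam (dilated (D j v) t : borel V -> R) by exact: dilated_L1.
have SL : L1 lam (fun z : borel V => \sum_j dilated (D j v) t z) by apply: L1_sum.
have iL : L1 lam (fun z : borel V => e1 / L * \1_B z) by apply: L1Z; exact: indic_cube_L1.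
have gL : L1 lam g by apply: L1Z; exact: L1D.
have gE : Rint lam g = K * `|s ^+ 2 - t ^+ 2| * (A + e1).
  rewrite /g RintZ; last exact: L1D.
  rewrite RintD// Rint_sum// RintZ; last exact: indic_cube_L1.
  rewrite Rint_indic ?cube_around0_volume; last exact: cube_around0_measurable.
  by rewrite divfK// gt_eqF.
have := @Rint_combination_le _ _ _ lam bool [:: true; false] (fun b => if b then 1 else -1)
  (fun b => if b then dilated v s else dilated v t) g.
rewrite !big_cons !big_nil /= addr0 mul1r mulN1r gE => h.
apply: (le_trans (h _ gL _)); first by case; exact: dilated_L1.
  move=> z; rewrite !big_cons !big_nil addr0 mul1r mulN1r /g indicE.
  have [/set_mem hz|hz] := boolP (z \in B); last first.
    have nz : ~ B z by move=> hz'; move: hz; rewrite notin_setE.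
    by rewrite !dilated_out// subrr normr0 big1 ?mulr0 ?addr0 ?mulr0// => j _; rewrite dilated_out.
  have zr := cube_around0_le hz.
  have x1 := le_lt_trans (dilate_small ht zr) rhor.
  have y1 := le_lt_trans (dilate_small hs zr) rhor.
  have nxy : `|s ^+ 2 *: z - t ^+ 2 *: z| <= `|s ^+ 2 - t ^+ 2| * rho.
    by rewrite -scalerBl normrZ ler_wpM2l.
  rewrite !dilatedE// mulr1 (le_trans (ler_dist_dist _ _))//.
  apply: le_trans (h1 _ _ x1 y1 _) _.
    apply: (le_lt_trans nxy); rewrite st2; apply: le_lt_trans sd.
    by rewrite -mulrA ler_wpM2l// ler_wpM2r ?(ltW rho0)//; exact: lerD.
  have -> : \sum_j dilated (D j v) t z = \sum_j `|F (D j v) (t ^+ 2 *: z)|.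
    by apply: eq_bigr => j _; rewrite dilatedE.
  rewrite ler_wpM2r//; first by rewrite addr_ge0 ?sumr_ge0// ltW// divr_gt0.
  have -> : K * `|s ^+ 2 - t ^+ 2| = C * (`|s ^+ 2 - t ^+ 2| * rho) by ring.
  by rewrite ler_wpM2l// ltW.
rewrite st2 -/A.
have -> : K * (`|s - t| * (s + t)) * (A + e1) = K * (A + e1) * (s + t) * `|s - t| by ring.
rewrite ler_wpM2r//.
have s2 : s + t <= 2 * t + `|s - t| by rewrite -lerBlDl (_ : _ - _ = s - t) ?ler_norm//; ring.
have k0 : 0 <= K * (A + e1) by rewrite mulr_ge0 ?(ltW K0)// addr_ge0// ltW.
apply: (le_trans (ler_wpM2l k0 s2)).
have e1E : 4 * K * e1 = e by rewrite /e1; field; rewrite gt_eqF// gt_eqF.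
have kk : 0 <= K * e1 by rewrite mulr_ge0 ?(ltW K0)// ltW.
have h2 := ler_wpM2r kk t1.
move: se; rewrite cE; lra.
Qed.

Fixpoint iteration_constant k : R :=
  if k is k'.+1 then 1 + 2 * K * n%:R * iteration_constant k' else 1.

Lemma iteration_constant_ge0 k : 0 <= iteration_constant k.
Proof.
elim: k => [|k ih] /=; first exact: ler01.
by rewrite addr_ge0// mulr_ge0// mulr_ge0// mulr_ge0// mulr_ge0// ltW.
Qed.

Lemma average_slope v t a e : P v -> 0 < t <= 1 -> (forall j, average (D j v) t <= a) -> 0 < e ->
  exists2 d : R, 0 < d & forall s, 0 <= s <= 1 -> `|s - t| < d ->
    `|average v s - average v t| <= (e + 2 * K * n%:R * (t * a)) * `|s - t|.
Proof.
move=> hv /andP[t0 t1] ha e0.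
have [|d d0 hd] := average_increment hv (t := t) _ e0; first by rewrite ltW.
exists d => // s hs hst; apply: (le_trans (hd s hs hst)); rewrite ler_wpM2r// addrC lerD2l.
have -> : 2 * K * n%:R * (t * a) = 2 * t * K * (n%:R * a) by ring.
rewrite ler_wpM2l//; first by rewrite mulr_ge0 ?(ltW (mulr_gt0 C0 rho0))// mulr_ge0// ltW.
apply: (@le_trans _ _ (\sum_(j < n) a)); first exact: ler_sum.
by rewrite sumr_const card_ord mulr_natl.
Qed.

Let deriv_inv_pow (L t : R) q : 0 < t ->
  is_derive t (1 : R) (fun s => L * s^-1 ^+ q.+1) (- (L * q.+1%:R * t^-1 ^+ q.+2)).
Proof.
move=> t0; have tn : t != 0 by rewrite gt_eqF.
have d1 : is_derive t (1 : R) (fun s : R => s^-1) (- t ^- 2).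
  by have := @is_deriveV R id t 1 1 tn (is_derive_id _ _); rewrite [_ *: _]mulr1.
have := is_deriveZ L (is_deriveX q.+1 d1).
have -> : L \*: (fun s : R => s^-1) ^+ q.+1 = (fun s => L * s^-1 ^+ q.+1).
  by apply/funext => s; rewrite /= exprfctE.
have -> : L *: (q.+1%:R * t^-1 ^+ q.+1.-1 *: - t ^- 2) = - (L * q.+1%:R * t^-1 ^+ q.+2).
  transitivity (L * (q.+1%:R * t^-1 ^+ q * (- t ^- 2))); first by [].
  rewrite -exprVn -[q.+2]addn2 exprD.
  by rewrite !mulrN !mulrA.
by [].
Qed.

(** Each further derivative lowers the exponent of 1/tau by two: the factor t of the slope takes
    away one power and integration the other. The dilation bound tau^(-2 n) is weakened to the odd
    exponent 2 n + 1 at the start, so the exponents go down to 1 at k = n. *)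
Lemma average_iterate k : (k <= n)%N -> forall v b, P v ->
  (forall w : seq 'I_n, (size w <= k)%N -> average (word_act D w v) 1 <= b) ->
  forall tau, 0 < tau <= 1 ->
    average v tau <= iteration_constant k * b * tau^-1 ^+ (2 * (n - k)).+1.
Proof.
elim: k => [|k ih] kn v b hv hb tau /andP[t0 t1].
  have b0 : average v 1 <= b by exact: (hb [::]).
  rewrite /= mul1r subn0 (le_trans (average_dilation _ _)) ?t0//.
  have ti : 1 <= tau^-1 by rewrite invr_ge1 ?unitfE ?gt_eqF.
  rewrite mulrC exprSr mulrA.
  apply: (@le_trans _ _ (b * tau^-1 ^+ (2 * n))).
    by rewrite ler_wpM2r// exprn_ge0// invr_ge0 ltW.
  by rewrite ler_peMr// mulr_ge0 ?exprn_ge0 ?invr_ge0 ?(ltW t0)// (le_trans (average_ge0 v 1)).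
have b0 : 0 <= b by exact: le_trans (average_ge0 v 1) (hb [::] isT).
have hD j s : 0 < s <= 1 -> average (D j v) s <=
    iteration_constant k * b * s^-1 ^+ (2 * (n - k)).+1.
  apply: ih => //; [exact: ltnW | exact: PD | move=> w hw].
  have := hb (rcons w j); rewrite size_rcons /word_act -cats1 foldr_cat /=; exact.
set m := (n - k.+1)%N; have mE : (n - k = m.+1)%N by rewrite /m subnSK.
pose L := 2 * K * n%:R * (iteration_constant k * b).
have L0 : 0 <= L.
  rewrite mulr_ge0 ?mulr_ge0 ?iteration_constant_ge0//; exact: ltW.
have := @decay_compare R (average v) (fun s => L * s^-1 ^+ (2 * m).+1)
  (fun s => - (L * (2 * m).+1%:R * s^-1 ^+ (2 * m).+2)) tau 1 t1.
move=> h; have {}h : average v tau <= average v 1 + (L * tau^-1 ^+ (2 * m).+1 - L * 1^-1 ^+ (2 * m).+1).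
  apply: h => [s /andP[s0 _]|s /andP[s0 s1] e e0]; first by apply: deriv_inv_pow; exact: lt_le_trans s0.
  have sp : 0 < s by exact: lt_le_trans s0.
  have hs : 0 < s <= 1 by rewrite sp.
  have [d d0 hd] := average_slope hv hs (fun j => hD j s hs) e0.
  exists d => // x /andP[x0 x1] hx; apply: (le_trans (hd x _ hx)).
    by rewrite x1 andbT (le_trans (ltW t0)).
  rewrite ler_wpM2r// lerD2l opprK.
  have -> : 2 * K * n%:R * (s * (iteration_constant k * b * s^-1 ^+ (2 * (n - k)).+1)) =
      L * s^-1 ^+ (2 * m).+2.
    rewrite mE mulnS [(2 + _)%N]addnC addn2 exprS /L; field.
    by rewrite gt_eqF.
  by rewrite ler_wpM2r ?exprn_ge0 ?invr_ge0 ?(ltW sp)// ler_peMr// ler1n.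
apply: (le_trans h); rewrite -/m /=.
have ti : 1 <= tau^-1 ^+ (2 * m).+1 by rewrite exprn_ege1// invr_ge1 ?unitfE ?gt_eqF.
have hv1 : average v 1 <= b * tau^-1 ^+ (2 * m).+1.
  by apply: (le_trans (hb [::] isT)); rewrite ler_peMr.
rewrite invr1 expr1n mulr1.
have -> : (1 + 2 * K * n%:R * iteration_constant k) * b * tau^-1 ^+ (2 * m).+1 =
    b * tau^-1 ^+ (2 * m).+1 + L * tau^-1 ^+ (2 * m).+1 by rewrite /L; ring.
by rewrite lerD// lerBlDr lerDl.
Qed.

(** With derivatives of averages bounded by a multiple of 1/t, the factor t of the slope cancels the
    singularity: derivative n + 1 makes the average bounded as tau tends to 0, where it becomes the
    volume times |l v|. *)
Lemma average_bounded v b : P v ->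
  (forall w : seq 'I_n, (size w <= n.+1)%N -> average (word_act D w v) 1 <= b) ->
  (rho + rho) ^+ n * `|l v| <= iteration_constant n.+1 * b.
Proof.
move=> hv hb.
have b0 : 0 <= b by exact: le_trans (average_ge0 v 1) (hb [::] isT).
have hD j s : 0 < s <= 1 -> average (D j v) s <= iteration_constant n * b * s^-1.
  move=> hs; have := @average_iterate n (leqnn n) (D j v) b (PD j hv) _ s hs.
  rewrite subnn muln0 expr1; apply=> w hw.
  have := hb (rcons w j); rewrite size_rcons /word_act -cats1 foldr_cat /=; exact.
pose L := 2 * K * n%:R * (iteration_constant n * b).
have bnd tau : 0 < tau <= 1 -> average v tau <= iteration_constant n.+1 * b.
  move=> /andP[t0 t1].
  have := @decay_compare R (average v) (fun s => - L * s) (fun=> - L) tau 1 t1.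
  move=> h; have {}h : average v tau <= average v 1 + (- L * tau - - L * 1).
    apply: h => [s _|s /andP[s0 s1] e e0].
      have := @is_deriveM R R^o (cst (- L)) id s 1 0 1 (is_derive_cst _ _ _) (is_derive_id _ _).
      by rewrite scaler0 addr0 [_ *: _]mulr1.
    have sp : 0 < s by exact: lt_le_trans s0.
    have hs : 0 < s <= 1 by rewrite sp.
    have [d d0 hd] := average_slope hv hs (fun j => hD j s hs) e0.
    exists d => // x /andP[x0 x1] hx; apply: (le_trans (hd x _ hx)).
      by rewrite x1 andbT (le_trans (ltW t0)).
    rewrite ler_wpM2r// lerD2l opprK /L le_eqVlt; apply/orP; left; apply/eqP; field.
    by rewrite gt_eqF.
  apply: (le_trans h); have := hb [::] isT; rewrite /= => h1.
  have L0 : 0 <= L.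
    rewrite mulr_ge0 ?mulr_ge0 ?iteration_constant_ge0//; exact: ltW.
  by have := mulr_ge0 L0 (ltW t0); rewrite /L; lra.
rewrite -average0; apply: le_addgt0P => e e0.
have z01 : 0 <= (0 : R) <= 1 by rewrite lexx ler01.
have [d d0 hd] := average_increment hv z01 e0.
pose s := Num.min d 1 / 2; have m0 : 0 < Num.min d 1 by rewrite lt_min d0 ltr01.
have s0 : 0 < s by rewrite divr_gt0.
have : s < Num.min d 1 by rewrite /s ltr_pdivrMr// ltr_pMr// ltr1n.
rewrite lt_min => /andP[sd s1].
have := hd s; rewrite (ltW s0) (ltW s1) subr0 gtr0_norm// mulr0 !mul0r add0r => /(_ isT sd).
have hs : 0 < s <= 1 by rewrite s0 ltW.
have := bnd s hs; rewrite ler_norml => h1 /andP[h2 _].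
have : e * s <= e by rewrite ler_piMr// ltW.
by move=> es; move: h2; rewrite lerBrDr addrC lerBlDr => /le_trans; apply; exact: lerD.
Qed.

End LocalAverage.

Section LocalSobolev.
Context (R : realType) (n : nat) (G : lieGroupType R n) (gm : G -> 'M[R]_n).
Hypothesis hgm : is_riemannian_metric gm.
Hypothesis hinv : left_invariant_metric gm.
Context (X : 'I_n -> 'rV[R]_n) (hX : is_orthonormal_basis gm X).
Context (mu : {measure set (borel G) -> \bar R}) (hmu : is_riemannian_measure gm mu).
Local Notation V := 'rV[R]_n.

(** The lower bound on measures of small sets is an inequality between [mu] and the image of [lam]
    restricted to B, hence passes to integrals. Patching [gexp] off [gdom] makes it measurable
    everywhere. *)
Lemma haar_local_le (lam : {measure set (borel V) -> \bar R}) (B : set V) (c : R)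
    (F : G -> \bar R) : 0 <= c -> @measurable _ (borel V) B ->
  (forall A, @measurable _ (borel V) A -> A `<=` B ->
     [/\ A `<=` gdom G, @measurable _ (borel G) (gexp G @` A) &
       (c%:E * lam A <= mu (gexp G @` A))%E]) ->
  measurable_fun [set: borel G] (F : borel G -> \bar R) -> (forall g, (0 <= F g)%E) ->
  (c%:E * \int[lam]_(z in B) F (gexp G z) <= \int[mu]_g F g)%E.
Proof.
move=> c0 mB hB mF F0; have [Bd _ _] := hB B mB (@subset_refl _ B).
pose phi : V -> G := gexp G \_ (gdom G).
have mphi : measurable_fun [set: borel V] (phi : borel V -> borel G).
  apply/(measurable_restrictT _ (borel_open (gdom_open (G := G)))).
  move=> _ A mA; apply: (borel_preimage (gdom_open (G := G)) _ mA) => z hz.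
  exact: gexp_continuous.
have phiE z : B z -> phi z = gexp G z by move=> hz; rewrite /phi patchE mem_set//; exact: Bd.
pose m0 := measure_function_mrestr__canonical__measure_function_Measure lam mB.
pose m1 := measure_function_pushforward__canonical__measure_function_Measure m0 mphi.
have le1 (A : set (borel G)) : measurable A -> (mscale (NngNum c0) m1 A <= mu A)%E.
  move=> mA; have mA' : @measurable _ (borel V) (phi @^-1` A `&` B).
    by apply: measurableI => //; rewrite -[X in measurable X]setTI; exact: (mphi measurableT A mA).
  have [_ mI lo] := hB _ mA' (@subIsetr _ _ _).
  apply: (le_trans lo); apply: le_measure; rewrite ?inE//.
  by move=> _ [z [Az Bz] <-]; rewrite -phiE.
have := @ge0_le_measure_integral _ _ _ (mscale (NngNum c0) m1) mu le1 F setT measurableT F0 mF.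
rewrite (ge0_integral_mscale m1 measurableT (NngNum c0))//=.
rewrite (ge0_integral_pushforward mphi m0 measurableT mF)//.
move=> h; apply: le_trans h; apply: lee_wpmul2l; first by rewrite lee_fin.
have -> : (\int[lam]_(z in B) F (gexp G z) = \int[m0]_(z in B) (F \o phi) z)%E.
  rewrite (eq_measure_integral m0) => [|A mA AB]; last by rewrite /= /mrestr setIidl.
  by apply: eq_integral => z /set_mem Bz; rewrite /= phiE.
rewrite preimage_setT; apply: ge0_subset_integral => //.
  exact: (measurableT_comp mF mphi).
by move=> x _; exact: F0.
Qed.

Context (E : completeNormedModType R) (pi : G -> E -> E) (hpi : is_banach_rep pi).
Context (U : algType R) (iota : V -> U) (hU : lie_hom G iota).
Context (dpi : U -> E -> E) (hdpi : is_derived_rep pi iota dpi).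
Local Notation P := (smooth_vector pi).
Local Notation D := (lie_derive X iota dpi).
Context (Psi : G -> R) (c C C0 c1 c2 S : R).
Hypothesis c0 : 0 < c.
Hypothesis Cp : 0 < C.
Hypothesis C00 : 0 < C0.
Hypothesis c10 : 0 < c1.
Hypothesis c20 : 0 < c2.
Hypothesis S0 : 0 < S.
Hypothesis growth : forall g, (opnorm (pi g) <= C%:E * expeR (c%:E * dist1 gm g))%E.
Hypothesis hC0 : (\int[mu]_g expeR (- (C0%:E * dist1 gm g)) < +oo)%E.
Hypothesis mPsi : measurable_fun [set: borel G] (Psi : borel G -> R).
Hypothesis Psi_ge0 : forall g, 0 <= Psi g.
Hypothesis Psi_le : forall g, Psi g <= c2 * weight gm (2 * c + C0) g.
Hypothesis Psi_ge : forall g, c1 * weight gm S g <= Psi g.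
Local Notation Q l := (weighted_form mu pi Psi l).

(** Averages over a small cube are L1 norms, bounded by L2 norms by Cauchy-Schwarz, and these by the
    norm of Q since [Psi] is bounded below near 1. The constant does not depend on l. *)
Lemma local_sobolev : exists2 K : R, 0 < K & forall l : E -> R,
  (forall a u v, l (a *: u + v) = a * l u + l v) -> (forall v, `|l v| <= `|v|) ->
  forall v b, P v -> (forall w : seq 'I_n, (size w <= n.+1)%N ->
    form_norm (Q l) (word_act D w v) <= b) -> `|l v| <= K * b.
Proof.
have [r1 [M [r10 M0 hM]]] := rep_locally_bounded hpi.
have [r2 [Ci [r20 Ci0 hinc]]] := matrix_coeff_increment hgm hX hpi hU hdpi.
have [r3 [cm [r30 cm0 [lam hlam hmeas]]]] := measure_near1 hgm hinv hX hmu.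
have [r4 r40 hr4] := dist1_near1 hgm hinv hX ltr01.
have /near_distP[r5 r50 hr5] : \forall z \near (0 : V), gdom G z.
  by apply: open_nbhs_nbhs; split; [exact: gdom_open | exact: gdom0].
pose r := Num.min (Num.min r1 r2) (Num.min r3 (Num.min r4 r5)).
have r0 : 0 < r by rewrite !lt_min r10 r20 r30 r40.
have rr (x : R) : x < r -> [/\ x < r1, x < r2, x < r3, x < r4 & x < r5].
  by rewrite !lt_min => /andP[/andP[? ?] /and3P[? ? ?]].
clearbody r; pose rho := r / 2.
have rho0 : 0 < rho by rewrite divr_gt0.
have rhor : rho < r by rewrite /rho ltr_pdivrMr// ltr_pMr// ltr1n.
clearbody rho; pose B : set V := cube_around0 rho.
have mB : @measurable _ (borel V) B by exact: cube_around0_measurable.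
have hB z : B z -> `|z| < r by move=> /(cube_around0_le rho0) hz; exact: le_lt_trans rhor.
have hdom z : `|z| < r -> gdom G z.
  by move=> /rr[_ _ _ _ zr]; apply: hr5; rewrite subr0.
pose L := (rho + rho) ^+ n; have L0 : 0 < L by rewrite exprn_gt0// addr_gt0.
pose kap := c1 * expR (- S); have kap0 : 0 < kap by rewrite mulr_gt0// expR_gt0.
have Psi_lo z : B z -> kap <= Psi (gexp G z).
  move=> /hB /rr[_ _ _ /hr4 hz _]; apply: le_trans (Psi_ge _); rewrite ler_pM2l//.
  have := weight_le hgm hinv S0 (y := gexp G z) (z := 1%g) (a := 1).
  rewrite (dist1_one hgm hinv) adde0 => /(_ hz).
  by rewrite weight1// mulr1 -ler_pdivrMl ?expR_gt0// mulr1 -expRN.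
(* From N^2 <= L q and cm kap q <= Q(x, x), where N is the average and q the square integral. *)
pose Kq := Num.sqrt (L / (cm * kap)); have Kq0 : 0 <= Kq by exact: sqrtr_ge0.
pose It := iteration_constant n Ci rho n.+1.
have It0 : 0 <= It by exact: iteration_constant_ge0.
exists (It * Kq / L + 1); first by rewrite ltr_wpDl// divr_ge0 ?(ltW L0)// mulr_ge0.
move=> l llin lb v b hv hb.
have b0 : 0 <= b by exact: le_trans (form_norm_ge0 _ _) (hb [::] isT).
have hMr (u : V) (x : E) : `|u| < r -> `|pi (gexp G u)^-1%g x| <= M * `|x|.
  by move=> /rr[ur _ _ _ _]; have [] := hM u x ur.
have h01 : 0 <= (1 : R) <= 1 by rewrite ler01 lexx.
have avg x : average pi lam l rho x 1 <= Kq * form_norm (Q l) x.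
  pose f := dilated pi l rho x 1.
  have mf : measurable_fun [set: borel V] (f : borel V -> R).
    exact: (dilated_measurable hpi llin lb rho0 rhor hdom).
  have fL : L1 lam (f : borel V -> R).
    exact: (dilated_L1 hpi hlam llin lb rho0 rhor hdom hMr).
  have f0 z : 0 <= f z by exact: dilated_ge0.
  have fb z : f z <= M * `|x| * \1_B z.
    rewrite indicE; have [/set_mem hz|hz] := boolP (z \in B).
      rewrite mulr1 /f dilatedE// (le_trans (lb _))// hMr// expr1n scale1r; exact: hB.
    by rewrite mulr0 /f dilated_out// => hz'; move: hz; rewrite notin_setE.
  have f2L : L1 lam (fun z : borel V => f z * f z).
    apply: (L1_le _ _ (L1Z (M * `|x|) fL)); first exact: measurable_funM.
    move=> z; rewrite ger0_norm ?mulr_ge0// ler_wpM2r// (le_trans (fb z))//.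
    by rewrite ler_piMr ?mulr_ge0 ?(ltW M0)// indicE; case: (_ \in _); rewrite ?ler01 ?lexx.
  have BL : L1 lam (\1_B : borel V -> R) by exact: (indic_cube_L1 hlam rho0).
  have BE : Rint lam (\1_B : borel V -> R) = L.
    by rewrite Rint_indic// cube_around0_volume.
  pose N := average pi lam l rho x 1; pose q := Rint lam (fun z : borel V => f z * f z).
  (* Cauchy-Schwarz on the cube: the integral of (f - t)^2 is nonnegative, and t = N / L minimises
     it. *)
  have N2 : N ^+ 2 <= L * q.
    have h (t : R) : 0 <= q + (- (2 * t)) * N + t ^+ 2 * L.
      have -> : q + (- (2 * t)) * N + t ^+ 2 * L =
          Rint lam (fun z : borel V => f z * f z + (- (2 * t)) * f z + t ^+ 2 * \1_B z).
        rewrite !RintD ?RintZ ?BE//; do ?[exact: L1Z | by apply: L1D; [|exact: L1Z]].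
      apply: Rint_ge0 => z; rewrite indicE; have [/set_mem hz|hz] := boolP (z \in B).
        rewrite mulr1; have -> : f z * f z + (- (2 * t)) * f z + t ^+ 2 = (f z - t) ^+ 2 by ring.
        exact: sqr_ge0.
      rewrite /f dilated_out; first by rewrite !mulr0 !addr0.
      by move=> hz'; move: hz; rewrite notin_setE.
    have := h (N / L).
    have -> : q + (- (2 * (N / L))) * N + (N / L) ^+ 2 * L = (L * q - N ^+ 2) / L.
      by field; rewrite gt_eqF.
    by rewrite pmulr_lge0 ?invr_gt0// subr_ge0.
  have qQ : cm * kap * q <= Q l x x.
    pose H g := matrix_coeff pi l x g * matrix_coeff pi l x g * Psi g.
    have HL : L1 mu (H : borel G -> R).
      exact: (form_L1 hgm hinv hX hpi c0 C00 growth hC0 mPsi Psi_ge0 Psi_le llin lb).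
    have H0 g : 0 <= H g by rewrite mulr_ge0// -expr2 sqr_ge0.
    have hBm A : @measurable _ (borel V) A -> A `<=` B -> [/\ A `<=` gdom G,
        @measurable _ (borel G) (gexp G @` A) & (cm%:E * lam A <= mu (gexp G @` A))%E].
      move=> mA AB; have [] := hmeas A mA _ => // u Au.
      by have [] := rr _ (hB u (AB u Au)).
    have := haar_local_le (F := fun g => (H g)%:E) (ltW cm0) mB hBm _ _.
    move=> h; have {}h : (cm%:E * \int[lam]_(z in B) (H (gexp G z))%:E <= \int[mu]_g (H g)%:E)%E.
      apply: h; last by move=> g; rewrite lee_fin.
      by apply/measurable_EFinP; exact: L1_measurable HL.
    rewrite (RintE HL) in h; rewrite -lee_fin -/(Q l x x).
    apply: le_trans h; rewrite -mulrA EFinM lee_wpmul2l// ?lee_fin ?(ltW cm0)//.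
    rewrite -RintZ// -(RintE (L1Z kap f2L)).
    rewrite [in leRHS]integral_mkcond; apply: ge0_le_integral => //.
    - by move=> z _; rewrite lee_fin mulr_ge0 ?(ltW kap0)// mulr_ge0.
    - by apply/measurable_EFinP; exact: L1_measurable (L1Z kap f2L).
    - apply/(measurable_restrictT _ mB); apply/measurable_EFinP.
      apply: (measurable_comp (f := (H : borel G -> R)) measurableT (@subsetT _ _)).
        exact: L1_measurable HL.
      move=> _ A mA; have := measurableI _ _ mB (borel_preimage (gdom_open (G := G))
        (fun z hz => gexp_continuous hz) mA).
      congr measurable; apply/seteqP; split=> z /= [? ?]; first by split=> //; tauto.
      by split=> //; split=> //; exact: hdom (hB _ _).
    move=> z _; rewrite patchE; case: ifPn => [/set_mem hz|hz].
      rewrite lee_fin /H mulrC; apply: ler_pM => //.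
      - by rewrite mulr_ge0.
      - exact: ltW.
      - by rewrite /f dilatedE// expr1n scale1r -normrM ger0_norm// -expr2 sqr_ge0.
      - exact: Psi_lo.
    rewrite /f dilated_out ?mulr0//.
    by move=> hz'; move: hz; rewrite notin_setE.
  have N0 : 0 <= N by exact: average_ge0.
  have Q0 : 0 <= Q l x x.
    by have [_ _] := weighted_form_psd hgm hinv hX hpi c0 C00 growth hC0 mPsi Psi_ge0 Psi_le llin lb.
  rewrite -(@ler_pXn2r _ 2) ?nnegrE ?mulr_ge0 ?form_norm_ge0//.
  rewrite exprMn /Kq /form_norm !sqr_sqrtr//; last by rewrite divr_ge0 ?(ltW L0)// ltW// mulr_gt0.
  apply: (le_trans N2); rewrite mulrAC -mulrA ler_wpM2l ?(ltW L0)//.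
  have ck : 0 < cm * kap by exact: mulr_gt0.
  by rewrite (ler_pdivlMr _ _ ck) mulrC.
have PD j u : P u -> P (D j u) by move=> hu; exact: (dpi_smooth hdpi).
have hinc' x : P x -> forall e, 0 < e ->
    exists2 d : R, 0 < d & forall y z : V, `|y| < r -> `|z| < r -> `|z - y| < d ->
    `|matrix_coeff pi l x (gexp G z) - matrix_coeff pi l x (gexp G y)| <=
      Ci * `|z - y| * (\sum_j `|matrix_coeff pi l (D j x) (gexp G y)| + e).
  move=> hx e e0; have [d d0 hd] := hinc l llin lb x hx e e0.
  by exists d => // y z /rr[_ ? _ _ _] /rr[_ ? _ _ _]; exact: hd.
have := average_bounded hpi PD hlam llin lb Ci0 rho0 rhor hdom hMr hinc' hv (b := Kq * b).
move=> h; have {}h : L * `|l v| <= It * (Kq * b).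
  by apply: h => w hw; apply: (le_trans (avg _)); rewrite ler_wpM2l// hb.
rewrite mulrDl mul1r ler_wpDr//.
have -> : It * Kq / L * b = It * (Kq * b) / L by ring.
by rewrite ler_pdivlMr// mulrC.
Qed.

End LocalSobolev.

(** * The two inequalities between Sobolev and Laplace norms *)

Lemma mul_laplace_term (R : realType) (U : algType R) (w y : U) (a : R) :
  w * ((- y - a%:A) * y) = (-1) *: (w * (y * y)) + (-1) *: (a *: (w * y)).
Proof. by rewrite mulrBl mulNr mulr_algl mulrBr mulrN -scalerAr !scaleN1r. Qed.

Section Assembly.
Context (R : realType) (n : nat) (G : lieGroupType R n) (gm : G -> 'M[R]_n).
Hypothesis hgm : is_riemannian_metric gm.
Hypothesis hinv : left_invariant_metric gm.
Context (mu : {measure set (borel G) -> \bar R}) (hmu : is_riemannian_measure gm mu).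
Context (X : 'I_n -> 'rV[R]_n) (hX : is_orthonormal_basis gm X).
Context (U : algType R) (iota : 'rV[R]_n -> U) (hU : lie_hom G iota).
Context (E : completeNormedModType R) (pi : G -> E -> E) (hpi : is_banach_rep pi).
Context (dpi : U -> E -> E) (hdpi : is_derived_rep pi iota dpi).
Context (r : R).
Local Notation P := (smooth_vector pi).
Local Notation D := (lie_derive X iota dpi).
Local Notation x := (fun i => iota (X i)).
Local Notation t := (fun j => tr_ad G (X j)).
Local Notation L := ((r ^+ 2)%:A + laplace G iota X).
Local Notation A := (elliptic_op D t r).

Let PD j v : P v -> P (D j v).
Proof. by move=> hv; exact: (dpi_smooth hdpi). Qed.

Let hxx := iota_comm hgm hX hU.

Lemma dpi_word w v : P v -> dpi (word_prod x w) v = word_act D w v.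
Proof.
move=> hv; elim: w => [|i w ih]; first by rewrite /word_prod big_nil (dpi_one hdpi).
by rewrite word_prod_cons (dpi_mul hdpi)// ih.
Qed.

Lemma dpi_shifted_laplace v : P v -> dpi L v = A v.
Proof.
move=> hv; rewrite (dpiD hdpi)// (dpiZ hdpi)// (dpi_one hdpi)// /elliptic_op -addrA; congr (_ + _).
rewrite /laplace (dpi_sum hdpi)// -opprD -big_split/= -sumrN; apply: eq_bigr => j _.
rewrite (dpi_mul hdpi)// -[- iota _]scaleN1r (dpiD hdpi) ?(dpiZ hdpi)//; try exact: PD.
rewrite -scaleNr (dpiZ hdpi); last exact: PD.
by rewrite (dpi_one hdpi) ?scaleN1r ?scaleNr ?opprD//; exact: PD.
Qed.

Lemma dpi_laplace_power k v : P v -> dpi (L ^+ k) v = iter k A v.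
Proof.
move=> hv; elim: k => [|k ih]; first by rewrite expr0 (dpi_one hdpi).
rewrite exprS (dpi_mul hdpi)// ih dpi_shifted_laplace//.
by rewrite -ih; exact: (dpi_smooth hdpi).
Qed.

(** The last factor is absorbed into the predicate: the induction hypothesis is applied to u |-> B
    (u L), which is linear again. *)
Lemma laplace_power_span k (B : U -> Prop) :
  (forall a u v, B u -> B v -> B (a *: u + v)) -> B 0 ->
  (forall w : seq 'I_n, (size w <= 2 * k)%N -> B (word_prod x w)) -> B (L ^+ k).
Proof.
elim: k B => [|k ih] B Blin B0 hB.
  by have := hB [::] isT; rewrite /word_prod big_nil expr0.
rewrite exprSr; apply: (ih (fun u => B (u * L))).
- by move=> a u v hu hv; rewrite mulrDl -scalerAl; exact: Blin.
- by rewrite mul0r.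
move=> w hw; have hs (s : seq 'I_n) : (size s <= 2)%N -> B (word_prod x (w ++ s)).
  by move=> s2; apply: hB; rewrite size_cat mulnS [(2 + _)%N]addnC leq_add.
rewrite mulrDr; apply: (B_add Blin).
  rewrite -scalerAr mulr1; apply: (B_scale Blin B0).
  by have := hs [::] isT; rewrite cats0.
rewrite /laplace mulr_sumr; apply: (B_sum Blin B0) => j; rewrite mul_laplace_term.
apply: (B_add Blin); apply: (B_scale Blin B0).
  have := hs [:: j; j] isT; rewrite word_prod_cat !word_prod_cons.
  by rewrite /word_prod big_nil mulr1.
apply: (B_scale Blin B0).
have := hs [:: j] isT; rewrite word_prod_cat word_prod_cons.
by rewrite /word_prod big_nil mulr1.
Qed.

Lemma monomial_le_sobolev k (w : seq 'I_n) v : (size w <= k)%N ->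
  `|dpi (\prod_(i < n) x i ^+ count_mem i w) v| <= sobolev_norm iota dpi X k v.
Proof.
move=> hw; have ci i : (count_mem i w < k.+1)%N by rewrite ltnS (leq_trans (count_size _ _)).
pose m : {ffun 'I_n -> 'I_k.+1} := [ffun i => Ordinal (ci i)].
have mE i : m i = count_mem i w :> nat by rewrite ffunE.
rewrite -[leLHS]ger0_norm// -sqrtr_sqr /sobolev_norm ler_wsqrtr//.
have -> : \prod_(i < n) x i ^+ count_mem i w = \prod_(i < n) iota (X i) ^+ m i.
  by apply: eq_bigr => i _; rewrite mE.
rewrite (bigD1 m)/=; last by under eq_bigr => i _ do rewrite mE; rewrite count_word.
by rewrite lerDl; apply: sumr_ge0 => m' _; exact: sqr_ge0.
Qed.

Lemma sobolev_le k v b : P v -> 0 <= b ->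
  (forall w : seq 'I_n, (size w <= k)%N -> `|word_act D w v| <= b) ->
  sobolev_norm iota dpi X k v <= #|{: {ffun 'I_n -> 'I_k.+1}}|%:R * b.
Proof.
move=> hv b0 hb; set N : R := _%:R; have N0 : 0 <= N by [].
rewrite -(@ler_pXn2r _ 2) ?nnegrE ?sqrtr_ge0 ?mulr_ge0// sqr_sqrtr; last first.
  by apply: sumr_ge0 => m _; exact: sqr_ge0.
apply: (@le_trans _ _ (\sum_(m : {ffun 'I_n -> 'I_k.+1}) b ^+ 2)).
  rewrite [leRHS](bigID (fun m : {ffun 'I_n -> 'I_k.+1} => (\sum_(i < n) m i <= k)%N))/=.
  apply: ler_wpDr; first by apply: sumr_ge0 => m _; exact: sqr_ge0.
  apply: ler_sum => m hm; rewrite ler_pXn2r ?nnegrE//.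
  by rewrite -(word_prod_monomial x (fun i => m i)) dpi_word// hb// size_monomial_word.
rewrite sumr_const -[leLHS]mulr_natl -/N exprMn ler_wpM2r ?sqr_ge0//.
rewrite expr2 /N -natrM ler_nat; case: (#|_|) => // q; by rewrite leq_pmulr.
Qed.

Lemma laplace_le_sobolev k : exists2 c : R, 0 < c & forall v, P v ->
  c * `|dpi (L ^+ k) v| <= sobolev_norm iota dpi X (2 * k) v.
Proof.
(* Domination by the Sobolev norm is a linear condition on u; ordered monomials satisfy it with C =
   1. *)
pose B u := exists2 C : R, 0 <= C & forall v, P v ->
  `|dpi u v| <= C * sobolev_norm iota dpi X (2 * k) v.
have Blin a u u' : B u -> B u' -> B (a *: u + u').
  move=> [C C0 hC] [C' C'0 hC']; exists (`|a| * C + C') => [|v hv]; first by rewrite addr_ge0// mulr_ge0.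
  rewrite (dpi_linearl hdpi)// (le_trans (ler_normD _ _))// mulrDl lerD ?hC'//.
  by rewrite normrZ -mulrA ler_wpM2l// hC.
have B0 : B 0 by exists 0 => // v hv; rewrite (dpi0 hdpi)// normr0 mul0r.
have Bw w : (size w <= 2 * k)%N -> B (word_prod x w).
  apply: (word_prod_span hxx Blin B0) => w' hw'.
  by exists 1 => // v hv; rewrite mul1r; exact: monomial_le_sobolev.
have [C C0 hC] := laplace_power_span Blin B0 Bw.
exists (C + 1)^-1 => [|v hv]; first by rewrite invr_gt0 ltr_wpDl.
rewrite ler_pdivrMl ?ltr_wpDl// (le_trans (hC v hv))// ler_wpM2r ?sqrtr_ge0// lerDl.
exact: ler01.
Qed.

Context (cG : R) (hcG0 : 0 < cG).
Hypothesis hcG : forall C : R, cG < C ->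
  (\int[mu]_g expeR (- (C%:E * dist1 gm g)) < +oo)%E.
Hypothesis hr : growth_rate gm pi + cG < r.

(** Duality: for Y = sum t_j X_j the trace of ad Y is the sum of the t_j^2, while the length of Y is
    its square root. *)
Lemma sum_sqr_tr_ad C : cG < C -> \sum_j t j ^+ 2 <= C ^+ 2.
Proof.
move=> cC; have C0 : 0 < C by exact: lt_trans cC.
pose Y := \sum_j t j *: X j; pose q := Num.sqrt (\sum_j t j ^+ 2).
have S0 : 0 <= \sum_j t j ^+ 2 by apply: sumr_ge0 => j _; exact: sqr_ge0.
have tY : tr_ad G Y = \sum_j t j ^+ 2.
  rewrite /Y; move: (tr_ad G) (tr_ad_linear G) => f flin.
  elim: (index_enum _) => [|j s ih]; last by rewrite !big_cons flin ih expr2.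
  rewrite !big_nil; have := flin 1 0 0; rewrite scale1r addr0 mul1r => e.
  by apply: (@addrI _ (f 0)); rewrite addr0 -e.
have := tr_ad_bound hgm hinv hX hmu C0 (hcG cC) Y.
rewrite tY ger0_norm// qn_combination// -/q => h.
have q0 : 0 <= q by exact: sqrtr_ge0.
have q2 : \sum_j t j ^+ 2 = q ^+ 2 by rewrite sqr_sqrtr.
rewrite q2 ler_pXn2r ?nnegrE ?(ltW C0)//; rewrite q2 in h.
have [->|qn0] := eqVneq q 0; first exact: ltW.
by rewrite -(ler_pM2r (_ : 0 < q)) -?expr2// lt_neqAle eq_sym qn0.
Qed.

Lemma word_le_laplace m k : ~~ odd m -> (1 + n <= m)%N ->
  exists2 C : R, 0 < C & forall v, P v -> forall w : seq 'I_n, (size w <= 2 * k)%N ->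
    `|word_act D w v| <= C * `|dpi (L ^+ (k + m./2)) v|.
Proof.
move=> meven mn.
have [c1 [K1 [c10 K10 hg1]]] := growth_rate_finite hgm hinv hX hmu hpi.
(* [growth_rate] is an infimum of reals, so c can be drawn from the set below r - cG only once the
   set is known to be nonempty; [growth_rate_finite] gives that. *)
have [c [cp [C Cp growth]] cr] : exists2 c, [set c : R | 0 < c /\ exists2 C : R, 0 < C &
      forall g, (opnorm (pi g) <= C%:E * expeR (c%:E * dist1 gm g))%E] c & c < r - cG.
  apply: inf_lt; last by rewrite ltrBrDr.
  by exists c1; split=> //; exists K1.
(* The gap is shared out: C0 exceeds cG by de/3 for integrability, 2 s' exceeds the decay 2 c + C0
   by de/3 for the mollification, and s' + C0/2 = r - de/2 leaves the margin for coercivity. *)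
pose de := r - cG - c; have de0 : 0 < de by rewrite subr_gt0.
pose C0 := cG + de / 3; have C00 : 0 < C0 by rewrite addr_gt0// divr_gt0.
have cC0 : cG < C0 by rewrite ltrDl divr_gt0.
pose s' := c + C0 / 2 + de / 6.
have s'0 : 0 <= s' by rewrite !addr_ge0 ?divr_ge0 ?ltW.
have S0 : 0 < 2 * c + C0 by rewrite addr_gt0// mulr_gt0.
have SS' : 2 * c + C0 < 2 * s'.
  have -> : 2 * s' = 2 * c + C0 + de / 3 by rewrite /s'; field.
  by rewrite ltrDl divr_gt0.
have rsT : s' ^+ 2 + s' * C0 < r ^+ 2.
  (* Completing the square: a = s' + C0/2 and b = C0/2. *)
  pose a := r - de / 2; pose b := cG / 2 + de / 6.
  have -> : s' ^+ 2 + s' * C0 = a ^+ 2 - b ^+ 2 by rewrite /s' /a /b /C0 /de; field.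
  have b0 : 0 < b by rewrite addr_gt0 ?divr_gt0.
  have r0 : 0 < r by move: de0 cp hcG0; rewrite /de; lra.
  have a0 : 0 <= a by move: cp hcG0; rewrite /a /de; move: de0; rewrite /de; lra.
  have ar : a ^+ 2 <= r ^+ 2.
    by rewrite ler_pXn2r ?nnegrE ?(ltW r0)// /a lerBlDr lerDl divr_ge0// ltW.
  by apply: lt_le_trans ar; rewrite ltrBlDr ltrDl exprn_gt0.
have [Psi [p1 [p2 [mPsi [p10 p20] hPsi hder]]]] := weight_smoothing hgm hinv hX hmu S0 SS'.
have Psi_lo g : p1 * weight gm (2 * c + C0) g <= Psi g by have /andP[] := hPsi g.
have Psi_hi g : Psi g <= p2 * weight gm (2 * c + C0) g by have /andP[] := hPsi g.
have Psi0 g : 0 <= Psi g.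
  by apply: le_trans (Psi_lo g); rewrite mulr_ge0 ?(ltW p10)// weight_ge0.
have [K K0 hK] := local_sobolev hgm hinv hX hmu hpi hU hdpi cp C00 p10 S0 growth (hcG cC0)
  mPsi Psi0 Psi_hi Psi_lo.
have Plin a u v : P u -> P v -> P (a *: u + v) by exact: (smooth_linear hpi).
have Dlin i a u v : P u -> P v -> D i (a *: u + v) = a *: D i u + D i v.
  by move=> hu hv; exact: (dpi_linear hdpi).
have [K2 K20 hK2] := elliptic_regularity (smooth0 hpi) Plin PD Dlin
  (lie_derive_comm hgm hX hU hdpi) s'0 C00 (sum_sqr_tr_ad cC0) rsT (k + m./2).
pose fb := form_bound gm mu C C0 p2.
have fb0 : 0 <= fb by exact: form_bound_ge0.
exists (K * (K2 * Num.sqrt fb) + 1).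
  by rewrite ltr_wpDl// mulr_ge0 ?(ltW K0)// mulr_ge0 ?sqrtr_ge0// ltW.
(* From here the functional, and with it the form, depends on v and w; all constants have been
   fixed. *)
move=> v hv w hw; have [l [llin lb lw]] := norming_functional (word_act D w v).
have psd := weighted_form_psd hgm hinv hX hpi cp C00 growth (hcG cC0) mPsi Psi0 Psi_hi llin lb.
have skew := weighted_form_almost_skew hgm hinv hX hmu hpi cp C00 p20 growth (hcG cC0) mPsi
  Psi0 Psi_hi llin lb hdpi hder s'0.
have bd := weighted_form_bound hgm hinv hX hpi cp C00 growth (hcG cC0) mPsi Psi0 Psi_hi llin lb.
rewrite dpi_laplace_power//; set y := iter _ _ _.
have ny : form_norm (weighted_form mu pi Psi l) y <= Num.sqrt fb * `|y|.
  rewrite /form_norm -[leRHS]ger0_norm ?mulr_ge0 ?sqrtr_ge0// -sqrtr_sqr ler_wsqrtr//.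
  by rewrite exprMn sqr_sqrtr// (le_trans (ler_norm _))// (le_trans (bd _ _))// expr2 mulrA.
have hb (w' : seq 'I_n) : (size w' <= n.+1)%N ->
    form_norm (weighted_form mu pi Psi l) (word_act D w' (word_act D w v)) <= K2 * (Num.sqrt fb * `|y|).
  (* The words have total length at most (n + 1) + 2 k <= m + 2 k, which is 2 (k + m/2) because m is
     even: exactly the order that k + m/2 powers of A control. *)
  move=> hw'; rewrite -word_act_cat; apply: (@le_trans _ _ (K2 * form_norm (weighted_form mu pi Psi l) y)).
    apply: hK2 => //; rewrite size_cat mulnDr [(2 * k + _)%N]addnC leq_add// mul2n.
    by rewrite (even_halfK meven) (leq_trans hw').
  by rewrite ler_wpM2l// ltW.
have := hK l llin lb _ _ (dom_word PD w hv) hb; rewrite lw ger0_norm// => h.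
apply: (le_trans h); rewrite mulrDl mul1r ler_wpDr//.
by rewrite le_eqVlt; apply/orP; left; apply/eqP; ring.
Qed.

End Assembly.

Theorem proposition4p1 (R : realType) (n : nat) (G : lieGroupType R n)
    (gm : G -> 'M[R]_n) (hgm : is_riemannian_metric gm)
    (hinv : left_invariant_metric gm)
    (mu : {measure set (borel G) -> \bar R}) (hmu : is_riemannian_measure gm mu)
    (cG : R) (hcG0 : 0 < cG)
    (hcG : forall C : R, cG < C ->
       (\int[mu]_g expeR (- (C%:E * dist1 gm g)) < +oo)%E)
    (X : 'I_n -> 'rV[R]_n) (hX : is_orthonormal_basis gm X)
    (U : algType R) (iota : 'rV[R]_n -> U) (hU : is_enveloping_algebra G iota)
    (E : completeNormedModType R) (pi : G -> E -> E) (hpi : is_banach_rep pi)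
    (dpi : U -> E -> E) (hdpi : is_derived_rep pi iota dpi)
    (r : R) (hr : growth_rate gm pi + cG < r)
    (m : nat) (hm_even : ~~ odd m) (hm_ge : (1 + n <= m)%N)
    (hm_min : forall m' : nat, ~~ odd m' -> (1 + n <= m')%N -> (m <= m')%N) :
  forall k : nat, exists c C : R, [/\ 0 < c, 0 < C &
    forall v : E, smooth_vector pi v ->
      c * laplace_norm G iota dpi X r (2 * k) v
        <= sobolev_norm iota dpi X (2 * k) v
      /\ sobolev_norm iota dpi X (2 * k) v
        <= C * laplace_norm G iota dpi X r (2 * k + m) v].
Proof.
move=> k; have hl : lie_hom G iota := hU.1.
have [c c0 hc] := laplace_le_sobolev hgm hX hl hdpi r k.
have [C C0 hC] := word_le_laplace hgm hinv hmu hX hl hpi hdpi hcG0 hcG hr k hm_even hm_ge.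
exists c, (#|{: {ffun 'I_n -> 'I_(2 * k).+1}}|%:R * C + 1); split=> //.
  by rewrite ltr_wpDl// mulr_ge0// ltW.
move=> v hv; rewrite /laplace_norm halfD mul2n doubleK odd_double /= add0n -mul2n.
split; first exact: hc.
have b0 : 0 <= C * `|dpi (((r ^+ 2)%:A + laplace G iota X) ^+ (k + m./2)) v|.
  by rewrite mulr_ge0// ltW.
apply: (le_trans (sobolev_le hdpi hv b0 (hC v hv))).
by rewrite mulrDl mul1r -mulrA lerDl.
Qed.
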